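(* Let $U$ be the exterior of a complete umbilic, not totally geodesic $n$-dimensional hypersurface $N$ in the $(n+1)$-dimensional space form $M_\kappa$ of constant sectional curvature $\kappa$. (a) If a smooth unit vector field $v$ on $N$ is geodesic, then $v$ is bifoliating (i.e. $v$ bifoliates $U$). (b) If $n>1$, there exists a smooth bifoliating vector field on $N$ which is not geodesic.
   Context: Setting. $M_\kappa$ is the $(n+1)$-dimensional space form of constant sectional curvature $\kappa$: Euclidean space $\mathbb{R}^{n+1}$ if $\kappa=0$, the round sphere of radius $1/\sqrt{\kappa}$ if $\kappa>0$, and hyperbolic space if $\kappa<0$, for which one uses the upper half-space model $\{(x_0,\dots,x_n)\in\mathbb{R}^{n+1}: x_0>0\}$ with metric $(dx_0^2+\cdots+dx_n^2)/(-\kappa x_0^2)$. A hypersurface is umbilic if all its principal curvatures are equal. The complete umbilic, not totally geodesic hypersurfaces $N\subset M_\kappa$ considered are: (1) $\kappa=0$: round $n$-spheres; (2) $\kappa>0$: geodesic spheres which are not great spheres; (3) $\kappa<0$: (3a) geodesic spheres, (3b) horospheres (congruent by an isometry to $x_0=1$), (3c) hypersurfaces congruent by an isometry to the intersection of the half-space with a hyperplane through the origin that is not orthogonal to $\{x_0=0\}$. Exterior. The exterior $U$ of $N$ is the connected component of $M_\kappa\setminus N$ into which the opposite of the mean curvature vector field of $N$ points, except that for $\kappa>0$, $U$ is further restricted to be the zone between $N$ and its antipodal image $-N$. Bifoliation. For $u\in TM_\kappa$, $\gamma_u$ is the geodesic of $M_\kappa$ with initial velocity $u$. Put $T_\kappa=\infty$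 if $\kappa\le0$ and $T_\kappa=\pi/\sqrt{\kappa}$ if $\kappa>0$. A smooth unit vector field $v$ on $N$ forward foliates $U$ if the geodesic rays $\gamma_{v(p)}(0,T_\kappa)$, $p\in N$, are the leaves of a smooth foliation of $U$; it backward foliates $U$ if the rays $\gamma_{-v(p)}(0,T_\kappa)$, $p\in N$, are the leaves of a smooth foliation of $U$; it bifoliates $U$ (is bifoliating) if it does both. A geodesic vector field on $N$ is a unit vector field on $N$ whose integral curves are geodesics of $N$.
   Formalization: Part (b) is proved under the extra assumption that n is odd when N is compact (i.e. a sphere); for even-dimensional spheres the claim is false, since by the hairy ball theorem such N carries no continuous unit tangent vector field. *)

(* Defs.v *)
From HB Require Import structures.
From mathcomp Require Import all_boot all_order all_algebra.
From mathcomp Require Import all_classical all_reals all_analysis.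
Import Order.TTheory GRing.Theory Num.Theory.
Import numFieldNormedType.Exports.

Set Implicit Arguments.
Unset Strict Implicit.
Unset Printing Implicit Defensive.

Local Open Scope classical_set_scope.
Local Open Scope ring_scope.

(* 'rV[R]_d carries the sup norm of the library, which is only used for its
   topology; all metric notions go through [dot] and [inner]. *)

Section Smoothness.
Context {R : realType}.

(* Intended for open A in a finite-dimensional V: there, continuity of all
   iterated directional derivatives up to order k is the usual C^k. *)
Fixpoint Ck {V W : normedModType R} (k : nat) (A : set V) (f : V -> W) : Prop :=
  (forall x, A x -> {for x, continuous f}) /\
  (if k is k'.+1 then
     forall u : V, (forall x, A x -> derivable f x u) /\ Ck k' A ('D_u f)
   else True).

Definition smooth_open {V W : normedModType R} (A : set V) (f : V -> W) : Prop :=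
  forall k, Ck k A f.

(* smoothness on an arbitrary subset, by local smooth extension *)
Definition smooth_on {V W : normedModType R} (A : set V) (f : V -> W) : Prop :=
  forall p, A p -> exists (O : set V) (F : V -> W),
    [/\ open O, O p, smooth_open O F & forall x, A x -> O x -> F x = f x].

End Smoothness.

(* Below, S is a submanifold of an open subset of R^d on which g is a
   Riemannian metric, given by its Gram matrices in the standard coordinates;
   S carries the induced metric. *)
Section RiemannianSubmanifolds.
Context {R : realType} {d : nat}.
Local Notation E := 'rV[R]_d.
Local Notation metric := (E -> 'M[R]_d).

Definition dot (u w : E) : R := \sum_i u ord0 i * w ord0 i.

Definition inner (g : metric) (x u w : E) : R :=
  (u *m g x *m w^T) ord0 ord0.

Definition smooth_curve (S : set E) (I : set R) (c : R -> E) : Prop :=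
  [/\ open I, is_interval I, smooth_open (V := R) I c & forall t, I t -> S (c t)].

Definition curve_through (S : set E) (p w : E) (I : set R) (c : R -> E) : Prop :=
  [/\ smooth_curve S I c, I 0, c 0 = p & derive1 c 0 = w].

Definition tangent_space (S : set E) (p : E) : set E :=
  [set w | exists I c, curve_through S p w I c].

Definition partial (f : E -> R) (x : E) (i : 'I_d) : R :=
  'D_(delta_mx ord0 i) f x.

(* Gamma^k_ij at x *)
Definition christoffel (g : metric) (x : E) (k i j : 'I_d) : R :=
  2^-1 * \sum_l invmx (g x) k l *
    (partial (fun y => g y j l) x i + partial (fun y => g y i l) x j
     - partial (fun y => g y i j) x l).

(* covariant derivative of c' along c, for the Levi-Civita connection of g *)
Definition acceleration (g : metric) (c : R -> E) (t : R) : E :=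
  \row_k (derive1n 2 c t ord0 k + \sum_i \sum_j
    christoffel g (c t) k i j * derive1 c t ord0 i * derive1 c t ord0 j).

(* The Levi-Civita connection of S is the tangential part of the ambient one,
   so c is a geodesic of S when its ambient acceleration is normal to S. *)
Definition geodesic (g : metric) (S : set E) (I : set R) (c : R -> E) : Prop :=
  smooth_curve S I c /\
  forall t w, I t -> tangent_space S (c t) w ->
    inner g (c t) (acceleration g c t) w = 0.

Definition geodesic_from (g : metric) (S : set E) (u : E) (p : E)
    (c : R -> E) : Prop :=
  [/\ geodesic g S setT c, c 0 = p & derive1 c 0 = u].

(* w = II_p(u, u), the second fundamental form of N in M: the component
   tangent to M and normal to N of the acceleration of a curve of N with
   velocity u *)
Definition second_fundamental (g : metric) (M N : set E) (p u w : E) : Prop :=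
  let normal z := tangent_space M p z /\
    (forall y, tangent_space N p y -> inner g p z y = 0) in
  normal w /\
  exists I c, curve_through N p u I c /\
    forall z, normal z -> inner g p (acceleration g c 0) z = inner g p w z.

Definition mean_curvature_vector (g : metric) (n : nat) (M N : set E)
    (p H : E) : Prop :=
  exists e w : 'I_n -> E,
    [/\ forall i, tangent_space N p (e i),
        forall i j, inner g p (e i) (e j) = (i == j)%:R,
        forall i, second_fundamental g M N p (e i) (w i)
      & H = n%:R^-1 *: \sum_i w i].

Definition points_into (M C : set E) (p w : E) : Prop :=
  exists I c, curve_through M p w I c /\ forall t, I t -> 0 < t -> C (c t).

Definition is_component (C A : set E) : Prop :=
  exists2 x, A x & C = connected_component A x.

Definition unit_vector_field (g : metric) (N : set E) (v : E -> E) : Prop :=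
  smooth_on N v /\
  forall p, N p -> tangent_space N p (v p) /\ inner g p (v p) (v p) = 1.

Definition geodesic_vector_field (g : metric) (N : set E) (v : E -> E) : Prop :=
  unit_vector_field g N v /\
  forall (I : set R) (c : R -> E), smooth_curve N I c ->
    (forall t, I t -> derive1 c t = v (c t)) -> geodesic g N I c.

(* A chart of the m-dimensional submanifold M with domain V and image the
   whole of R^m; psi is the inverse parametrization. *)
Definition chart (m : nat) (M V : set E) (phi : E -> 'rV[R]_m.+1) : Prop :=
  (exists2 O, open O & V = M `&` O) /\ smooth_on V phi /\
  exists psi : 'rV[R]_m.+1 -> E,
    [/\ smooth_open setT psi, forall y, V (psi y),
        forall y, phi (psi y) = y & forall x, V x -> psi (phi x) = x].

(* F is the set of leaves of a smooth one-dimensional foliation of the open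
   subset U of the (m+1)-dimensional submanifold M: a decomposition of U into
   connected sets such that, in suitable charts, the connected components of
   the traces of the leaves are the coordinate lines of the 0th coordinate. *)
Definition smooth_line_foliation (m : nat) (M U : set E) (F : set (set E)) : Prop :=
  [/\ exists2 O, open O & U = M `&` O,
      partition F id U,
      forall L, F L -> connected L
    & forall x, U x -> exists V (phi : E -> 'rV[R]_m.+1),
        [/\ chart M V phi, V x, V `<=` U &
          forall L y, F L -> (V `&` L) y ->
            connected_component (V `&` L) y =
              [set z | V z /\
                 forall j, j != ord0 -> phi z ord0 j = phi y ord0 j]]].

End RiemannianSubmanifolds.

Section SpaceForms.
Context {R : realType}.

(* M_kappa lies in R^(n+2) if kappa > 0 and in R^(n+1) otherwise. *)
Definition amb (n : nat) (kappa : R) : nat := (n + (0 < kappa)%R).+1.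

Local Notation E n kappa := 'rV[R]_(amb n kappa).

Definition space_form (n : nat) (kappa : R) : set (E n kappa) :=
  [set x : E n kappa | (0 < kappa -> dot x x = kappa^-1) /\
                       (kappa < 0 -> 0 < x ord0 ord0)].

Definition space_metric (n : nat) (kappa : R) (x : E n kappa)
    : 'M[R]_(amb n kappa) :=
  if kappa < 0 then ((- kappa * x ord0 ord0 ^+ 2)^-1)%:M else 1%:M.

(* the image under exp_c of the sphere of radius r of T_c M_kappa *)
Definition geodesic_sphere (n : nat) (kappa : R) (c : E n kappa) (r : R)
    : set (E n kappa) :=
  [set q | exists u gamma,
     [/\ geodesic_from (@space_metric n kappa) (@space_form n kappa) u c gamma,
         inner (@space_metric n kappa) c u u = 1 & gamma r = q]].

(* Isometries of the space forms that are open in the ambient space (kappa <= 0) *)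
Definition isometry (n : nat) (kappa : R) (f : E n kappa -> E n kappa) : Prop :=
  let M := @space_form n kappa in
  let g := @space_metric n kappa in
  [/\ smooth_open M f, forall x, M x -> M (f x),
      exists h, [/\ smooth_open M h, forall x, M x -> M (h x),
                    forall x, M x -> h (f x) = x
                  & forall x, M x -> f (h x) = x]
    & forall x u w, M x -> inner g (f x) ('D_u f x) ('D_w f x) = inner g x u w].

(* The complete umbilic, not totally geodesic hypersurfaces of M_kappa. *)
Inductive complete_umbilic (n : nat) (kappa : R) : set (E n kappa) -> Prop :=
| RoundSphere (c : E n kappa) (r : R) of kappa = 0 & 0 < r :
    complete_umbilic [set x | dot (x - c) (x - c) = r ^+ 2]
| SmallSphere (c : E n kappa) (r : R) of
    0 < kappa & @space_form n kappa c &
    0 < r < pi / Num.sqrt kappa & r != pi / (2 * Num.sqrt kappa) :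
    complete_umbilic (geodesic_sphere c r)
| HyperbolicSphere (c : E n kappa) (r : R) of
    kappa < 0 & @space_form n kappa c & 0 < r :
    complete_umbilic (geodesic_sphere c r)
| Horosphere (f : E n kappa -> E n kappa) of kappa < 0 & isometry f :
    complete_umbilic (f @` [set x : E n kappa | x ord0 ord0 = 1])
  (* The hyperplane a^\perp is orthogonal to {x_0 = 0} iff a_0 = 0; the last
     condition excludes {x_0 = 0} itself, which misses the half-space. *)
| Equidistant (f : E n kappa -> E n kappa) (a : E n kappa) of
    kappa < 0 & isometry f & a ord0 ord0 != 0 &
    (exists2 i, i != ord0 & a ord0 i != 0) :
    complete_umbilic (f @` [set x : E n kappa | @space_form n kappa x /\ dot a x = 0]).

(* C is the component of M_kappa \ N into which -H points.  For kappa > 0 the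
   zone between N and -N is the component of C \ -N adherent to both; the
   other one is the open cap bounded by -N. *)
Definition exterior (n : nat) (kappa : R) (N U : set (E n kappa)) : Prop :=
  let M := @space_form n kappa in
  let g := @space_metric n kappa in
  let antipode := [set x | N (- x)] in
  exists C, [/\ is_component C (M `\` N),
    forall p, N p ->
      exists2 H, mean_curvature_vector g n M N p H & points_into M C p (- H)
  & if 0 < kappa then
      [/\ is_component U (C `\` antipode),
          N `<=` closure U & antipode `<=` closure U]
    else U = C].

Definition T_max (kappa : R) : \bar R :=
  if 0 < kappa then (pi / Num.sqrt kappa)%:E else +oo%E.

(* the sets gamma_{v(p)}(0, T_kappa), p in N *)
Definition rays (n : nat) (kappa : R) (N : set (E n kappa))
    (v : E n kappa -> E n kappa) : set (set (E n kappa)) :=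
  [set L | exists p gamma,
     [/\ N p,
         geodesic_from (@space_metric n kappa) (@space_form n kappa) (v p) p gamma
       & L = gamma @` [set t | 0 < t /\ (t%:E < T_max kappa)%E]]].

Definition bifoliates (n : nat) (kappa : R) (N U : set (E n kappa))
    (v : E n kappa -> E n kappa) : Prop :=
  let M := @space_form n kappa in
  [/\ unit_vector_field (@space_metric n kappa) N v,
      smooth_line_foliation n M U (rays N v)
    & smooth_line_foliation n M U (rays N (fun p => - v p))].

End SpaceForms.

(* Main.v *)
(* A space form embeds isometrically, by a map [Phi], in the light cone of a
   space with a symmetric bilinear form, as the part of the cone in a hyperplane
   [<X, K> = -1] with [<K, K> = - kappa].  Its unit speed geodesics are the curves
   [C X + S V + E K], where [C], [S], [E] are the cosine, sine and versine of
   curvature [kappa].  The umbilic hypersurfaces are the slices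
   [N = {x | <Phi x, A> = 0}] with [<A, A> = 1] and [eta = <A, K> > 0]; such an [N]
   has curvature [k = kappa + eta^2], and its geodesics are given by the same
   formulas with [k] and [KA = K - eta A] for [kappa] and [K].  The exterior is the
   zone [0 < height x], [kappa * height x < 2], where [height x = <Phi x, A> / eta].

   Projecting a point [x] of the zone to [y] in [N] along the pencil of [A] and [K]
   turns "x lies on the ray of v(p)" into [c Phi p + s V(p) + e KA = Phi y], where
   [V = dPhi v] and [c, s, e] depend only on the height of [x], with
   [c^2 + k s^2 = 1], [c = 1 - k e] and [eta^2 s^2 < 1].  So the rays foliate the
   zone as soon as this equation has a unique solution [p] depending smoothly on
   [x].  If [v] is geodesic, the left-hand side is a point of the flow line of [p],
   and one gets [p] back from [y] by the backward flow.

   For (b), [V] is the normalized velocity field of a one-parameter group of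
   boosts if [k < 0] and of rotations with angular speeds 1 and 2 if [k > 0]; the
   length of the unnormalized velocity at [p] is then the root of a quadratic
   equation given by [y].  If [k = 0], [N] is a Euclidean space and [V] is a unit
   field whose direction depends on one coordinate only, which reduces the
   equation to a one-variable implicit function.

   Isometries of the hyperbolic space preserve [<Phi x, Phi y>], hence map slices
   to slices: along a unit speed curve, [y = 1 + kappa <Phi p, Phi c>] satisfies
   [y'^2 <= - kappa (y^2 - 1)], so it grows at most like a hyperbolic cosine. *)

Require Import Defs.
From HB Require Import structures.
From mathcomp Require Import all_boot all_order all_algebra.
From mathcomp Require Import all_classical all_reals all_analysis.
From mathcomp Require Import ring lra.
Import Order.TTheory GRing.Theory Num.Theory.
Import numFieldNormedType.Exports.

Set Implicit Arguments.
Unset Strict Implicit.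
Unset Printing Implicit Defensive.

Local Open Scope classical_set_scope.
Local Open Scope ring_scope.

(** * Smooth maps *)

Section CkCalculus.
Context {R : realType}.
Implicit Types (V W : normedModType R).

(** The hypothesis on a geodesic field only speaks about its integral curves, so these must first be
    produced: a local existence theorem is applied in a chart, the resulting curve is identified
    with the explicit geodesic, and a connectedness argument extends this to all times. The explicit
    geodesic depends smoothly on its initial point because v and [Phi] do, which settles the
    smoothness of the inverse map in (a). Charts must be onto the whole coordinate space, and this
    dictates the projections used below. Rotations with a single speed would have great circles as
    orbits, hence be geodesic; two speeds break this, and as only two denominators occur the
    equation for the length stays quadratic. If k = 0, the bound eta^2 s^2 < 1 is what leaves room
    for a nonconstant direction. An isometry is only known to act on points, whereas a slice is
    given by a vector A; for the standard horosphere and equidistant hypersurfaces A is written as a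
    combination of K and of two points Phi p1, Phi p2, and the same combination of the image points
    gives the new vector. *)

Lemma Ck_continuous V W k (A : set V) (f : V -> W) x :
  Ck k A f -> A x -> {for x, continuous f}.
Proof. by case: k => [|k] [+ _]; apply. Qed.

Lemma Ck_derivable V W k (A : set V) (f : V -> W) x u :
  Ck k.+1 A f -> A x -> derivable f x u.
Proof. by move=> [_ /(_ u)[+ _]]; apply. Qed.

Lemma Ck_derive V W k (A : set V) (f : V -> W) u :
  Ck k.+1 A f -> Ck k A ('D_u f).
Proof. by move=> [_ /(_ u)[_]]. Qed.

Lemma open_near V (A : set V) x : open A -> A x -> \forall y \near x, A y.
Proof. by move=> oA Ax; apply: open_nbhs_nbhs. Qed.

(** Openness turns equality on [A] into equality near each of its points, which all derivatives
    inherit. *)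
Lemma Ck_ext V W k (A : set V) (f g : V -> W) :
  open A -> (forall x, A x -> f x = g x) -> Ck k A f -> Ck k A g.
Proof.
move=> oA; elim: k f g => [|k IH] f g fg [cf df].
  split=> // x Ax; rewrite /prop_for /continuous_at -(fg _ Ax).
  apply: cvg_trans (cf _ Ax); apply: near_eq_cvg.
  by near=> y; apply: fg; near: y; exact: open_near.
have fgx x : A x -> \forall y \near x, f y = g y.
  by move=> Ax; near=> y; apply: fg; near: y; exact: open_near.
split=> [x Ax|u].
  rewrite /prop_for /continuous_at -(fg _ Ax).
  apply: cvg_trans (cf _ Ax); apply: near_eq_cvg; exact: fgx.
have [d1 d2] := df u; split=> [x Ax|].
  by apply: near_eq_derivable (d1 _ Ax); exact: fgx.
by apply: IH d2 => x Ax; apply: near_eq_derive; exact: fgx.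
Unshelve. all: by end_near. Qed.

Lemma Ck_sub V W k (A B : set V) (f : V -> W) :
  B `<=` A -> Ck k A f -> Ck k B f.
Proof.
move=> BA; elim: k f => [|k IH] f [cf df]; first by split=> // x /BA; exact: cf.
split=> [x /BA|u]; first exact: cf.
by have [d1 d2] := df u; split=> [x /BA|]; [exact: d1|exact: IH].
Qed.

Lemma CkS V W k (A : set V) (f : V -> W) : Ck k.+1 A f -> Ck k A f.
Proof.
elim: k f => [|k IH] f [cf df]; split=> // u.
by have [d1 d2] := df u; split=> //; exact: IH.
Qed.

(** [Ck] is a condition at each point of [A] on the total function [f] and its derivatives, so it
    can be checked point by point. *)
Lemma Ck_local V W k (A : set V) (f : V -> W) :
  (forall x, A x -> exists2 B, B x & Ck k B f) -> Ck k A f.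
Proof.
elim: k f => [|k IH] f H.
  by split=> // x /H[B Bx] /Ck_continuous H'; exact: H'.
split=> [x /H[B Bx] /Ck_continuous H'|u]; first exact: H'.
split=> [x /H[B Bx] /Ck_derivable H'|]; first exact: H'.
by apply: IH => x /H[B Bx /Ck_derive]; exists B.
Qed.

Lemma Ck_cst V W k (A : set V) (w : W) : Ck k A (cst w : V -> W).
Proof.
elim: k w => [|k IH] w; first by split=> // x _; exact: cst_continuous.
split=> [x _|u]; first exact: cst_continuous.
split=> [x _|]; first exact: derivable_cst.
rewrite (_ : 'D_u _ = cst 0) //; apply/funext => x; exact: derive_cst.
Qed.

Lemma Ck_lin V W k (A : set V) (f : {linear V -> W}) :
  continuous f -> Ck k A f.
Proof.
case: k => [|k] cf; first by split=> // x _; exact: cf.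
split=> [x _|u]; first exact: cf.
split=> [x _|].
  by apply: diff_derivable; exact: linear_differentiable.
rewrite (_ : 'D_u _ = cst (f u)); first exact: Ck_cst.
apply/funext => x; rewrite deriveE ?diff_lin //; exact: linear_differentiable.
Qed.

Lemma Ck_id V k (A : set V) : Ck k A (fun x : V => x).
Proof. by apply: (@Ck_lin V V k A idfun) => x; exact: cvg_id. Qed.

Lemma Ck_add V W k (A : set V) (f g : V -> W) : open A ->
  Ck k A f -> Ck k A g -> Ck k A (fun x => f x + g x).
Proof.
move=> oA; elim: k f g => [|k IH] f g cf cg.
  split=> // x Ax; apply: continuousD; [exact: Ck_continuous cf Ax|exact: Ck_continuous cg Ax].
split=> [x Ax|u]; first by apply: continuousD; [exact: Ck_continuous cf Ax|exact: Ck_continuous cg Ax].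
split=> [x Ax|]; first by apply: derivableD; [exact: Ck_derivable cf Ax|exact: Ck_derivable cg Ax].
apply: (@Ck_ext _ _ _ _ (fun x => 'D_u f x + 'D_u g x)) => //.
  by move=> x Ax; rewrite -deriveD //; [exact: Ck_derivable cf Ax|exact: Ck_derivable cg Ax].
by apply: IH; exact: Ck_derive.
Qed.

Lemma derivableZ_fun V W (f : V -> R) (g : V -> W) x u :
  derivable f x u -> derivable g x u ->
  is_derive x u (fun y => f y *: g y) ('D_u f x *: g x + f x *: 'D_u g x).
Proof.
move=> df dg.
have H : h^-1 *: (f (h *: u + x) *: g (h *: u + x) - f x *: g x)
    @[h --> 0^'] --> 'D_u f x *: g x + f x *: 'D_u g x.
  rewrite [X in X @ _ --> _](_ : _ = (fun h : R =>
      (h^-1 *: (f (h *: u + x) - f x)) *: g (h *: u + x) +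
      f x *: (h^-1 *: (g (h *: u + x) - g x)))); last first.
    apply/funext => h.
    set a := f (_ + x); set b := g (_ + x).
    transitivity (h^-1 *: ((a - f x) *: b + f x *: (b - g x))).
      by congr (_ *: _); rewrite scalerBl scalerBr addrA subrK.
    by rewrite scalerDr; congr (_ + _); rewrite !scalerA // mulrC.
  apply: cvgD; last by apply: cvgZl_tmp; exact: dg.
  apply: cvgZ; first exact: df.
  have /derivable1P/derivable1_diffP/differentiable_continuous := dg.
  move=> H; have -> : g x = g ((0 : R) *: u + x) by rewrite scale0r add0r.
  by apply: cvg_trans H; apply: cvg_app; exact: cvg_within.
by apply: DeriveDef; [apply/cvg_ex; eexists; exact: H|exact: cvg_lim].
Qed.

Lemma Ck_scale V W k (A : set V) (f : V -> R) (g : V -> W) : open A ->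
  Ck k A f -> Ck k A g -> Ck k A (fun x => f x *: g x).
Proof.
move=> oA; elim: k f g => [|k IH] f g cf cg.
  split=> // x Ax; apply: cvgZ; [exact: Ck_continuous cf Ax|exact: Ck_continuous cg Ax].
split=> [x Ax|u]; first by apply: cvgZ; [exact: Ck_continuous cf Ax|exact: Ck_continuous cg Ax].
have H x : A x -> is_derive x u (fun y => f y *: g y)
    ('D_u f x *: g x + f x *: 'D_u g x).
  by move=> Ax; apply: derivableZ_fun; [exact: Ck_derivable cf Ax|exact: Ck_derivable cg Ax].
split=> [x /H[] //|].
apply: (@Ck_ext _ _ _ _ (fun x => 'D_u f x *: g x + f x *: 'D_u g x)) => //.
  by move=> x /H[].
by apply: Ck_add => //; apply: IH => //; do ?[exact: Ck_derive|exact: CkS].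
Qed.

Lemma Ck_mul V k (A : set V) (f g : V -> R) : open A ->
  Ck k A f -> Ck k A g -> Ck k A (fun x => f x * g x).
Proof. exact: (@Ck_scale V R). Qed.

Lemma Ck_sum V W k n (A : set V) (f : 'I_n -> V -> W) : open A ->
  (forall i, Ck k A (f i)) -> Ck k A (fun x => \sum_i f i x).
Proof.
move=> oA; elim: n f => [|n IH] f H.
  by apply: Ck_ext oA _ (Ck_cst k A 0) => x _; rewrite big_ord0.
apply: Ck_ext oA _ (Ck_add oA (H ord0) (IH _ (fun i => H (lift ord0 i)))).
by move=> x _; rewrite big_ord_recl.
Qed.

Lemma coord_lin_continuous n (i : 'I_n) :
  continuous (fun x : 'rV[R]_n => x ord0 i).
Proof. by move=> x; exact: coord_continuous. Qed.

Lemma Ck_coord n k (A : set 'rV[R]_n) (i : 'I_n) :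
  Ck k A (fun x => x ord0 i).
Proof.
pose f (x : 'rV[R]_n) : R := x ord0 i.
have lf : linear f by move=> a x y; rewrite /f !mxE.
pose F := GRing.isLinear.Build R 'rV[R]_n R *:%R f lf.
pose g : {linear 'rV[R]_n -> R} := HB.pack f F.
exact: (@Ck_lin _ _ k A g (@coord_lin_continuous n i)).
Qed.

Lemma row_sum_coord n (x : 'rV[R]_n) :
  x = \sum_i x ord0 i *: (delta_mx ord0 i : 'rV[R]_n).
Proof. exact: row_sum_delta. Qed.

Lemma Ck_row V n k (A : set V) (f : V -> 'rV[R]_n) : open A ->
  (forall i, Ck k A (fun x => f x ord0 i)) -> Ck k A f.
Proof.
move=> oA H; apply: (@Ck_ext _ _ _ _
  (fun x => \sum_i f x ord0 i *: (delta_mx ord0 i : 'rV[R]_n))) => //.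
  by move=> x _; rewrite -row_sum_coord.
by apply: Ck_sum => // i; apply: Ck_scale => //; exact: Ck_cst.
Qed.

End CkCalculus.

Section C1Differentiable.
Context {R : realType}.
Implicit Types (V W : normedModType R).

Lemma is_derive_line V W (f : V -> W) x u (t : R) :
  derivable f (t *: u + x) u ->
  is_derive t (1 : R) (fun s => f (s *: u + x)) ('D_u f (t *: u + x)).
Proof.
move=> df.
have E : (fun h : R => h^-1 *: (((fun s => f (s *: u + x)) \o shift t) (h *: 1) -
    f (t *: u + x))) = (fun h => h^-1 *: ((f \o shift (t *: u + x)) (h *: u)
    - f (t *: u + x))).
  by apply/funext => h /=; rewrite [h *: 1]mulr1 scalerDl addrA.
by split; rewrite /derivable /derive E.
Qed.

(** A scalar mean value theorem on the line through [x]; bounding [xi] by absolute value serves both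
    signs of [h]. *)
Lemma mvt_line V (f : V -> R) x u (h : R) :
  (forall s, `|s| <= `|h| -> derivable f (s *: u + x) u) ->
  exists2 xi, `|xi| <= `|h| & f (h *: u + x) - f x = h * 'D_u f (xi *: u + x).
Proof.
move=> df.
pose g s := f (s *: u + x).
have g0 : f x = g 0 by rewrite /g scale0r add0r.
have dg s : `|s| <= `|h| -> is_derive s (1 : R) g ('D_u f (s *: u + x)).
  by move=> /df; exact: is_derive_line.
have cg a b : (forall s, s \in `[a, b] -> `|s| <= `|h|) ->
    {within `[a, b], continuous g}.
  move=> H; apply: derivable_within_continuous => s /H /dg[] //.
have sub (a b s : R) : s \in `]a, b[ -> s \in `[a, b].
  by rewrite !in_itv /= => /andP[/ltW -> /ltW ->].
rewrite g0; have [h0|h0|->] := ltgtP h 0.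
- have H s : s \in `[h, 0] -> `|s| <= `|h|.
    rewrite in_itv /= => /andP[h1 h2].
    by rewrite (ler0_norm h2) (ltr0_norm h0) lerN2.
  have [c /sub /H ch E] := MVT h0 (fun s sh => dg s (H s (sub _ _ _ sh))) (cg _ _ H).
  by exists c => //; rewrite -/(g h) -opprB E /= mulrC sub0r mulNr opprK.
- have H s : s \in `[0, h] -> `|s| <= `|h|.
    rewrite in_itv /= => /andP[h1 h2].
    by rewrite (ger0_norm h1) (gtr0_norm h0).
  have [c /sub /H ch E] := MVT h0 (fun s sh => dg s (H s (sub _ _ _ sh))) (cg _ _ H).
  by exists c => //; rewrite -/(g h) E /= mulrC subr0.
- by exists 0 => //; rewrite -/(g 0) subrr mul0r.
Qed.

Section C1.
Context {V : normedModType R} (A : set V) (f : V -> R).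
Hypotheses (oA : open A) (cf : Ck 1 A f).

Lemma C1_near x u (e : R) : A x -> 0 < e -> exists2 d, 0 < d &
  forall y, `|y| < d -> A (y + x) /\ `|'D_u f (y + x) - 'D_u f x| < e.
Proof.
move=> Ax e0.
have cD : 'D_u f @ x --> 'D_u f x := Ck_continuous (Ck_derive u cf) Ax.
have H := @cvgr_dist_lt _ _ _ _ _ _ _ cD _ e0.
have /nbhs_ballP[d d0 dH] : nbhs x (fun y => A y /\ `|'D_u f x - 'D_u f y| < e).
  by apply: filterI; [exact: (open_near oA)|exact: H].
exists d => // y yd; have [|H1 H2] := dH (y + x).
  by rewrite -ball_normE /= opprD addrCA subrr addr0 normrN.
by split => //; rewrite distrC.
Qed.

(** Directional derivatives add up because they are continuous: move first by [h v], then by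
    [h c u]. The second increment is [h c] times the value of ['D_u f] at a point close to [x]. *)
Lemma C1_is_derive_lin x u v (c : R) : A x ->
  is_derive x (c *: u + v) f (c * 'D_u f x + 'D_v f x).
Proof.
move=> Ax.
have H : h^-1 *: (f (h *: (c *: u + v) + x) - f x) @[h --> 0^'] -->
    c * 'D_u f x + 'D_v f x.
  rewrite [X in X @ _ --> _](_ : _ = (fun h : R =>
      h^-1 *: (f ((h * c) *: u + (h *: v + x)) - f (h *: v + x)) +
      h^-1 *: (f (h *: v + x) - f x))); last first.
    apply/funext => h; rewrite -scalerDr addrA subrK.
    by congr (_ *: (f _ - _)); rewrite scalerDr scalerA addrA.
  apply: cvgD; last first.
    by have dv : derivable f x v := Ck_derivable cf Ax; exact: dv.
  apply/cvgrPdist_lt => e e0.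
  have c1 : 0 < `|c| + 1 by rewrite ltr_wpDl.
  have [d d0 dH] := C1_near u Ax (divr_gt0 e0 c1).
  have K0 : 0 < `|c| * `|u| + `|v| + 1 by rewrite ltr_wpDl // addr_ge0 // mulr_ge0.
  near=> h. 
  have h0 : h != 0 by near: h; exact: nbhs_dnbhs_neq.
  have hd : `|h| * (`|c| * `|u| + `|v|) < d.
    apply: (@le_lt_trans _ _ (`|h| * (`|c| * `|u| + `|v| + 1))).
      by rewrite ler_wpM2l // lerDl.
    rewrite -ltr_pdivlMr //; near: h; apply: dnbhs0_lt; exact: divr_gt0.
  have B s : `|s| <= `|h * c| -> `|s *: u + h *: v| < d.
    move=> sh; apply: le_lt_trans hd; apply: le_trans (ler_normD _ _) _.
    rewrite !normrZ mulrDr lerD // mulrA ler_wpM2r //.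
    by rewrite -normrM.
  have [s /B sh|xi /B xih ->] := @mvt_line V f (h *: v + x) u (h * c).
    by rewrite addrA; apply: Ck_derivable cf _; exact: (dH _ sh).1.
  rewrite -mulrA [_ *: _]mulKf // -mulrBr addrA.
  have [_] := dH _ xih; rewrite distrC => H'.
  rewrite normrM; apply: (@le_lt_trans _ _ (`|c| * (e / (`|c| + 1)))).
    by rewrite ler_wpM2l // ltW.
  by rewrite mulrA ltr_pdivrMr // mulrC ltr_pM2l // ltrDl.
by split; [apply/cvg_ex; eexists; exact: H|exact: cvg_lim].
Unshelve. all: by end_near. Qed.

Lemma C1_deriveZD x u v (c : R) : A x ->
  'D_(c *: u + v) f x = c * 'D_u f x + 'D_v f x.
Proof. by move=> Ax; have [] := C1_is_derive_lin u v c Ax. Qed.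

Lemma C1_derive_sum x n (c : 'I_n -> R) (b : 'I_n -> V) : A x ->
  'D_(\sum_i c i *: b i) f x = \sum_i c i * 'D_(b i) f x.
Proof.
move=> Ax; elim: n c b => [|n IH] c b; first by rewrite !big_ord0 derive0.
by rewrite !big_ord_recl C1_deriveZD // IH.
Qed.

End C1.

Lemma coord_norm_le n (x : 'rV[R]_n) i : `|x ord0 i| <= `|x|.
Proof.
rewrite [leRHS]/Num.Def.normr /= mx_normrE.
by apply: le_trans (le_bigmax _ _ (ord0, i)).
Qed.

Lemma C1_derive_coord n (A : set 'rV[R]_n) (f : 'rV[R]_n -> R) x u :
  open A -> Ck 1 A f -> A x ->
  'D_u f x = \sum_i u ord0 i * 'D_(delta_mx ord0 i) f x.
Proof.
by move=> oA cf Ax; rewrite {1}(row_sum_coord u) (C1_derive_sum oA cf).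
Qed.

(** [Ck] only knows directional derivatives, whereas the chain rule needs a total differential. The
    candidate is the map from [u] to ['D_u f x]; the remainder is controlled by the mean value
    theorem in the direction [h] itself. *)
Lemma C1_differentiable n (A : set 'rV[R]_n) (f : 'rV[R]_n -> R) x :
  open A -> Ck 1 A f -> A x -> differentiable f x.
Proof.
move=> oA cf Ax.
pose L (u : 'rV[R]_n) : R := 'D_u f x.
have lL : linear L.
  by move=> a u v; rewrite /L (C1_deriveZD oA cf).
pose F := GRing.isLinear.Build R 'rV[R]_n R *:%R L lL.
pose g : {linear 'rV[R]_n -> R} := HB.pack L F.
have cg : continuous g.
  have -> : (g : _ -> R) = (fun u => \sum_i u ord0 i * 'D_(delta_mx ord0 i) f x).
    by apply/funext => u; rewrite -(C1_derive_coord u oA cf).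
  move=> u; apply: (@Ck_continuous _ _ _ 0 setT) => //.
  apply: Ck_sum; first exact: openT.
  move=> i; apply: Ck_mul; first exact: openT.
    exact: Ck_coord.
  exact: Ck_cst.
have E : (f : 'rV[R]_n -> R^o) \o shift x =
    cst (f x : R^o) + (g : _ -> R^o) +o_ (0 : 'rV[R]_n) id.
  apply/eqaddoP => e e0.
  (* Each of the n partial derivatives may deviate by [e / n.+1], so that their sum deviates by at
     most [e], also when n = 0. *)
  have /fin_all_exists2[d d0 dH] : forall i : 'I_n, exists2 d, 0 < d & forall y, `|y| < d ->
      A (y + x) /\ `|'D_(delta_mx ord0 i) f (y + x) -
        'D_(delta_mx ord0 i) f x| < e / n.+1%:R.
    by move=> i; apply: C1_near => //; rewrite divr_gt0.
  have [d' d'0 dH'] := C1_near oA cf 0 Ax ltr01.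
  have N0 (r : R) : 0 < r -> \forall h \near (0 : 'rV[R]_n), `|h| < r.
    by move=> r0; exact: nbhs0_lt.
  have N1 : \forall h \near (0 : 'rV[R]_n), forall i, `|h| < d i.
    by apply: (@filter_forall 'rV[R]_n 'I_n (fun i h => `|h| < d i) (nbhs (0 : 'rV[R]_n)) _) => i; exact: N0.
  near=> h.
  have hd' : `|h| < d' by near: h; exact: N0.
  have hd i : `|h| < d i by move: i; near: h; exact: N1.
  have S (s r : R) : 0 < r -> `|s| <= `|1 : R| -> `|h| < r -> `|s *: h| < r.
    move=> r0; rewrite normr1 => s1 hr.
    by rewrite normrZ (le_lt_trans _ hr) // ler_piMl.
  have [s s1|xi xi1] := @mvt_line _ f x h 1.
    by apply: Ck_derivable cf _; exact: (dH' _ (S _ _ d'0 s1 hd')).1.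
  rewrite scale1r mul1r => E.
  rewrite -[X in `|X| <= _]/(f (h + x) - (f x + L h)) opprD addrA E.
  rewrite /L !(C1_derive_coord h oA cf) //; last first.
    exact: (dH' _ (S _ _ d'0 xi1 hd')).1.
  rewrite -sumrB; apply: le_trans (ler_norm_sum _ _ _) _.
  apply: (@le_trans _ _ (\sum_(i < n) `|h| * (e / n.+1%:R))).
    apply: ler_sum => i _; rewrite -mulrBr normrM ler_pM ?coord_norm_le //.
    by apply: ltW; exact: (dH i _ (S _ _ (d0 i) xi1 (hd i))).2.
  rewrite sumr_const card_ord -mulrnAr [leRHS]mulrC ler_wpM2l //.
  by rewrite -mulr_natr mulrAC ler_pdivrMr ?ltr0n // ler_pM2l // ler_nat.
apply/diff_locallyP; rewrite (diff_unique cg E); split => //.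
Unshelve. all: by end_near. Qed.

End C1Differentiable.

Section CkComposition.
Context {R : realType}.
Implicit Types (V W : normedModType R).

(** Only the derivative of [f] along [u] is available, so [f] is restricted to the line through [x],
    where derivability is differentiability, and the chain rule is applied at parameter 0. *)
Lemma is_derive_comp_dir V V' W (f : V -> V') (g : V' -> W) x u :
  derivable f x u -> differentiable g (f x) ->
  is_derive x u (fun y => g (f y)) ('D_('D_u f x) g (f x)).
Proof.
move=> df dg.
pose l (h : R) := f (h *: u + x).
have l0 : l 0 = f x by rewrite /l scale0r add0r.
have dl : derivable l 0 1 := (derivable1P f x u).1 df.
have Dg (T : normedModType R) (k : V' -> T) :
    'D_1 (fun h : R => k (l h)) 0 = 'D_u (fun y => k (f y)) x.
  have E : (fun h : R => h^-1 *: (((fun h => k (l h)) \o shift 0) (h *: 1) - k (l 0)))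
      = (fun h => h^-1 *: (((fun y => k (f y)) \o shift x) (h *: u) - k (f x))).
    by apply/funext => h /=; rewrite /l addr0 scale0r add0r [h *: 1]mulr1.
  by rewrite /derive E.
have Dl : 'D_1 l 0 = 'D_u f x by rewrite -(Dg _ id).
have dl' : differentiable l 0 by apply/derivable1_diffP.
have dgl : differentiable g (l 0) by rewrite l0.
have dc : differentiable (g \o l) 0 by exact: differentiable_comp.
split; first by apply/derivable1P; apply/derivable1_diffP; exact: dc.
transitivity ('D_1 (g \o l) 0); first by rewrite -Dg.
by rewrite deriveE // diff_comp //= l0 -Dl !deriveE.
Qed.

Lemma derive_coord V n (f : V -> 'rV[R]_n) x u i : derivable f x u ->
  is_derive x u (fun y => f y ord0 i) ('D_u f x ord0 i).
Proof.
move=> df; split; first by move/derivable_mxP : df.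
by rewrite derive_mx // mxE.
Qed.

Lemma continuous_at_comp (T1 T2 T3 : topologicalType) (f : T1 -> T2) (g : T2 -> T3) x :
  {for x, continuous f} -> {for f x, continuous g} ->
  {for x, continuous (fun y => g (f y))}.
Proof. exact: continuous_comp. Qed.

Lemma Ck_coordf V n k (A : set V) (f : V -> 'rV[R]_n) i : open A ->
  Ck k A f -> Ck k A (fun x => f x ord0 i).
Proof.
move=> oA; elim: k f => [|k IH] f cf.
  split=> // x Ax; apply: (@continuous_at_comp _ _ _ f (fun y => y ord0 i) x (Ck_continuous cf Ax)).
  exact: coord_lin_continuous.
split=> [x Ax|u].
  apply: (@continuous_at_comp _ _ _ f (fun y => y ord0 i) x (Ck_continuous cf Ax)); exact: coord_lin_continuous.
have df x : A x -> is_derive x u (fun y => f y ord0 i) ('D_u f x ord0 i).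
  by move=> Ax; apply: derive_coord; exact: Ck_derivable cf Ax.
split=> [x /df[] //|].
apply: Ck_ext oA _ (IH _ (Ck_derive u cf)) => x Ax.
by have [_ ->] := df _ Ax.
Qed.

(** Expanded over the coordinates, the derivative of the composite is a sum of products of a
    derivative of [f] with a partial derivative of [g] composed with [f], and the induction
    hypothesis applies to the latter. *)
Lemma Ck_comp_rVR V n k (A : set V) (B : set 'rV[R]_n)
    (f : V -> 'rV[R]_n) (g : 'rV[R]_n -> R) :
  open A -> open B -> (forall x, A x -> B (f x)) ->
  Ck k A f -> Ck k B g -> Ck k A (fun x => g (f x)).
Proof.
move=> oA oB AB; elim: k g f AB => [|k IH] g f AB cf cg.
  split=> // x Ax.
  exact: (continuous_at_comp (Ck_continuous cf Ax) (Ck_continuous cg (AB _ Ax))).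
have cg1 : Ck 1 B g by elim: (k) cg => // j IHj /CkS.
have d x u : A x -> is_derive x u (fun y => g (f y)) ('D_('D_u f x) g (f x)).
  move=> Ax; apply: is_derive_comp_dir; first exact: Ck_derivable cf Ax.
  by apply: (C1_differentiable oB) => //; exact: AB.
split=> [x Ax|u].
  exact: (continuous_at_comp (Ck_continuous cf Ax) (Ck_continuous cg (AB _ Ax))).
split=> [x Ax|]; first by have [] := d x u Ax.
apply: (@Ck_ext _ _ _ _ _
  (fun x => \sum_i 'D_u f x ord0 i * 'D_(delta_mx ord0 i) g (f x))) => //.
  move=> x Ax; have [_ ->] := d x u Ax.
  by rewrite (C1_derive_coord _ oB cg1) //; exact: AB.
apply: Ck_sum => // i; apply: Ck_mul => //.
  by apply: Ck_coordf => //; exact: Ck_derive.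
exact: (IH _ _ AB (CkS cf) (Ck_derive _ cg)).
Qed.

Lemma Ck_comp_rV V n m k (A : set V) (B : set 'rV[R]_n)
    (f : V -> 'rV[R]_n) (g : 'rV[R]_n -> 'rV[R]_m) :
  open A -> open B -> (forall x, A x -> B (f x)) ->
  Ck k A f -> Ck k B g -> Ck k A (fun x => g (f x)).
Proof.
move=> oA oB AB cf cg; apply: Ck_row => // i.
exact: (Ck_comp_rVR oA oB AB cf (Ck_coordf i oB cg)).
Qed.

Lemma Ck_comp_R V W k (A : set V) (B : set R) (f : V -> R) (g : R -> W) :
  open A -> (forall x, A x -> B (f x)) ->
  Ck k A f -> Ck k B g -> Ck k A (fun x => g (f x)).
Proof.
move=> oA AB; elim: k g f AB => [|k IH] g f AB cf cg.
  split=> // x Ax.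
  exact: (continuous_at_comp (Ck_continuous cf Ax) (Ck_continuous cg (AB _ Ax))).
have dg y : B y -> differentiable g y.
  by move=> By; apply/derivable1_diffP; exact: Ck_derivable cg By.
have d x u : A x -> is_derive x u (fun y => g (f y)) ('D_('D_u f x) g (f x)).
  move=> Ax; apply: is_derive_comp_dir; first exact: Ck_derivable cf Ax.
  by apply: dg; exact: AB.
split=> [x Ax|u].
  exact: (continuous_at_comp (Ck_continuous cf Ax) (Ck_continuous cg (AB _ Ax))).
split=> [x Ax|]; first by have [] := d x u Ax.
apply: (@Ck_ext _ _ _ _ _ (fun x => 'D_u f x *: 'D_1 g (f x))) => //.
  move=> x Ax; have [_ ->] := d x u Ax.
  rewrite !(deriveE _ (dg _ (AB _ Ax))).
  by rewrite -linearZ /= [_ *: 1]mulr1.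
exact: (Ck_scale oA (Ck_derive u cf) (IH _ _ AB (CkS cf) (Ck_derive (1 : R) cg))).
Qed.

(** On the line every direction is a multiple of 1, so one derivative decides. This is the bootstrap
    used below: a function whose derivative is a smooth expression in itself gains one order at each
    step. *)
Lemma Ck_antideriv W k (A : set R) (f g : R -> W) : open A ->
  (forall x, A x -> is_derive x 1 f (g x)) -> Ck k A g -> Ck k.+1 A f.
Proof.
move=> oA d cg.
have df x : A x -> differentiable f x.
  by move=> /d[df _]; apply/derivable1_diffP.
split=> [x Ax|u]; first by apply: differentiable_continuous; exact: df.
split=> [x Ax|]; first by apply: diff_derivable; exact: df.
apply: (@Ck_ext _ _ _ _ _ (fun x => u *: g x)) => //.
  move=> x Ax; have [_ <-] := d _ Ax; rewrite !deriveE; try exact: df.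
  by rewrite -linearZ /= [_ *: 1]mulr1.
by apply: Ck_scale => //; exact: Ck_cst.
Qed.

Lemma Ck_opp V W k (A : set V) (f : V -> W) : open A ->
  Ck k A f -> Ck k A (fun x => - f x).
Proof.
move=> oA cf; apply: Ck_ext oA _ (Ck_scale oA (Ck_cst k A (-1 : R)) cf) => x _.
by rewrite /cst scaleN1r.
Qed.

Lemma open_neq0 : open [set x : R | x != 0].
Proof.
rewrite (_ : [set x : R | x != 0] = ~` [set 0]).
  apply: closed_openC; exact: closed_eq.
by apply/seteqP; split => x /= /eqP.
Qed.

Lemma Ck_inv_R k : Ck k [set x : R | x != 0] (fun x => x^-1).
Proof.
elim: k => [|k IH]; first by split=> // x x0; exact: inv_continuous.
apply: (@Ck_antideriv _ _ _ _ (fun x => - (x^-1 * x^-1))); first exact: open_neq0.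
  move=> x x0; split; first exact: (@derivableV _ _ id x 1 x0 (@derivable_id _ _ _ _)).
  rewrite (@deriveV _ _ id x 1 x0 (@derivable_id _ _ _ _)) derive_id.
  by rewrite [_ *: _]mulr1 expr2 invfM.
have o := open_neq0.
exact: (Ck_opp o (Ck_mul o IH IH)).
Qed.

Lemma open_gt0 : open [set x : R | 0 < x].
Proof. exact: open_gt. Qed.

Lemma Ck_sqrt_R k : Ck k [set x : R | 0 < x] (@Num.sqrt R).
Proof.
elim: k => [|k IH]; first by split=> // x x0; exact: sqrt_continuous.
apply: (@Ck_antideriv _ _ _ _ (fun x => (2 * Num.sqrt x)^-1)); first exact: open_gt0.
have o := open_gt0.
have H (x : R) : 0 < x -> 2 * Num.sqrt x != 0.
  by move=> x0; rewrite mulf_neq0 // gt_eqF // sqrtr_gt0.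
exact: (Ck_comp_R o H (Ck_mul o (Ck_cst k _ (2 : R)) IH) (Ck_inv_R k)).
Qed.

End CkComposition.

Section SmoothOn.
Context {R : realType}.
Implicit Types (V W : normedModType R).

Lemma open_preimage_in V W (B : set V) (C : set W) (f : V -> W) :
  open B -> open C -> (forall x, B x -> {for x, continuous f}) ->
  open (B `&` f @^-1` C).
Proof.
move=> oB oC cf; rewrite openE => x [Bx Cfx].
apply: filterI; first exact: open_nbhs_nbhs.
by apply: (cf x Bx); exact: open_nbhs_nbhs.
Qed.

Lemma smooth_on_ext V W (A : set V) (f g : V -> W) :
  (forall x, A x -> f x = g x) -> smooth_on A f -> smooth_on A g.
Proof.
move=> fg H p Ap; have [B [F [oB Bp sF FE]]] := H p Ap.
by exists B, F; split => // x Ax Bx; rewrite FE // fg.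
Qed.

Lemma smooth_on_sub V W (A B : set V) (f : V -> W) :
  B `<=` A -> smooth_on A f -> smooth_on B f.
Proof.
move=> BA H p /BA Ap; have [C [F [oC Cp sF FE]]] := H p Ap.
by exists C, F; split => // x /BA; exact: FE.
Qed.

Lemma smooth_open_on V W (A : set V) (f : V -> W) :
  open A -> smooth_open A f -> smooth_on A f.
Proof. by move=> oA sf p Ap; exists A, f. Qed.

Lemma smooth_on_open V W (A : set V) (f : V -> W) :
  open A -> smooth_on A f -> smooth_open A f.
Proof.
move=> oA sf k; apply: Ck_local => p Ap; have [B [F [oB Bp sF FE]]] := sf p Ap.
exists (A `&` B) => //; apply: (@Ck_ext _ _ _ _ _ F); first exact: openI.
  by move=> x [Ax Bx]; rewrite FE.
by apply: Ck_sub (sF k) => x [].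
Qed.

Lemma smooth_on_cst V W (A : set V) (w : W) : smooth_on A (fun=> w).
Proof.
by move=> p _; exists setT, (cst w); split => //; [exact: openT|move=> k; exact: Ck_cst].
Qed.

Lemma smooth_on_id V (A : set V) : smooth_on A (fun x => x).
Proof.
by move=> p _; exists setT, id; split => //; [exact: openT|move=> k; exact: Ck_id].
Qed.

Lemma smooth_on2 V W1 W2 W (op : W1 -> W2 -> W) (A : set V) f g :
  (forall k (B : set V) F G, open B -> Ck k B F -> Ck k B G ->
     Ck k B (fun x => op (F x) (G x))) ->
  smooth_on A f -> smooth_on A g -> smooth_on A (fun x => op (f x) (g x)).
Proof.
move=> H sf sg p Ap.
have [B [F [oB Bp sF FE]]] := sf p Ap; have [C [G [oC Cp sG GE]]] := sg p Ap.
exists (B `&` C), (fun x => op (F x) (G x)); split => //; first exact: openI.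
  move=> k; apply: H; first exact: openI.
    by apply: Ck_sub (sF k) => x [].
  by apply: Ck_sub (sG k) => x [].
by move=> x Ax [Bx Cx]; rewrite FE // GE.
Qed.

Lemma smooth_on_add V W (A : set V) (f g : V -> W) :
  smooth_on A f -> smooth_on A g -> smooth_on A (fun x => f x + g x).
Proof. by apply: smooth_on2 => k B F G; exact: Ck_add. Qed.

Lemma smooth_on_scale V W (A : set V) (f : V -> R) (g : V -> W) :
  smooth_on A f -> smooth_on A g -> smooth_on A (fun x => f x *: g x).
Proof. by apply: smooth_on2 => k B F G; exact: Ck_scale. Qed.

Lemma smooth_on_mul V (A : set V) (f g : V -> R) :
  smooth_on A f -> smooth_on A g -> smooth_on A (fun x => f x * g x).
Proof. by apply: smooth_on2 => k B F G; exact: Ck_mul. Qed.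

Lemma smooth_on_opp V W (A : set V) (f : V -> W) :
  smooth_on A f -> smooth_on A (fun x => - f x).
Proof.
move=> sf; apply: (@smooth_on_ext _ _ _ (fun x => -1 *: f x)).
  by move=> x _; rewrite scaleN1r.
by apply: smooth_on_scale => //; exact: smooth_on_cst.
Qed.

Lemma smooth_on_sum V W n (A : set V) (f : 'I_n -> V -> W) :
  (forall i, smooth_on A (f i)) -> smooth_on A (fun x => \sum_i f i x).
Proof.
elim: n f => [|n IH] f H.
  apply: (@smooth_on_ext _ _ _ (fun=> 0)); last exact: smooth_on_cst.
  by move=> x _; rewrite big_ord0.
apply: smooth_on_ext (smooth_on_add (H ord0) (IH _ (fun i => H (lift ord0 i)))).
by move=> x _; rewrite big_ord_recl.
Qed.

Lemma smooth_on_comp_rVR V n (A : set V) (B : set 'rV[R]_n)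
    (f : V -> 'rV[R]_n) (g : 'rV[R]_n -> R) :
  smooth_on A f -> smooth_on B g -> (forall x, A x -> B (f x)) ->
  smooth_on A (fun x => g (f x)).
Proof.
move=> sf sg AB p Ap.
have [B' [F [oB Bp sF FE]]] := sf p Ap; have [C [G [oC Cp sG GE]]] := sg _ (AB _ Ap).
have o : open (B' `&` F @^-1` C).
  by apply: open_preimage_in => // x Bx; exact: (Ck_continuous (sF 0%N)).
exists (B' `&` F @^-1` C), (fun x => G (F x)); split => //.
- by split => //=; rewrite FE.
- move=> k; apply: (@Ck_comp_rVR _ _ _ _ _ C) => //; first by move=> x [].
  by apply: Ck_sub (sF k) => x [].
- move=> x Ax [Bx /= CF]; rewrite GE ?FE //; first exact: AB.
  by rewrite -FE.
Qed.

Lemma smooth_on_row V n (A : set V) (f : V -> 'rV[R]_n) :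
  (forall i, smooth_on A (fun x => f x ord0 i)) -> smooth_on A f.
Proof.
move=> H; apply: (@smooth_on_ext _ _ _
  (fun x => \sum_i f x ord0 i *: (delta_mx ord0 i : 'rV[R]_n))) => //.
  by move=> x _; rewrite -row_sum_coord.
by apply: smooth_on_sum => i; apply: smooth_on_scale => //; exact: smooth_on_cst.
Qed.

Lemma smooth_on_coord V n (A : set V) (f : V -> 'rV[R]_n) i :
  smooth_on A f -> smooth_on A (fun x => f x ord0 i).
Proof.
move=> sf; apply: (@smooth_on_comp_rVR _ _ _ setT _ (fun y : 'rV[R]_n => y ord0 i)) => //.
by move=> p _; exists setT, (fun y : 'rV[R]_n => y ord0 i); split => //;
  [exact: openT|move=> k; exact: Ck_coord].
Qed.

Lemma smooth_on_comp V n m (A : set V) (B : set 'rV[R]_n)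
    (f : V -> 'rV[R]_n) (g : 'rV[R]_n -> 'rV[R]_m) :
  smooth_on A f -> smooth_on B g -> (forall x, A x -> B (f x)) ->
  smooth_on A (fun x => g (f x)).
Proof.
move=> sf sg AB; apply: smooth_on_row => i.
by apply: (@smooth_on_comp_rVR _ _ _ B _ (fun y => g y ord0 i)) => //; exact: smooth_on_coord.
Qed.

Lemma smooth_on_comp_R V W (A : set V) (B : set R) (f : V -> R) (g : R -> W) :
  smooth_on A f -> smooth_on B g -> (forall x, A x -> B (f x)) ->
  smooth_on A (fun x => g (f x)).
Proof.
move=> sf sg AB p Ap.
have [B' [F [oB Bp sF FE]]] := sf p Ap; have [C [G [oC Cp sG GE]]] := sg _ (AB _ Ap).
have o : open (B' `&` F @^-1` C).
  by apply: open_preimage_in => // x Bx; exact: (Ck_continuous (sF 0%N)).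
exists (B' `&` F @^-1` C), (fun x => G (F x)); split => //.
- by split => //=; rewrite FE.
- move=> k; apply: (@Ck_comp_R _ _ _ _ _ C) => //; first by move=> x [].
  by apply: Ck_sub (sF k) => x [].
- move=> x Ax [Bx /= CF]; rewrite GE ?FE //; first exact: AB.
  by rewrite -FE.
Qed.

Lemma smooth_on_mulmx V n m (A : set V) (f : V -> 'rV[R]_n) (M : 'M[R]_(n, m)) :
  smooth_on A f -> smooth_on A (fun x => f x *m M).
Proof.
move=> sf; apply: smooth_on_row => i.
apply: (@smooth_on_ext _ _ _ (fun x => \sum_j f x ord0 j * M j i)).
  by move=> x _; rewrite mxE.
apply: smooth_on_sum => j; apply: smooth_on_mul; first exact: smooth_on_coord.
exact: smooth_on_cst.
Qed.

Lemma smooth_on_row_mx V n m (A : set V) (f : V -> 'rV[R]_n) (g : V -> 'rV[R]_m) :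
  smooth_on A f -> smooth_on A g -> smooth_on A (fun x => row_mx (f x) (g x)).
Proof.
move=> sf sg; apply: smooth_on_row => i.
case: (split_ordP i) => j ->.
  by apply: smooth_on_ext (smooth_on_coord j sf) => x _; rewrite row_mxEl.
by apply: smooth_on_ext (smooth_on_coord j sg) => x _; rewrite row_mxEr.
Qed.

Lemma smooth_on_inv V (A : set V) (f : V -> R) :
  smooth_on A f -> (forall x, A x -> f x != 0) -> smooth_on A (fun x => (f x)^-1).
Proof.
move=> sf f0; apply: (@smooth_on_comp_R _ _ _ [set x | x != 0] _ (fun x => x^-1)) => //.
by apply: smooth_open_on; [exact: open_neq0|move=> k; exact: Ck_inv_R].
Qed.

Lemma smooth_on_div V (A : set V) (f g : V -> R) :
  smooth_on A f -> smooth_on A g -> (forall x, A x -> g x != 0) ->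
  smooth_on A (fun x => f x / g x).
Proof. by move=> sf sg g0; apply: smooth_on_mul => //; exact: smooth_on_inv. Qed.

Lemma smooth_on_exp V (A : set V) (f : V -> R) n :
  smooth_on A f -> smooth_on A (fun x => f x ^+ n).
Proof.
move=> sf; elim: n => [|n IH]; first exact: smooth_on_cst.
by apply: (@smooth_on_ext _ _ _ (fun x => f x * f x ^+ n));
  [move=> x _; rewrite exprS|exact: smooth_on_mul].
Qed.

Lemma smooth_on_sqrt V (A : set V) (f : V -> R) :
  smooth_on A f -> (forall x, A x -> 0 < f x) ->
  smooth_on A (fun x => Num.sqrt (f x)).
Proof.
move=> sf f0; apply: (@smooth_on_comp_R _ _ _ [set x | 0 < x] _ Num.sqrt) => //.
by apply: smooth_open_on; [exact: open_gt0|move=> k; exact: Ck_sqrt_R].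
Qed.

Lemma smooth_on_continuous V W (A : set V) (f : V -> W) :
  smooth_on A f -> {within A, continuous f}.
Proof.
move=> sf; apply/subspace_continuousP => x Ax.
have [B [F [oB Bx sF FE]]] := sf x Ax.
have cF : F @ within A (nbhs x) --> f x.
  rewrite -FE //; apply: cvg_trans (Ck_continuous (sF 0%N) Bx).
  by apply: cvg_app; exact: cvg_within.
apply: cvg_trans cF; apply: near_eq_cvg.
rewrite near_withinE; near=> y => Ay; rewrite FE //.
by near: y; exact: open_near.
Unshelve. all: by end_near. Qed.

Lemma smooth_on_continuous_at V W (A : set V) (f : V -> W) x :
  open A -> smooth_on A f -> A x -> {for x, continuous f}.
Proof. by move=> oA sf Ax; exact: (Ck_continuous (smooth_on_open oA sf 0%N) Ax). Qed.

End SmoothOn.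

(** * Constant-curvature trigonometry *)

Section DerivRules.
Context {R : realType}.
Implicit Types (V W : normedModType R).

Lemma isd_add V W (f g : V -> W) x u df dg :
  is_derive x u f df -> is_derive x u g dg ->
  is_derive x u (fun y => f y + g y) (df + dg).
Proof. exact: is_deriveD. Qed.

Lemma isd_opp V W (f : V -> W) x u df :
  is_derive x u f df -> is_derive x u (fun y => - f y) (- df).
Proof. exact: is_deriveN. Qed.

Lemma isd_cst V W (w : W) (x u : V) : is_derive x u (fun=> w) 0.
Proof. exact: is_derive_cst. Qed.

Lemma isd_scale V W (f : V -> R) (g : V -> W) x u df dg :
  is_derive x u f df -> is_derive x u g dg ->
  is_derive x u (fun y => f y *: g y) (df *: g x + f x *: dg).
Proof.
move=> [f1 <-] [g1 <-]; exact: derivableZ_fun.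
Qed.

Lemma isd_mul V (f g : V -> R) x u df dg :
  is_derive x u f df -> is_derive x u g dg ->
  is_derive x u (fun y => f y * g y) (df * g x + f x * dg).
Proof. exact: isd_scale. Qed.

Lemma isd_comp (f g : R -> R) x a b :
  is_derive (g x) 1 f a -> is_derive x 1 g b ->
  is_derive x 1 (fun y => f (g y)) (a * b).
Proof. exact: is_derive1_comp. Qed.

Lemma isd_sum V W n (h : 'I_n -> V -> W) x u dh :
  (forall i, is_derive x u (h i) (dh i)) ->
  is_derive x u (fun y => \sum_i h i y) (\sum_i dh i).
Proof.
move=> H; rewrite (_ : (fun y => _) = \sum_i h i).
  exact: is_derive_sum.
by apply/funext => y; rewrite fct_sumE.
Qed.

Lemma isd_coord V n (f : V -> 'rV[R]_n) x u df i :
  is_derive x u f df -> is_derive x u (fun y => f y ord0 i) (df ord0 i).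
Proof. by move=> [f1 <-]; exact: derive_coord. Qed.

Lemma isd_row V n (f : V -> 'rV[R]_n) x u (df : 'rV[R]_n) :
  (forall i, is_derive x u (fun y => f y ord0 i) (df ord0 i)) ->
  is_derive x u f df.
Proof.
move=> H; have d : derivable f x u.
  by apply/derivable_mxP => i j; rewrite (ord1 i); have [] := H j.
split => //; rewrite derive_mx //; apply/rowP => i; rewrite mxE.
by have [_ ->] := H i.
Qed.

Lemma isd_mulmx V n m (M : 'M[R]_(n, m)) (f : V -> 'rV[R]_n) x u df :
  is_derive x u f df -> is_derive x u (fun y => f y *m M) (df *m M).
Proof.
move=> H; apply: isd_row => i; rewrite mxE.
rewrite (_ : (fun y => _) = (fun y => \sum_j f y ord0 j * M j i)); last first.
  by apply/funext => y; rewrite mxE.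
apply: isd_sum => j.
apply: is_derive_eq (isd_mul (isd_coord j H) (isd_cst (M j i) x u)) _.
by rewrite mulr0 addr0.
Qed.

Lemma isd_near V W (f g : V -> W) x u df :
  (\near x, f x = g x) -> is_derive x u f df -> is_derive x u g df.
Proof. exact: near_eq_is_derive. Qed.

Lemma isd_unique V W (f : V -> W) x u df dg :
  is_derive x u f df -> is_derive x u f dg -> df = dg.
Proof. by move=> [_ <-] [_ <-]. Qed.

Lemma isd_smooth W (A : set R) (f : R -> W) t :
  open A -> smooth_open A f -> A t -> is_derive t 1 f (derive1 f t).
Proof.
by move=> oA sf At; rewrite derive1E; split => //; exact: Ck_derivable (sf 1%N) At.
Qed.

Lemma cst_on_interval (I : set R) (f : R -> R) x y : is_interval I ->
  (forall z, I z -> is_derive z 1 f 0) -> I x -> I y -> f x = f y.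
Proof.
move=> iI df; wlog xy : x y / x <= y.
  by move=> H Ix Iy; case: (leP x y) => [/H|/ltW/H] -> //.
move=> Ix Iy.
have sub z : z \in `[x, y] -> I z.
  by rewrite in_itv /= => zxy; exact: iI Ix Iy _ zxy.
have [||z _] := @MVT_segment R f (fun=> 0) x y xy.
- move=> z; rewrite in_itv /= => /andP[/ltW xz /ltW zy]; apply/df/sub.
  by rewrite in_itv /= xz zy.
- by apply: derivable_within_continuous => z /sub /df[].
- by rewrite mul0r => /eqP; rewrite subr_eq0 => /eqP ->.
Qed.

End DerivRules.

Section CurvatureTrig.
Context {R : realType}.
Implicit Types (k t : R).

Definition cosk k t : R :=
  if 0 < k then cos (Num.sqrt k * t)
  else if k < 0 then (expR (Num.sqrt (- k) * t) + expR (- (Num.sqrt (- k) * t))) / 2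
  else 1.

Definition sink k t : R :=
  if 0 < k then sin (Num.sqrt k * t) / Num.sqrt k
  else if k < 0 then
    (expR (Num.sqrt (- k) * t) - expR (- (Num.sqrt (- k) * t))) / (2 * Num.sqrt (- k))
  else t.

(** The antiderivative of [sink k] that vanishes at 0. Geodesics are parametrized with it because,
    unlike the cosine, it is not constant when k = 0. *)
Definition versk k t : R := if k == 0 then t ^+ 2 / 2 else (1 - cosk k t) / k.

Lemma isd_linear (a t : R) : is_derive t (1 : R) (fun s : R => a * s) a.
Proof.
apply: is_derive_eq (isd_mul (isd_cst a t (1 : R)) (is_derive_id _ _)) _.
by rewrite mul0r add0r mulr1.
Qed.

Lemma is_derive_cosk k t : is_derive t 1 (cosk k) (- k * sink k t).
Proof.
rewrite /sink /cosk.
case: (ltrgtP 0 k) => [k0|k0|<-]; last first.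
- by rewrite oppr0 mul0r; exact: isd_cst.
- have s0 : 0 < Num.sqrt (- k) by rewrite sqrtr_gt0 oppr_gt0.
  have d := isd_linear (Num.sqrt (- k)) t.
  apply: is_derive_eq (isd_mul (isd_add (isd_comp (is_derive_expR _) d)
    (isd_comp (is_derive_expR _) (isd_opp d))) (isd_cst _ _ _)) _.
  have E : - k = Num.sqrt (- k) ^+ 2 by rewrite sqr_sqrtr // oppr_ge0 ltW.
  rewrite [X in _ = X * _]E; move: (Num.sqrt (- k)) s0 {d E} => s s0.
  by field; rewrite gt_eqF.
- have s0 : 0 < Num.sqrt k by rewrite sqrtr_gt0.
  have d := isd_linear (Num.sqrt k) t.
  apply: is_derive_eq (isd_comp (is_derive_cos _) d) _.
  have E : k = Num.sqrt k ^+ 2 by rewrite sqr_sqrtr // ltW.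
  rewrite [X in _ = - X * _]E; move: (Num.sqrt k) s0 {d E} => s s0.
  by field; rewrite gt_eqF.
Qed.

Lemma is_derive_sink k t : is_derive t 1 (sink k) (cosk k t).
Proof.
rewrite /sink /cosk.
case: (ltrgtP 0 k) => [k0|k0|_]; last first.
- exact: is_derive_id.
- have s0 : 0 < Num.sqrt (- k) by rewrite sqrtr_gt0 oppr_gt0.
  have d := isd_linear (Num.sqrt (- k)) t.
  apply: is_derive_eq (isd_mul (isd_add (isd_comp (is_derive_expR _) d)
    (isd_opp (isd_comp (is_derive_expR _) (isd_opp d)))) (isd_cst _ _ _)) _.
  move: (Num.sqrt (- k)) s0 {d} => s s0.
  by field; rewrite gt_eqF.
- have s0 : 0 < Num.sqrt k by rewrite sqrtr_gt0.
  have d := isd_linear (Num.sqrt k) t.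
  apply: is_derive_eq (isd_mul (isd_comp (is_derive_sin _) d) (isd_cst _ _ _)) _.
  move: (Num.sqrt k) s0 {d} => s s0.
  by field; rewrite gt_eqF.
Qed.

Lemma cosk0 k : cosk k 0 = 1.
Proof.
rewrite /cosk !mulr0 oppr0 expR0 cos0; do 2?case: ifP => // _.
by field.
Qed.

Lemma sink0 k : sink k 0 = 0.
Proof.
rewrite /sink !mulr0 oppr0 expR0 sin0 subrr; do 2?case: ifP => // _; by rewrite mul0r.
Qed.

Lemma versk0 k : versk k 0 = 0.
Proof. by rewrite /versk cosk0 subrr mul0r expr0n /= mul0r if_same. Qed.

Lemma is_derive_versk k t : is_derive t 1 (versk k) (sink k t).
Proof.
rewrite /versk; case: eqP => [->|/eqP k0].
  apply: is_derive_eq (isd_mul (isd_mul (is_derive_id _ _) (is_derive_id _ _)) (isd_cst _ _ _)) _.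
  by rewrite /sink ltxx /=; field.
apply: is_derive_eq (isd_mul (isd_add (isd_cst _ _ _) (isd_opp (is_derive_cosk _ _))) (isd_cst _ _ _)) _.
by field.
Qed.

Lemma cosk_versk k t : cosk k t = 1 - k * versk k t.
Proof.
rewrite /versk; case: eqP => [->|/eqP k0]; first by rewrite mul0r subr0 /cosk ltxx.
by field.
Qed.

Lemma cosk_sink k t : cosk k t ^+ 2 + k * sink k t ^+ 2 = 1.
Proof.
rewrite /sink /cosk; case: (ltrgtP 0 k) => [k0|k0|<-]; last by rewrite mul0r addr0 expr1n.
- have s0 : 0 < Num.sqrt k by rewrite sqrtr_gt0.
  have E : k = Num.sqrt k ^+ 2 by rewrite sqr_sqrtr // ltW.
  rewrite [X in _ + X * _]E -[RHS](cos2Dsin2 (Num.sqrt k * t)).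
  by move: (Num.sqrt k) s0 {E} => s s0; field; rewrite gt_eqF.
- have s0 : 0 < Num.sqrt (- k) by rewrite sqrtr_gt0 oppr_gt0.
  have E : k = - Num.sqrt (- k) ^+ 2 by rewrite sqr_sqrtr ?opprK // oppr_ge0 ltW.
  rewrite [X in _ + X * _]E.
  have := expRxMexpNx_1 (Num.sqrt (- k) * t).
  move: (expR (- _)) (expR _) => y x xy.
  transitivity (x * y); last by [].
  by move: (Num.sqrt (- k)) s0 {E} => s s0; field; rewrite gt_eqF.
Qed.

Lemma sink_versk k t : sink k t ^+ 2 = 2 * versk k t - k * versk k t ^+ 2.
Proof.
have [->|k0] := eqVneq k 0.
  by rewrite /sink /versk !ltxx eqxx mul0r subr0; field.
apply: (mulfI k0); apply: (addrI (cosk k t ^+ 2)); rewrite cosk_sink cosk_versk.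
by ring.
Qed.

Lemma versk_ge0 k t : 0 <= versk k t.
Proof.
rewrite /versk; case: eqP => [_|/eqP k0]; first by rewrite divr_ge0 // sqr_ge0.
rewrite /cosk; case: (ltrgtP 0 k) k0 => // [k0|k0] _.
  by rewrite divr_ge0 ?(ltW k0) // subr_ge0 cos_le1.
rewrite -mulrNN mulr_ge0 //; last by rewrite -invrN invr_ge0 oppr_ge0 ltW.
rewrite opprB subr_ge0.
have := expRxMexpNx_1 (Num.sqrt (- k) * t).
have := expR_gt0 (Num.sqrt (- k) * t).
move: (expR (- _)) (expR _) => y x x0 xy.
have : 0 <= (x - y) ^+ 2 by exact: sqr_ge0.
have y0 : 0 < y by rewrite -(pmulr_rgt0 _ x0) xy.
nra.
Qed.

(** For k <= 0 the conic c^2 + k s^2 = 1 has two branches, hence the condition on the sign of c. The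
    last clause places t in the interval of times on which rays are defined. *)
Lemma cosk_sink_surj k c s : c ^+ 2 + k * s ^+ 2 = 1 -> (k <= 0 -> 0 < c) ->
  exists t, [/\ cosk k t = c, sink k t = s &
    0 < s -> 0 < t /\ (0 < k -> t < pi / Num.sqrt k)].
Proof.
rewrite /sink /cosk => E; case: (ltrgtP 0 k) => [k0|k0|k0] cp; last first.
- exists s; split => //.
  have c0 : 0 < c by exact: cp.
  move: E; rewrite -k0 mul0r addr0 => /eqP; rewrite sqrf_eq1 => /orP[/eqP ->//|/eqP cE].
  by move: c0; rewrite cE oppr_gt0 ltr10.
- have {cp} c0 : 0 < c by exact: cp.
  have s0 : 0 < Num.sqrt (- k) by rewrite sqrtr_gt0 oppr_gt0.
  have kE : k = - Num.sqrt (- k) ^+ 2 by rewrite sqr_sqrtr ?opprK // oppr_ge0 ltW.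
  move: E; rewrite {1}kE; move: (Num.sqrt (- k)) s0 {kE} => a a0 E.
  have p0 : 0 < c + a * s.
    have : (c + a * s) * (c - a * s) = 1 by rewrite -E; ring.
    nra.
  (* With k = - a^2 the equation reads (c + a s)(c - a s) = 1, and c + a s has to be exp (a t). *)
  exists (ln (c + a * s) / a).
  rewrite mulrCA divff ?gt_eqF // mulr1 expRN lnK ?posrE //.
  have -> : (c + a * s)^-1 = c - a * s.
    by apply: (mulfI (lt0r_neq0 p0)); rewrite divff ?gt_eqF // -E; ring.
  split; [by field|by field; rewrite gt_eqF|move=> sp].
  split => //; rewrite divr_gt0 // ln_gt0 //.
  have : 0 < a * s by exact: mulr_gt0.
  have : (c + a * s) * (c - a * s) = 1 by rewrite -E; ring.
  nra.
- have s0 : 0 < Num.sqrt k by rewrite sqrtr_gt0.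
  have kE : k = Num.sqrt k ^+ 2 by rewrite sqr_sqrtr // ltW.
  move: E; rewrite {1}kE; move: (Num.sqrt k) s0 {kE} => a a0 E.
  have c1 : -1 <= c <= 1.
    have : 0 <= (a * s) ^+ 2 by exact: sqr_ge0.
    rewrite exprMn => h; apply/andP; split; nra.
  have c1' : c \in `[-1, 1] by rewrite in_itv.
  have sE : 1 - c ^+ 2 = (a * s) ^+ 2 by rewrite -E; ring.
  have [sp|sn] := leP 0 s.
    exists (acos c / a); rewrite mulrCA divff ?gt_eqF // mulr1 acosK // sin_acos //.
    rewrite sE sqrtr_sqr ger0_norm ?mulr_ge0 // ?ltW //; split => //.
      by rewrite mulrC mulKf // gt_eqF.
    move=> sp'; have as0 : 0 < a * s by exact: mulr_gt0.
    have cc : -1 < c < 1.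
      have : 0 < (a * s) ^+ 2 by exact: exprn_gt0.
      rewrite -sE => h; apply/andP; split; nra.
    case/andP: cc => cc1 cc2; case/andP: c1 => c11 c12.
    split => [|_]; first by rewrite divr_gt0 // acos_gt0 // c11.
    by rewrite ltr_pM2r ?invr_gt0 // acos_ltpi // cc1.
  exists (- (acos c / a)); rewrite mulrN mulrCA divff ?gt_eqF // mulr1 cosN sinN acosK // sin_acos //.
  rewrite sE sqrtr_sqr ler0_norm; last by rewrite mulr_ge0_le0 // ltW.
  rewrite opprK; split => //; first by rewrite mulrC mulKf // gt_eqF.
  by move=> sp; move: (lt_trans sp sn); rewrite ltxx.
Qed.

Lemma sink_gt0 k t : 0 < t -> (0 < k -> t < pi / Num.sqrt k) -> 0 < sink k t.
Proof.
rewrite /sink; case: (ltrgtP 0 k) => [k0|k0|k0] t0 tT //.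
- have s0 : 0 < Num.sqrt k by rewrite sqrtr_gt0.
  rewrite divr_gt0 // sin_gt0_pi // mulr_gt0 //=.
  by rewrite mulrC -ltr_pdivlMr // tT.
- have s0 : 0 < Num.sqrt (- k) by rewrite sqrtr_gt0 oppr_gt0.
  rewrite divr_gt0 // ?mulr_gt0 // subr_gt0 ltr_expR.
  have : 0 < Num.sqrt (- k) * t by exact: mulr_gt0.
  lra.
Qed.

Lemma smooth_cosk_sink k j :
  Ck j setT (cosk k) /\ Ck j setT (sink k).
Proof.
elim: j => [|j [IHc IHs]].
  split; split => // t _; apply: differentiable_continuous; apply/derivable1_diffP.
    by have [] := is_derive_cosk k t.
  by have [] := is_derive_sink k t.
split.
  apply: (Ck_antideriv openT (fun t _ => is_derive_cosk k t)).
  exact: (Ck_scale openT (Ck_cst j _ (- k : R)) IHs).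
exact: (Ck_antideriv openT (fun t _ => is_derive_sink k t) IHc).
Qed.

Lemma smooth_versk k : smooth_open setT (versk k).
Proof.
move=> j; apply: CkS; apply: (Ck_antideriv openT (fun t _ => is_derive_versk k t)).
by have [] := smooth_cosk_sink k j.
Qed.

(** The difference (z, w) with the explicit solution satisfies z' = w and w' = - k z. Rotating it
    back by [cosk] and [sink] gives two quantities of derivative 0, and [cosk_sink] recovers z from
    them. *)
Lemma ode_unique1 k (k0 x0 v0 : R) (I : set R) (x v : R -> R) :
  is_interval I -> I 0 -> x 0 = x0 -> v 0 = v0 ->
  (forall t, I t -> is_derive t 1 x (v t)) ->
  (forall t, I t -> is_derive t 1 v (- k * x t + k0)) ->
  forall t, I t -> x t = cosk k t * x0 + sink k t * v0 + versk k t * k0.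
Proof.
move=> iI I0 xE vE dx dv t It.
pose z s := x s - (cosk k s * x0 + sink k s * v0 + versk k s * k0).
pose w s := v s - (- k * sink k s * x0 + cosk k s * v0 + sink k s * k0).
have dz s : I s -> is_derive s 1 z (w s).
  move=> Is; rewrite /z; apply: is_derive_eq (isd_add (dx s Is) (isd_opp
    (isd_add (isd_add (isd_mul (is_derive_cosk k s) (isd_cst x0 _ _))
     (isd_mul (is_derive_sink k s) (isd_cst v0 _ _)))
     (isd_mul (is_derive_versk k s) (isd_cst k0 _ _))))) _.
  by rewrite /w; ring.
have dw s : I s -> is_derive s 1 w (- k * z s).
  move=> Is; rewrite /w; apply: is_derive_eq (isd_add (dv s Is) (isd_opp
    (isd_add (isd_add (isd_mul (isd_mul (isd_cst (- k) _ _) (is_derive_sink k s)) (isd_cst x0 _ _))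
     (isd_mul (is_derive_cosk k s) (isd_cst v0 _ _)))
     (isd_mul (is_derive_sink k s) (isd_cst k0 _ _))))) _.
  by rewrite /z cosk_versk; ring.
have z0 : z 0 = 0 by rewrite /z cosk0 sink0 versk0 xE; ring.
have w0 : w 0 = 0 by rewrite /w cosk0 sink0 vE; ring.
have a0 : cosk k t * z t - sink k t * w t = 0.
  have -> : 0 = cosk k 0 * z 0 - sink k 0 * w 0 :> R by rewrite z0 w0; ring.
  apply: (@cst_on_interval _ I (fun s => cosk k s * z s - sink k s * w s)) => // s Is.
  apply: is_derive_eq (isd_add (isd_mul (is_derive_cosk k s) (dz s Is))
    (isd_opp (isd_mul (is_derive_sink k s) (dw s Is)))) _.
  by ring.
have b0 : k * sink k t * z t + cosk k t * w t = 0.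
  have -> : 0 = k * sink k 0 * z 0 + cosk k 0 * w 0 :> R by rewrite z0 w0; ring.
  apply: (@cst_on_interval _ I (fun s => k * sink k s * z s + cosk k s * w s)) => // s Is.
  apply: is_derive_eq (isd_add (isd_mul (isd_mul (isd_cst k _ _) (is_derive_sink k s)) (dz s Is))
    (isd_mul (is_derive_cosk k s) (dw s Is))) _.
  by ring.
have : z t = cosk k t * (cosk k t * z t - sink k t * w t) +
    sink k t * (k * sink k t * z t + cosk k t * w t).
  by rewrite -[LHS]mul1r -(cosk_sink k t); ring.
by rewrite a0 b0 !mulr0 addr0 => /eqP; rewrite subr_eq0 => /eqP.
Qed.

End CurvatureTrig.

(** * Local solutions of differential equations *)

Section Picard.
Context {R : realType}.

Lemma antiderivative (g : R -> R) : continuous g ->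
  exists G : R -> R, G 0 = 0 /\ forall t : R, `|t| < 1 -> is_derive t 1 G (g t).
Proof.
move=> cg.
have ig : (@lebesgue_measure R).-integrable `[-1, 2] (EFin \o g).
  apply: continuous_compact_integrable; first exact: segment_compact.
  exact: continuous_subspaceT.
(* Integrating from -1, over a segment that reaches up to 2, puts every t with |t| < 1 in the
   interior, where the fundamental theorem applies. *)
pose F (x : R) : R := (\int[lebesgue_measure]_(t in [set` `[-1, x]]) (g t))%R.
exists (fun x => F x - F 0); split=> [|t]; first by rewrite subrr.
rewrite ltr_norml => /andP[t1 t2].
have [|d1 d2] := @continuous_FTC1_closed R g (-1) t 2 _ ig t1 (cg t); first by lra.
apply: is_derive_eq (isd_add (DeriveDef d1 erefl) (isd_opp (isd_cst (F 0) t (1 : R)))) _.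
by rewrite oppr0 addr0 -derive1E.
Qed.

Lemma row_norm_le n (x : 'rV[R]_n) (b : R) :
  0 <= b -> (forall i, `|x ord0 i| <= b) -> `|x| <= b.
Proof.
move=> b0 H; rewrite [leLHS]/Num.Def.normr /= mx_normrE.
by apply: bigmax_le => // -[i j] _ /=; rewrite (ord1 i).
Qed.

Lemma row_mvt n (G g : R -> 'rV[R]_n) (d b : R) : 0 <= b ->
  (forall s : R, `|s| <= d -> is_derive s 1 G (g s)) ->
  (forall s, `|s| <= d -> `|g s| <= b) ->
  forall s t, `|s| <= d -> `|t| <= d -> `|G t - G s| <= b * `|t - s|.
Proof.
move=> b0 dG gb s t; wlog st : s t / s <= t.
  move=> H sd td; have [st|/ltW ts] := leP s t; first exact: H.
  by rewrite distrC (distrC t); exact: H.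
move=> sd td; apply: row_norm_le => [|i]; first by rewrite mulr_ge0.
have sub z : z \in `[s, t] -> `|z| <= d.
  move: sd td; rewrite in_itv /= !ler_norml => /andP[? ?] /andP[? ?] /andP[? ?].
  by apply/andP; split; lra.
have [||z zst] := @MVT_segment R (fun z => G z ord0 i) (fun z => g z ord0 i) s t st.
- move=> z zi; apply: isd_coord; apply/dG/sub.
  by move: zi; rewrite !in_itv /= => /andP[/ltW -> /ltW ->].
- by apply: derivable_within_continuous => z /sub /dG /(isd_coord i)[].
move=> E; rewrite !mxE E normrM ler_wpM2r //.
apply: le_trans (coord_norm_le _ _) _; exact/gb/sub.
Qed.

(** The increments from step k on sum to at most 2 b / 2^k, so the intervals of that radius around
    [u k] are nested; the limit is the supremum of their left ends. *)
Lemma geometric_limit (u : nat -> R) (b : R) :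
  (forall k, `|u k.+1 - u k| <= b * 2^-1 ^+ k) ->
  exists l, forall k, `|l - u k| <= 2 * b * 2^-1 ^+ k.
Proof.
move=> H; pose a k := u k - 2 * b * 2^-1 ^+ k; pose c k := u k + 2 * b * 2^-1 ^+ k.
have aS k : a k <= a k.+1 /\ c k.+1 <= c k.
  have := H k; rewrite ler_norml /a /c exprS => /andP[h1 h2].
  by move: (2^-1 ^+ k) h1 h2 => p h1 h2; split; lra.
have mono k j : a k <= a (k + j)%N /\ c (k + j)%N <= c k.
  elim: j => [|j [IH1 IH2]]; first by rewrite addn0.
  rewrite addnS; have [h1 h2] := aS (k + j)%N.
  by split; [exact: le_trans h1|exact: le_trans IH2].
have b0 : 0 <= b by have := H 0%N; rewrite expr0 mulr1; exact: le_trans.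
have ac k : a k <= c k.
  have : 0 <= 2 * b * 2^-1 ^+ k by rewrite mulr_ge0 ?mulr_ge0 // exprn_ge0.
  by rewrite /a /c; lra.
have acj k j : a k <= c j.
  have [h1 h2] := mono k j; have [h3 h4] := mono j k.
  by apply: le_trans h1 _; apply: le_trans (ac _) _; rewrite addnC.
have ub k : ubound (range a) (c k) by move=> _ [j _ <-]; exact: acj.
have hub : has_ubound (range a) by exists (c 0%N); exact: ub.
exists (sup (range a)) => k.
have h1 : a k <= sup (range a) by apply: ub_le_sup => //; exists k.
have h2 : sup (range a) <= c k by apply: ge_sup => //; exists (a 0%N), 0%N.
by rewrite ler_norml; rewrite /a /c in h1 h2; apply/andP; split; lra.
Qed.

Lemma C1_lipschitz n (w : 'rV[R]_n -> 'rV[R]_n) (p : 'rV[R]_n) : Ck 1 setT w ->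
  exists r L : R, [/\ 0 < r, 0 < L & forall x y, `|x - p| <= r -> `|y - p| <= r ->
    `|w x - w y| <= L * `|x - y|].
Proof.
move=> cw.
have cwj j : Ck 1 setT (fun x => w x ord0 j) by apply: Ck_coordf => //; exact: openT.
have H j i : exists r : R, 0 < r /\ forall y, `|y| < r ->
    `|'D_(delta_mx ord0 i) (fun x => w x ord0 j) (y + p)| <=
    `|'D_(delta_mx ord0 i) (fun x => w x ord0 j) p| + 1.
  have [r r0 rH] := C1_near openT (cwj j) (delta_mx ord0 i) (I : setT p) ltr01.
  exists r; split => // y /rH[_ h].
  by rewrite -lerBlDl (le_trans (lerB_dist _ _)) // ltW.
have {}H : exists r : R, 0 < r /\ forall j i y, `|y| < r ->
    `|'D_(delta_mx ord0 i) (fun x => w x ord0 j) (y + p)| <=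
    `|'D_(delta_mx ord0 i) (fun x => w x ord0 j) p| + 1.
  pose rr j i := projT1 (cid (H j i)).
  have rrP j i := projT2 (cid (H j i)).
  exists (\big[Order.min/1]_(j < n) \big[Order.min/1]_(i < n) rr j i); split.
    apply: lt_bigmin => // j _; apply: lt_bigmin => // i _.
    exact: (rrP j i).1.
  move=> j i y yr; apply: (rrP j i).2; apply: lt_le_trans yr _.
  by apply: le_trans (bigmin_le _ j _) _; exact: bigmin_le.
have [r [r0 rH]] := H.
pose S j := \sum_i (`|'D_(delta_mx ord0 i) (fun x => w x ord0 j) p| + 1).
have S0 j : 0 <= S j by apply: sumr_ge0 => i _; rewrite addr_ge0.
pose L := \sum_j S j + 1.
have SL j : S j <= L.
  rewrite /L (bigD1 j) //= -addrA lerDl addr_ge0 // sumr_ge0 // => i _; exact: S0.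
have L0 : 0 < L by rewrite /L ltr_wpDl // sumr_ge0 // => j _; exact: S0.
(* This radius keeps the segment from y to x inside the ball of radius r: at most r / 2 for x - y
   and r / 4 for y - p. *)
exists (r / 4), L; split => //; first by rewrite divr_gt0.
move=> x y xr yr; apply: row_norm_le => [|j]; first by rewrite mulr_ge0 // ltW.
have xyr : `|x - y| <= r / 2.
  rewrite -(subrKA p) (le_trans (ler_normD _ _)) // (distrC p); lra.
have B s : `|s| <= `|1 : R| -> `|s *: (x - y) + (y - p)| < r.
  rewrite normr1 => s1; rewrite (le_lt_trans (ler_normD _ _)) // normrZ.
  have : `|s| * `|x - y| <= `|x - y| by rewrite ler_piMl.
  lra.
have [s sh|xi /B xih] := @mvt_line R _ (fun x => w x ord0 j) y (x - y) 1.
  exact: Ck_derivable (cwj j) I.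
rewrite scale1r subrK mul1r !mxE => ->.
rewrite (C1_derive_coord _ openT (cwj j) I) (le_trans (ler_norm_sum _ _ _)) //.
apply: (@le_trans _ _ (S j * `|x - y|)); last by rewrite ler_wpM2r.
rewrite mulr_suml ler_sum // => i _; rewrite normrM mulrC ler_pM ?coord_norm_le //.
by have := rH j i _ xih; rewrite -addrA subrK.
Qed.

(** Freezing time outside [- d, d] makes the Picard iterates total continuous functions, although
    they are controlled only there. *)
Definition clamp (d t : R) : R := Order.max (- d) (Order.min d t).

Lemma clamp_id d t : `|t| <= d -> clamp d t = t.
Proof.
rewrite ler_norml /clamp => /andP[h1 h2].
by rewrite (min_idPr h2) (max_idPr h1).
Qed.

Lemma clamp_le d t : 0 <= d -> `|clamp d t| <= d.
Proof.
move=> d0; rewrite ler_norml /clamp le_max lexx /= ge_max ge_min lexx /= andbT; lra.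
Qed.

Lemma clamp_lip d s t : 0 <= d -> `|clamp d s - clamp d t| <= `|s - t|.
Proof.
move=> d0; wlog st : s t / s <= t.
  by move=> H; have [/H//|/ltW/H] := leP s t; rewrite distrC (distrC t).
rewrite (distrC s) (distrC (clamp d s)) (ger0_norm (_ : 0 <= t - s)) ?subr_ge0 //.
rewrite /clamp /Order.max /Order.min; rewrite ler_norml.
by do 4?case: ifP => [|/negbT]; rewrite -?leNgt => *; apply/andP; split; lra.
Qed.

Lemma near_dist (t e : R) : 0 < e -> \forall s \near t, `|t - s| < e.
Proof.
by move=> e0; have /(_ e0) := @nbhsx_ballx R R t e; rewrite -ball_normE.
Qed.

Lemma clamp_continuous d : 0 <= d -> continuous (clamp d).
Proof.
move=> d0 t; apply/cvgrPdist_lt => e e0; near=> s.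
apply: le_lt_trans (clamp_lip _ _ d0) _; near: s.
exact: near_dist.
Unshelve. all: by end_near. Qed.

Lemma lipschitz_continuous n (c : R -> 'rV[R]_n) (M : R) : 0 < M ->
  (forall s t, `|c s - c t| <= M * `|s - t|) -> continuous c.
Proof.
move=> M0 H t; apply/cvgrPdist_lt => e e0; near=> s.
apply: le_lt_trans (H _ _) _; rewrite mulrC -ltr_pdivlMr //.
by near: s; apply: near_dist; exact: divr_gt0.
Unshelve. all: by end_near. Qed.

Lemma row_antiderivative n (g : R -> 'rV[R]_n) : continuous g ->
  exists G : R -> 'rV[R]_n, G 0 = 0 /\ forall t : R, `|t| < 1 -> is_derive t 1 G (g t).
Proof.
move=> cg.
have H i : exists G : R -> R, G 0 = 0 /\
    forall t : R, `|t| < 1 -> is_derive t 1 G (g t ord0 i).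
  apply: antiderivative => t.
  exact: (@continuous_at_comp _ _ _ g (fun y => y ord0 i) t (cg t) (@coord_lin_continuous R n i (g t))).
pose G i := projT1 (cid (H i)); have GP i := projT2 (cid (H i)).
exists (fun t => \row_i G i t); split.
  by apply/rowP => i; rewrite !mxE; exact: (GP i).1.
move=> t t1; apply: isd_row => i; rewrite (_ : (fun _ => _) = G i).
  exact: (GP i).2.
by apply/funext => y; rewrite mxE.
Qed.

(** Successive approximation in the sup norm. The curves it produces will be identified as
    geodesics, which have their own uniqueness result. *)
Theorem picard n (w : 'rV[R]_n -> 'rV[R]_n) (p : 'rV[R]_n) : Ck 1 setT w ->
  exists (d : R) (c : R -> 'rV[R]_n), [/\ 0 < d, c 0 = p &
    forall t : R, `|t| < d -> is_derive t 1 c (w (c t))].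
Proof.
move=> cw; have [r [L [r0 L0 Lip]]] := C1_lipschitz p cw.
have ww : continuous w by move=> x; exact: (Ck_continuous cw I).
pose M := `|w p| + L * r + 1.
have M0 : 0 < M by rewrite /M ltr_wpDl // addr_ge0 // mulr_ge0 // ltW.
have wM x : `|x - p| <= r -> `|w x| <= M.
  move=> xr; have := Lip x p xr; rewrite subrr normr0 => /(_ (ltW r0)) h.
  rewrite -[w x](subrK (w p)) (le_trans (ler_normD _ _)) // /M addrC -addrA lerD2l.
  rewrite (le_trans h) // (le_trans (_ : _ <= L * r)) ?lerDl // ler_wpM2l //.
  exact: ltW.
(* 1/2 stays in the domain of the antiderivatives, r / M keeps the iterates in the ball where [w] is
   Lipschitz, and 1 / (2 L) makes each step contract by 1/2. *)
pose d := Order.min (1 / 2) (Order.min (r / M) (1 / (2 * L))).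
have d0 : 0 < d by rewrite !lt_min !divr_gt0 // ?mulr_gt0.
have d1 : d < 1 by rewrite gt_min; apply/orP; left; lra.
have dM : M * d <= r.
  by rewrite mulrC -ler_pdivlMr // /d !ge_min lexx orbT.
have dL : L * d <= 1 / 2.
  rewrite mulrC -ler_pdivlMr // /d !ge_min; apply/orP; right; apply/orP; right.
  by rewrite -mulrA -invfM.
have d0' := ltW d0.
(* An antiderivative is only available for continuous input, hence the case distinction; [next_cont]
   shows that the iterates remain in the first case. *)
pose next (g : R -> 'rV[R]_n) : R -> 'rV[R]_n :=
  if pselect (continuous g) is left cg then
    let cwg : continuous (fun t => w (g t)) :=
      fun t => continuous_at_comp (cg t) (ww (g t)) in
    fun t => p + projT1 (cid (row_antiderivative cwg)) (clamp d t)
  else g.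
have nextP g : continuous g -> exists G : R -> 'rV[R]_n,
    [/\ G 0 = 0, forall t : R, `|t| < 1 -> is_derive t 1 G (w (g t)) &
      next g = fun t => p + G (clamp d t)].
  move=> cg; rewrite /next; case: pselect => // cg'.
  by case: cid => G [G0 dG] /=; exists G.
have next_cont g : continuous g -> continuous (next g).
  move=> cg; have [G [G0 dG ->]] := nextP g cg => t.
  have cG : {for t, continuous (fun t => G (clamp d t))}.
    apply: (continuous_at_comp (@clamp_continuous d d0' t)).
    have /dG[+ _] : `|clamp d t| < 1 by apply: le_lt_trans d1; exact: clamp_le.
    by move/derivable1_diffP/differentiable_continuous.
  by apply: (continuousD _ cG); exact: cst_continuous.
pose gam k := iter k next (fun=> p).
have gamc k : continuous (gam k).
  by elim: k => [|k IH]; [move=> t; exact: cst_continuous|exact: next_cont].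
have dn k : exists G : R -> 'rV[R]_n,
    [/\ G 0 = 0, forall t : R, `|t| <= d -> is_derive t 1 G (w (gam k t)) &
      gam k.+1 = fun t => p + G (clamp d t)].
  have [G [G0 dG E]] := nextP _ (gamc k); exists G; split => // t td.
  by apply: dG; exact: le_lt_trans d1.
have gamr k t : `|t| <= d -> `|gam k t - p| <= r.
  elim: k t => [|k IH] t td; first by rewrite subrr normr0 ltW.
  have [G [G0 dG ->]] := dn k; rewrite clamp_id // addrAC subrr add0r.
  have := row_mvt (ltW M0) dG (fun s sd => wM _ (IH s sd)) (_ : `|0| <= d) td.
  rewrite normr0 => /(_ d0'); rewrite G0 !subr0 => h; apply: le_trans h _.
  by apply: le_trans dM; rewrite ler_wpM2l // ltW.
have gamL k s t : `|s| <= d -> `|t| <= d -> `|gam k s - gam k t| <= M * `|s - t|.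
  move=> sd td; case: k => [|k]; first by rewrite subrr normr0 mulr_ge0 // ltW.
  have [G [G0 dG ->]] := dn k; rewrite !clamp_id // opprD addrACA subrr add0r.
  exact: (row_mvt (ltW M0) dG (fun s sd => wM _ (gamr k s sd))).
have step k t : `|t| <= d -> `|gam k.+1 t - gam k t| <= r * 2^-1 ^+ k.
  elim: k t => [|k IH] t td; first by rewrite expr0 mulr1; exact: gamr.
  have [G [G0 dG ->]] := dn k.+1; have [F [F0 dF E]] := dn k.
  rewrite E !clamp_id // opprD addrACA subrr add0r.
  have b0 : 0 <= L * (r * 2^-1 ^+ k).
    by rewrite !mulr_ge0 ?exprn_ge0 // ltW.
  have := row_mvt (G := fun t => G t - F t) b0
    (fun s sd => isd_add (dG s sd) (isd_opp (dF s sd)))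
    (fun s sd => le_trans (Lip _ _ (gamr _ _ sd) (gamr _ _ sd))
       (ler_wpM2l (ltW L0) (IH s sd))) (_ : `|0| <= d) td.
  rewrite normr0 => /(_ d0'); rewrite G0 F0 subrr !subr0 => h; apply: le_trans h _.
  apply: (@le_trans _ _ (L * (r * 2^-1 ^+ k) * d)); first by rewrite ler_wpM2l.
  have q0 : 0 <= r * 2^-1 ^+ k by rewrite mulr_ge0 ?exprn_ge0 // ltW.
  have := ler_wpM2r q0 dL; rewrite exprS; move: (2^-1 ^+ k) => q; lra.
have lim t i : exists l, forall k, `|l - gam k (clamp d t) ord0 i| <= 2 * r * 2^-1 ^+ k.
  apply: geometric_limit => k; have := step k _ (clamp_le t d0').
  by apply: le_trans; apply: le_trans (coord_norm_le _ i); rewrite !mxE.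
pose c t : 'rV[R]_n := \row_i projT1 (cid (lim t i)).
have cP t k : `|c t - gam k (clamp d t)| <= 2 * r * 2^-1 ^+ k.
  apply: row_norm_le => [|i]; first by rewrite !mulr_ge0 ?exprn_ge0 // ltW.
  by rewrite !mxE; exact: (projT2 (cid (lim t i))).
(* Passage to the limit: an inequality that holds up to an error of order 2^-k for every k holds
   exactly. *)
have small (a b q : R) : 0 <= q -> (forall k : nat, a <= b + q * 2^-1 ^+ k) -> a <= b.
  move=> q0 H; rewrite leNgt; apply/negP => ba.
  have ab0 : 0 < a - b by rewrite subr_gt0.
  have [k _ /(_ k (leqnn k))] : \forall k \near \oo, q * 2^-1 ^+ k < a - b.
    have h : (fun k : nat => q * 2^-1 ^+ k) @ \oo --> (0 : R).
      rewrite -(mulr0 q); apply: cvgM; first exact: cvg_cst.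
      by apply: cvg_expr; rewrite ger0_norm //; lra.
    exact: (@cvgr_lt _ _ _ _ (fun k : nat => q * 2^-1 ^+ k) 0 h _ ab0).
  by have := H k; lra.
have cL s t : `|c s - c t| <= M * `|s - t|.
  apply: (@small _ _ (4 * r)); first by rewrite mulr_ge0 // ltW.
  move=> k.
  have h1 := cP s k; have h2 := cP t k.
  have h3 := gamL k _ _ (clamp_le s d0') (clamp_le t d0').
  have h4 : M * `|clamp d s - clamp d t| <= M * `|s - t|.
    by rewrite ler_wpM2l ?(ltW M0) // clamp_lip.
  rewrite -(subrKA (gam k (clamp d s)) (c s)) -(subrKA (gam k (clamp d t)) (gam k (clamp d s))).
  apply: le_trans (ler_normD _ _) _; apply: le_trans (lerD h1 (ler_normD _ _)) _.
  rewrite (distrC _ (c t)).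
  by move: (2^-1 ^+ k) h2 h1 => q h2 h1; lra.
have cc : continuous c := lipschitz_continuous M0 cL.
have [G [G0 dG]] := row_antiderivative (fun t => continuous_at_comp (cc t) (ww (c t))).
have cr t : `|t| <= d -> `|c t - p| <= r.
  move=> td; apply: (@small _ _ (2 * r)); first by rewrite mulr_ge0 // ltW.
  move=> k; rewrite -(subrKA (gam k (clamp d t))); apply: le_trans (ler_normD _ _) _.
  by rewrite addrC lerD // gamr // clamp_le.
have cE t : `|t| <= d -> c t = p + G t.
  move=> td; apply/eqP; rewrite -subr_eq0 -normr_le0.
  apply: (@small _ _ (4 * r)); first by rewrite mulr_ge0 // ltW.
  move=> k; rewrite add0r.
  have h1 := cP t k.+1; rewrite clamp_id // in h1.
  have [F [F0 dF E]] := dn k.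
  have b0 : 0 <= L * (2 * r * 2^-1 ^+ k).
    by rewrite !mulr_ge0 ?exprn_ge0 // ltW.
  have dG' (s : R) : `|s| <= d -> is_derive s 1 G (w (c s)).
    by move=> sd; apply: dG; exact: le_lt_trans d1.
  have h s : `|s| <= d -> `|w (gam k s) - w (c s)| <= L * (2 * r * 2^-1 ^+ k).
    move=> sd; apply: le_trans (Lip _ _ (gamr _ _ sd) (cr _ sd)) _.
    rewrite ler_wpM2l ?(ltW L0) // distrC; have := cP s k; by rewrite clamp_id.
  have := row_mvt (G := fun t => F t - G t) b0
    (fun s sd => isd_add (dF s sd) (isd_opp (dG' s sd))) h (_ : `|0| <= d) td.
  rewrite normr0 => /(_ d0'); rewrite F0 G0 subrr !subr0 => h2.
  have h3 : `|F t - G t| <= r * 2^-1 ^+ k.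
    apply: le_trans h2 _; apply: (@le_trans _ _ (L * (2 * r * 2^-1 ^+ k) * d)).
      by rewrite ler_wpM2l.
    have q0 : 0 <= r * 2^-1 ^+ k by rewrite mulr_ge0 ?exprn_ge0 // ltW.
    have := ler_wpM2r q0 dL; move: (2^-1 ^+ k) => q; lra.
  have -> : c t - (p + G t) = (c t - gam k.+1 t) + (F t - G t).
    by rewrite E clamp_id // !opprD !addrA addrNK.
  apply: le_trans (ler_normD _ _) _; apply: le_trans (lerD h1 h3) _.
  have q0 : 0 <= (2^-1 : R) ^+ k by rewrite exprn_ge0.
  by rewrite exprS; move: (2^-1 ^+ k) q0 => q q0; nra.
exists d, c; split => //.
  by rewrite cE ?normr0 // G0 addr0.
move=> t td; apply: (@isd_near _ _ _ (fun t => p + G t)).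
  near=> s; rewrite cE //; apply: ltW; near: s.
  have o : open [set s : R | `|s| < d].
    rewrite (_ : [set s | _] = ball (0 : R) d); first exact: ball_open.
    by apply/seteqP; split => s /=; rewrite -ball_normE /= sub0r normrN.
  exact: (open_near o).
apply: is_derive_eq (isd_add (isd_cst p _ _) (dG t (lt_trans td d1))) _.
by rewrite add0r.
Unshelve. all: by end_near. Qed.

End Picard.

(** * Bilinear forms given by a matrix *)

Section BilinearForm.
Context {R : realType} {m : nat} (J : 'M[R]_m).
Implicit Types (X Y Z : 'rV[R]_m) (a : R).

Definition bf X Y : R := (X *m J *m Y^T) ord0 ord0.

Lemma bfE X Y : bf X Y = \sum_j (X *m J) ord0 j * Y ord0 j.
Proof. by rewrite /bf mxE; apply: eq_bigr => j _; rewrite [_^T _ _]mxE. Qed.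

Lemma bfDl X Y Z : bf (X + Y) Z = bf X Z + bf Y Z.
Proof. by rewrite /bf !mulmxDl mxE. Qed.

Lemma bfDr X Y Z : bf Z (X + Y) = bf Z X + bf Z Y.
Proof. by rewrite /bf linearD /= mulmxDr mxE. Qed.

Lemma bfZl a X Y : bf (a *: X) Y = a * bf X Y.
Proof. by rewrite /bf -!scalemxAl mxE. Qed.

Lemma bfZr a X Y : bf X (a *: Y) = a * bf X Y.
Proof. by rewrite /bf linearZ /= -scalemxAr mxE. Qed.

Lemma bfNl X Y : bf (- X) Y = - bf X Y.
Proof. by rewrite -scaleN1r bfZl mulN1r. Qed.

Lemma bfNr X Y : bf X (- Y) = - bf X Y.
Proof. by rewrite -scaleN1r bfZr mulN1r. Qed.

Lemma bf0l X : bf 0 X = 0.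
Proof. by rewrite -(scale0r 0) bfZl mul0r. Qed.

Lemma bf0r X : bf X 0 = 0.
Proof. by rewrite -(scale0r 0) bfZr mul0r. Qed.

Lemma bf_suml n (X : 'I_n -> 'rV[R]_m) Y : bf (\sum_i X i) Y = \sum_i bf (X i) Y.
Proof. by rewrite /bf !mulmx_suml summxE. Qed.

Lemma bf_sumr n (X : 'I_n -> 'rV[R]_m) Y : bf Y (\sum_i X i) = \sum_i bf Y (X i).
Proof. by rewrite /bf linear_sum /= mulmx_sumr summxE. Qed.

Lemma bfC X Y : J^T = J -> bf X Y = bf Y X.
Proof.
move=> sJ; transitivity ((X *m J *m Y^T)^T ord0 ord0); first by rewrite mxE.
by rewrite /bf !trmx_mul trmxK sJ mulmxA.
Qed.

Definition bfL := (bfDl, bfDr, bfZl, bfZr, bfNl, bfNr, bf0l, bf0r).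

Lemma isd_bf (V : normedModType R) (X Y : V -> 'rV[R]_m) x u dX dY :
  is_derive x u X dX -> is_derive x u Y dY ->
  is_derive x u (fun y => bf (X y) (Y y)) (bf dX (Y x) + bf (X x) dY).
Proof.
move=> hX hY; rewrite (_ : (fun y => _) = (fun y =>
  \sum_j (X y *m J) ord0 j * Y y ord0 j)); last first.
  by apply/funext => y; rewrite bfE.
apply: is_derive_eq (isd_sum (fun j => isd_mul
  (isd_coord j (isd_mulmx J hX)) (isd_coord j hY))) _.
by rewrite !bfE -big_split.
Qed.

Lemma smooth_on_bf (V : normedModType R) (A : set V) (X Y : V -> 'rV[R]_m) :
  smooth_on A X -> smooth_on A Y -> smooth_on A (fun x => bf (X x) (Y x)).
Proof.
move=> sX sY; apply: (@smooth_on_ext _ _ _ _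
  (fun x => \sum_j (X x *m J) ord0 j * Y x ord0 j)).
  by move=> x _; rewrite bfE.
apply: smooth_on_sum => j; apply: smooth_on_mul; last exact: smooth_on_coord.
by apply: smooth_on_coord; exact: smooth_on_mulmx.
Qed.

End BilinearForm.

(** * Smooth curves and their velocities *)

Section Curves.
Context {R : realType}.

Lemma smooth_curve_ext d (S : set 'rV[R]_d) I c c' : smooth_curve S I c ->
  (forall t, I t -> c t = c' t) -> smooth_curve S I c'.
Proof.
move=> [oI iI sc Sc] E; split => // [k|t It]; last by rewrite -E //; exact: Sc.
exact: Ck_ext oI E (sc k).
Qed.

Lemma isd_shift (W : normedModType R) (c : R -> W) (t0 t : R) w :
  is_derive (t + t0) 1 c w -> is_derive t 1 (fun s => c (s + t0)) w.
Proof.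
move=> [d E]; have H : (fun h : R => h^-1 *: (((fun s => c (s + t0)) \o shift t) (h *: 1) - c (t + t0))) =
   (fun h => h^-1 *: ((c \o shift (t + t0)) (h *: 1) - c (t + t0))).
  by apply/funext => h /=; rewrite addrA.
by split; rewrite /derivable /derive H.
Qed.

Lemma smooth_curve_shift d (S : set 'rV[R]_d) I c t0 : smooth_curve S I c ->
  smooth_curve S [set s | I (s + t0)] (fun s => c (s + t0)).
Proof.
move=> [oI iI sc Sc].
have o : open [set s | I (s + t0)].
  rewrite openE => s Is.
  have h : (fun s : R => s + t0) @ s --> s + t0.
    by apply: cvgD; [exact: cvg_id|exact: cvg_cst].
  by apply: h; exact: open_nbhs_nbhs.
split => //.
- move=> x y Ix Iy z /andP[xz zy]; apply: (iI (x + t0) (y + t0)) => //.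
  by rewrite !lerD2r xz.
- apply: smooth_on_open => //; apply: (smooth_on_comp_R (B := I)) => //.
    by apply: smooth_on_add; [exact: smooth_on_id|exact: smooth_on_cst].
  exact: smooth_open_on.
- by move=> t It; exact: Sc.
Qed.

Lemma smooth_curve_tangent d (S : set 'rV[R]_d) I c t : smooth_curve S I c ->
  I t -> tangent_space S (c t) (derive1 c t).
Proof.
move=> sc It; exists [set s | I (s + t)], (fun s => c (s + t)); split.
- exact: smooth_curve_shift.
- by rewrite /= add0r.
- by rewrite add0r.
- have [oI _ s _] := sc.
  rewrite derive1E; apply: derive_val; apply: isd_shift; rewrite add0r.
  exact: (isd_smooth oI s It).
Qed.

Lemma is_derive_derive1 (W : normedModType R) (c : R -> W) (t : R) w :
  is_derive t 1 c w -> derive1 c t = w.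
Proof. by move=> [_ <-]; rewrite derive1E. Qed.

Lemma smooth_derive1 (W : normedModType R) (I : set R) (c : R -> W) :
  open I -> smooth_open I c -> smooth_open I (derive1 c).
Proof.
move=> oI sc k.
have E (t : R) : I t -> 'D_1 c t = derive1 c t by rewrite derive1E.
exact: (Ck_ext oI E (Ck_derive (1 : R) (sc k.+1))).
Qed.

End Curves.

(** * The light-cone model *)

(* [lcPhi] embeds [lcM], with the metric [lcg], isometrically in the light cone of
   [bf lcJ]; [lcdPhi] is its differential, and [lcPi] and [lcsec x] are the inverses
   of [lcPhi] and of [lcdPhi x]. *)
Record light_cone_model (R : realType) (d m : nat) (kappa : R) := LightConeModel {
  lcM : set 'rV[R]_d;
  lcg : 'rV[R]_d -> 'M[R]_d;
  lcJ : 'M[R]_m;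
  lcK : 'rV[R]_m;
  lcPhi : 'rV[R]_d -> 'rV[R]_m;
  lcdPhi : 'rV[R]_d -> 'rV[R]_d -> 'rV[R]_m;
  lcPi : 'rV[R]_m -> 'rV[R]_d;
  lcsec : 'rV[R]_d -> 'rV[R]_m -> 'rV[R]_d;
  lc_sym : lcJ^T = lcJ;
  lc_unit : lcJ \in unitmx;
  lcKK : bf lcJ lcK lcK = - kappa;
  lcPhiPhi : forall x, lcM x -> bf lcJ (lcPhi x) (lcPhi x) = 0;
  lcPhiK : forall x, lcM x -> bf lcJ (lcPhi x) lcK = -1;
  lcPhi_le0 : forall x y, lcM x -> lcM y -> bf lcJ (lcPhi x) (lcPhi y) <= 0;
  lcPi_Phi : forall x, lcM x -> lcPi (lcPhi x) = x;
  lcPhi_Pi : forall x X, lcM x -> bf lcJ X X = 0 -> bf lcJ X lcK = -1 ->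
    bf lcJ X (lcPhi x) <= 0 -> lcM (lcPi X) /\ lcPhi (lcPi X) = X;
  lc_pos : forall x Z, lcM x -> bf lcJ Z (lcPhi x) = 0 -> bf lcJ Z lcK = 0 ->
    Z != 0 -> 0 < bf lcJ Z Z;
  lc_smoothPhi : smooth_on lcM lcPhi;
  lc_smoothPi : smooth_on (lcPhi @` lcM) lcPi;
  lcdPhi_linear : forall x, linear (lcdPhi x);
  lcdPhi_derive : forall (c : R -> 'rV[R]_d) (t : R) v, lcM (c t) ->
    is_derive t 1 c v -> is_derive t 1 (fun s => lcPhi (c s)) (lcdPhi (c t) v);
  lcdPhi_inj : forall x u, lcM x -> lcdPhi x u = 0 -> u = 0;
  lc_inner : forall x u w, lcM x ->
    inner lcg x u w = bf lcJ (lcdPhi x u) (lcdPhi x w);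
  lcdPhi_sec : forall x Z, lcM x -> bf lcJ Z (lcPhi x) = 0 -> bf lcJ Z lcK = 0 ->
    lcdPhi x (lcsec x Z) = Z;
  lc_smooth_dPhi : forall (V : normedModType R) (A : set V) f v, smooth_on A f ->
    smooth_on A v -> (forall x, A x -> lcM (f x)) ->
    smooth_on A (fun x => lcdPhi (f x) (v x));
  lc_smooth_sec : forall (V : normedModType R) (A : set V) f Z, smooth_on A f ->
    smooth_on A Z -> (forall x, A x -> lcM (f x)) ->
    smooth_on A (fun x => lcsec (f x) (Z x));
  lc_acceleration : forall I c t z, smooth_curve lcM I c -> I t ->
    bf lcJ (derive1n 2 (fun s => lcPhi (c s)) t) (lcdPhi (c t) z) =
    inner lcg (c t) (acceleration lcg c t) z
}.

(** * Geodesics of slices of the light cone *)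

Section Geodesics.
Context {R : realType} {d m : nat} {kappa : R}.
Variable Mo : light_cone_model d m kappa.
Local Notation M := (lcM Mo).
Local Notation g := (lcg Mo).
Local Notation K := (lcK Mo).
Local Notation Phi := (lcPhi Mo).
Local Notation dPhi := (lcdPhi Mo).
Local Notation Pi := (lcPi Mo).
Local Notation sec := (lcsec Mo).
Local Notation b := (bf (lcJ Mo)).

Lemma lc_bfC X Y : b X Y = b Y X.
Proof. exact: bfC (lc_sym Mo). Qed.

Lemma dPhiB x u w : dPhi x (u - w) = dPhi x u - dPhi x w.
Proof. by rewrite addrC -scaleN1r lcdPhi_linear scaleN1r addrC. Qed.

Lemma dPhi0 x : dPhi x 0 = 0.
Proof. by rewrite -(subrr 0) dPhiB subrr. Qed.

Lemma dPhiZ x a u : dPhi x (a *: u) = a *: dPhi x u.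
Proof. by rewrite -[a *: u]addr0 lcdPhi_linear dPhi0 addr0. Qed.

Lemma dPhiN x u : dPhi x (- u) = - dPhi x u.
Proof. by rewrite -scaleN1r dPhiZ scaleN1r. Qed.

Lemma dPhi_injective x u w : M x -> dPhi x u = dPhi x w -> u = w.
Proof.
move=> Mx E; apply/eqP; rewrite -subr_eq0; apply/eqP.
by apply: (lcdPhi_inj Mx); rewrite dPhiB E subrr.
Qed.

Lemma smooth_Phi_curve (S : set 'rV[R]_d) I c : S `<=` M -> smooth_curve S I c ->
  smooth_open I (fun s => Phi (c s)).
Proof.
move=> SM [oI _ sc Sc]; apply: smooth_on_open => //.
apply: (smooth_on_comp (smooth_open_on oI sc) (lc_smoothPhi (l := Mo))).
by move=> t It; exact/SM/Sc.
Qed.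

Lemma derive_Phi_curve (S : set 'rV[R]_d) I c t : S `<=` M ->
  smooth_curve S I c -> I t ->
  is_derive t 1 (fun s => Phi (c s)) (dPhi (c t) (derive1 c t)).
Proof.
move=> SM [oI _ sc Sc] It; apply: lcdPhi_derive; first exact/SM/Sc.
exact: isd_smooth oI sc It.
Qed.

Lemma derive2_Phi_curve (S : set 'rV[R]_d) I c t : S `<=` M ->
  smooth_curve S I c -> I t ->
  is_derive t 1 (fun s => dPhi (c s) (derive1 c s))
    (derive1n 2 (fun s => Phi (c s)) t).
Proof.
move=> SM sc It; have [oI _ _ _] := sc.
apply: (@isd_near _ _ _ (derive1 (fun s => Phi (c s)))).
  near=> s; apply: is_derive_derive1; apply: (derive_Phi_curve SM sc).
  by near: s; exact: (open_near oI It).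
have sG := smooth_derive1 oI (smooth_Phi_curve SM sc).
exact: (isd_smooth oI sG It).
Unshelve. all: by end_near. Qed.

Lemma isd_const_near (f : R -> R) (a t df : R) (I : set R) : open I -> I t ->
  (forall s, I s -> f s = a) -> is_derive t 1 f df -> df = 0.
Proof.
move=> oI It E H; apply: (isd_unique H); apply: (@isd_near _ _ _ (fun=> a)).
by near=> s; rewrite E //; near: s; exact: (open_near oI It).
Unshelve. all: by end_near. Qed.

Section Slice.
Variables (A : 'rV[R]_m) (eta : R).
Hypotheses (hAA : eta * b A A = eta) (hAK : b A K = eta).

(** The hypothesis is [eta * b A A = eta] rather than [b A A = 1] in order to admit A = 0, eta = 0:
    the slice is then M, its curvature kappa and its [slice_K] is [K], so that every statement on
    geodesics of N also covers those of the ambient space. *)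
Definition slice : set 'rV[R]_d := [set x | M x /\ b (Phi x) A = 0].
Definition slice_curv := kappa + eta ^+ 2.
(* Locked: rewriting with bfL must not split it. *)
Definition slice_K := locked (K - eta *: A).
Local Notation N := slice.
Local Notation k := slice_curv.
Local Notation KA := slice_K.

Definition unit_tangent p (V : 'rV[R]_m) :=
  [/\ b (Phi p) V = 0, b K V = 0, b A V = 0 & b V V = 1].

Definition slice_point p V (c s e : R) : 'rV[R]_m := c *: Phi p + s *: V + e *: KA.

Lemma slice_KE : KA = K - eta *: A.
Proof. by rewrite /slice_K -lock. Qed.

Lemma slice_sub : N `<=` M. Proof. by move=> x []. Qed.

Lemma b_KAKA : b KA KA = - k.
Proof.
rewrite !slice_KE !bfL lcKK (lc_bfC K A) hAK hAA /slice_curv; ring.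
Qed.

Lemma b_KKA : b K KA = - k.
Proof. rewrite !slice_KE !bfL lcKK (lc_bfC K A) hAK /slice_curv; ring. Qed.

Lemma b_AKA : b A KA = 0.
Proof. by rewrite !slice_KE !bfL hAK hAA subrr. Qed.

Lemma b_PhiKA p : N p -> b (Phi p) KA = -1.
Proof. by move=> [Mp pA]; rewrite !slice_KE !bfL lcPhiK // pA mulr0 subr0. Qed.

Lemma b_KAV p V : unit_tangent p V -> b KA V = 0.
Proof. by case=> _ KV AV _; rewrite !slice_KE !bfL KV AV mulr0 subr0. Qed.

Lemma frameE p V : N p -> unit_tangent p V ->
  ((b (Phi p) (Phi p) = 0) * (b (Phi p) V = 0) * (b V (Phi p) = 0) *
   (b (Phi p) KA = -1) * (b KA (Phi p) = -1) * (b (Phi p) K = -1) *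
   (b K (Phi p) = -1) * (b (Phi p) A = 0) * (b A (Phi p) = 0) *
   (b V V = 1) * (b V KA = 0) * (b KA V = 0) * (b V K = 0) * (b K V = 0) *
   (b V A = 0) * (b A V = 0) * (b KA KA = - k) * (b K KA = - k) *
   (b KA K = - k) * (b A KA = 0) * (b KA A = 0) * (b K K = - kappa) *
   (b A K = eta) * (b K A = eta))%type.
Proof.
move=> Np uV; have kv := b_KAV uV; have pk := b_PhiKA Np.
have [Mp pA] := Np; have [PV KV AV VV] := uV.
have PP := lcPhiPhi Mp; have PK := lcPhiK Mp.
have kk := b_KAKA; have k1 := b_KKA; have ak := b_AKA; have k2 := lcKK Mo.
have k3 := hAK.
by do !split => //; rewrite lc_bfC.
Qed.

(** The relations between c, s and e make the point null, of pairing -1 with [K] and orthogonal to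
    [A]. Its pairing with [Phi p] is - e, so [0 <= e] puts it on the sheet of the cone that [Phi]
    parametrizes. *)
Lemma slice_pointE p V c s e : N p -> unit_tangent p V ->
  s ^+ 2 = 2 * e - k * e ^+ 2 -> c = 1 - k * e -> 0 <= e ->
  N (Pi (slice_point p V c s e)) /\
  Phi (Pi (slice_point p V c s e)) = slice_point p V c s e.
Proof.
move=> Np uV hs -> e0; have F := frameE Np uV; have [Mp _] := Np.
set X := slice_point _ _ _ _ _.
have [||| MX EX] := @lcPhi_Pi _ _ _ _ Mo p X Mp.
- rewrite /X /slice_point !bfL !F.
  transitivity (s ^+ 2 - 2 * e + k * e ^+ 2); first by ring.
  by rewrite hs; ring.
- by rewrite /X /slice_point !bfL !F; ring.
- by rewrite /X /slice_point !bfL !F; lra.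
by split => //; split => //; rewrite EX /X /slice_point !bfL !F; ring.
Qed.

Definition geo p V t := slice_point p V (cosk k t) (sink k t) (versk k t).
Definition dgeo p V t := slice_point p V (- k * sink k t) (cosk k t) (sink k t).
Definition geoE p V t : 'rV[R]_d := Pi (geo p V t).

Lemma geoP p V t : N p -> unit_tangent p V ->
  N (geoE p V t) /\ Phi (geoE p V t) = geo p V t.
Proof.
move=> Np uV; apply: slice_pointE => //; first exact: sink_versk.
  exact: cosk_versk.
exact: versk_ge0.
Qed.

Lemma geo0 p V : geo p V 0 = Phi p.
Proof. by rewrite /geo /slice_point cosk0 sink0 versk0 scale1r !scale0r !addr0. Qed.

Lemma geoE0 p V : N p -> geoE p V 0 = p.
Proof. by move=> [Mp _]; rewrite /geoE geo0 lcPi_Phi. Qed.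

Lemma dgeo0 p V : dgeo p V 0 = V.
Proof.
by rewrite /dgeo /slice_point cosk0 sink0 mulr0 scale1r !scale0r add0r addr0.
Qed.

Lemma is_derive_slice_point p V (c s e : R -> R) (t dc ds de : R) :
  is_derive t 1 c dc -> is_derive t 1 s ds -> is_derive t 1 e de ->
  is_derive t 1 (fun t => slice_point p V (c t) (s t) (e t))
    (slice_point p V dc ds de).
Proof.
move=> hc hs he; rewrite /slice_point.
apply: is_derive_eq (isd_add (isd_add (isd_scale hc (isd_cst (Phi p) t (1 : R)))
  (isd_scale hs (isd_cst V t (1 : R)))) (isd_scale he (isd_cst KA t (1 : R)))) _.
by rewrite !scaler0 !addr0.
Qed.

Lemma is_derive_geo p V (t : R) : is_derive t 1 (geo p V) (dgeo p V t).
Proof.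
apply: is_derive_slice_point; first exact: is_derive_cosk.
  exact: is_derive_sink.
exact: is_derive_versk.
Qed.

(** The acceleration is a combination of the position vector, [K] and [A], all orthogonal to the
    tangent space of the slice; this is why these curves are geodesics. *)
Lemma is_derive_dgeo p V (t : R) : is_derive t 1 (dgeo p V) (- k *: geo p V t + KA).
Proof.
apply: is_derive_eq (is_derive_slice_point p V (isd_mul (isd_cst (- k) _ _) (is_derive_sink k t))
  (is_derive_cosk k t) (is_derive_sink k t)) _.
apply/rowP => i; rewrite /geo /slice_point !mxE.
by rewrite [cosk k t in RHS]cosk_versk cosk_versk; ring.
Qed.

Lemma dgeo_unit p V t : N p -> unit_tangent p V -> unit_tangent (geoE p V t) (dgeo p V t).
Proof.
move=> Np uV; have [Nt Et] := geoP t Np uV; have F := frameE Np uV.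
have sv := sink_versk k t; have cv := cosk_versk k t.
split; rewrite ?Et /geo /dgeo /slice_point !bfL !F ?cv.
- by ring.
- by ring.
- by ring.
- transitivity (1 + k * (sink k t ^+ 2 - (2 * versk k t - k * versk k t ^+ 2))); first ring.
  by rewrite sv; ring.
Qed.

Lemma smooth_geo p V : smooth_on setT (geo p V).
Proof.
rewrite /geo /slice_point; do ![apply: smooth_on_add]; apply: smooth_on_scale;
  try exact: smooth_on_cst; apply: smooth_open_on; try exact: openT.
- by move=> j; have [] := smooth_cosk_sink k j.
- by move=> j; have [] := smooth_cosk_sink k j.
- exact: smooth_versk.
Qed.

Lemma geoE_curve p V (a : R) : N p -> unit_tangent p V ->
  smooth_curve N setT (fun t => geoE p V (a * t)).
Proof.
move=> Np uV; split => //; first exact: openT.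
- apply: smooth_on_open; first exact: openT.
  apply: (smooth_on_comp (B := Phi @` M) _ (lc_smoothPi (l := Mo))).
    apply: (smooth_on_comp_R (B := setT)) => //; last exact: smooth_geo.
    by apply: smooth_on_mul; [exact: smooth_on_cst|exact: smooth_on_id].
  move=> t _; have [[Mt _] Et] := geoP (a * t) Np uV.
  by exists (geoE p V (a * t)).
- by move=> t _; have [] := geoP (a * t) Np uV.
Qed.

Lemma geoE_curve1 p V : N p -> unit_tangent p V -> smooth_curve N setT (geoE p V).
Proof.
move=> Np uV; apply: smooth_curve_ext (geoE_curve 1 Np uV) _ => t _.
by rewrite mul1r.
Qed.

Lemma dPhi_geoE p V t : N p -> unit_tangent p V ->
  dPhi (geoE p V t) (derive1 (geoE p V) t) = dgeo p V t.
Proof.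
move=> Np uV; have H := derive_Phi_curve slice_sub (geoE_curve1 Np uV) (I : setT t).
apply: (isd_unique H); rewrite (_ : (fun s => _) = geo p V); first exact: is_derive_geo.
by apply/funext => s; have [] := geoP s Np uV.
Qed.

(** Obtained by differentiating twice the constraints <G, G> = 0, <G, K> = -1 and <G, A> = 0. *)
Lemma slice_curve_orth I c t : smooth_curve N I c -> I t ->
  let G := Phi (c t) in let G1 := dPhi (c t) (derive1 c t) in
  let G2 := derive1n 2 (fun s => Phi (c s)) t in
  [/\ b G G1 = 0, b K G1 = 0, b A G1 = 0 &
   [/\ b G G2 = - b G1 G1, b K G2 = 0 & b A G2 = 0]].
Proof.
move=> sc It; have [oI _ _ Nc] := sc.
have D s Is := derive_Phi_curve (t := s) slice_sub sc Is.
have D2 := derive2_Phi_curve slice_sub sc It.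
have NM s : I s -> M (c s) by move=> /Nc[].
have o1 s : I s -> b (Phi (c s)) (dPhi (c s) (derive1 c s)) = 0.
  move=> Is; have := isd_const_near oI Is _ (isd_bf (lcJ Mo) (D s Is) (D s Is)).
  move=> /(_ 0 (fun s Is => lcPhiPhi (NM s Is))) /eqP.
  by rewrite (lc_bfC _ (Phi _)) -mulr2n -mulr_natl mulf_eq0 pnatr_eq0 /= => /eqP.
have o2 s : I s -> b K (dPhi (c s) (derive1 c s)) = 0.
  move=> Is; have := isd_const_near oI Is _ (isd_bf (lcJ Mo) (D s Is) (isd_cst K s (1 : R))).
  by move=> /(_ (-1) (fun s Is => lcPhiK (NM s Is))); rewrite bf0r addr0 lc_bfC.
have o3 s : I s -> b A (dPhi (c s) (derive1 c s)) = 0.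
  move=> Is; have := isd_const_near oI Is _ (isd_bf (lcJ Mo) (D s Is) (isd_cst A s (1 : R))).
  by move=> /(_ 0 (fun s Is => (Nc s Is).2)); rewrite bf0r addr0 lc_bfC.
split; [exact: o1|exact: o2|exact: o3|split].
- have := isd_const_near oI It o1 (isd_bf (lcJ Mo) (D t It) D2).
  by move/eqP; rewrite addrC addr_eq0 => /eqP.
- have := isd_const_near oI It o2 (isd_bf (lcJ Mo) (isd_cst K t (1 : R)) D2).
  by rewrite bf0l add0r.
- have := isd_const_near oI It o3 (isd_bf (lcJ Mo) (isd_cst A t (1 : R)) D2).
  by rewrite bf0l add0r.
Qed.

Lemma tangent_orth p w : N p -> tangent_space N p w ->
  [/\ b (Phi p) (dPhi p w) = 0, b K (dPhi p w) = 0 & b A (dPhi p w) = 0].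
Proof.
move=> Np [I [c [sc I0 c0 cw]]].
by have [] := slice_curve_orth sc I0; rewrite c0 cw.
Qed.

(** Tangent vectors are velocities of curves, so a curve has to be exhibited: the geodesic in the
    direction Z / |Z| run at speed |Z|, or a constant curve if Z = 0. *)
Lemma orth_tangent p Z : N p -> b (Phi p) Z = 0 -> b K Z = 0 -> b A Z = 0 ->
  tangent_space N p (sec p Z).
Proof.
move=> Np PZ KZ AZ; have [Mp _] := Np.
have secE : dPhi p (sec p Z) = Z by rewrite lcdPhi_sec // lc_bfC.
have [Z0|Z0] := eqVneq Z 0.
  have E0 : sec p Z = 0 by apply: (lcdPhi_inj Mp); rewrite secE.
  rewrite E0; exists setT, (fun=> p); split => //.
    split => //; first exact: openT.
    by move=> k; exact: Ck_cst.
  by rewrite derive1_cst.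
have ZZ : 0 < b Z Z by apply: (lc_pos Mp) => //; rewrite lc_bfC.
pose r := Num.sqrt (b Z Z); have r0 : 0 < r by rewrite sqrtr_gt0.
have r2 : r ^+ 2 = b Z Z by rewrite sqr_sqrtr // ltW.
have uV : unit_tangent p (r^-1 *: Z).
  split; rewrite !bfL ?PZ ?KZ ?AZ ?mulr0 // -r2; field; exact: lt0r_neq0.
exists setT, (fun t => geoE p (r^-1 *: Z) (r * t)); split => //.
- exact: geoE_curve.
- by rewrite mulr0 geoE0.
- have sc := geoE_curve r Np uV.
  apply: (@dPhi_injective p) => //; rewrite secE.
  have := derive_Phi_curve slice_sub sc (I : setT 0); rewrite mulr0 geoE0 // => D.
  apply: (isd_unique D).
  rewrite (_ : (fun s => _) = fun s => geo p (r^-1 *: Z) (r * s)); last first.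
    by apply/funext => s; have [] := geoP (r * s) Np uV.
  have dl (f df : R -> R) : (forall t : R, is_derive t 1 f (df t)) ->
      is_derive (0 : R) 1 (fun s => f (r * s)) (r * df 0).
    move=> fd; have H : is_derive (r * 0) 1 f (df 0) by rewrite mulr0.
    by apply: is_derive_eq (isd_comp H (isd_linear r 0)) _; rewrite mulrC.
  apply: is_derive_eq (is_derive_slice_point p (r^-1 *: Z)
    (dl _ _ (is_derive_cosk k)) (dl _ _ (is_derive_sink k)) (dl _ _ (is_derive_versk k))) _.
  rewrite /slice_point cosk0 sink0 !mulr0 !scale0r add0r addr0 mulr1 scalerA divff ?scale1r //.
  exact: lt0r_neq0.
Qed.

Lemma geoE_geodesic p V : N p -> unit_tangent p V -> geodesic g N setT (geoE p V).
Proof.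
move=> Np uV; have sc := geoE_curve1 Np uV; split => // t w _ tw.
have [Nt Et] := geoP t Np uV.
have scM : smooth_curve M setT (geoE p V).
  by have [a1 a2 a3 a4] := sc; split => // s /a4 /slice_sub.
have [h1 h2 h3] := tangent_orth Nt tw.
rewrite -(lc_acceleration _ scM) //.
have D2 := derive2_Phi_curve slice_sub sc (I : setT t).
have -> : derive1n 2 (fun s => Phi (geoE p V s)) t = - k *: Phi (geoE p V t) + KA.
  rewrite Et; apply: (isd_unique D2); rewrite (_ : (fun s => _) = dgeo p V).
    exact: is_derive_dgeo.
  by apply/funext => s; rewrite dPhi_geoE.
by rewrite slice_KE !bfL h1 h2 h3; ring.
Qed.

Lemma pos_eq0 p Z : M p -> b Z (Phi p) = 0 -> b Z K = 0 -> b Z Z = 0 -> Z = 0.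
Proof.
move=> Mp ZP ZK ZZ; apply/eqP/negPn/negP => Z0.
by have := lc_pos Mp ZP ZK Z0; rewrite ZZ ltxx.
Qed.

(* The ambient acceleration G2 of a unit speed geodesic satisfies
   G2 = - k G + KA: the difference is tangent to N and orthogonal to itself. *)
Lemma geodesic_unique p I c : geodesic g N I c -> I 0 -> c 0 = p ->
  b (dPhi p (derive1 c 0)) (dPhi p (derive1 c 0)) = 1 ->
  forall t, I t -> Phi (c t) = geo p (dPhi p (derive1 c 0)) t.
Proof.
move=> [sc gc] I0 c0 u0; have [oI iI _ Nc] := sc.
have scM : smooth_curve M I c by have [a1 a2 a3 a4] := sc; split => // s /a4 /slice_sub.
pose G s := Phi (c s); pose G1 s := dPhi (c s) (derive1 c s).
pose G2 s := derive1n 2 (fun s => Phi (c s)) s.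
have D1 s : I s -> is_derive s 1 G (G1 s) := derive_Phi_curve slice_sub sc.
have D2 s : I s -> is_derive s 1 G1 (G2 s) := derive2_Phi_curve slice_sub sc.
have G2w s w : I s -> tangent_space N (c s) w -> b (G2 s) (dPhi (c s) w) = 0.
  by move=> Is tw; rewrite (lc_acceleration _ scM) // gc.
(* The speed is constant because [G2] is orthogonal to the tangent vector [G1]. *)
have speed s : I s -> b (G1 s) (G1 s) = 1.
  move=> Is; rewrite -u0 -[in RHS]c0.
  apply: (@cst_on_interval _ I (fun s => b (G1 s) (G1 s))) => // z Iz.
  apply: is_derive_eq (isd_bf (lcJ Mo) (D2 z Iz) (D2 z Iz)) _.
  have E : b (G2 z) (G1 z) = 0 by apply: G2w => //; exact: (smooth_curve_tangent sc Iz).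
  by rewrite (lc_bfC (G1 z)) E addr0.
have G2E s : I s -> G2 s = - k *: G s + KA.
  move=> Is; have Ns := Nc s Is; have [Ms As] := Ns.
  have [h1 h2 h3 [q1 q2 q3]] := slice_curve_orth sc Is.
  have [Y YE] : {Y | Y = G2 s + k *: G s - KA} by eexists.
  have YP : b (Phi (c s)) Y = 0.
    by rewrite YE !bfL q1 -/(G1 s) speed // lcPhiPhi // b_PhiKA //; ring.
  have YK : b K Y = 0.
    by rewrite YE !bfL q2 (lc_bfC K (G s)) lcPhiK // b_KKA; ring.
  have YA : b A Y = 0 by rewrite YE !bfL q3 (lc_bfC A (G s)) As b_AKA; ring.
  have YKA : b KA Y = 0 by rewrite slice_KE !bfL YK YA; ring.
  have GY : b (G2 s) Y = 0.
    have E : dPhi (c s) (sec (c s) Y) = Y by rewrite lcdPhi_sec // lc_bfC.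
    by rewrite -[Y in LHS]E; apply: G2w => //; exact: orth_tangent.
  have YY : b Y Y = 0 by rewrite {1}YE !bfL GY YP YKA; ring.
  have /eqP : Y = 0 by apply: (@pos_eq0 (c s)) => //; rewrite lc_bfC.
  by rewrite YE subr_eq0 scaleNr => /eqP <-; rewrite addrC addrK.
move=> t It; apply/rowP => i; rewrite /geo /slice_point !mxE.
have -> : Phi p = G 0 by rewrite /G c0.
have -> : dPhi p (derive1 c 0) = G1 0 by rewrite /G1 c0.
apply: (@ode_unique1 _ k _ _ _ I (fun t => G t ord0 i) (fun t => G1 t ord0 i)) => //.
- by move=> s Is; apply: isd_coord; exact: D1.
- move=> s Is; apply: is_derive_eq (isd_coord i (D2 s Is)) _.
  by rewrite G2E // !mxE.
Qed.

End Slice.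

Lemma ambient_slice : slice (0 : 'rV[R]_m) = M.
Proof. by apply/seteqP; split => [x []//|x Mx]; split => //; rewrite bf0r. Qed.

End Geodesics.

(** * Orthonormal frames along a slice *)

Section Frames.
Context {R : realType} {d m : nat} {kappa : R}.
Variable Mo : light_cone_model d m kappa.
Local Notation M := (lcM Mo).
Local Notation K := (lcK Mo).
Local Notation Phi := (lcPhi Mo).
Local Notation b := (bf (lcJ Mo)).
Variables (A : 'rV[R]_m) (eta : R).
Hypotheses (hAA : b A A = 1) (hAK : b A K = eta).
Local Notation N := (slice Mo A).

Definition orth3 p Z := [/\ b (Phi p) Z = 0, b K Z = 0 & b A Z = 0].

Definition orthonormal_at p j (f : 'I_j -> 'rV[R]_m) :=
  (forall i, orth3 p (f i)) /\ forall i i', b (f i) (f i') = (i == i')%:R.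

Definition frame_mx p j (f : 'I_j -> 'rV[R]_m) : 'M[R]_(1 + (1 + 1) + j, m) :=
  col_mx (col_mx (Phi p) (col_mx K A)) (\matrix_i f i).

Lemma frame_mxE p j f (c : 'rV[R]_(1 + (1 + 1) + j)) : exists a1 a2 a3 : R,
  exists2 a : 'I_j -> R,
  c *m frame_mx p f = a1 *: Phi p + (a2 *: K + a3 *: A) + \sum_i a i *: f i &
  (a1 = 0 -> a2 = 0 -> a3 = 0 -> (forall i, a i = 0) -> c = 0).
Proof.
pose c1 := lsubmx (lsubmx c); pose c2 := lsubmx (rsubmx (lsubmx c)).
pose c3 := rsubmx (rsubmx (lsubmx c)); pose c4 := rsubmx c.
have cE : c = row_mx (row_mx c1 (row_mx c2 c3)) c4 by rewrite !hsubmxK.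
exists (c1 0 0), (c2 0 0), (c3 0 0); exists (fun i => c4 0 i) => [|h1 h2 h3 h4].
  rewrite {1}cE /frame_mx !mul_row_col; congr (_ + (_ + _) + _).
  - by rewrite {1}[c1]mx11_scalar mul_scalar_mx.
  - by rewrite {1}[c2]mx11_scalar mul_scalar_mx.
  - by rewrite {1}[c3]mx11_scalar mul_scalar_mx.
  - rewrite mulmx_sum_row; apply: eq_bigr => i _; congr (_ *: _).
    by apply/rowP => i'; rewrite !mxE.
have z1 (a : 'rV[R]_1) : a 0 0 = 0 -> a = 0.
  by move=> a0; apply/rowP => i; rewrite (ord1 i) a0 mxE.
have c40 : c4 = 0 by apply/rowP => i; rewrite h4 mxE.
by rewrite cE (z1 _ h1) (z1 _ h2) (z1 _ h3) c40 !row_mx0.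
Qed.

(** Pairing the expansion with [Phi p], [A] and [K], in this order, isolates [a2], [a3] and [a1],
    because [Phi p] is null and orthogonal to [A]. The case Z = 0 is linear independence. *)
Lemma frame_pairing p j (f : 'I_j -> 'rV[R]_m) (a1 a2 a3 : R) (a : 'I_j -> R) Z :
  N p -> orthonormal_at p f -> orth3 p Z ->
  Z = a1 *: Phi p + (a2 *: K + a3 *: A) + \sum_i a i *: f i ->
  [/\ a1 = 0, a2 = 0, a3 = 0 & forall i, a i = b Z (f i)].
Proof.
move=> Np [fo ff] [ZP ZK ZA] ZE; have [Mp pA] := Np.
have s0 (Y : 'rV[R]_m) : (forall i, b Y (f i) = 0) -> b Y (\sum_i a i *: f i) = 0.
  by move=> H; rewrite bf_sumr big1 // => i _; rewrite bfZr H mulr0.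
have eP : a2 = 0.
  move: ZP; rewrite ZE !bfL lcPhiPhi // lcPhiK // pA s0; last first.
    by move=> i; have [] := fo i.
  lra.
have eA : a3 = 0.
  move: ZA; rewrite ZE !bfL (lc_bfC Mo A (Phi p)) pA hAA hAK eP s0; last first.
    by move=> i; have [] := fo i.
  lra.
have eK : a1 = 0.
  move: ZK; rewrite ZE !bfL (lc_bfC Mo K (Phi p)) lcPhiK // eP eA s0; last first.
    by move=> i; have [] := fo i.
  lra.
split => // i; rewrite ZE eP eA eK !scale0r !add0r bf_suml (bigD1 i) //= big1.
  by rewrite bfZl ff eqxx mulr1 addr0.
by move=> i' ne; rewrite bfZl ff (negbTE ne) mulr0.
Qed.

(** A nonzero vector orthogonal to the 3 + j rows of [frame_mx] exists for reasons of dimension; its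
    square is positive by [lc_pos], so it can be normalized. *)
Lemma orthonormal_extend p j (f : 'I_j -> 'rV[R]_m) : N p ->
  orthonormal_at p f -> (3 + j < m)%N ->
  exists f' : 'I_j.+1 -> 'rV[R]_m, orthonormal_at p f'.
Proof.
move=> Np [fo ff] jm; have [Mp _] := Np.
pose C : 'M[R]_(m, 1 + (1 + 1) + j) := (frame_mx p f *m lcJ Mo)^T.
have /rowV0Pn[Z] : kermx C != 0.
  rewrite -mxrank_eq0 mxrank_ker subn_eq0 -ltnNge.
  exact: leq_ltn_trans (rank_leq_col _) jm.
move=> /sub_kermxP ZC Z0.
have H (q : 'rV[R]_(1 + (1 + 1) + j)) : b (q *m frame_mx p f) Z = 0.
  rewrite /bf -(mulmxA q) -mulmxA -[frame_mx p f *m _]trmxK -trmx_mul ZC.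
  by rewrite trmx0 mulmx0 mxE.
have HP : b (Phi p) Z = 0.
  rewrite -(H (row_mx (row_mx 1 (row_mx 0 0)) 0)) /frame_mx !mul_row_col.
  by rewrite !mul0mx !addr0 mul1mx.
have HK : b K Z = 0.
  rewrite -(H (row_mx (row_mx 0 (row_mx 1 0)) 0)) /frame_mx !mul_row_col.
  by rewrite !mul0mx !addr0 add0r mul1mx.
have HA : b A Z = 0.
  rewrite -(H (row_mx (row_mx 0 (row_mx 0 1)) 0)) /frame_mx !mul_row_col.
  by rewrite !mul0mx !addr0 !add0r mul1mx.
have Hf i : b (f i) Z = 0.
  rewrite -(H (row_mx 0 (delta_mx 0 i))) /frame_mx mul_row_col mul0mx add0r.
  by rewrite -rowE rowK.
have ZZ : 0 < b Z Z by apply: (lc_pos Mp) => //; rewrite lc_bfC.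
pose r := (Num.sqrt (b Z Z))^-1.
have r2 : r * (r * b Z Z) = 1.
  have s0 : 0 < Num.sqrt (b Z Z) by rewrite sqrtr_gt0.
  rewrite /r -{3}(@sqr_sqrtr _ (b Z Z)) ?ltW //.
  by field; rewrite gt_eqF.
exists (fun i => if unlift ord0 i is Some i' then f i' else r *: Z); split=> [i|i i'].
  by case: unliftP => [i'|] _; [exact: fo|split; rewrite bfZr ?HP ?HK ?HA mulr0].
case: unliftP => [i1|] ->; case: unliftP => [i2|] ->.
- by rewrite ff (inj_eq lift_inj).
- by rewrite bfZr Hf mulr0 eq_sym (negbTE (neq_lift _ _)).
- by rewrite bfZl lc_bfC Hf mulr0 (negbTE (neq_lift _ _)).
- by rewrite !bfL eqxx r2.
Qed.

(** With m - 3 vectors [frame_mx] is square with independent rows, hence spans; the expansion of a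
    vector orthogonal to [Phi p], [K] and [A] then only involves the frame. *)
Lemma orthonormal_frame p n : N p -> m = (3 + n)%N ->
  exists f : 'I_n -> 'rV[R]_m, orthonormal_at p f /\
    forall Z, orth3 p Z -> Z = \sum_i b Z (f i) *: f i.
Proof.
move=> Np mn.
have [f of_] : exists f : 'I_n -> 'rV[R]_m, orthonormal_at p f.
  have H j : (j <= n)%N -> exists f : 'I_j -> 'rV[R]_m, orthonormal_at p f.
    elim: j => [|j IH] jn; first by exists (fun=> 0); split => [[]|[]].
    have [f of_] := IH (ltnW jn); apply: (orthonormal_extend Np of_).
    by rewrite mn ltn_add2l.
  exact: H.
exists f; split => // Z oZ.
have o0 : orth3 p 0 by split; rewrite bf0r.
have free : row_free (frame_mx p f).
  apply: inj_row_free => c cE.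
  have [a1 [a2 [a3 [a E H]]]] := frame_mxE p f c.
  have [h1 h2 h3 h4] := frame_pairing Np of_ o0 (etrans (esym cE) E).
  by apply: H => // i; rewrite h4 bf0l.
have full : row_full (frame_mx p f).
  by move/eqP: free => free; apply/eqP; rewrite free mn.
have /submxP[c cE] := submx_full Z full.
have [a1 [a2 [a3 [a E H]]]] := frame_mxE p f c.
have [h1 h2 h3 h4] := frame_pairing Np of_ oZ (etrans cE E).
rewrite {1}cE E h1 h2 h3 !scale0r !add0r.
by apply: eq_bigr => i _; rewrite h4.
Qed.

End Frames.

(** * Charts of umbilic slices *)

Section SliceCharts.
Context {R : realType} {d m : nat} {kappa : R}.
Variable Mo : light_cone_model d m kappa.
Local Notation M := (lcM Mo).
Local Notation g := (lcg Mo).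
Local Notation K := (lcK Mo).
Local Notation Phi := (lcPhi Mo).
Local Notation dPhi := (lcdPhi Mo).
Local Notation Pi := (lcPi Mo).
Local Notation sec := (lcsec Mo).
Local Notation b := (bf (lcJ Mo)).
Variables (A : 'rV[R]_m) (eta : R).
Hypotheses (hAA : b A A = 1) (hAK : b A K = eta).
Local Notation N := (slice Mo A).
Local Notation k := (@slice_curv R kappa eta).
Local Notation KA := (slice_K Mo A eta).

Let hAA' : eta * b A A = eta. Proof. by rewrite hAA mulr1. Qed.

Lemma slice_vecE p Y c e : N p -> orth3 Mo A p Y ->
  b Y Y = 2 * e - k * e ^+ 2 -> c = 1 - k * e -> 0 <= e ->
  N (Pi (c *: Phi p + Y + e *: KA)) /\
  Phi (Pi (c *: Phi p + Y + e *: KA)) = c *: Phi p + Y + e *: KA.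
Proof.
move=> Np [YP YK YA] YY -> e0; have [Mp pA] := Np.
have YKA : b KA Y = 0 by rewrite slice_KE !bfL YK YA; ring.
have F1 := b_PhiKA eta Np; have F2 := b_KAKA hAA' hAK.
have F3 := b_KKA hAK; have F4 := b_AKA hAA' hAK.
set X := _ + e *: KA.
have [||| MX EX] := @lcPhi_Pi _ _ _ _ Mo p X Mp.
- rewrite /X !bfL lcPhiPhi // !(lc_bfC Mo Y) YP YKA YY (lc_bfC Mo KA (Phi p)) F1 F2.
  by ring.
- by rewrite /X !bfL lcPhiK // (lc_bfC Mo Y) YK (lc_bfC Mo KA) F3; ring.
- by rewrite /X !bfL lcPhiPhi // (lc_bfC Mo Y) YP (lc_bfC Mo KA) F1; lra.
by split => //; split => //; rewrite EX /X !bfL pA (lc_bfC Mo Y) YA (lc_bfC Mo KA) F4; ring.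
Qed.

(** The versine of the distance in N from p to x. Accordingly [slice_vec] is the term s V in the
    formula for the geodesic from p to x. *)
Definition slice_ht p x := - b (Phi x) (Phi p).
Definition slice_vec p x :=
  Phi x - (1 - k * slice_ht p x) *: Phi p - slice_ht p x *: KA.

Lemma slice_vecK p x :
  Phi x = (1 - k * slice_ht p x) *: Phi p + slice_vec p x + slice_ht p x *: KA.
Proof. by rewrite /slice_vec; apply/rowP => i; rewrite !mxE; ring. Qed.

Lemma slice_vecP p x : N p -> N x ->
  [/\ orth3 Mo A p (slice_vec p x), 0 <= slice_ht p x &
   b (slice_vec p x) (slice_vec p x) =
     2 * slice_ht p x - k * slice_ht p x ^+ 2].
Proof.
move=> Np Nx; have [Mp pA] := Np; have [Mx xA] := Nx.
have F1 := b_PhiKA eta Np; have F2 := b_KAKA hAA' hAK.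
have F3 := b_KKA hAK; have F4 := b_AKA hAA' hAK.
have F5 := b_PhiKA eta Nx.
have Ee : b (Phi x) (Phi p) = - slice_ht p x by rewrite opprK.
have PK := lcPhiK Mp; have XK := lcPhiK Mx.
have PP := lcPhiPhi Mp; have XX := lcPhiPhi Mx.
split; [split| |].
- by rewrite /slice_vec !bfL (lc_bfC Mo _ (Phi x)) Ee PP F1; ring.
- by rewrite /slice_vec !bfL !(lc_bfC Mo K (Phi _)) PK XK F3; ring.
- by rewrite /slice_vec !bfL !(lc_bfC Mo A (Phi _)) pA xA F4; ring.
- by rewrite oppr_ge0; exact: lcPhi_le0.
- rewrite /slice_vec !bfL (lc_bfC Mo (Phi p) (Phi x)) !(lc_bfC Mo KA (Phi _)).
  by rewrite Ee PP F1 F2 F5 XX; ring.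
Qed.

(** If k = 0 the relation on c is empty. In general k versk = k e makes the quadratic terms of the
    second relation agree, which leaves the linear ones. *)
Lemma versk_unique (t c s e : R) : cosk k t = c -> sink k t = s ->
  c = 1 - k * e -> s ^+ 2 = 2 * e - k * e ^+ 2 -> versk k t = e.
Proof.
move=> hc hs ce se.
have h1 : k * versk k t = k * e by have := cosk_versk k t; rewrite hc ce; lra.
have := sink_versk k t; rewrite hs se.
have -> : k * versk k t ^+ 2 = k * versk k t * versk k t by ring.
rewrite h1; have -> : k * e * versk k t = k * versk k t * e by ring.
rewrite h1; have -> : k * e * e = k * e ^+ 2 by ring.
lra.
Qed.

Lemma geo_surj p x V0 : N p -> N x -> unit_tangent Mo A p V0 ->
  exists V t, unit_tangent Mo A p V /\ x = geoE Mo A eta p V t.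
Proof.
move=> Np Nx u0; have [Mx _] := Nx.
have [[YP YK YA] e0 YY] := slice_vecP Np Nx.
have XE := slice_vecK p x.
move: (slice_vec p x) (slice_ht p x) YP YK YA e0 YY XE => Y e YP YK YA e0 YY XE.
have [Mp _] := Np.
have [V [s [uV sV ss]]] : exists V s, [/\ unit_tangent Mo A p V, s *: V = Y &
    s ^+ 2 = b Y Y].
  (* If the tangential part vanishes (x = p, or x antipodal to p when k > 0), any unit direction
     will do. *)
  have [Y0|Y0] := eqVneq Y 0.
    by exists V0, 0; split => //; rewrite ?scale0r ?Y0 // bf0l expr0n.
  have YY0 : 0 < b Y Y by apply: (lc_pos Mp) => //; rewrite lc_bfC.
  have s0 : 0 < Num.sqrt (b Y Y) by rewrite sqrtr_gt0.
  have s2 : Num.sqrt (b Y Y) ^+ 2 = b Y Y by rewrite sqr_sqrtr // ltW.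
  exists ((Num.sqrt (b Y Y))^-1 *: Y), (Num.sqrt (b Y Y)); split => //.
    split; rewrite !bfL ?YP ?YK ?YA ?mulr0 // -{3}s2.
    by move: (Num.sqrt _) s0 => q q0; field; exact: lt0r_neq0.
  by rewrite scalerA divff ?scale1r // gt_eqF.
have hc : (1 - k * e) ^+ 2 + k * s ^+ 2 = 1 by rewrite ss YY; ring.
have [|t [tc ts _]] := cosk_sink_surj hc.
  by move=> k0; have : k * e <= 0 by [exact: mulr_le0_ge0]; lra.
exists V, t; split => //; rewrite /geoE /geo /slice_point tc ts.
rewrite (versk_unique tc ts erefl) ?ss // sV.
by rewrite -[x in LHS](lcPi_Phi Mx); congr Pi; exact: XE.
Qed.

Lemma slice_connected p V0 : N p -> unit_tangent Mo A p V0 -> connected N.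
Proof.
move=> Np u0.
have -> : N = \bigcup_(V in unit_tangent Mo A p) (geoE Mo A eta p V @` setT).
  apply/seteqP; split => [x Nx|x [V uV [t _ <-]]].
    by have [V [t [uV ->]]] := geo_surj Np Nx u0; exists V => //; exists t.
  by have [] := geoP hAA' hAK t Np uV.
apply: bigcup_connected.
  by exists p => V uV; exists 0 => //; rewrite geoE0.
move=> V uV; apply: connected_continuous_connected.
  by apply/connected_intervalP => x y _ _ z _.
apply: continuous_subspaceT => t.
have [_ _ sc _] := geoE_curve1 hAA' hAK Np uV.
exact: (Ck_continuous (sc 0%N) (I : setT t)).
Qed.

Section Chart.
Variables (n : nat) (p : 'rV[R]_d) (f : 'I_n -> 'rV[R]_m).
Hypotheses (Np : N p) (orth_f : orthonormal_at Mo A p f).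
Hypothesis f_spans : forall Z, orth3 Mo A p Z -> Z = \sum_i b Z (f i) *: f i.

Definition chart_dom : set 'rV[R]_d := [set x | N x /\ 0 < 1 - k * slice_ht p x].

(** For k > 0 the central projection of an open hemisphere, for k <= 0 the orthogonal projection to
    the tangent space at p. Both are onto the whole of R^n, as [chart] requires of the foliation
    charts built from them. *)
Definition chart_map x : 'rV[R]_n :=
  \row_i (b (Phi x) (f i) / (if 0 < k then 1 - k * slice_ht p x else 1)).

Definition sqn (z : 'rV[R]_n) : R := \sum_i z ord0 i * z ord0 i.
Definition chart_cos z : R :=
  if 0 < k then (Num.sqrt (1 + k * sqn z))^-1 else Num.sqrt (1 - k * sqn z).
Definition chart_scale z : R := if 0 < k then chart_cos z else 1.
(** Since sink^2 = versk (1 + cosk), this quotient is the versine, obtained without dividing by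
    k. *)
Definition chart_ht z : R := chart_scale z ^+ 2 * sqn z / (1 + chart_cos z).
Definition chart_vec z := chart_scale z *: \sum_i z ord0 i *: f i.
Definition chart_inv z : 'rV[R]_m :=
  chart_cos z *: Phi p + chart_vec z + chart_ht z *: KA.
Definition chart_invE z : 'rV[R]_d := Pi (chart_inv z).

Lemma sqn_ge0 z : 0 <= sqn z.
Proof. by apply: sumr_ge0 => i _; rewrite -expr2 sqr_ge0. Qed.

Lemma chart_cos_gt0 z : 0 < chart_cos z.
Proof.
rewrite /chart_cos; case: ifP => [k0|/negbT]; have q0 := sqn_ge0 z.
  rewrite invr_gt0 sqrtr_gt0.
  have : 0 <= k * sqn z by rewrite mulr_ge0 // ltW.
  lra.
rewrite -leNgt => k0; rewrite sqrtr_gt0.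
have : k * sqn z <= 0 by exact: mulr_le0_ge0.
lra.
Qed.

Lemma chart_cosE z : chart_cos z ^+ 2 + k * (chart_scale z ^+ 2 * sqn z) = 1.
Proof.
rewrite /chart_scale /chart_cos; have q0 := sqn_ge0 z; case: ifP => [k0|/negbT].
  have h : 0 < 1 + k * sqn z.
    have : 0 <= k * sqn z by rewrite mulr_ge0 // ltW.
    lra.
  have s0 : Num.sqrt (1 + k * sqn z) != 0 by rewrite gt_eqF // sqrtr_gt0.
  rewrite exprVn (sqr_sqrtr (ltW h)).
  by field; rewrite gt_eqF.
rewrite -leNgt => k0.
have h : k * sqn z <= 0 by exact: mulr_le0_ge0.
rewrite sqr_sqrtr; last lra.
by ring.
Qed.

Lemma chart_cos_ht z : chart_cos z = 1 - k * chart_ht z.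
Proof.
have c0 := chart_cos_gt0 z; have E := chart_cosE z; rewrite /chart_ht.
move: (chart_scale z ^+ 2 * sqn z) (chart_cos z) c0 E => y c c0 E.
have c1 : 1 + c != 0 by rewrite gt_eqF // addr_gt0.
apply: (mulIf c1); rewrite mulrBl mul1r -mulrA mulfVK // -[in X in _ - X](addrK (c ^+ 2) (k * y)).
by rewrite [k * y + _]addrC E; ring.
Qed.

Lemma chart_ht_ge0 z : 0 <= chart_ht z.
Proof.
apply: divr_ge0; first by rewrite mulr_ge0 ?sqr_ge0 // sqn_ge0.
by rewrite ltW // addr_gt0 // chart_cos_gt0.
Qed.

Lemma chart_ht_sqn z : chart_scale z ^+ 2 * sqn z =
  2 * chart_ht z - k * chart_ht z ^+ 2.
Proof.
have c1 : 1 + chart_cos z != 0 by rewrite gt_eqF // addr_gt0 // chart_cos_gt0.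
have -> : 2 * chart_ht z - k * chart_ht z ^+ 2 = chart_ht z * (1 + (1 - k * chart_ht z)).
  by ring.
by rewrite -chart_cos_ht /chart_ht mulfVK.
Qed.

Lemma chart_vec_orth z : orth3 Mo A p (chart_vec z).
Proof.
have [fo _] := orth_f.
split; rewrite /chart_vec bfZr bf_sumr big1 ?mulr0 // => i _; rewrite bfZr;
  by have [hP hK hA] := fo i; rewrite ?hP ?hK ?hA mulr0.
Qed.

Lemma b_sum_f (a : 'I_n -> R) j : b (\sum_i a i *: f i) (f j) = a j.
Proof.
have [_ ff] := orth_f.
rewrite bf_suml (bigD1 j) //= big1 ?addr0 ?bfZl ?ff ?eqxx ?mulr1 //.
by move=> i ij; rewrite bfZl ff (negbTE ij) mulr0.
Qed.

Lemma chart_vec_sqr z : b (chart_vec z) (chart_vec z) = chart_scale z ^+ 2 * sqn z.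
Proof.
rewrite /chart_vec bfZl bfZr mulrA -expr2 bf_sumr; congr (_ * _).
by apply: eq_bigr => i _; rewrite bfZr b_sum_f.
Qed.

Lemma chart_invP z : N (chart_invE z) /\ Phi (chart_invE z) = chart_inv z.
Proof.
apply: slice_vecE => //; first exact: chart_vec_orth.
- by rewrite chart_vec_sqr chart_ht_sqn.
- exact: chart_cos_ht.
- exact: chart_ht_ge0.
Qed.

Lemma slice_ht_inv z : slice_ht p (chart_invE z) = chart_ht z.
Proof.
have [_ E] := chart_invP z; rewrite /slice_ht E /chart_inv.
have [VP _ _] := chart_vec_orth z; have [Mp _] := Np.
move: (chart_vec z) VP => Y VP.
rewrite !bfDl !bfZl lcPhiPhi // (lc_bfC Mo Y) VP (lc_bfC Mo KA).
by rewrite b_PhiKA //; ring.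
Qed.

Lemma chart_inv_dom z : chart_dom (chart_invE z).
Proof.
split; first by have [] := chart_invP z.
by rewrite slice_ht_inv -chart_cos_ht chart_cos_gt0.
Qed.

Lemma chart_invK z : chart_map (chart_invE z) = z.
Proof.
have [_ E] := chart_invP z; have [fo ff] := orth_f.
apply/rowP => i; rewrite !mxE slice_ht_inv -chart_cos_ht E /chart_inv.
have [fP fK fA] := fo i.
have fKA : b KA (f i) = 0 by rewrite slice_KE !bfL fK fA; ring.
have vf : b (chart_vec z) (f i) = chart_scale z * z ord0 i by rewrite bfZl b_sum_f.
rewrite bfDl bfDl (bfZl _ (chart_cos z)) (bfZl _ (chart_ht z)) fP fKA vf.
rewrite !mulr0 add0r addr0 /chart_scale.
have c0 := chart_cos_gt0 z.
by case: ifP => _; field; rewrite ?gt_eqF // oner_neq0.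
Qed.

Lemma chart_mapK x : chart_dom x -> chart_inv (chart_map x) = Phi x.
Proof.
move=> [Nx cx]; have [oY e0 YY] := slice_vecP Np Nx.
have [fo ff] := orth_f.
set e := slice_ht p x in cx e0 YY; have eE : e = slice_ht p x by [].
have [Y YE0] : {Y | Y = slice_vec p x} by eexists.
rewrite -YE0 in oY YY; clearbody e.
have Yf i : b Y (f i) = b (Phi x) (f i).
  have [fP fK fA] := fo i.
  have fKA : b KA (f i) = 0 by rewrite slice_KE !bfL fK fA; ring.
  by rewrite YE0 /slice_vec !bfL fP fKA; ring.
set h := (if 0 < k then 1 - k * e else 1).
have h0 : 0 < h by rewrite /h; case: ifP.
have zE i : chart_map x ord0 i = b Y (f i) / h by rewrite mxE Yf -eE.
have YE := f_spans oY.
have q : sqn (chart_map x) = b Y Y / h ^+ 2.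
  rewrite {1}YE bf_suml mulr_suml; apply: eq_bigr => i _.
  rewrite zE bfZl (lc_bfC Mo (f i)); field.
  by rewrite gt_eqF.
have cE : chart_cos (chart_map x) = 1 - k * e.
  rewrite /chart_cos q YY /h; case: ifP => [k0|k0].
    rewrite k0 in h0 *.
    have -> : 1 + k * ((2 * e - k * e ^+ 2) / (1 - k * e) ^+ 2) = ((1 - k * e)^-1) ^+ 2.
      by field; rewrite gt_eqF.
    by rewrite sqrtr_sqr gtr0_norm ?invr_gt0 // invrK.
  rewrite k0; have -> : 1 - k * ((2 * e - k * e ^+ 2) / 1 ^+ 2) = (1 - k * e) ^+ 2 by field.
  by rewrite sqrtr_sqr gtr0_norm.
have sE : chart_scale (chart_map x) = h by rewrite /chart_scale cE.
have hE : chart_ht (chart_map x) = e.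
  rewrite /chart_ht sE q cE mulrCA divff ?expf_neq0 ?gt_eqF // mulr1 YY.
  by field; rewrite gt_eqF // addr_gt0.
rewrite /chart_inv cE hE [RHS](slice_vecK p x) -YE0 -eE; congr (_ + _ + _).
rewrite [RHS]YE /chart_vec sE scaler_sumr; apply: eq_bigr => i _.
by rewrite zE scalerA mulrCA divff ?mulr1 // gt_eqF.
Qed.

Lemma chart_mapKE x : chart_dom x -> chart_invE (chart_map x) = x.
Proof.
by move=> Vx; rewrite /chart_invE chart_mapK // lcPi_Phi //; have [[]] := Vx.
Qed.

Lemma smooth_sqn : smooth_on setT sqn.
Proof.
apply: smooth_on_sum => i.
have h : smooth_on setT (fun z : 'rV[R]_n => z ord0 i).
  exact: (smooth_on_coord i (@smooth_on_id R 'rV[R]_n setT)).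
exact: smooth_on_mul.
Qed.

Lemma smooth_chart_cos : smooth_on setT chart_cos.
Proof.
have sq := smooth_sqn.
have h e : smooth_on setT (fun z => 1 + e * sqn z).
  apply: smooth_on_add; first exact: smooth_on_cst.
  by apply: smooth_on_mul => //; exact: smooth_on_cst.
have [k0|k0] := ltP 0 k.
  apply: (@smooth_on_ext _ _ _ _ (fun z => (Num.sqrt (1 + k * sqn z))^-1)).
    by move=> z _; rewrite /chart_cos k0.
  have p0 z : 0 < 1 + k * sqn z.
    have : 0 <= k * sqn z by rewrite mulr_ge0 ?sqn_ge0 // ltW.
    lra.
  apply: smooth_on_inv; last by move=> z _; rewrite gt_eqF // sqrtr_gt0.
  by apply: smooth_on_sqrt.
apply: (@smooth_on_ext _ _ _ _ (fun z => Num.sqrt (1 - k * sqn z))).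
  by move=> z _; rewrite /chart_cos ltNge k0.
apply: smooth_on_sqrt => [|z _].
  apply: (@smooth_on_ext _ _ _ _ (fun z => 1 + - k * sqn z)); last exact: h.
  by move=> z' _; rewrite mulNr.
have : k * sqn z <= 0 by rewrite mulr_le0_ge0 ?sqn_ge0.
lra.
Qed.

Lemma smooth_chart_inv : smooth_on setT chart_inv.
Proof.
have sc := smooth_chart_cos.
have ss : smooth_on setT chart_scale.
  have [k0|k0] := ltP 0 k.
    by apply: smooth_on_ext sc => z _; rewrite /chart_scale k0.
  apply: (@smooth_on_ext _ _ _ _ (fun=> 1 : R)); last exact: smooth_on_cst.
  by move=> z _; rewrite /chart_scale ltNge k0.
have sh : smooth_on setT chart_ht.
  apply: smooth_on_div.
  - by apply: smooth_on_mul; [exact: smooth_on_exp|exact: smooth_sqn].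
  - by apply: smooth_on_add => //; exact: smooth_on_cst.
  - by move=> z _; rewrite gt_eqF // addr_gt0 // chart_cos_gt0.
apply: smooth_on_add; last by apply: smooth_on_scale => //; exact: smooth_on_cst.
apply: smooth_on_add; first by apply: smooth_on_scale => //; exact: smooth_on_cst.
apply: smooth_on_scale => //; apply: smooth_on_sum => i; apply: smooth_on_scale.
  exact: (smooth_on_coord i (@smooth_on_id R 'rV[R]_n setT)).
exact: smooth_on_cst.
Qed.

Lemma smooth_chart_invE : smooth_on setT chart_invE.
Proof.
apply: (smooth_on_comp smooth_chart_inv (lc_smoothPi (l := Mo))) => z _.
by have [[Mz _] E] := chart_invP z; exists (chart_invE z).
Qed.

Lemma smooth_slice_ht S : S `<=` M -> smooth_on S (slice_ht p).
Proof.
move=> SM; apply: smooth_on_opp; apply: smooth_on_bf; last exact: smooth_on_cst.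
exact: smooth_on_sub SM (lc_smoothPhi (l := Mo)).
Qed.

Lemma smooth_chart_map : smooth_on chart_dom chart_map.
Proof.
have VM : chart_dom `<=` M by move=> x [[]].
apply: smooth_on_row => i.
apply: (@smooth_on_ext _ _ _ _ (fun x => b (Phi x) (f i) /
    (if 0 < k then 1 - k * slice_ht p x else 1))) => [x _|]; first by rewrite mxE.
apply: smooth_on_div.
- apply: smooth_on_bf; last exact: smooth_on_cst.
  exact: smooth_on_sub VM (lc_smoothPhi (l := Mo)).
- case: (0 < k); last exact: smooth_on_cst.
  apply: smooth_on_add; first exact: smooth_on_cst.
  apply: smooth_on_opp; apply: smooth_on_mul; first exact: smooth_on_cst.
  exact: smooth_slice_ht.
- by move=> x [_ h]; case: ifP => _; rewrite ?oner_neq0 // gt_eqF.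
Qed.

Lemma chart_dom_center : chart_dom p.
Proof.
split => //; have [Mp _] := Np.
by rewrite /slice_ht lcPhiPhi // oppr0 mulr0 subr0.
Qed.

End Chart.
End SliceCharts.

(** * Flow lines of geodesic fields *)

Section Flow.
Context {R : realType} {d m : nat} {kappa : R}.
Variable Mo : light_cone_model d m kappa.
Local Notation M := (lcM Mo).
Local Notation g := (lcg Mo).
Local Notation K := (lcK Mo).
Local Notation Phi := (lcPhi Mo).
Local Notation dPhi := (lcdPhi Mo).
Local Notation Pi := (lcPi Mo).
Local Notation b := (bf (lcJ Mo)).
Variables (A : 'rV[R]_m) (eta : R).
Hypotheses (hAA : b A A = 1) (hAK : b A K = eta).
Local Notation N := (slice Mo A).
Local Notation k := (@slice_curv R kappa eta).
Local Notation KA := (slice_K Mo A eta).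
Local Notation Geo := (geo Mo A eta).
Local Notation dGeo := (dgeo Mo A eta).
Local Notation GeoE := (geoE Mo A eta).

Let hAA' : eta * b A A = eta. Proof. by rewrite hAA mulr1. Qed.

Lemma isd_comp_smooth n j (F : 'rV[R]_n -> 'rV[R]_j) (f : R -> 'rV[R]_n) (t : R) df :
  smooth_on setT F -> is_derive t 1 f df ->
  is_derive t 1 (fun s => F (f s)) ('D_df F (f t)).
Proof.
move=> sF fd; apply: isd_row => i.
have dF : derivable F (f t) df.
  exact: (Ck_derivable (smooth_on_open openT sF 1%N) I).
have [_ E] := derive_coord i dF; rewrite -E.
have [df1 <-] := fd; apply: (is_derive_comp_dir df1).
apply: (C1_differentiable openT _ I).
by apply: (smooth_on_open openT); exact: smooth_on_coord.
Qed.

Lemma isd_div (f h : R -> R) (t df dh : R) : h t != 0 ->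
  is_derive t 1 f df -> is_derive t 1 h dh ->
  is_derive t 1 (fun s => f s / h s) ((df * h t - f t * dh) / h t ^+ 2).
Proof.
move=> h0 fd hd; have iv : is_derive t 1 (fun s => (h s)^-1) (- (h t) ^- 2 * dh).
  exact: is_deriveV.
apply: is_derive_eq (isd_mul fd iv) _.
by field.
Qed.

(** Both sides solve the same linear equation with the same data at time 0. *)
Lemma geo_shift p V t0 s : N p -> unit_tangent Mo A p V ->
  Geo (GeoE p V t0) (dGeo p V t0) s = Geo p V (s + t0) /\
  dGeo (GeoE p V t0) (dGeo p V t0) s = dGeo p V (s + t0).
Proof.
move=> Np uV; have [Nq Eq] := geoP hAA' hAK t0 Np uV.
have H r : Geo (GeoE p V t0) (dGeo p V t0) r = Geo p V (r + t0).
  have E q W r' i : Geo q W r' ord0 i = cosk k r' * Phi q ord0 i +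
      sink k r' * W ord0 i + versk k r' * KA ord0 i.
    by rewrite /geo /slice_point !mxE.
  apply/rowP => i; rewrite (E (GeoE p V t0)) Eq; apply/esym.
  apply: (@ode_unique1 _ k _ _ _ setT (fun t => Geo p V (t + t0) ord0 i)
    (fun t => dGeo p V (t + t0) ord0 i)) => //; rewrite ?add0r //.
  - by move=> t _; apply: isd_coord; apply: isd_shift; exact: is_derive_geo.
  - move=> t _; apply: is_derive_eq (isd_coord i (isd_shift (is_derive_dgeo _ _ _ _ _ _))) _.
    by rewrite !mxE.
split => //; apply: (isd_unique (is_derive_geo _ _ _ _ _ s)).
rewrite (_ : Geo _ _ = fun r => Geo p V (r + t0)); last exact/funext.
by apply: isd_shift; exact: is_derive_geo.
Qed.

Section Field.
Variable (v : 'rV[R]_d -> 'rV[R]_d).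
Hypothesis uv : unit_vector_field g N v.
Local Notation VF x := (dPhi x (v x)).

Lemma field_unit p : N p -> unit_tangent Mo A p (VF p).
Proof.
move=> Np; have [_ /(_ p Np)[tv iv]] := uv.
have [h1 h2 h3] := tangent_orth Np tv.
by split => //; rewrite -lc_inner //; case: Np.
Qed.

Lemma smooth_field (V : normedModType R) (S : set V) (f : V -> 'rV[R]_d) :
  smooth_on S f -> (forall x, S x -> N (f x)) ->
  smooth_on S (fun x => VF (f x)).
Proof.
move=> sf SN; have [sv _] := uv.
apply: lc_smooth_dPhi => //; last by move=> x /SN[].
exact: smooth_on_comp sf sv SN.
Qed.

(** The field is carried to R^n by the chart centred at [q], integrated there by [picard], and the
    solution is mapped back. *)
Lemma integral_curve n q : m = (3 + n)%N -> N q ->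
  exists (delta : R) (c : R -> 'rV[R]_d),
    [/\ 0 < delta, smooth_curve N [set t | `|t| < delta] c, c 0 = q &
      forall t, `|t| < delta -> derive1 c t = v (c t)].
Proof.
move=> mn Nq; have [f [of_ fs]] := orthonormal_frame hAA hAK Nq mn.
pose psi := chart_inv Mo A eta q f; pose psiE := chart_invE Mo A eta q f.
pose phi := chart_map Mo eta q f.
have psiP z := chart_invP hAA hAK Nq of_ z.
have spsi := smooth_chart_inv Mo A eta q f : smooth_on setT psi.
have spsiE : smooth_on setT psiE by exact: smooth_chart_invE.
have sV : smooth_on setT (fun z => VF (psiE z)).
  by apply: smooth_field => // z _; have [] := psiP z.
pose h z := if 0 < k then 1 - k * slice_ht Mo q (psiE z) else 1.
pose h' z := if 0 < k then k * b (VF (psiE z)) (Phi q) else 0.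
(* The derivative of [chart_map] along the field, by the quotient rule: [h] is the denominator and
   [h'] its derivative. *)
pose w z : 'rV[R]_n := \row_i ((b (VF (psiE z)) (f i) * h z -
   b (psi z) (f i) * h' z) / h z ^+ 2).
have h0 z : h z != 0.
  have [_ /gt_eqF hz] := chart_inv_dom hAA hAK Nq of_ z.
  by rewrite /h; case: ifP; rewrite ?hz ?oner_eq0.
have bV (Y : 'rV[R]_m) (X : 'rV[R]_n -> 'rV[R]_m) : smooth_on setT X ->
    smooth_on setT (fun z => b (X z) Y).
  by move=> sX; apply: smooth_on_bf => //; exact: smooth_on_cst.
have sh : smooth_on setT h.
  rewrite /h; case: (0 < k); last exact: smooth_on_cst.
  apply: (@smooth_on_ext _ _ _ _ (fun z => 1 - k * - b (psi z) (Phi q))).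
    by move=> z _; rewrite /slice_ht (psiP z).2.
  apply: smooth_on_add; first exact: smooth_on_cst.
  apply: smooth_on_opp; apply: smooth_on_mul; first exact: smooth_on_cst.
  by apply: smooth_on_opp; exact: bV.
have sh' : smooth_on setT h'.
  rewrite /h'; case: (0 < k); last exact: smooth_on_cst.
  by apply: smooth_on_mul; [exact: smooth_on_cst|exact: bV].
have sw : smooth_on setT w.
  apply: smooth_on_row => i.
  apply: (@smooth_on_ext _ _ _ _ (fun z => (b (VF (psiE z)) (f i) * h z -
     b (psi z) (f i) * h' z) / h z ^+ 2)); first by move=> z _; rewrite mxE.
  apply: smooth_on_div; last by move=> z _; rewrite expf_neq0.
    apply: smooth_on_add; first by apply: smooth_on_mul => //; exact: bV.
    by apply: smooth_on_opp; apply: smooth_on_mul => //; exact: bV.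
  exact: smooth_on_exp.
have sw' := smooth_on_open openT sw.
have [delta [z [d0 z0 dz]]] := picard (phi q) (sw' 1%N).
pose I := [set t : R | `|t| < delta].
have IE : I = ball (0 : R) delta.
  by apply/seteqP; split => s; rewrite /I /= -ball_normE /= sub0r normrN.
have oI : open I by rewrite IE; exact: ball_open.
have sz : smooth_open I z.
  elim=> [|j IH].
    split => // t /dz[dzt _]; apply: differentiable_continuous.
    exact/derivable1_diffP.
  apply: (Ck_antideriv oI dz).
  exact: (Ck_comp_rV oI openT (fun _ _ => Logic.I) IH (sw' j)).
pose c t := psiE (z t).
have sc : smooth_curve N I c.
  split => //.
  - move=> x y; rewrite /I /= !ltr_norml => /andP[x1 x2] /andP[y1 y2] u /andP[xu uy].
    by rewrite ltr_norml (lt_le_trans x1 xu) (le_lt_trans uy y2).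
  - apply: (smooth_on_open oI).
    by apply: (smooth_on_comp (smooth_open_on oI sz) spsiE).
  - by move=> t _; have [] := psiP (z t).
exists delta, c; split => //.
  by rewrite /c z0; apply: chart_mapKE => //; exact: chart_dom_center.
move=> t It; have [Nt Et] := psiP (z t).
apply: (@dPhi_injective _ _ _ _ Mo (c t)); first by case: Nt.
have D := derive_Phi_curve (@slice_sub _ _ _ _ Mo A) sc It.
apply: (isd_unique D).
have D1 : is_derive t 1 (fun s => Phi (c s)) ('D_(w (z t)) psi (z t)).
  rewrite (_ : (fun s => _) = fun s => psi (z s)); last first.
    by apply/funext => s; have [] := psiP (z s).
  exact: isd_comp_smooth (dz t It).
suff <- : 'D_(w (z t)) psi (z t) = VF (c t) by [].
(* To see that the inverse chart carries [w] back to the field, differentiate along the geodesic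
   [gam] whose initial velocity is the field: near 0 it is unchanged by the chart followed by its
   inverse. *)
have uV := field_unit Nt; pose gam := GeoE (c t) (VF (c t)).
have gP s := geoP hAA' hAK s Nt uV.
have gE s : Phi (gam s) = Geo (c t) (VF (c t)) s by have [] := gP s.
have dg : is_derive (0 : R) 1 (fun s => Phi (gam s)) (VF (c t)).
  rewrite (_ : (fun s => _) = Geo (c t) (VF (c t))); last exact/funext.
  by apply: is_derive_eq (is_derive_geo _ _ _ _ _ _) _; rewrite dgeo0.
have g0 : gam 0 = c t by rewrite /gam geoE0.
have dphi : is_derive (0 : R) 1 (fun s => phi (gam s)) (w (z t)).
  apply: isd_row => i; rewrite mxE.
  rewrite (_ : (fun s => _) = fun s => b (Phi (gam s)) (f i) /
     (if 0 < k then 1 - k * slice_ht Mo q (gam s) else 1)); last first.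
    by apply/funext => s; rewrite mxE.
  have hE : (if 0 < k then 1 - k * slice_ht Mo q (gam 0) else 1) = h (z t).
    by rewrite g0.
  have nE : b (Phi (gam 0)) (f i) = b (psi (z t)) (f i) by rewrite g0 Et.
  have dh : is_derive (0 : R) 1
      (fun s => if 0 < k then 1 - k * slice_ht Mo q (gam s) else 1) (h' (z t)).
    rewrite /h'; case: (0 < k); last exact: isd_cst.
    apply: is_derive_eq (isd_add (isd_cst (1 : R) _ _) (isd_opp (isd_mul (isd_cst k _ _)
      (isd_opp (isd_bf (lcJ Mo) dg (isd_cst (Phi q) _ _)))))) _.
    by rewrite bf0r /c; ring.
  apply: is_derive_eq (isd_div _ (isd_bf (lcJ Mo) dg (isd_cst (f i) _ _)) dh) _.
    by rewrite hE.
  by rewrite hE nE bf0r addr0.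
have dpsi : is_derive (0 : R) 1 (fun s => psi (phi (gam s))) ('D_(w (z t)) psi (z t)).
  have zt : phi (gam 0) = z t by rewrite g0 /phi (chart_invK hAA hAK Nq of_).
  have E := isd_comp_smooth spsi dphi.
  by rewrite zt in E.
apply: (isd_unique dpsi); apply: isd_near (dg).
have cont : (fun s => 1 - k * slice_ht Mo q (gam s)) @ (0 : R) -->
    1 - k * slice_ht Mo q (gam 0).
  have dd : is_derive (0 : R) 1 (fun s => 1 - k * slice_ht Mo q (gam s))
      (k * b (VF (c t)) (Phi q)).
    apply: is_derive_eq (isd_add (isd_cst (1 : R) _ _) (isd_opp (isd_mul (isd_cst k _ _)
      (isd_opp (isd_bf (lcJ Mo) dg (isd_cst (Phi q) _ _)))))) _.
    by rewrite bf0r; ring.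
  by case: dd => /derivable1_diffP/differentiable_continuous.
have pos0 : 0 < 1 - k * slice_ht Mo q (gam 0).
  by rewrite g0; have [] := chart_inv_dom hAA hAK Nq of_ (z t).
have npos : \forall s \near (0 : R), 0 < 1 - k * slice_ht Mo q (gam s).
  exact: (@cvgr_gt _ _ _ _ _ _ cont _ pos0).
near=> s; have [Ns _] := gP s.
have cd : chart_dom Mo A eta q (gam s).
  by split; [exact: Ns|near: s; exact: npos].
exact: esym (chart_mapK hAA hAK Nq of_ fs cd).
Unshelve. all: by end_near. Qed.

Hypothesis gv : geodesic_vector_field g N v.

(** The integral curve is a geodesic by hypothesis, hence equal to the explicit one; comparing
    velocities gives the value of the field along it. *)
Lemma local_flow n q : m = (3 + n)%N -> N q -> exists2 delta, 0 < delta &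
  forall t, `|t| < delta -> VF (GeoE q (VF q) t) = dGeo q (VF q) t.
Proof.
move=> mn Nq; have [delta [c [d0 sc c0 cv]]] := integral_curve mn Nq.
have [_ /(_ _ _ sc cv) gc] := gv.
have I0 : `|0 : R| < delta by rewrite normr0.
have c'0 : derive1 c 0 = v q by rewrite cv // c0.
have uq := field_unit Nq.
have H t : `|t| < delta -> Phi (c t) = Geo q (VF q) t.
  move=> It; have [_ _ _ V1] := uq; rewrite -c'0.
  by apply: (geodesic_unique hAA' hAK gc) => //; rewrite c'0.
have cE t : `|t| < delta -> c t = GeoE q (VF q) t.
  move=> It; have [_ _ _ /(_ t It)[Mt _]] := sc.
  by rewrite -[c t](lcPi_Phi Mt) H.
exists delta => // t It; have [oI _ _ Nc] := sc.
rewrite -cE // -cv //; have D := derive_Phi_curve (@slice_sub _ _ _ _ Mo A) sc It.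
apply: (isd_unique D); apply: isd_near (is_derive_geo _ _ _ _ _ t).
near=> s; apply/esym/H; near: s; exact: (open_near oI It).
Unshelve. all: by end_near. Qed.

(** The set of times at which the equality holds contains 0, is open by [local_flow] restarted at
    time t0, and is closed by continuity, so it is the whole line. *)
Lemma flow n p t : m = (3 + n)%N -> N p ->
  VF (GeoE p (VF p) t) = dGeo p (VF p) t.
Proof.
move=> mn Np; have up := field_unit Np.
pose T := [set t | VF (GeoE p (VF p) t) = dGeo p (VF p) t].
suff : T = setT by move=> TE; have : T t by rewrite TE.
have cT : connected [set: R] by apply/connected_intervalP => x y _ _ z _.
apply: cT.
- by exists 0; rewrite /T /= geoE0 // dgeo0.
- exists T; last by rewrite setTI.
  rewrite openE => t0 Tt0; have [Nq Eq] := geoP hAA' hAK t0 Np up.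
  have [delta d0 H] := local_flow mn Nq.
  have : \forall s \near t0, `|t0 - s| < delta by exact: near_dist.
  apply: filterS => s sd; rewrite /T /=.
  have := H (s - t0); rewrite distrC => /(_ sd); rewrite Tt0.
  have [h1 h2] := geo_shift t0 (s - t0) Np up.
  by rewrite h2 /geoE h1 subrK.
- exists T; last by rewrite setTI.
  have sg := geoE_curve1 hAA' hAK Np up.
  have cl : continuous (fun t => VF (GeoE p (VF p) t) - dGeo p (VF p) t).
    move=> s; apply: cvgB.
      have [_ _ sg' Ng] := sg.
      exact: (smooth_on_continuous_at openT (smooth_field (smooth_open_on openT sg') Ng) I).
    by apply: differentiable_continuous; apply/derivable1_diffP;
      have [] := is_derive_dgeo Mo A eta p (VF p) s.
  rewrite (_ : T = (fun t => VF (GeoE p (VF p) t) - dGeo p (VF p) t) @^-1` [set 0]).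
    apply: closed_comp; first by move=> x _; exact: cl.
    by apply: compact_closed; [exact: norm_hausdorff|exact: compact_set1].
  apply/seteqP; split => s; rewrite /T /=; first by move=> ->; rewrite subrr.
  by move/eqP; rewrite subr_eq0 => /eqP.
Qed.

End Field.
End Flow.

(** * The foliation by rays *)

Section RelativelyOpen.
Context {R : realType} {V : normedModType R}.
Implicit Types (M B : set V).

Lemma relatively_openP M B : B `<=` M ->
  (forall x, B x -> exists O, [/\ open O, O x & M `&` O `<=` B]) ->
  exists2 O, open O & B = M `&` O.
Proof.
move=> BM H; pose P O := open O /\ M `&` O `<=` B.
exists (\bigcup_(O in P) O).
  by apply: bigcup_open => B1 [].
apply/seteqP; split=> [x Bx|x [Mx [B1 [_ h1] h2]]]; last by apply: h1.
by split; [exact: BM|have [B1 [oB1 B1x OB]] := H x Bx; exists B1].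
Qed.

Lemma relatively_open_preimage M B (f : V -> R) (C : set R) :
  (exists2 O, open O & B = M `&` O) -> smooth_on B f -> open C ->
  exists2 O, open O & [set x | B x /\ C (f x)] = M `&` O.
Proof.
move=> [B1 oB1 BE] sf oC; apply: relatively_openP => [x [+ _]|x [Bx Cx]].
  by rewrite BE => -[].
have [B2 [F [q1 B2x sF FE]]] := sf x Bx.
exists (B1 `&` (B2 `&` F @^-1` C)); split.
- apply: openI => //; apply: open_preimage_in => // y B2y.
  exact: (Ck_continuous (sF 0%N) B2y).
- have [_ B1x] : (M `&` B1) x by rewrite -BE.
  by split => //; split => //=; rewrite FE.
- move=> y [My [B1y [B2y /= Cy]]].
  have By : B y by rewrite BE.
  by split => //; rewrite -FE.
Qed.

End RelativelyOpen.

Section HeightCoordinate.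
Context {R : realType}.

Definition ht_dom (kappa : R) : set R := [set e | 0 < e /\ kappa * e < 2].

Lemma ht_dom_gt0 kappa (e : R) : ht_dom kappa e -> 0 < 2 * e - kappa * e ^+ 2.
Proof.
move=> [e0 e2]; have -> : 2 * e - kappa * e ^+ 2 = e * (2 - kappa * e) by ring.
by rewrite mulr_gt0 // subr_gt0.
Qed.

(** The coordinate along the leaves must run over all of R. For kappa <= 0 the half-line is
    stretched by e - 1/e; for kappa > 0 the interval is rescaled to (-1, 1) and stretched by w /
    sqrt (1 - w^2). *)
Lemma ht_dom_line kappa : exists chi chi' : R -> R,
  [/\ smooth_on (ht_dom kappa) chi, smooth_on setT chi',
      forall e, ht_dom kappa e -> chi' (chi e) = e &
      forall r, ht_dom kappa (chi' r) /\ chi (chi' r) = r].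
Proof.
have sid (S : set R) : smooth_on S (fun x : R => x) by exact: smooth_on_id.
have [k0|k0] := leP kappa 0.
  exists (fun e => e - e^-1), (fun r => (r + Num.sqrt (r ^+ 2 + 4)) / 2).
  have p4 (r : R) : 0 < r ^+ 2 + 4 by have := sqr_ge0 r; lra.
  split.
  - apply: smooth_on_add => //; apply: smooth_on_opp; apply: smooth_on_inv => //.
    by move=> e [e0 _]; rewrite gt_eqF.
  - apply: smooth_on_mul; last exact: smooth_on_cst.
    apply: smooth_on_add => //; apply: smooth_on_sqrt => //.
    by apply: smooth_on_add; [exact: smooth_on_exp|exact: smooth_on_cst].
  - move=> e [e0 _]; have -> : (e - e^-1) ^+ 2 + 4 = (e + e^-1) ^+ 2.
      by field; rewrite gt_eqF.
    rewrite sqrtr_sqr ger0_norm; last by rewrite addr_ge0 ?invr_ge0 // ltW.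
    by field; rewrite gt_eqF.
  - move=> r; set s := Num.sqrt _.
    have s2 : s ^+ 2 = r ^+ 2 + 4 by rewrite sqr_sqrtr // ltW.
    have s0 : 0 < s by rewrite sqrtr_gt0.
    have e0 : 0 < (r + s) / 2.
      suff : 0 < r + s by move=> h; rewrite divr_gt0.
      have : (s + r) * (s - r) = 4 by have -> : (s + r) * (s - r) = s ^+ 2 - r ^+ 2; [ring|rewrite s2; ring].
      nra.
    split.
      split => //; apply: le_lt_trans (ltr0n _ 2); exact: mulr_le0_ge0 (ltW e0).
    have rs : r + s != 0 by move: e0; rewrite pmulr_lgt0 ?invr_gt0 // => /gt_eqF ->.
    have -> : ((r + s) / 2)^-1 = (s - r) / 2.
      apply: (mulfI (lt0r_neq0 e0)); rewrite divff ?gt_eqF //.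
      by have -> : (r + s) / 2 * ((s - r) / 2) = (s ^+ 2 - r ^+ 2) / 4; [field|rewrite s2; field].
    by field.
exists (fun e => (kappa * e - 1) / Num.sqrt (1 - (kappa * e - 1) ^+ 2)),
  (fun r => (1 + r / Num.sqrt (1 + r ^+ 2)) / kappa).
have p1 (r : R) : 0 < 1 + r ^+ 2 by have := sqr_ge0 r; lra.
have q1 (e : R) : ht_dom kappa e -> 0 < 1 - (kappa * e - 1) ^+ 2.
  move=> /ht_dom_gt0 h; have -> : 1 - (kappa * e - 1) ^+ 2 = kappa * (2 * e - kappa * e ^+ 2).
    by ring.
  exact: mulr_gt0.
have slin : smooth_on (ht_dom kappa) (fun e => kappa * e - 1).
  apply: smooth_on_add; last exact: smooth_on_cst.
  by apply: smooth_on_mul => //; exact: smooth_on_cst.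
split.
- apply: smooth_on_div => //.
    apply: smooth_on_sqrt => //; apply: smooth_on_add; first exact: smooth_on_cst.
    by apply: smooth_on_opp; exact: smooth_on_exp.
  by move=> e /q1 h; rewrite gt_eqF // sqrtr_gt0.
- apply: smooth_on_mul; last exact: smooth_on_cst.
  apply: smooth_on_add; first exact: smooth_on_cst.
  apply: smooth_on_div => //.
    apply: smooth_on_sqrt => //; apply: smooth_on_add; first exact: smooth_on_cst.
    exact: smooth_on_exp.
  by move=> r _; rewrite gt_eqF // sqrtr_gt0.
- move=> e /q1; have [w we] : {w | w = kappa * e - 1} by eexists.
  rewrite -we => h.
  have s0 : 0 < Num.sqrt (1 - w ^+ 2) by rewrite sqrtr_gt0.
  have s2 : Num.sqrt (1 - w ^+ 2) ^+ 2 = 1 - w ^+ 2 by rewrite sqr_sqrtr // ltW.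
  have -> : 1 + (w / Num.sqrt (1 - w ^+ 2)) ^+ 2 = ((Num.sqrt (1 - w ^+ 2))^-1) ^+ 2.
    rewrite expr_div_n exprVn s2; field; rewrite gt_eqF //.
  rewrite sqrtr_sqr gtr0_norm ?invr_gt0 // invrK mulfVK ?gt_eqF //.
  by rewrite we; field; rewrite gt_eqF.
- move=> r; have s0 : 0 < Num.sqrt (1 + r ^+ 2) by rewrite sqrtr_gt0.
  have s2 : Num.sqrt (1 + r ^+ 2) ^+ 2 = 1 + r ^+ 2 by rewrite sqr_sqrtr // ltW.
  move: (Num.sqrt _) s0 s2 => s s0 s2.
  have k1 : kappa != 0 by rewrite gt_eqF.
  have s1 : s != 0 by rewrite gt_eqF.
  have rs : `|r / s| < 1.
    rewrite normrM normfV (gtr0_norm s0) ltr_pdivrMr // mul1r.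
    have : `|r| ^+ 2 < s ^+ 2 by rewrite real_normK ?num_real // s2; lra.
    by rewrite ltr_pXn2r ?nnegrE // ltW.
  have kE : kappa * ((1 + r / s) / kappa) - 1 = r / s by field; rewrite k1 s1.
  split.
    move: rs; rewrite ltr_norml => /andP[h1 h2]; split.
      by rewrite divr_gt0 //; lra.
    by move: kE; lra.
  rewrite kE.
  have -> : 1 - (r / s) ^+ 2 = (s^-1) ^+ 2.
    apply: (mulfI (expf_neq0 2 s1)).
    have -> : s ^+ 2 * (1 - (r / s) ^+ 2) = s ^+ 2 - r ^+ 2 by field.
    have -> : s ^+ 2 * s^-1 ^+ 2 = 1 by field.
    by rewrite s2; ring.
  by rewrite sqrtr_sqr gtr0_norm ?invr_gt0 // invrK mulfVK.
Qed.

Lemma lt_T_max (kappa t : R) : (t%:E < T_max kappa)%E <->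
  (0 < kappa -> t < pi / Num.sqrt kappa).
Proof.
rewrite /T_max; case: ifP => k0.
  by rewrite lte_fin; split => [//|]; exact.
by split => // _; rewrite ltry.
Qed.

End HeightCoordinate.

Section Foliation.
Context {R : realType} {d m : nat} {kappa : R}.
Variable Mo : light_cone_model d m kappa.
Local Notation M := (lcM Mo).
Local Notation g := (lcg Mo).
Local Notation K := (lcK Mo).
Local Notation Phi := (lcPhi Mo).
Local Notation dPhi := (lcdPhi Mo).
Local Notation Pi := (lcPi Mo).
Local Notation b := (bf (lcJ Mo)).
Variables (A : 'rV[R]_m) (eta : R).
Hypotheses (hAA : b A A = 1) (hAK : b A K = eta) (eta0 : 0 < eta).
Local Notation N := (slice Mo A).
Local Notation k := (@slice_curv R kappa eta).
Local Notation KA := (slice_K Mo A eta).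

Let hAA' : eta * b A A = eta. Proof. by rewrite hAA mulr1. Qed.
Let h00 : (0 : R) * b 0 0 = 0. Proof. exact: mul0r. Qed.
Let h0K : b 0 K = 0. Proof. exact: bf0l. Qed.

Lemma slice_curv0 : @slice_curv R kappa 0 = kappa.
Proof. by rewrite /slice_curv expr0n addr0. Qed.

Lemma slice_K0 : slice_K Mo 0 0 = K.
Proof. by rewrite slice_KE scaler0 subr0. Qed.

Lemma slice0 x : M x -> slice Mo 0 x.
Proof. by move=> Mx; split => //; rewrite bf0r. Qed.

(** Dividing by eta = <K, A> makes the height of a point on a ray equal to the versine of its time
    parameter. *)
Definition height x : R := b (Phi x) A / eta.
Definition zone : set 'rV[R]_d := [set x | M x /\ ht_dom kappa (height x)].

Lemma bA_height x : b (Phi x) A = eta * height x.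
Proof. by rewrite /height mulrCA divff ?mulr1 // gt_eqF. Qed.

Lemma unit_tangent0 p V : unit_tangent Mo A p V -> unit_tangent Mo 0 p V.
Proof. by case=> h1 h2 _ h4; split => //; rewrite bf0l. Qed.

(** A ray parametrized by height instead of time; the positive square root is the sine, which is
    positive for times in (0, T_kappa). *)
Definition rayW p (V : 'rV[R]_m) (e : R) : 'rV[R]_m :=
  (1 - kappa * e) *: Phi p + Num.sqrt (2 * e - kappa * e ^+ 2) *: V + e *: K.
Definition rayE p V e : 'rV[R]_d := Pi (rayW p V e).

Lemma rayEP p V e : N p -> unit_tangent Mo A p V -> ht_dom kappa e ->
  [/\ M (rayE p V e), Phi (rayE p V e) = rayW p V e & height (rayE p V e) = e].
Proof.
move=> Np uV he; have [Mp pA] := Np; have h0 := ht_dom_gt0 he.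
have [[Me _] Ee] : slice Mo 0 (rayE p V e) /\ Phi (rayE p V e) = rayW p V e.
  have := slice_pointE h00 h0K (slice0 Mp) (unit_tangent0 uV).
  rewrite /slice_point slice_K0 slice_curv0; apply => //; last by case: he => /ltW.
  by rewrite sqr_sqrtr // ltW.
split => //; rewrite /height Ee /rayW !bfDl !bfZl pA.
have [_ _ VA _] := uV; rewrite (lc_bfC Mo V) VA (lc_bfC Mo K) hAK.
by field; rewrite gt_eqF.
Qed.

Definition model_rays (v : 'rV[R]_d -> 'rV[R]_d) : set (set 'rV[R]_d) :=
  [set L | exists p gamma, [/\ N p, geodesic_from g M (v p) p gamma &
     L = gamma @` [set t | 0 < t /\ (t%:E < T_max kappa)%E]]].

Lemma ray_geodesic p V : N p -> unit_tangent Mo A p V ->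
  geoE Mo 0 0 p V @` [set t | 0 < t /\ (t%:E < T_max kappa)%E] =
  rayE p V @` ht_dom kappa.
Proof.
move=> Np uV; have k0 := slice_curv0.
apply/seteqP; split => x [].
  move=> t [t0 /lt_T_max tT] <-; exists (versk kappa t).
    have s0 := sink_gt0 t0 tT; have e0 := versk_ge0 kappa t.
    have : 0 < sink kappa t ^+ 2 by rewrite exprn_gt0.
    rewrite sink_versk.
    have -> : 2 * versk kappa t - kappa * versk kappa t ^+ 2 =
      versk kappa t * (2 - kappa * versk kappa t) by ring.
    move=> h; have e1 : 0 < versk kappa t.
      rewrite lt_neqAle e0 andbT eq_sym; apply/eqP => E; move: h.
      by rewrite E mul0r ltxx.
    by move: h; rewrite pmulr_rgt0 // subr_gt0.
  rewrite /rayE /geoE /rayW /geo /slice_point slice_K0 k0 -cosk_versk -sink_versk.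
  by rewrite sqrtr_sqr gtr0_norm // sink_gt0.
move=> e he <-; have h0 := ht_dom_gt0 he.
have s0 : 0 < Num.sqrt (2 * e - kappa * e ^+ 2) by rewrite sqrtr_gt0.
have s2 : Num.sqrt (2 * e - kappa * e ^+ 2) ^+ 2 = 2 * e - kappa * e ^+ 2.
  by rewrite sqr_sqrtr // ltW.
have hc : (1 - kappa * e) ^+ 2 + kappa * Num.sqrt (2 * e - kappa * e ^+ 2) ^+ 2 = 1.
  by rewrite s2; ring.
have [|t [tc ts /(_ s0)[t0 tT]]] := cosk_sink_surj hc.
  by move=> k1; have : kappa * e <= 0; [case: he => /ltW e0 _; exact: mulr_le0_ge0|lra].
exists t; first by split => //; exact/lt_T_max.
rewrite /rayE /geoE /rayW /geo /slice_point slice_K0 k0 tc ts.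
congr (Pi (_ + _ *: _)).
rewrite -[kappa]k0 in tc ts s2 |- *.
exact: (versk_unique tc ts erefl s2).
Qed.

Lemma model_raysE v L : unit_vector_field g N v ->
  model_rays v L <-> exists2 p, N p & L = rayE p (dPhi p (v p)) @` ht_dom kappa.
Proof.
move=> uv; split.
  move=> [p [gam [Np [gg g0 g1] ->]]]; exists p => //.
  have uV := field_unit uv Np; have [Mp _] := Np.
  rewrite -ray_geodesic //; congr (_ @` _); apply/funext => t.
  have gg' : geodesic g (slice Mo 0) setT gam by rewrite ambient_slice.
  have u1 : b (dPhi p (derive1 gam 0)) (dPhi p (derive1 gam 0)) = 1.
    by rewrite g1; case: uV.
  have [_ _ _ /(_ t I)[Mt _]] := gg'.1.
  rewrite -[LHS](lcPi_Phi Mt) (geodesic_unique h00 h0K gg' I g0 u1) //.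
  by rewrite g1.
move=> [p Np ->]; have uV := field_unit uv Np; have [Mp _] := Np.
have N0p := slice0 Mp; have u0 := unit_tangent0 uV.
exists p, (geoE Mo 0 0 p (dPhi p (v p))); split => //; last by rewrite ray_geodesic.
split; first by rewrite -(ambient_slice Mo); exact: geoE_geodesic.
  exact: geoE0.
apply: (dPhi_injective Mp).
by have := dPhi_geoE h00 h0K 0 N0p u0; rewrite geoE0 // dgeo0.
Qed.

Definition slice_S e : R := Num.sqrt (2 * e - kappa * e ^+ 2).
(** On a ray Phi x - e K = C Phi p + S V. To be the first two terms of a point of N this must be
    scaled so that c^2 + k s^2 = 1; as C^2 + kappa S^2 = 1, the factor is given by C^2 + k S^2 = 1 +
    eta^2 S^2. *)
Definition slice_sig e : R := Num.sqrt (1 + eta ^+ 2 * (2 * e - kappa * e ^+ 2)).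
Definition slice_c e : R := (1 - kappa * e) / slice_sig e.
Definition slice_s e : R := slice_S e / slice_sig e.
Definition slice_e e : R := slice_s e ^+ 2 / (1 + slice_c e).
Definition slice_projW x : 'rV[R]_m :=
  (slice_sig (height x))^-1 *: (Phi x - height x *: K) + slice_e (height x) *: KA.

Lemma slice_params e : ht_dom kappa e ->
  [/\ 0 < slice_S e, 1 < slice_sig e, 0 < slice_s e, -1 < slice_c e &
   [/\ slice_S e ^+ 2 = 2 * e - kappa * e ^+ 2,
     slice_sig e ^+ 2 = 1 + eta ^+ 2 * slice_S e ^+ 2,
     slice_c e ^+ 2 + k * slice_s e ^+ 2 = 1,
     slice_c e = 1 - k * slice_e e &
     slice_s e ^+ 2 = 2 * slice_e e - k * slice_e e ^+ 2]].
Proof.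
move=> he; have h0 := ht_dom_gt0 he; have [e0 e2] := he.
have S0 : 0 < slice_S e by rewrite sqrtr_gt0.
have S2 : slice_S e ^+ 2 = 2 * e - kappa * e ^+ 2 by rewrite sqr_sqrtr // ltW.
have hS : 0 < eta ^+ 2 * slice_S e ^+ 2 by rewrite mulr_gt0 // exprn_gt0.
have g2 : slice_sig e ^+ 2 = 1 + eta ^+ 2 * slice_S e ^+ 2.
  by rewrite sqr_sqrtr -?S2 //; lra.
have g0 : 0 <= slice_sig e by exact: sqrtr_ge0.
have g1 : 1 < slice_sig e by nra.
have s0 : 0 < slice_s e by rewrite divr_gt0 //; lra.
have gn : slice_sig e != 0 by rewrite gt_eqF //; lra.
have c1 : -1 < slice_c e.
  rewrite /slice_c ltr_pdivlMr; last lra.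
  lra.
have cs : slice_c e ^+ 2 + k * slice_s e ^+ 2 = 1.
  have -> : slice_c e ^+ 2 + k * slice_s e ^+ 2 =
    ((1 - kappa * e) ^+ 2 + k * slice_S e ^+ 2) / slice_sig e ^+ 2.
    by rewrite /slice_c /slice_s; field.
  have -> : (1 - kappa * e) ^+ 2 + k * slice_S e ^+ 2 = slice_sig e ^+ 2.
    rewrite g2 /slice_curv mulrDl; have -> : kappa * slice_S e ^+ 2 = 1 - (1 - kappa * e) ^+ 2.
      by rewrite S2; ring.
    by ring.
  by rewrite divff // expf_neq0.
have cn : 1 + slice_c e != 0 by rewrite gt_eqF //; lra.
have ce : slice_c e = 1 - k * slice_e e.
  have -> : k * slice_e e = (1 - slice_c e ^+ 2) / (1 + slice_c e).
    by rewrite /slice_e mulrA; congr (_ / _); rewrite -cs; ring.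
  by field.
split => //; split => //.
have -> : 2 * slice_e e - k * slice_e e ^+ 2 = slice_e e * (1 + (1 - k * slice_e e)).
  by ring.
by rewrite -ce /slice_e mulfVK.
Qed.

(** The projection is checked directly to be null, to have pairings -1 with [K] and 0 with [A], and
    to lie on the right sheet; no ray through [x] is presupposed. *)
Lemma slice_projP x : zone x ->
  N (Pi (slice_projW x)) /\ Phi (Pi (slice_projW x)) = slice_projW x.
Proof.
move=> [Mx he]; have [S0 g1 s0 c1 [S2 g2 cs ce se]] := slice_params he.
have xA := bA_height x.
have F1 : b KA (Phi x) = -1 - eta ^+ 2 * height x.
  by rewrite slice_KE !bfL (lc_bfC Mo K) (lc_bfC Mo A) lcPhiK // xA; ring.
have F2 := b_KAKA hAA' hAK; have F3 := b_KKA hAK; have F4 := b_AKA hAA' hAK.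
have XX := lcPhiPhi Mx; have XK := lcPhiK Mx; have KK := lcKK Mo.
have [W WE] : {W | W = slice_projW x} by eexists.
rewrite -WE; move: WE; rewrite /slice_projW.
have [e0 e2] := he.
have cE : slice_c (height x) * slice_sig (height x) = 1 - kappa * height x.
  by rewrite mulfVK // gt_eqF //; lra.
have sE : slice_s (height x) * slice_sig (height x) = slice_S (height x).
  by rewrite mulfVK // gt_eqF //; lra.
have eE : slice_e (height x) * (1 + slice_c (height x)) = slice_s (height x) ^+ 2.
  by rewrite mulfVK // gt_eqF //; lra.
have eta2 : 0 < eta ^+ 2 by rewrite exprn_gt0.
move: (height x) (slice_sig (height x)) (slice_c _) (slice_s _) (slice_S _) (slice_e _)
  xA F1 e0 e2 S0 g1 s0 c1 S2 g2 cs ce se cE sE eE =>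
  e sg c s S ee xA F1 e0 e2 S0 g1 s0 c1 S2 g2 cs ce se cE sE eE WE.
have sg0 : 0 < sg by lra.
have sgn : sg != 0 by rewrite gt_eqF.
(* After clearing denominators the sign condition becomes [sg <= sg ^+ 2], which follows from
   [1 < sg]. *)
have WX : b W (Phi x) <= 0.
  rewrite WE !bfL XX (lc_bfC Mo K) XK F1.
  have -> : sg^-1 * (0 - e * -1) + ee * (-1 - eta ^+ 2 * e) =
    (e - sg * ee * (1 + eta ^+ 2 * e)) / sg by field.
  rewrite mulr_le0_ge0 ?invr_ge0 ?(ltW sg0) // subr_le0.
  have gc : 0 < sg * (1 + c) by rewrite mulr_gt0 //; lra.
  rewrite -(ler_pM2r gc).
  have -> : sg * ee * (1 + eta ^+ 2 * e) * (sg * (1 + c)) =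
    (s * sg) ^+ 2 * (1 + eta ^+ 2 * e) by rewrite exprMn -eE; ring.
  rewrite sE S2; have -> : sg * (1 + c) = sg + (1 - kappa * e) by rewrite -cE; ring.
  have -> : (2 * e - kappa * e ^+ 2) * (1 + eta ^+ 2 * e) =
    e * ((1 - kappa * e) + (1 + eta ^+ 2 * (2 * e - kappa * e ^+ 2))) by ring.
  rewrite -S2 -g2 ler_pM2l // addrC lerD2l; nra.
have WK : b W K = -1.
  rewrite WE !bfL XK KK (lc_bfC Mo KA) F3.
  have -> : sg^-1 * (-1 - e * - kappa) = - ((1 - kappa * e) / sg) by field.
  rewrite -cE mulfK // ce; ring.
have WW : b W W = 0.
  rewrite WE !bfL XX XK KK (lc_bfC Mo K (Phi x)) XK (lc_bfC Mo (Phi x) KA) F1 F2 F3.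
  rewrite (lc_bfC Mo KA K) F3.
  transitivity ((2 * e - kappa * e ^+ 2) / sg ^+ 2 + 2 * ee * (- ((1 - kappa * e) / sg)) - k * ee ^+ 2).
    by rewrite /slice_curv; field.
  rewrite -S2 -cE -sE mulfK // exprMn mulfK ?expf_neq0 // se ce; ring.
have [MW EW] := lcPhi_Pi Mx WW WK WX.
split => //; split => //; rewrite EW WE !bfL xA (lc_bfC Mo K A) hAK (lc_bfC Mo KA) F4.
by ring.
Qed.

(** Subtract the term in [K], divide by [slice_sig] and add the term in [KA]: each of these steps is
    reversible. *)
Lemma ray_proj x p V : zone x -> N p -> unit_tangent Mo A p V ->
  Phi x = rayW p V (height x) <->
  slice_c (height x) *: Phi p + slice_s (height x) *: V + slice_e (height x) *: KA
    = slice_projW x.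
Proof.
move=> [Mx he] Np uV; have [S0 g1 s0 c1 _] := slice_params he.
have gn : slice_sig (height x) != 0 by rewrite gt_eqF //; lra.
rewrite /slice_projW; split => [E|].
  congr (_ + _); rewrite [X in X - _]E /rayW addrK scalerDr !scalerA.
  by rewrite /slice_c /slice_s !(mulrC (slice_sig _)^-1).
move/addIr => /(congr1 (fun Y => slice_sig (height x) *: Y)).
rewrite [RHS]scalerA divff // scale1r scalerDr !scalerA.
rewrite ![slice_sig _ * _]mulrC /slice_c /slice_s !mulfVK // => E.
by rewrite /rayW E subrK.
Qed.

End Foliation.

Section FoliationTheorem.
Context {R : realType} {d m : nat} {kappa : R}.
Variable Mo : light_cone_model d m kappa.
Local Notation M := (lcM Mo).
Local Notation g := (lcg Mo).
Local Notation K := (lcK Mo).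
Local Notation Phi := (lcPhi Mo).
Local Notation dPhi := (lcdPhi Mo).
Local Notation Pi := (lcPi Mo).
Local Notation b := (bf (lcJ Mo)).
Variables (A : 'rV[R]_m) (eta : R).
Hypotheses (hAA : b A A = 1) (hAK : b A K = eta) (eta0 : 0 < eta).
Local Notation N := (slice Mo A).
Local Notation k := (@slice_curv R kappa eta).
Local Notation KA := (slice_K Mo A eta).
Local Notation height := (height Mo A eta).
Local Notation zone := (zone Mo A eta).
Local Notation projW := (slice_projW Mo A eta).
Local Notation sc := (@slice_c R kappa eta).
Local Notation ss := (@slice_s R kappa eta).
Local Notation se := (@slice_e R kappa eta).
Local Notation rayE := (rayE Mo).

Lemma smooth_height (S : set 'rV[R]_d) : S `<=` M -> smooth_on S height.
Proof.
move=> SM; apply: smooth_on_mul; last exact: smooth_on_cst.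
apply: smooth_on_bf; last exact: smooth_on_cst.
exact: smooth_on_sub SM (lc_smoothPhi (l := Mo)).
Qed.

Lemma open_ht_dom : open (ht_dom kappa).
Proof.
rewrite (_ : ht_dom kappa = [set e : R | 0 < e] `&` (fun e => kappa * e) @^-1` [set e | e < 2]); last first.
  by apply/seteqP; split => e [].
apply: openI; first exact: open_gt0.
apply: open_comp; last exact: open_lt.
move=> e _; apply: cvgM; [exact: cvg_cst|exact: cvg_id].
Qed.

Lemma zone_sub : zone `<=` M. Proof. by move=> x []. Qed.

Lemma zone_open : exists2 O, open O & zone = M `&` O.
Proof.
have MO : exists2 O, open O & M = M `&` O by exists setT; [exact: openT|rewrite setIT].
have := relatively_open_preimage MO (smooth_height (@subset_refl _ M)) open_ht_dom.
by [].
Qed.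

Variables (v : 'rV[R]_d -> 'rV[R]_d) (q : 'rV[R]_d -> 'rV[R]_d) (n : nat).
Hypotheses (uv : unit_vector_field g N v) (mn : m = (3 + n)%N).
Local Notation VF x := (dPhi x (v x)).
Hypothesis smooth_q : smooth_on zone q.
Hypothesis qN : forall x, zone x -> N (q x).
Hypothesis qP : forall x p, zone x -> N p ->
  sc (height x) *: Phi p + ss (height x) *: VF p + se (height x) *: KA = projW x
  <-> p = q x.
Local Notation ray p := (rayE p (VF p)).

Lemma ray_zone p e : N p -> ht_dom kappa e ->
  [/\ zone (ray p e), height (ray p e) = e & q (ray p e) = p].
Proof.
move=> Np he; have uV := field_unit uv Np.
have [Mr Er hr] := rayEP hAK eta0 Np uV he.
have zr : zone (ray p e) by split => //; rewrite hr.
split => //; apply/esym/(qP zr Np)/(ray_proj eta0 zr Np uV).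
by rewrite hr Er.
Qed.

Lemma zone_ray x : zone x -> x = ray (q x) (height x).
Proof.
move=> zx; have Nq := qN zx; have uV := field_unit uv Nq.
rewrite -[LHS](lcPi_Phi (zone_sub zx)); congr Pi.
exact/(ray_proj eta0 zx Nq uV)/(qP zx Nq).
Qed.

Lemma smooth_ray (V : normedModType R) (S : set V) f h : smooth_on S f ->
  smooth_on S h -> (forall x, S x -> N (f x)) -> (forall x, S x -> ht_dom kappa (h x)) ->
  smooth_on S (fun x => ray (f x) (h x)).
Proof.
move=> sf sh SN Sh.
apply: (smooth_on_comp (B := Phi @` M) _ (lc_smoothPi (l := Mo))); last first.
  move=> x Sx; have uV := field_unit uv (SN x Sx).
  have [Mr Er _] := rayEP hAK eta0 (SN x Sx) uV (Sh x Sx).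
  by exists (ray (f x) (h x)).
have skh : smooth_on S (fun x => kappa * h x).
  by apply: smooth_on_mul => //; exact: smooth_on_cst.
apply: smooth_on_add; last by apply: smooth_on_scale => //; exact: smooth_on_cst.
apply: smooth_on_add; apply: smooth_on_scale.
- by apply: smooth_on_add; [exact: smooth_on_cst|exact: smooth_on_opp].
- by apply: (smooth_on_comp sf (lc_smoothPhi (l := Mo))) => x /SN[].
- apply: smooth_on_sqrt => [|x /Sh]; last exact: ht_dom_gt0.
  apply: smooth_on_add; first by apply: smooth_on_mul => //; exact: smooth_on_cst.
  apply: smooth_on_opp; apply: smooth_on_mul; first exact: smooth_on_cst.
  exact: smooth_on_exp.
- exact: (smooth_field uv).
Qed.

Lemma ray_connected p : N p -> connected (ray p @` ht_dom kappa).
Proof.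
move=> Np; apply: connected_continuous_connected.
  apply/connected_intervalP => x y [x0 x2] [y0 y2] z /andP[xz zy].
  split; first exact: lt_le_trans x0 xz.
  have [k0|k0] := leP kappa 0.
    by apply: le_lt_trans x2; rewrite ler_wnM2l.
  by apply: le_lt_trans y2; rewrite ler_pM2l.
apply: smooth_on_continuous; apply: smooth_ray => //; first exact: smooth_on_cst.
exact: smooth_on_id.
Qed.

(** [q] labels the rays and [height] is a coordinate along each of them, so a foliation chart
    consists of [chi] of the height and of a chart of N composed with [q]. *)
Theorem ray_foliation : smooth_line_foliation n M zone (model_rays Mo A v).
Proof.
have LE L := model_raysE L uv.
have Lq L y : model_rays Mo A v L -> L y ->
    zone y /\ L = ray (q y) @` ht_dom kappa.
  by move=> /LE[p Np ->] [e he <-]; have [zr hr qr] := ray_zone Np he; rewrite qr.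
split; first exact: zone_open.
- split.
  + apply/seteqP; split => [x [L FL Lx]|x zx]; first by have [] := Lq L x FL Lx.
    exists (ray (q x) @` ht_dom kappa).
      by apply/LE; exists (q x) => //; exact: qN.
    by exists (height x); [case: zx|rewrite -zone_ray].
  + apply/trivIsetP => L1 L2 F1 F2 /eqP ne; rewrite /idfun.
    apply/seteqP; split => // y [L1y L2y]; apply: ne.
    by have [_ ->] := Lq L1 y F1 L1y; have [_ ->] := Lq L2 y F2 L2y.
  + move=> L /LE[p Np ->]; have [e he] : exists e, ht_dom kappa e.
      have [chi0 [chi' [_ _ _ H]]] := ht_dom_line kappa; exists (chi' 0).
      by have [] := H 0.
    by exists (ray p e); exists e.
- by move=> L /LE[p Np ->]; exact: ray_connected.
move=> x0 zx0; set p0 := q x0; have Np0 : N p0 by exact: qN.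
have [f [of_ fs]] := orthonormal_frame hAA hAK Np0 mn.
have [chi [chi' [schi schi' chiK chi'K]]] := ht_dom_line kappa.
pose V := [set y | zone y /\ [set r : R | 0 < r] (1 - k * slice_ht Mo p0 (q y))].
pose phi (y : 'rV[R]_d) : 'rV[R]_(1 + n) :=
  row_mx (const_mx (chi (height y))) (chart_map Mo eta p0 f (q y)).
have Vdom y : V y -> chart_dom Mo A eta p0 (q y).
  by move=> [zy h]; split => //; exact: qN.
pose r0 (y : 'rV[R]_(1 + n)) : R := lsubmx y ord0 ord0.
pose psi (y : 'rV[R]_(1 + n)) : 'rV[R]_d :=
  ray (chart_invE Mo A eta p0 f (rsubmx y)) (chi' (r0 y)).
have Ninv z : N (chart_invE Mo A eta p0 f z) by have [] := chart_invP hAA hAK Np0 of_ z.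
have psiP y : [/\ zone (psi y), height (psi y) = chi' (r0 y) &
    q (psi y) = chart_invE Mo A eta p0 f (rsubmx y)].
  by apply: ray_zone => //; have [] := chi'K (r0 y).
have Vx0 : V x0.
  have [] : chart_dom Mo A eta p0 p0 by exact: chart_dom_center.
  by [].
have scm : smooth_on (chart_dom Mo A eta p0) (chart_map Mo eta p0 f) by exact: smooth_chart_map.
have sci : smooth_on setT (chart_invE Mo A eta p0 f) by exact: smooth_chart_invE.
exists V, phi; split => //; [split; [|split]| |].
- apply: relatively_open_preimage zone_open _ open_gt0.
  apply: smooth_on_add; first exact: smooth_on_cst.
  apply: smooth_on_opp; apply: smooth_on_mul; first exact: smooth_on_cst.
  apply: (smooth_on_comp_rVR smooth_q (smooth_slice_ht p0 (@slice_sub _ _ _ _ Mo A))).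
  exact: qN.
- suff sphi : @smooth_on R _ 'rV[R]_(1 + n) V phi by exact: sphi.
  apply: smooth_on_row_mx.
    apply: smooth_on_row => i.
    apply: (@smooth_on_ext _ _ _ _ (fun y => chi (height y))).
      by move=> y _; rewrite mxE.
    apply: (smooth_on_comp_R (smooth_height _) schi); first by move=> y [[]].
    by move=> y [[]].
  apply: (smooth_on_comp (B := chart_dom Mo A eta p0) _ scm) => //.
  by apply: smooth_on_sub smooth_q => y [].
- exists psi; split.
  + apply: (smooth_on_open openT); apply: smooth_ray => //.
    * apply: (smooth_on_comp (B := setT) _ sci) => //.
      apply: smooth_on_row => i; apply: (@smooth_on_ext _ _ _ _ (fun y : 'rV[R]_(1 + n) => y ord0 (rshift 1 i))).
        by move=> y _; rewrite mxE.
      exact: (smooth_on_coord _ (@smooth_on_id R 'rV[R]_(1 + n) setT)).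
    * apply: (smooth_on_comp_R (B := setT) _ schi') => //.
      apply: (@smooth_on_ext _ _ _ _ (fun y : 'rV[R]_(1 + n) => y ord0 (lshift n ord0))).
        by move=> y _; rewrite /r0 mxE.
      exact: (smooth_on_coord _ (@smooth_on_id R 'rV[R]_(1 + n) setT)).
    * by move=> y _; have [] := chi'K (r0 y).
  + move=> y; have [zy hy qy] := psiP y; split => //=; rewrite qy.
    by have [] := chart_inv_dom hAA hAK Np0 of_ (rsubmx (y : 'rV[R]_(1 + n))).
  + move=> y; have [zy hy qy] := psiP y; rewrite /phi hy qy.
    have [_ ->] := chi'K (r0 y); rewrite (chart_invK hAA hAK Np0 of_).
    have -> : const_mx (r0 y) = lsubmx (y : 'rV[R]_(1 + n)).
      by apply/rowP => i; rewrite (ord1 i) mxE.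
    exact: (@hsubmxK R 1 1 n y).
  + move=> y Vy; have zy : zone y by case: Vy.
    rewrite /psi /phi row_mxKr /r0 row_mxKl mxE chiK; last by case: zy.
    by rewrite (chart_mapKE hAA hAK Np0 of_ fs (Vdom _ Vy)) -zone_ray.
- by move=> y [].
move=> L y FL [Vy Ly]; have [zy LE'] := Lq L y FL Ly.
(* The chart domain restricts only the value of [q], so it is a union of leaves; the trace of a leaf
   is therefore the whole leaf, which is connected. *)
have LV : L `<=` V.
  rewrite LE' => _ [e he <-]; have [zr hr qr] := ray_zone (qN zy) he.
  by split => //; rewrite qr; case: Vy.
have -> : V `&` L = L by apply/seteqP; split => [x []//|x Lx]; split => //; exact: LV.
have -> : connected_component L y = L.
  apply/seteqP; split; first exact: connected_component_sub.
  apply: connected_component_max => //.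
  by rewrite LE'; apply: ray_connected; exact: qN.
have phiE z (i : 'I_n) : phi z ord0 (rshift 1 i) = chart_map Mo eta p0 f (q z) ord0 i.
  by rewrite /phi row_mxEr.
apply/seteqP; split => [z Lz|z [Vz zE]].
  split; first exact: LV.
  have qE : q z = q y.
    by move: Lz; rewrite LE' => -[e he <-]; have [] := ray_zone (qN zy) he.
  move=> j; case: (@split_ordP 1 n j) => i -> ne; last by rewrite !phiE qE.
  by move: ne; rewrite (ord1 i) => /eqP[]; exact/val_inj.
have cE : chart_map Mo eta p0 f (q z) = chart_map Mo eta p0 f (q y).
  by apply/rowP => i; rewrite -!phiE; apply: zE.
have qE : q z = q y.
  rewrite -(chart_mapKE hAA hAK Np0 of_ fs (Vdom _ Vz)) cE.
  exact: (chart_mapKE hAA hAK Np0 of_ fs (Vdom _ Vy)).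
have zz : zone z by case: Vz.
rewrite LE' -qE (zone_ray zz) (_ : q (ray _ _) = q z); last by rewrite -zone_ray.
by exists (height z) => //; case: zz.
Qed.

End FoliationTheorem.

(** * The exterior *)

Section Exterior.
Context {R : realType} {d m : nat} {kappa : R}.
Variable Mo : light_cone_model d m kappa.
Local Notation M := (lcM Mo).
Local Notation g := (lcg Mo).
Local Notation K := (lcK Mo).
Local Notation Phi := (lcPhi Mo).
Local Notation dPhi := (lcdPhi Mo).
Local Notation Pi := (lcPi Mo).
Local Notation sec := (lcsec Mo).
Local Notation b := (bf (lcJ Mo)).
Variables (A : 'rV[R]_m) (eta : R).
Hypotheses (hAA : b A A = 1) (hAK : b A K = eta) (eta0 : 0 < eta).
Local Notation N := (slice Mo A).
Local Notation height := (height Mo A eta).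
Local Notation zone := (zone Mo A eta).

Let h00 : (0 : R) * b 0 0 = 0. Proof. exact: mul0r. Qed.
Let h0K : b 0 K = 0. Proof. exact: bf0l. Qed.

Lemma orth_tangent_ambient p Z : M p -> b (Phi p) Z = 0 -> b K Z = 0 ->
  tangent_space M p (sec p Z).
Proof.
move=> Mp PZ KZ; rewrite -{1}(ambient_slice Mo).
by apply: (orth_tangent h00 h0K (slice0 Mp)) => //; rewrite bf0l.
Qed.

Lemma tangent_ambient_orth p w : M p -> tangent_space M p w ->
  b (Phi p) (dPhi p w) = 0 /\ b K (dPhi p w) = 0.
Proof.
rewrite -{2}(ambient_slice Mo) => Mp tw.
by have [h1 h2 _] := tangent_orth (slice0 Mp) tw.
Qed.

(** The test vector A + eta Phi p is tangent to M and normal to N. By [slice_curve_orth] the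
    acceleration of a curve of N with unit velocity pairs with it to - eta. *)
Lemma second_fundamental_normal p u w : N p -> inner g p u u = 1 ->
  second_fundamental g M N p u w -> b (dPhi p w) A = - eta.
Proof.
move=> Np u1 [[tw nw] [I [c [[sc I0 c0 cu] H]]]]; have [Mp pA] := Np.
have [wP wK] := tangent_ambient_orth Mp tw.
pose Z := A + eta *: Phi p.
have ZP : b (Phi p) Z = 0 by rewrite /Z !bfL pA lcPhiPhi //; ring.
have ZK : b K Z = 0 by rewrite /Z !bfL !(lc_bfC Mo K) hAK lcPhiK //; ring.
have secE : dPhi p (sec p Z) = Z by rewrite lcdPhi_sec // lc_bfC.
have scM : smooth_curve M I c.
  by have [a1 a2 a3 a4] := sc; split => // s /a4[].
have tz : tangent_space M p (sec p Z) by exact: orth_tangent_ambient.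
have nz y : tangent_space N p y -> inner g p (sec p Z) y = 0.
  move=> /(tangent_orth Np)[h1 h2 h3].
  by rewrite lc_inner // secE /Z !bfL h1 h3; ring.
have := H _ (conj tz nz).
rewrite -c0 -(lc_acceleration _ scM) // c0 secE lc_inner // secE.
have [_ _ _ [+ _ +]] := slice_curve_orth sc I0.
rewrite c0 cu -lc_inner // u1 => q1 q3.
by rewrite /Z !bfL (lc_bfC Mo _ A) q3 (lc_bfC Mo _ (Phi p)) q1 (lc_bfC Mo _ (Phi p)) wP; lra.
Qed.

(** Consequently the opposite of the mean curvature vector points to the side where <Phi x, A> is
    positive, which is the side of the zone. *)
Lemma mean_curvature_normal n p H : (0 < n)%N -> N p ->
  mean_curvature_vector g n M N p H -> b (dPhi p H) A = - eta.
Proof.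
move=> n0 Np [e [w [te oe sw ->]]].
have wA i : b (dPhi p (w i)) A = - eta.
  by apply: (second_fundamental_normal Np _ (sw i)); rewrite oe eqxx.
have sumE (j : nat) (F : 'I_j -> 'rV[R]_d) : dPhi p (\sum_i F i) = \sum_i dPhi p (F i).
  elim: j F => [|j IH] F; first by rewrite !big_ord0 dPhi0.
  by rewrite !big_ord_recl -[X in dPhi p (X + _)]scale1r lcdPhi_linear scale1r IH.
rewrite dPhiZ bfZl sumE bf_suml (eq_bigr (fun=> - eta)) //.
rewrite sumr_const card_ord -[- eta *+ n]mulr_natl mulKf //.
by rewrite pnatr_eq0 -lt0n.
Qed.

Lemma points_into_positive p C w : N p -> 0 < b (dPhi p w) A ->
  points_into M C p w -> exists x, C x /\ 0 < b (Phi x) A.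
Proof.
move=> [Mp pA] w0 [I [c [[sc I0 c0 cw] Cc]]].
have D := derive_Phi_curve (@subset_refl _ M) sc I0; rewrite c0 cw in D.
have D1 : is_derive (0 : R) 1 (fun s => b (Phi (c s)) A) (b (dPhi p w) A).
  by apply: is_derive_eq (isd_bf (lcJ Mo) D (isd_cst A _ _)) _; rewrite bf0r addr0.
have [dv1 dv2] := D1; have [oI _ _ _] := sc.
have cv : (fun h : R => h^-1 *: (b (Phi (c (h *: 1 + 0))) A - b (Phi (c 0)) A)) @ 0^' -->
    b (dPhi p w) A by rewrite -dv2; exact: dv1.
have near1 : \forall h \near (0 : R)^', 0 < h^-1 *: (b (Phi (c (h *: 1 + 0))) A - b (Phi (c 0)) A).
  exact: (@cvgr_gt _ _ _ _ _ _ cv _ w0).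
have near2 : \forall h \near (0 : R)^', I h.
  by apply: cvg_within; exact: (open_near oI I0).
have : \forall h \near (0 : R)^'+, 0 < h^-1 *: (b (Phi (c (h *: 1 + 0))) A - b (Phi (c 0)) A) /\ I h.
  have near3 : nbhs (0 : R) [set h | h != 0 ->
      0 < h^-1 *: (b (Phi (c (h *: 1 + 0))) A - b (Phi (c 0)) A) /\ I h].
    exact: filterI near1 near2.
  have : nbhs (0 : R) [set h | 0 < h ->
      0 < h^-1 *: (b (Phi (c (h *: 1 + 0))) A - b (Phi (c 0)) A) /\ I h].
    by apply: filterS near3 => h /= hh h0; apply: hh; rewrite gt_eqF.
  by [].
move=> /(filterI (@nbhs_right_gt R 0)) /filter_ex[h [h0 [h1 Ih]]].
exists (c h); split; first exact: Cc.
move: h1; rewrite c0 pA subr0 addr0 [h *: 1]mulr1 [_ *: _]/(_ * _).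
by rewrite pmulr_rgt0 // invr_gt0.
Qed.

Lemma connected_avoid (S : set 'rV[R]_d) (f : 'rV[R]_d -> R) (a : R) x y :
  connected S -> {within S, continuous f} -> (forall z, S z -> f z != a) ->
  S x -> S y -> f x < a -> f y < a.
Proof.
move=> cS cf fa Sx Sy fx; rewrite ltNge; apply/negP => fy.
have /connected_intervalP cI : connected (f @` S) by exact: connected_continuous_connected.
have [z Sz /eqP] : (f @` S) a.
  by apply: (cI (f x) (f y)); [exists x|exists y|rewrite (ltW fx)].
by apply/negP; exact: fa.
Qed.

(** The height does not vanish on the connected set C and is positive somewhere, so it is positive
    on C. If kappa > 0, a point of U near N lies below the level kappa * height = 2, and U, being
    connected and disjoint from that level, stays below it. The reverse inclusions are the
    maximality of components, as the zone is connected. *)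
Lemma exterior_zone n p0 (C U Ant : set 'rV[R]_d) : (0 < n)%N -> N p0 ->
  connected zone ->
  is_component C (M `\` N) ->
  (forall p, N p -> exists2 H, mean_curvature_vector g n M N p H &
     points_into M C p (- H)) ->
  (if 0 < kappa then is_component U (C `\` Ant) /\ N `<=` closure U else U = C) ->
  (forall x, M x -> 0 < kappa -> Ant x <-> kappa * height x = 2) ->
  U = zone.
Proof.
move=> n0 Np0 cz [x0 Mx0 CE] HC HU HA.
have cC : connected C by rewrite CE; exact: component_connected.
have CM : C `<=` M `\` N by rewrite CE; exact: connected_component_sub.
have cfM (S : set 'rV[R]_d) (a : R) : S `<=` M -> {within S, continuous (fun x => a * height x)}.
  move=> SM; apply: smooth_on_continuous; apply: smooth_on_mul; first exact: smooth_on_cst.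
  exact: smooth_height.
have [y0 [Cy0 y0A]] : exists x, C x /\ 0 < b (Phi x) A.
  have [H mH pH] := HC p0 Np0; apply: points_into_positive pH => //.
  by rewrite dPhiN bfNl (mean_curvature_normal n0 Np0 mH) opprK.
have hN x : M x -> N x <-> height x = 0.
  move=> Mx; rewrite /N /= (bA_height Mo A eta0); split => [[_]|->].
    by move/eqP; rewrite mulf_eq0 (gt_eqF eta0) => /eqP.
  by split => //; rewrite mulr0.
have Cpos x : C x -> 0 < height x.
  move=> Cx; have : -1 * height x < 0.
    apply: (@connected_avoid C (fun x => -1 * height x) 0 y0 x) => //.
    - by apply: cfM => z /CM[].
    - by move=> z /CM[Mz Nz]; rewrite mulN1r oppr_eq0; apply/eqP => /(hN z Mz).
    - by rewrite mulN1r oppr_lt0 divr_gt0.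
  by rewrite mulN1r oppr_lt0.
have zMN : zone `<=` M `\` N.
  by move=> x [Mx [h0 _]]; split => // /(hN x Mx) E; move: h0; rewrite E ltxx.
have zoneC y : C y -> zone y -> zone `<=` C.
  move=> Cy zy; rewrite CE; have yx : connected_component (M `\` N) x0 y by rewrite -CE.
  by rewrite (same_connected_component yx); exact: connected_component_max.
have [k0|k0] := ltP 0 kappa; last first.
  rewrite ltNge k0 /= in HU; rewrite HU.
  have Cz : C `<=` zone.
    move=> x Cx; have h0 := Cpos x Cx; split; first by have [] := CM x Cx.
    split => //; apply: le_lt_trans (ltr0n _ 2); exact: mulr_le0_ge0 (ltW h0).
  by apply/seteqP; split => //; apply: (zoneC y0) => //; exact: Cz.
rewrite k0 in HU; have [[u0 Cu0 UE] NU] := HU.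
have UC : U `<=` C `\` Ant by rewrite UE; exact: connected_component_sub.
have cU : connected U by rewrite UE; exact: component_connected.
have UM : U `<=` M by move=> x /UC[/CM[]].
have [y1 [Uy1 y1h]] : exists y, U y /\ kappa * height y < 2.
  have sh : smooth_on M (fun x => kappa * height x).
    apply: smooth_on_mul; first exact: smooth_on_cst.
    exact: smooth_height.
  have [Mp0 _] := Np0; have [B [F [oB Bp sF FE]]] := sh p0 Mp0.
  have h0 : height p0 = 0 by apply/(hN p0 Mp0).
  have op : open (B `&` F @^-1` [set r | r < 2]).
    apply: open_preimage_in; [exact: oB|exact: open_lt|].
    by move=> x Bx; exact: (Ck_continuous (sF 0%N) Bx).
  have := NU p0 Np0 _ (open_nbhs_nbhs (conj op _)).
  case; first by split => //=; rewrite FE // h0 mulr0.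
  by move=> y [Uy [By /= Fy]]; exists y; split => //; rewrite -FE //; exact: UM.
have Uz : U `<=` zone.
  move=> x Ux; have [Cx _] := UC x Ux; split; first exact: UM.
  split; first exact: Cpos.
  apply: (@connected_avoid U (fun x => kappa * height x) 2 y1 x) => //.
    exact: cfM.
  by move=> z Uz; apply/eqP => /(HA z (UM z Uz) k0); have [] := UC z Uz.
apply/seteqP; split => // x zx; rewrite UE.
have y1u : connected_component (C `\` Ant) u0 y1 by rewrite -UE.
rewrite (same_connected_component y1u).
have zy1 := Uz _ Uy1; have [Cy1 _] := UC _ Uy1.
apply: (@connected_component_max _ _ zone y1) => // z zz; split; first exact: (zoneC y1).
have [Mz [_ hz]] := zz; move=> /(HA z Mz k0) E; move: hz; by rewrite E ltxx.
Qed.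

End Exterior.

Section ZoneConnected.
Context {R : realType} {d m : nat} {kappa : R}.
Variable Mo : light_cone_model d m kappa.
Local Notation b := (bf (lcJ Mo)).
Variables (A : 'rV[R]_m) (eta : R).
Hypotheses (hAA : b A A = 1) (hAK : b A (lcK Mo) = eta) (eta0 : 0 < eta).
Local Notation N := (slice Mo A).
Local Notation height := (height Mo A eta).
Local Notation zone := (zone Mo A eta).
Variables (v : 'rV[R]_d -> 'rV[R]_d) (q : 'rV[R]_d -> 'rV[R]_d).
Hypothesis uv : unit_vector_field (lcg Mo) N v.
Local Notation VF x := (lcdPhi Mo x (v x)).
Hypothesis qN : forall x, zone x -> N (q x).
Hypothesis qP : forall x p, zone x -> N p ->
  @slice_c R kappa eta (height x) *: lcPhi Mo p +
  @slice_s R kappa eta (height x) *: VF p +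
  @slice_e R kappa eta (height x) *: slice_K Mo A eta = slice_projW Mo A eta x
  <-> p = q x.

(** Every ray meets the copy [S0] of N at a fixed height, and [S0] is connected because N is. *)
Lemma zone_connected p0 : N p0 -> connected zone.
Proof.
move=> Np0; have u0 := field_unit uv Np0.
have cN : connected N := slice_connected hAA hAK Np0 u0.
have [e0 he0] : exists e, ht_dom kappa e.
  have [chi0 [chi' [_ _ _ H]]] := ht_dom_line kappa; exists (chi' 0).
  by have [] := H 0.
pose S0 := (fun p => rayE Mo p (VF p) e0) @` N.
have cS0 : connected S0.
  apply: connected_continuous_connected => //; apply: smooth_on_continuous.
  by apply: (smooth_ray hAK eta0 uv); [exact: smooth_on_id|exact: smooth_on_cst| |].
have rz p e : N p -> ht_dom kappa e -> zone (rayE Mo p (VF p) e).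
  move=> Np he; have [Mr Er hr] := rayEP hAK eta0 Np (field_unit uv Np) he.
  by split => //; rewrite hr.
have -> : zone = \bigcup_(p in N) ((fun e => rayE Mo p (VF p) e) @` ht_dom kappa `|` S0).
  apply/seteqP; split => [x zx|x [p Np [[e he <-]|[p' Np' <-]]]]; do ?exact: rz.
  exists (q x); first exact: qN.
  left; exists (height x); first by case: zx.
  by rewrite -(zone_ray eta0 uv qN qP zx).
apply: bigcup_connected.
  by exists (rayE Mo p0 (VF p0) e0) => p Np; right; exists p0.
move=> p Np; apply: connectedU => //.
  by exists (rayE Mo p (VF p) e0); split; [exists e0|exists p].
exact: (ray_connected hAK eta0 uv).
Qed.

End ZoneConnected.

(** * Geodesic fields are bifoliating *)

Section CurvatureTrigParity.
Context {R : realType}.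
Implicit Types k t : R.

Lemma coskN k t : cosk k (- t) = cosk k t.
Proof. by rewrite /cosk !mulrN cosN opprK [X in X / 2]addrC. Qed.

Lemma sinkN k t : sink k (- t) = - sink k t.
Proof.
rewrite /sink !mulrN sinN opprK; case: ifP => _; first by rewrite mulNr.
by case: ifP => _ //; rewrite -[RHS]mulNr opprB.
Qed.

Lemma verskN k t : versk k (- t) = versk k t.
Proof. by rewrite /versk sqrrN coskN. Qed.

End CurvatureTrigParity.

Section Bifoliation.
Context {R : realType} {d m : nat} {kappa : R}.
Variable Mo : light_cone_model d m kappa.
Local Notation M := (lcM Mo).
Local Notation g := (lcg Mo).
Local Notation K := (lcK Mo).
Local Notation Phi := (lcPhi Mo).
Local Notation dPhi := (lcdPhi Mo).
Local Notation Pi := (lcPi Mo).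
Local Notation b := (bf (lcJ Mo)).
Variables (A : 'rV[R]_m) (eta : R).
Hypotheses (hAA : b A A = 1) (hAK : b A K = eta) (eta0 : 0 < eta).
Local Notation N := (slice Mo A).
Local Notation k := (@slice_curv R kappa eta).
Local Notation KA := (slice_K Mo A eta).
Local Notation height := (height Mo A eta).
Local Notation zone := (zone Mo A eta).
Local Notation projW := (slice_projW Mo A eta).
Local Notation sc := (@slice_c R kappa eta).
Local Notation ss := (@slice_s R kappa eta).
Local Notation se := (@slice_e R kappa eta).
Local Notation Geo := (geo Mo A eta).
Local Notation dGeo := (dgeo Mo A eta).
Local Notation GeoE := (geoE Mo A eta).

Let hAA' : eta * b A A = eta. Proof. by rewrite hAA mulr1. Qed.

(** [q x] is the foot of the unique ray through [x], expressed through the projected equation of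
    [ray_proj]. *)
Definition ray_inverse (v : 'rV[R]_d -> 'rV[R]_d) := exists q,
  [/\ smooth_on zone q, forall x, zone x -> N (q x) &
   forall x p, zone x -> N p ->
    sc (height x) *: Phi p + ss (height x) *: dPhi p (v p) + se (height x) *: KA
    = projW x <-> p = q x].

(** [Ant] stands for the antipodal image of N, which a model only sees as the level kappa * height =
    2. *)
Definition model_exterior n (U : set 'rV[R]_d) := exists C (Ant : set 'rV[R]_d),
  [/\ is_component C (M `\` N),
      forall p, N p -> exists2 H, mean_curvature_vector g n M N p H &
        points_into M C p (- H),
      if 0 < kappa then is_component U (C `\` Ant) /\ N `<=` closure U else U = C &
      forall x, M x -> 0 < kappa -> Ant x <-> kappa * height x = 2].

Lemma unit_field_intro v : smooth_on N v ->
  (forall p, N p -> unit_tangent Mo A p (dPhi p (v p))) -> unit_vector_field g N v.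
Proof.
move=> sv H; split => // p Np; have [VP VK VA VV] := H p Np; have [Mp _] := Np.
split; last by rewrite lc_inner.
have -> : v p = lcsec Mo p (dPhi p (v p)).
  by apply: (dPhi_injective Mp); rewrite lcdPhi_sec // lc_bfC.
exact: (orth_tangent hAA' hAK Np).
Qed.

Lemma unit_fieldN v : unit_vector_field g N v -> unit_vector_field g N (fun p => - v p).
Proof.
move=> uv; apply: unit_field_intro; first by apply: smooth_on_opp; case: uv.
move=> p Np; have [VP VK VA VV] := field_unit uv Np.
by split; rewrite dPhiN ?bfNr ?bfNl ?VP ?VK ?VA ?oppr0 // opprK.
Qed.

Lemma tangent_dim_gt0 n p V : m = (3 + n)%N -> N p -> unit_tangent Mo A p V -> (0 < n)%N.
Proof.
move=> mn Np [VP VK VA VV]; case: n mn => [|n] // mn.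
have [f [_ /(_ V) H]] := orthonormal_frame hAA hAK Np mn.
have V0 : V = 0 by rewrite H ?big_ord0.
by move: VV; rewrite V0 bf0l => /eqP; rewrite eq_sym oner_eq0.
Qed.

Theorem bifoliation n (U : set 'rV[R]_d) v p0 : m = (3 + n)%N ->
  unit_vector_field g N v -> ray_inverse v -> ray_inverse (fun p => - v p) ->
  N p0 -> model_exterior n U ->
  [/\ unit_vector_field g N v,
      smooth_line_foliation n M U (model_rays Mo A v)
    & smooth_line_foliation n M U (model_rays Mo A (fun p => - v p))].
Proof.
move=> mn uv [q [sq qN qP]] [q' [sq' qN' qP']] Np0 [C [Ant [h1 h2 h3 h4]]].
have cz := zone_connected hAA hAK eta0 uv qN qP Np0.
have n0 := tangent_dim_gt0 mn Np0 (field_unit uv Np0).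
have -> : U = zone by exact: (exterior_zone hAK eta0 n0 Np0 cz h1 h2 h3 h4).
split => //; first exact: (ray_foliation hAA hAK eta0 uv mn sq qN qP).
exact: (ray_foliation hAA hAK eta0 (unit_fieldN uv) mn sq' qN' qP').
Qed.

Lemma smooth_slice_params (j : nat) (S : set 'rV[R]_j) (h : 'rV[R]_j -> R) :
  smooth_on S h -> (forall x, S x -> ht_dom kappa (h x)) ->
  [/\ smooth_on S (fun x => sc (h x)), smooth_on S (fun x => ss (h x)),
      smooth_on S (fun x => se (h x)) & smooth_on S (fun x => (@slice_sig R kappa eta (h x))^-1)].
Proof.
move=> sh Sh; have cstS (a : R) : smooth_on S (fun=> a) by exact: smooth_on_cst.
have skh : smooth_on S (fun x => kappa * h x) by exact: smooth_on_mul.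
have s2 : smooth_on S (fun x => 2 * h x - kappa * h x ^+ 2).
  apply: smooth_on_add; first exact: smooth_on_mul.
  by apply: smooth_on_opp; apply: smooth_on_mul => //; exact: smooth_on_exp.
have sS : smooth_on S (fun x => @slice_S R kappa (h x)).
  by apply: smooth_on_sqrt => // x /Sh /ht_dom_gt0.
have pos x : S x -> 0 < 1 + eta ^+ 2 * (2 * h x - kappa * h x ^+ 2).
  move=> /Sh /ht_dom_gt0 h0; rewrite addr_gt0 // mulr_gt0 // exprn_gt0 //.
have ssig : smooth_on S (fun x => @slice_sig R kappa eta (h x)).
  apply: smooth_on_sqrt => //; apply: smooth_on_add => //.
  exact: smooth_on_mul.
have gi : smooth_on S (fun x => (@slice_sig R kappa eta (h x))^-1).
  by apply: smooth_on_inv => // x /pos h0; rewrite gt_eqF // sqrtr_gt0.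
have s_c : smooth_on S (fun x => sc (h x)).
  apply: smooth_on_mul => //; apply: smooth_on_add => //.
  exact: smooth_on_opp.
have s_s : smooth_on S (fun x => ss (h x)) by exact: smooth_on_mul.
split => //; apply: smooth_on_div; first exact: smooth_on_exp.
  exact: smooth_on_add.
move=> x /Sh he; have [_ _ _ c1 _] := slice_params eta0 he.
by rewrite gt_eqF //; lra.
Qed.

Definition projE x : 'rV[R]_d := Pi (projW x).

Lemma zone_height x : zone x -> ht_dom kappa (height x).
Proof. by case. Qed.

Lemma smooth_projW : smooth_on zone projW.
Proof.
have sh := smooth_height A eta (@zone_sub _ _ _ _ Mo A eta).
have [h1 h2 h3 h4] := smooth_slice_params sh zone_height.
apply: smooth_on_add; last by apply: smooth_on_scale => //; exact: smooth_on_cst.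
apply: smooth_on_scale => //; apply: smooth_on_add.
  exact: smooth_on_sub (@zone_sub _ _ _ _ Mo A eta) (lc_smoothPhi (l := Mo)).
by apply: smooth_on_opp; apply: smooth_on_scale => //; exact: smooth_on_cst.
Qed.

Lemma smooth_projE : smooth_on zone projE.
Proof.
apply: (smooth_on_comp smooth_projW (lc_smoothPi (l := Mo))) => x zx.
have [[My _] E] := slice_projP hAA hAK eta0 zx.
by exists (projE x).
Qed.

Section GeodesicField.
Variable v : 'rV[R]_d -> 'rV[R]_d.
Hypothesis uv : unit_vector_field g N v.
Local Notation VF x := (dPhi x (v x)).
Hypothesis v_flow : forall p t, N p -> VF (GeoE p (VF p) t) = dGeo p (VF p) t.

(** The equation says that [projE x] is reached from [p] by following the flow for a time t, so [p]
    is found by flowing back from [projE x]. *)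
Lemma flow_ray_inverse : ray_inverse v.
Proof.
(* The geodesic formula at time - t, written with c, s and e as smooth functions of the height; t
   itself is only chosen pointwise. *)
pose W x := sc (height x) *: projW x + (- ss (height x)) *: VF (projE x) + se (height x) *: KA.
have param x : zone x -> exists t, [/\ cosk k t = sc (height x),
    sink k t = ss (height x) & versk k t = se (height x)].
  move=> zx; have [S0 g1 s0 c1 [S2 g2 cs ce hse]] := slice_params eta0 (zone_height zx).
  have [|t [tc ts _]] := cosk_sink_surj cs.
    rewrite /slice_curv => k0; rewrite divr_gt0 //; last lra.
    have e2 : 0 < eta ^+ 2 by rewrite exprn_gt0.
    have [_ [/ltW h0 _]] := zx.
    have : kappa * height x <= 0 by apply: mulr_le0_ge0 => //; lra.
    lra.
  exists t; split => //; exact: (versk_unique tc ts ce hse).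
have projP x : zone x -> N (projE x) /\ Phi (projE x) = projW x.
  by move=> zx; exact: slice_projP.
have WE x t : zone x -> cosk k t = sc (height x) -> sink k t = ss (height x) ->
    versk k t = se (height x) -> W x = Geo (projE x) (VF (projE x)) (- t).
  move=> zx tc ts te; have [Ny Ey] := projP x zx.
  by rewrite /geo /slice_point coskN sinkN verskN tc ts te Ey.
have fl x t : zone x -> N (GeoE (projE x) (VF (projE x)) t) /\
    Phi (GeoE (projE x) (VF (projE x)) t) = Geo (projE x) (VF (projE x)) t.
  move=> zx; have [Ny Ey] := projP x zx.
  exact: (geoP hAA' hAK _ Ny (field_unit uv Ny)).
exists (fun x => Pi (W x)); split.
- apply: (smooth_on_comp (B := Phi @` M) _ (lc_smoothPi (l := Mo))); last first.
    move=> x zx; have [t [tc ts te]] := param x zx; rewrite (WE x t) //.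
    have [[My _] E] := fl x (- t) zx.
    by exists (GeoE (projE x) (VF (projE x)) (- t)).
  have sh := smooth_height A eta (@zone_sub _ _ _ _ Mo A eta).
  have [h1 h2 h3 h4] := smooth_slice_params sh zone_height.
  apply: smooth_on_add; last by apply: smooth_on_scale => //; exact: smooth_on_cst.
  apply: smooth_on_add; apply: smooth_on_scale => //.
  + exact: smooth_projW.
  + exact: smooth_on_opp.
  + by apply: (smooth_field uv); [exact: smooth_projE|move=> x /projP[]].
- move=> x zx; have [t [tc ts te]] := param x zx; rewrite (WE x t) //.
  by have [] := fl x (- t) zx.
- move=> x p zx Np; have [t [tc ts te]] := param x zx; rewrite (WE x t) //.
  have [Ny Ey] := projP x zx; have uy := field_unit uv Ny.
  have up := field_unit uv Np; rewrite -tc -ts -te -Ey.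
  have Mp : M p by case: Np.
  rewrite -/(Geo (projE x) (VF (projE x)) (- t)).
  split => [E|E].
    have yE : projE x = GeoE p (VF p) t.
      by rewrite -[LHS](lcPi_Phi Ny.1) -E.
    have Vy : VF (projE x) = dGeo p (VF p) t by rewrite yE v_flow.
    have [h1 _] := geo_shift hAA hAK t (- t) Np up.
    by rewrite Vy yE h1 addNr geo0 lcPi_Phi.
  have pE : p = GeoE (projE x) (VF (projE x)) (- t) by [].
  have Vp : VF p = dGeo (projE x) (VF (projE x)) (- t) by rewrite pE v_flow.
  have [h1 _] := geo_shift hAA hAK (- t) t Ny uy.
  transitivity (Geo p (VF p) t) => //.
  by rewrite Vp {1}pE h1 addrN geo0.
Qed.

End GeodesicField.

(** Backward rays are the rays of - v, and reversing time turns the flow property of v into that of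
    - v. *)
Theorem geodesic_bifoliation n (U : set 'rV[R]_d) v p0 : m = (3 + n)%N ->
  geodesic_vector_field g N v -> N p0 -> model_exterior n U ->
  [/\ unit_vector_field g N v,
      smooth_line_foliation n M U (model_rays Mo A v)
    & smooth_line_foliation n M U (model_rays Mo A (fun p => - v p))].
Proof.
move=> mn gv Np0 extU; have [uv _] := gv.
have fl p t Np := flow hAA hAK uv gv (n := n) (p := p) t mn Np.
apply: (bifoliation mn uv _ _ Np0 extU); first exact: flow_ray_inverse.
apply: flow_ray_inverse; first exact: unit_fieldN.
move=> p t Np; rewrite !dPhiN.
have gE : Geo p (- dPhi p (v p)) t = Geo p (dPhi p (v p)) (- t).
  by rewrite /geo /slice_point coskN sinkN verskN scalerN scaleNr.
rewrite /geoE gE -/(GeoE p (dPhi p (v p)) (- t)) fl // /dgeo /slice_point.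
by rewrite coskN sinkN; apply/rowP => i; rewrite !mxE; ring.
Qed.

End Bifoliation.

(** * Bifoliating fields that are not geodesic *)

Section AmbientFields.
Context {R : realType} {d m : nat} {kappa : R}.
Variable Mo : light_cone_model d m kappa.
Local Notation M := (lcM Mo).
Local Notation g := (lcg Mo).
Local Notation K := (lcK Mo).
Local Notation Phi := (lcPhi Mo).
Local Notation dPhi := (lcdPhi Mo).
Local Notation Pi := (lcPi Mo).
Local Notation b := (bf (lcJ Mo)).
Variables (A : 'rV[R]_m) (eta : R).
Hypotheses (hAA : b A A = 1) (hAK : b A K = eta) (eta0 : 0 < eta).
Local Notation N := (slice Mo A).
Local Notation k := (@slice_curv R kappa eta).
Local Notation KA := (slice_K Mo A eta).
Local Notation height := (height Mo A eta).
Local Notation zone := (zone Mo A eta).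
Local Notation sc := (@slice_c R kappa eta).
Local Notation ss := (@slice_s R kappa eta).
Local Notation se := (@slice_e R kappa eta).
Local Notation projE := (projE Mo A eta).

Let hAA' : eta * b A A = eta. Proof. by rewrite hAA mulr1. Qed.

Lemma ambient_field (V : 'rV[R]_d -> 'rV[R]_m) : smooth_on N V ->
  (forall p, N p -> unit_tangent Mo A p (V p)) ->
  let v x := lcsec Mo x (V x) in
  unit_vector_field g N v /\ forall p, N p -> dPhi p (v p) = V p.
Proof.
move=> sV uV v.
have E p : N p -> dPhi p (v p) = V p.
  move=> Np; have [h1 h2 h3 h4] := uV p Np; have [Mp _] := Np.
  by rewrite lcdPhi_sec // lc_bfC.
split => //; apply: (unit_field_intro hAA hAK) => [|p Np]; last by rewrite E //; exact: uV.
apply: lc_smooth_sec => //; first exact: smooth_on_id.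
by move=> x [].
Qed.

Lemma smooth_Phi_slice : smooth_on N Phi.
Proof. exact: smooth_on_sub (@slice_sub _ _ _ _ Mo A) (lc_smoothPhi (l := Mo)). Qed.

(** The last bound comes from s = S / sig with sig^2 = 1 + eta^2 S^2; it is the one that makes the
    case k = 0 solvable. *)
Record slice_parameters (c s e : R) : Prop := SliceParameters {
  sp_e : 0 < e;
  sp_s : 0 < s;
  sp_c : -1 < c;
  sp_cs : c ^+ 2 + k * s ^+ 2 = 1;
  sp_ce : c = 1 - k * e;
  sp_se : s ^+ 2 = 2 * e - k * e ^+ 2;
  sp_eta : eta ^+ 2 * s ^+ 2 < 1 }.

Lemma zone_parameters x : zone x ->
  slice_parameters (sc (height x)) (ss (height x)) (se (height x)).
Proof.
move=> zx; have [S0 g1 s0 c1 [S2 g2 cs ce hse]] := slice_params eta0 (zone_height zx).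
split => //.
  by rewrite divr_gt0 ?exprn_gt0 //; lra.
rewrite /slice_s expr_div_n mulrA ltr_pdivrMr; last by rewrite exprn_gt0 //; lra.
by rewrite mul1r g2; lra.
Qed.

(** What remains for each field is algebra in the ambient vector space: solve c Phi p + s V p + e KA
    = Y by an expression [Q] in [Y] and the parameters that depends smoothly on them. *)
Lemma ambient_ray_inverse v (V : 'rV[R]_d -> 'rV[R]_m)
    (Q : 'rV[R]_m -> R -> R -> R -> 'rV[R]_m) :
  (forall p, N p -> dPhi p (v p) = V p) ->
  smooth_on zone (fun x => Q (Phi (projE x)) (sc (height x)) (ss (height x)) (se (height x))) ->
  (forall y c s e, N y -> slice_parameters c s e ->
     N (Pi (Q (Phi y) c s e)) /\ Phi (Pi (Q (Phi y) c s e)) = Q (Phi y) c s e) ->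
  (forall y p c s e, N y -> N p -> slice_parameters c s e ->
     c *: Phi p + s *: V p + e *: KA = Phi y <-> Phi p = Q (Phi y) c s e) ->
  ray_inverse Mo A eta v.
Proof.
move=> vV sQ QN QP.
have projP x : zone x -> N (projE x) /\ Phi (projE x) = slice_projW Mo A eta x.
  by move=> zx; exact: (slice_projP hAA hAK eta0 zx).
exists (fun x => Pi (Q (Phi (projE x)) (sc (height x)) (ss (height x)) (se (height x)))).
have QE x (zx : zone x) := QN _ _ _ _ (projP x zx).1 (zone_parameters zx).
split=> [|x zx|x p zx Np]; last 1 first.
- have [Ny Ey] := projP x zx; rewrite vV // -Ey.
  have H := QP _ _ _ _ _ Ny Np (zone_parameters zx).
  have [[MQ _] EQ] := QE x zx; have [Mp _] := Np.
  split=> [/H E|E]; first by rewrite -E lcPi_Phi.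
  by apply/H; rewrite E EQ.
- apply: (smooth_on_comp sQ (lc_smoothPi (l := Mo))) => x zx.
  have [[MQ _] EQ] := QE x zx.
  by exists (Pi (Q (Phi (projE x)) (sc (height x)) (ss (height x)) (se (height x)))).
- by have [] := QE x zx.
Qed.

Lemma smooth_zone_params :
  [/\ smooth_on zone (fun x => Phi (projE x)), smooth_on zone (fun x => sc (height x)),
      smooth_on zone (fun x => ss (height x)) & smooth_on zone (fun x => se (height x))].
Proof.
have sh := smooth_height A eta (@zone_sub _ _ _ _ Mo A eta).
have [h1 h2 h3 h4] := smooth_slice_params eta0 sh (@zone_height _ _ _ _ Mo A eta).
split => //; apply: (smooth_on_comp (smooth_projE hAA hAK eta0) smooth_Phi_slice) => x zx.
by have [] := slice_projP hAA hAK eta0 zx.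
Qed.

Lemma smooth_bV (V : normedModType R) (S : set V) (X : V -> 'rV[R]_m) Y :
  smooth_on S X -> smooth_on S (fun x => b (X x) Y).
Proof. by move=> sX; apply: smooth_on_bf => //; exact: smooth_on_cst. Qed.

(** * Curvature k < 0: boost fields *)

Section Boost.
Variables (b0 f1 : 'rV[R]_m).
Hypothesis k0 : k < 0.
Hypotheses (h00 : b b0 b0 = -1) (h0K : b b0 K = 0) (h0A : b b0 A = 0).
Hypotheses (h11 : b f1 f1 = 1) (h1K : b f1 K = 0) (h1A : b f1 A = 0).
Hypothesis h01 : b b0 f1 = 0.
Hypothesis hN : forall p, N p -> 1 <= - k * (b (Phi p) b0 ^+ 2 - b (Phi p) f1 ^+ 2).

(** The generator of the boosts in the plane of the timelike [b0] and the spacelike [f1]. Its square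
    at X is <X, b0>^2 - <X, f1>^2, whence [boost_norm]. *)
Definition boost (X : 'rV[R]_m) : 'rV[R]_m := b X f1 *: b0 - b X b0 *: f1.
Definition boost_norm (X : 'rV[R]_m) : R := Num.sqrt (b X b0 ^+ 2 - b X f1 ^+ 2).
Definition boost_field p : 'rV[R]_m := (boost_norm (Phi p))^-1 *: boost (Phi p).

Lemma boost_pos p : N p -> 0 < b (Phi p) b0 ^+ 2 - b (Phi p) f1 ^+ 2.
Proof.
move=> /hN h; have : 0 < - k * (b (Phi p) b0 ^+ 2 - b (Phi p) f1 ^+ 2).
  exact: lt_le_trans ltr01 h.
by rewrite pmulr_rgt0 // oppr_gt0.
Qed.

Lemma boost_norm_gt0 p : N p -> 0 < boost_norm (Phi p).
Proof. by move=> Np; rewrite sqrtr_gt0; exact: boost_pos. Qed.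

Lemma boost_norm_sqr p : N p ->
  boost_norm (Phi p) ^+ 2 = b (Phi p) b0 ^+ 2 - b (Phi p) f1 ^+ 2.
Proof. by move=> Np; rewrite sqr_sqrtr // ltW // boost_pos. Qed.

Lemma boost_field_unit p : N p -> unit_tangent Mo A p (boost_field p).
Proof.
move=> Np; have r0 := boost_norm_gt0 Np; have r2 := boost_norm_sqr Np.
have rn : boost_norm (Phi p) != 0 by rewrite gt_eqF.
have hK0 := h0K; have hA0 := h0A; have hK1 := h1K; have hA1 := h1A.
rewrite lc_bfC in hK0; rewrite lc_bfC in hA0; rewrite lc_bfC in hK1; rewrite lc_bfC in hA1.
have h10 : b f1 b0 = 0 by rewrite lc_bfC.
rewrite /boost_field /boost; move: (boost_norm _) r0 r2 rn => r r0 r2 rn.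
split; rewrite !bfL ?hK0 ?hA0 ?hK1 ?hA1; try by ring.
rewrite h00 h01 h10 h11.
transitivity ((b (Phi p) b0 ^+ 2 - b (Phi p) f1 ^+ 2) / r ^+ 2); first by field.
by rewrite -r2 divff // expf_neq0.
Qed.

Lemma smooth_boost_field : smooth_on N boost_field.
Proof.
have sP := smooth_Phi_slice; have s0 := smooth_bV b0 sP; have s1 := smooth_bV f1 sP.
apply: smooth_on_scale.
  apply: smooth_on_inv; last by move=> x /boost_norm_gt0 h; rewrite gt_eqF.
  apply: smooth_on_sqrt; last exact: boost_pos.
  apply: smooth_on_add; first exact: smooth_on_exp.
  by apply: smooth_on_opp; exact: smooth_on_exp.
apply: smooth_on_add; first by apply: smooth_on_scale => //; exact: smooth_on_cst.
by apply: smooth_on_opp; apply: smooth_on_scale => //; exact: smooth_on_cst.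
Qed.

(** Let rho be the length of the velocity at p. Paired with [b0] and [f1], the equation is a linear
    system in P0 = <Phi p, b0> and P1 = <Phi p, f1>; as P0^2 - P1^2 = rho^2, the difference of the
    squares of its right-hand sides is c^2 rho^2 - s^2, which gives rho^2. *)
Definition boost_inv_norm2 (Y : 'rV[R]_m) (c s : R) : R :=
  (b Y b0 ^+ 2 - b Y f1 ^+ 2 + s ^+ 2) / c ^+ 2.
Definition boost_inv (Y : 'rV[R]_m) (c s e : R) : 'rV[R]_m :=
  let r := s / Num.sqrt (boost_inv_norm2 Y c s) in
  let D := c ^+ 2 - r ^+ 2 in
  c^-1 *: (Y - r *: (((c * b Y f1 + r * b Y b0) / D) *: b0 -
                     ((c * b Y b0 + r * b Y f1) / D) *: f1) - e *: KA).

Lemma boost_paramsE (Y : 'rV[R]_m) c s e : slice_parameters c s e ->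
  1 <= - k * (b Y b0 ^+ 2 - b Y f1 ^+ 2) ->
  [/\ 1 < c, 0 < boost_inv_norm2 Y c s &
      0 < c ^+ 2 - (s / Num.sqrt (boost_inv_norm2 Y c s)) ^+ 2].
Proof.
move=> [e0 s0 c1 cs ce hse _] hY.
have c0 : 1 < c by rewrite ce; have : k * e < 0 by [rewrite nmulr_rlt0]; lra.
have c2 : 0 < c ^+ 2 by rewrite exprn_gt0 //; lra.
have Y0 : 0 < b Y b0 ^+ 2 - b Y f1 ^+ 2.
  have : 0 < - k * (b Y b0 ^+ 2 - b Y f1 ^+ 2) by exact: lt_le_trans ltr01 hY.
  by rewrite pmulr_rgt0 // oppr_gt0.
have r0 : 0 < boost_inv_norm2 Y c s by rewrite divr_gt0 // addr_gt0 // exprn_gt0.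
split => //; rewrite expr_div_n sqr_sqrtr ?(ltW r0) // subr_gt0 ltr_pdivrMr //.
by rewrite /boost_inv_norm2 mulrCA divff ?mulr1 ?gt_eqF //; lra.
Qed.

Lemma boost_invP y c s e : N y -> slice_parameters c s e ->
  [/\ N (Pi (boost_inv (Phi y) c s e)),
     Phi (Pi (boost_inv (Phi y) c s e)) = boost_inv (Phi y) c s e &
     forall p, N p -> c *: Phi p + s *: boost_field p + e *: KA = Phi y <->
       Phi p = boost_inv (Phi y) c s e].
Proof.
move=> Ny hp; have [c0 r20 D0] := boost_paramsE hp (hN Ny).
have [e0 s0 c1 cs ce hse _] := hp.
have r2E : boost_inv_norm2 (Phi y) c s * c ^+ 2 = b (Phi y) b0 ^+ 2 - b (Phi y) f1 ^+ 2 + s ^+ 2.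
  by rewrite mulfVK // expf_neq0 // gt_eqF //; lra.
rewrite /boost_inv.
move: (boost_inv_norm2 (Phi y) c s) r20 D0 r2E => r2 r20 D0 r2E.
have rho0 : 0 < Num.sqrt r2 by rewrite sqrtr_gt0.
have rho2 : Num.sqrt r2 ^+ 2 = r2 by rewrite sqr_sqrtr // ltW.
move: (Num.sqrt r2) rho0 rho2 D0 => rho rho0 rho2 D0.
have cn : c != 0 by rewrite gt_eqF //; lra.
have rhon : rho != 0 by rewrite gt_eqF.
set r := s / rho in D0 *.
have rE : r * rho = s by rewrite /r mulfVK.
clearbody r.
set D := c ^+ 2 - r ^+ 2 in D0 *.
have Dn : D != 0 by rewrite gt_eqF.
have hK0 := h0K; have hA0 := h0A; have hK1 := h1K; have hA1 := h1A.
rewrite lc_bfC in hK0; rewrite lc_bfC in hA0; rewrite lc_bfC in hK1; rewrite lc_bfC in hA1.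
have h10 : b f1 b0 = 0 by rewrite lc_bfC.
have K0 : b KA b0 = 0 by rewrite slice_KE !bfL hK0 hA0; ring.
have K1 : b KA f1 = 0 by rewrite slice_KE !bfL hK1 hA1; ring.
have YK := b_PhiKA eta Ny; have KK := b_KAKA hAA' hAK; have KK1 := b_KKA hAK.
have KA0 := b_AKA hAA' hAK.
set a' := b (Phi y) b0; set b' := b (Phi y) f1.
(* Cramer's rule for the system c P0 - r P1 = a', c P1 - r P0 = b' of determinant [D]. *)
set al := (c * a' + r * b') / D; set be := (c * b' + r * a') / D.
have alE : c * al - r * be = a' by rewrite /al /be /D; field.
have beE : c * be - r * al = b' by rewrite /al /be /D; field.
have normE : al ^+ 2 - be ^+ 2 = rho ^+ 2.
  have E : (al ^+ 2 - be ^+ 2) * D = a' ^+ 2 - b' ^+ 2.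
    by rewrite -alE -beE /D; ring.
  apply: (mulIf Dn); rewrite E /D.
  have -> : rho ^+ 2 * (c ^+ 2 - r ^+ 2) = rho ^+ 2 * c ^+ 2 - (r * rho) ^+ 2 by ring.
  by rewrite rE rho2 r2E -/a' -/b'; ring.
clearbody al be.
have [Q QE] : {Q | Q = c^-1 *: (Phi y - r *: (be *: b0 - al *: f1) - e *: KA)} by eexists.
rewrite -QE.
have a'E : b (Phi y) b0 = a' by []. have b'E : b (Phi y) f1 = b' by [].
clearbody a' b'.
have [My yA] := Ny; have YY := lcPhiPhi My; have YK1 := lcPhiK My.
have ec : e * (1 + c) = s ^+ 2 by rewrite hse ce; ring.
have Qb0 : b Q b0 = al.
  rewrite QE !bfL a'E h00 h10 K0 -alE; by field.
have Qf1 : b Q f1 = be.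
  rewrite QE !bfL b'E h01 h11 K1 -beE; by field.
have cQ : c *: Q + r *: (be *: b0 - al *: f1) + e *: KA = Phi y.
  rewrite QE scalerA divff // scale1r; apply/rowP => i; rewrite !mxE; ring.
have QY : b Q (Phi y) = - e.
  rewrite QE !bfL YY (lc_bfC Mo b0) a'E (lc_bfC Mo f1) b'E (lc_bfC Mo KA) YK.
  rewrite -alE -beE.
  transitivity (- c^-1 * (r ^+ 2 * (al ^+ 2 - be ^+ 2) - e)); first by ring.
  rewrite normE -exprMn rE -ec; by field.
have QK : b Q K = -1.
  rewrite QE !bfL YK1 h0K h1K (lc_bfC Mo KA) KK1.
  by rewrite ce; field; rewrite -ce.
have QA : b Q A = 0.
  by rewrite QE !bfL yA h0A h1A (lc_bfC Mo KA) KA0; ring.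
have QKA : b Q KA = -1 by rewrite slice_KE !bfL QK QA; ring.
have QQ : b Q Q = 0.
  rewrite {2}QE !bfL QY Qb0 Qf1 QKA; by field.
have QY0 : b Q (Phi y) <= 0 by rewrite QY oppr_le0 ltW.
have [MQ EQ] := lcPhi_Pi My QQ QK QY0.
split => //; first by split => //; rewrite EQ.
move=> p Np; split => [E|E]; last first.
  rewrite /boost_field /boost E Qb0 Qf1 /boost_norm Qb0 Qf1 normE sqrtr_sqr gtr0_norm //.
  by rewrite scalerA -rE mulfK.
have q0 := boost_norm_gt0 Np; have q2 := boost_norm_sqr Np.
have qn : boost_norm (Phi p) != 0 by rewrite gt_eqF.
rewrite /boost_field /boost scalerA in E.
set P0 := b (Phi p) b0 in q2 E; set P1 := b (Phi p) f1 in q2 E.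
have P0E : b (Phi p) b0 = P0 by []. have P1E : b (Phi p) f1 = P1 by [].
clearbody P0 P1.
move: (boost_norm _) q0 q2 qn E => rp q0 q2 qn E.
have e1 : a' = c * P0 - s / rp * P1.
  by rewrite -a'E -E !bfL P0E h00 h10 K0; ring.
have e2 : b' = c * P1 - s / rp * P0.
  by rewrite -b'E -E !bfL P1E h01 h11 K1; ring.
have rr : rp = rho.
  have : rp ^+ 2 = rho ^+ 2.
    apply: (mulIf (expf_neq0 2 cn)); rewrite rho2 r2E a'E b'E e1 e2.
    have -> : (c * P0 - s / rp * P1) ^+ 2 - (c * P1 - s / rp * P0) ^+ 2 =
      (c ^+ 2 - (s / rp) ^+ 2) * (P0 ^+ 2 - P1 ^+ 2) by ring.
    by rewrite -q2; field.
  by move/eqP; rewrite eqf_sqr => /orP[/eqP //|/eqP E']; move: q0; rewrite E'; lra.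
rewrite rr in e1 e2 E; have sr : s / rho = r by rewrite -rE mulfK.
rewrite sr in e1 e2 E.
have d1 : P0 = al.
  apply: (mulIf Dn); rewrite /D.
  have -> : P0 * (c ^+ 2 - r ^+ 2) = c * (c * P0 - r * P1) + r * (c * P1 - r * P0) by ring.
  by rewrite -e1 -e2 -alE -beE; ring.
have d2 : P1 = be.
  apply: (mulIf Dn); rewrite /D.
  have -> : P1 * (c ^+ 2 - r ^+ 2) = c * (c * P1 - r * P0) + r * (c * P0 - r * P1) by ring.
  by rewrite -e1 -e2 -alE -beE; ring.
apply: (scalerI cn); move: E; rewrite -cQ d1 d2 => /addIr /addIr //.
Qed.

Lemma smooth_boost_inv : smooth_on zone (fun x =>
  boost_inv (Phi (projE x)) (sc (height x)) (ss (height x)) (se (height x))).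
Proof.
have [sP s_c s_s s_e] := smooth_zone_params.
have NP x : zone x -> N (projE x) by move=> zx; have [] := slice_projP hAA hAK eta0 zx.
have H x (zx : zone x) := boost_paramsE (zone_parameters zx) (hN (NP x zx)).
have t0 := smooth_bV b0 sP; have t1 := smooth_bV f1 sP.
have cn x : zone x -> sc (height x) != 0.
  by move=> /H[h _ _]; rewrite gt_eqF //; lra.
have srho : smooth_on zone (fun x => boost_inv_norm2 (Phi (projE x)) (sc (height x)) (ss (height x))).
  apply: smooth_on_div; last by move=> x /cn h; rewrite expf_neq0.
    apply: smooth_on_add; last exact: smooth_on_exp.
    apply: smooth_on_add; first exact: smooth_on_exp.
    by apply: smooth_on_opp; exact: smooth_on_exp.
  exact: smooth_on_exp.
have sr : smooth_on zone (fun x => ss (height x) /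
    Num.sqrt (boost_inv_norm2 (Phi (projE x)) (sc (height x)) (ss (height x)))).
  apply: smooth_on_div => //; first by apply: smooth_on_sqrt => // x /H[].
  by move=> x /H[_ h _]; rewrite gt_eqF // sqrtr_gt0.
have sD : smooth_on zone (fun x => sc (height x) ^+ 2 - (ss (height x) /
    Num.sqrt (boost_inv_norm2 (Phi (projE x)) (sc (height x)) (ss (height x)))) ^+ 2).
  apply: smooth_on_add; first exact: smooth_on_exp.
  by apply: smooth_on_opp; exact: smooth_on_exp.
have Dn x : zone x -> sc (height x) ^+ 2 - (ss (height x) /
    Num.sqrt (boost_inv_norm2 (Phi (projE x)) (sc (height x)) (ss (height x)))) ^+ 2 != 0.
  by move=> /H[_ _ h]; rewrite gt_eqF.
have cstS (Y : 'rV[R]_m) : smooth_on zone (fun=> Y) by exact: smooth_on_cst.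
apply: smooth_on_scale; first exact: smooth_on_inv.
apply: smooth_on_add; last by apply: smooth_on_opp; exact: smooth_on_scale.
apply: smooth_on_add => //; apply: smooth_on_opp; apply: smooth_on_scale => //.
apply: smooth_on_add.
  apply: smooth_on_scale => //; apply: smooth_on_div => //.
  by apply: smooth_on_add; exact: smooth_on_mul.
apply: smooth_on_opp; apply: smooth_on_scale => //; apply: smooth_on_div => //.
by apply: smooth_on_add; exact: smooth_on_mul.
Qed.

Lemma boost_ray_inverse v : (forall p, N p -> dPhi p (v p) = boost_field p) ->
  ray_inverse Mo A eta v.
Proof.
move=> vE; apply: (ambient_ray_inverse vE smooth_boost_inv).
  by move=> y c s e Ny hp; have [] := boost_invP Ny hp.
by move=> y p c s e Ny Np hp; have [_ _] := boost_invP Ny hp; apply.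
Qed.

End Boost.
End AmbientFields.

Section BoostFields.
Context {R : realType} {d m : nat} {kappa : R}.
Variable Mo : light_cone_model d m kappa.
Local Notation M := (lcM Mo).
Local Notation g := (lcg Mo).
Local Notation K := (lcK Mo).
Local Notation Phi := (lcPhi Mo).
Local Notation dPhi := (lcdPhi Mo).
Local Notation Pi := (lcPi Mo).
Local Notation b := (bf (lcJ Mo)).
Variables (A : 'rV[R]_m) (eta : R).
Hypotheses (hAA : b A A = 1) (hAK : b A K = eta) (eta0 : 0 < eta).
Local Notation N := (slice Mo A).
Local Notation k := (@slice_curv R kappa eta).
Local Notation KA := (slice_K Mo A eta).

Let hAA' : eta * b A A = eta. Proof. by rewrite hAA mulr1. Qed.

Lemma flow_pair n v (V : 'rV[R]_d -> 'rV[R]_m) p t : m = (3 + n)%N ->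
  unit_vector_field g N v -> (forall p, N p -> dPhi p (v p) = V p) ->
  geodesic_vector_field g N v -> N p -> exists q,
  [/\ N q, Phi q = slice_point Mo A eta p (V p) (cosk k t) (sink k t) (versk k t) &
      V q = slice_point Mo A eta p (V p) (- k * sink k t) (cosk k t) (sink k t)].
Proof.
move=> mn uv vV gv Np; have up := field_unit uv Np.
have := flow hAA hAK uv gv t mn Np; rewrite vV // in up *.
have [Nq qE] := geoP hAA' hAK t Np up.
by rewrite vV // => E; exists (geoE Mo A eta p (V p) t).
Qed.

Lemma sum_sqr_frame p j (f : 'I_j -> 'rV[R]_m) Z : orthonormal_at Mo A p f ->
  Z = \sum_i b Z (f i) *: f i -> b Z Z = \sum_i b Z (f i) ^+ 2.
Proof.
move=> _ {1}->; rewrite bf_suml; apply: eq_bigr => i _.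
by rewrite bfZl (lc_bfC Mo (f i)) expr2.
Qed.

Lemma sink_neq0 t : k <= 0 -> 0 < t -> sink k t != 0.
Proof. by move=> k0 t0; rewrite gt_eqF // sink_gt0 // => /lt_le_trans/(_ k0); rewrite ltxx. Qed.

Theorem boost_bifoliates n (U : set 'rV[R]_d) p0 : m = (3 + n)%N -> (1 < n)%N ->
  k < 0 -> N p0 -> model_exterior Mo A eta n U ->
  exists v, [/\ unit_vector_field g N v,
      smooth_line_foliation n M U (model_rays Mo A v),
      smooth_line_foliation n M U (model_rays Mo A (fun p => - v p)) &
      ~ geodesic_vector_field g N v].
Proof.
move=> mn n1 k0 Np0 eU; have [f [[f3 ff] fspan]] := orthonormal_frame hAA hAK Np0 mn.
have n0 : (0 < n)%N by exact: ltnW.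
pose i1 := Ordinal n0; pose i2 := Ordinal n1.
have f12 : b (f i1) (f i2) = 0 by rewrite ff.
have h11 : b (f i1) (f i1) = 1 by rewrite ff eqxx.
have h22 : b (f i2) (f i2) = 1 by rewrite ff eqxx.
move: (f3 i1) (f3 i2).
move=> [h1P h1K h1A] [h2P h2K h2A].
set s := Num.sqrt (- k); have s0 : 0 < s by rewrite sqrtr_gt0 oppr_gt0.
have s2 : s ^+ 2 = - k by rewrite sqr_sqrtr // oppr_ge0 ltW.
have sn : s != 0 by rewrite gt_eqF.
have [Mp0 p0A] := Np0.
have F1 := b_PhiKA eta Np0; have F2 := b_KAKA hAA' hAK.
have F3 := b_KKA hAK; have F4 := b_AKA hAA' hAK.
have PP := lcPhiPhi Mp0; have PK := lcPhiK Mp0.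
have fKA i : b (f i) KA = 0.
  have [_ fK fA] := f3 i; rewrite slice_KE !bfL (lc_bfC Mo _ K) fK (lc_bfC Mo _ A) fA; ring.
(* The vector k Phi p0 - KA is orthogonal to [K], [A] and the frame, and its square is k < 0;
   dividing by sqrt (- k) makes it unit timelike. *)
have [b0 b0E] : {X | X = s^-1 *: (k *: Phi p0 - KA)} by eexists.
have h00 : b b0 b0 = -1.
  rewrite b0E !bfL PP F1 F2 (lc_bfC Mo KA (Phi p0)) F1.
  transitivity (k / s ^+ 2); first by field.
  by rewrite s2 invrN mulrN divff // lt_eqF.
have h0K : b b0 K = 0 by rewrite b0E !bfL PK (lc_bfC Mo KA) F3; ring.
have h0A : b b0 A = 0 by rewrite b0E !bfL p0A (lc_bfC Mo KA) F4; ring.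
have h0f i : b b0 (f i) = 0.
  by have [fP _ _] := f3 i; rewrite b0E !bfL fP (lc_bfC Mo KA) fKA; ring.
have fK i : b (f i) K = 0 by rewrite lc_bfC; have [] := f3 i.
have fA i : b (f i) A = 0 by rewrite lc_bfC; have [] := f3 i.
(* For the geodesic from p0 to p the first square contributes (1 - k e)^2, the squared cosine, and
   Bessel's inequality bounds the second by the squared sine; then use cosk^2 + k sink^2 = 1. *)
have hN p : N p -> 1 <= - k * (b (Phi p) b0 ^+ 2 - b (Phi p) (f i1) ^+ 2).
  move=> Np; have [h3 e0 YY] := slice_vecP hAA hAK Np0 Np.
  have XE := slice_vecK Mo A eta p0 p; have G1 := b_PhiKA eta Np.
  have eE : b (Phi p) (Phi p0) = - slice_ht Mo p0 p by rewrite opprK.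
  move: (slice_vec Mo A eta p0 p) (slice_ht Mo p0 p) h3 e0 YY XE eE => Y e h3 e0 YY XE eE.
  have Yf : b (Phi p) (f i1) = b Y (f i1).
    by rewrite XE !bfL h1P (lc_bfC Mo KA) fKA; ring.
  have B : b Y (f i1) ^+ 2 <= b Y Y.
    rewrite (sum_sqr_frame (conj f3 ff) (fspan Y h3)) (bigD1 i1) //= lerDl.
    by apply: sumr_ge0 => i _; exact: sqr_ge0.
  have E0 : - k * b (Phi p) b0 ^+ 2 = (1 - k * e) ^+ 2.
    rewrite b0E !bfL eE G1 -s2 exprMn exprVn mulrA divff ?expf_neq0 //; ring.
  rewrite mulrBr E0 Yf; rewrite YY in B.
  have : - k * b Y (f i1) ^+ 2 <= - k * (2 * e - k * e ^+ 2).
    by apply: ler_wpM2l => //; rewrite oppr_ge0 ltW.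
  have -> : - k * (2 * e - k * e ^+ 2) = (1 - k * e) ^+ 2 - 1 by ring.
  lra.
pose f1' := - f i1.
have hN' p : N p -> 1 <= - k * (b (Phi p) b0 ^+ 2 - b (Phi p) f1' ^+ 2).
  by move=> Np; rewrite bfNr sqrrN; exact: hN.
have uV p : N p -> unit_tangent Mo A p (boost_field Mo b0 (f i1) p).
  by move=> Np; exact: (boost_field_unit k0 h00 h0K h0A h11 (fK _) (fA _) (h0f _) hN Np).
have sV : smooth_on N (boost_field Mo b0 (f i1)) by exact: (smooth_boost_field k0 hN).
have [uv vE] := ambient_field hAA hAK sV uV.
set v := fun x : 'rV[R]_d => _ in uv vE.
exists v.
have r1 : ray_inverse Mo A eta v.
  exact: (boost_ray_inverse hAA hAK eta0 k0 h00 h0K h0A h11 (fK _) (fA _) (h0f _) hN vE).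
have r2 : ray_inverse Mo A eta (fun p => - v p).
  have H1 : b f1' f1' = 1 by rewrite !bfL opprK.
  have H2 : b f1' K = 0 by rewrite bfNl fK oppr0.
  have H3 : b f1' A = 0 by rewrite bfNl fA oppr0.
  have H4 : b b0 f1' = 0 by rewrite bfNr h0f oppr0.
  apply: (boost_ray_inverse hAA hAK eta0 k0 h00 h0K h0A H1 H2 H3 H4 hN') => p Np.
  rewrite dPhiN vE // /boost_field /boost_norm /boost !bfNr sqrrN.
  by apply/rowP => i; rewrite !mxE; ring.
have [w1 w2 w3] := bifoliation hAA hAK eta0 mn uv r1 r2 Np0 eU.
split => // gv.
(* Not geodesic: the field has no component along [f i2], but a geodesic leaving [x] with such a
   velocity acquires the component - k sink <Phi x, f i2>. It is nonzero if [x] is reached from p0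
   in the direction [f i2]. *)
have u2 : unit_tangent Mo A p0 (f i2) by split.
have [Nx xE] := geoP hAA' hAK 1 Np0 u2.
set x := geoE Mo A eta p0 (f i2) 1 in Nx xE.
have sk : sink k 1 != 0 by apply: sink_neq0; rewrite ?ltW.
have xf2 : b (Phi x) (f i2) = sink k 1.
  by rewrite xE /geo /slice_point !bfL h2P h22 (lc_bfC Mo KA) fKA; ring.
have [q [Nq qE VqE]] := flow_pair 1 mn uv vE gv Nx.
have Vf y : b (boost_field Mo b0 (f i1) y) (f i2) = 0.
  by rewrite /boost_field /boost !bfL h0f f12; ring.
have := Vf q; have := Vf x; rewrite VqE /slice_point.
move: (boost_field Mo b0 (f i1) x) => V Vf2; rewrite !bfL Vf2 xf2 (lc_bfC Mo KA) fKA !mulr0 !addr0.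
by move/eqP; rewrite !mulf_eq0 oppr_eq0 (negbTE sk) !orbF lt_eqF.
Qed.

End BoostFields.

(** * Curvature k > 0: rotation fields *)

Section Rotation.
Context {R : realType} {j : nat}.
Variables (sg : 'I_j -> 'I_j) (ep a : 'I_j -> R).
Hypotheses (sgK : involutive sg) (ep2 : forall i, ep i ^+ 2 = 1).
Hypotheses (epN : forall i, ep (sg i) = - ep i) (asg : forall i, a (sg i) = a i).

(** The map c + r J, where J is the skew matrix that turns the plane of the coordinates i and [sg i]
    with speed [a i]; thus J^2 is diagonal with entries - a_i^2. *)
Definition rotate (c r : R) (u : 'I_j -> R) i := c * u i + r * (ep i * a i * u (sg i)).

(** The cross terms cancel in pairs under [sg], where [ep] changes sign while [h] and [a] do not. *)
Lemma rotate_sum (h u : 'I_j -> R) c r : (forall i, h (sg i) = h i) ->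
  \sum_i h i * rotate c r u i ^+ 2 = \sum_i h i * (c ^+ 2 + r ^+ 2 * a i ^+ 2) * u i ^+ 2.
Proof.
move=> hs.
have cross0 : \sum_i h i * (ep i * a i * u (sg i) * u i) = 0.
  apply/eqP; rewrite -[_ == 0](mulrn_eq0 _ 2) /= mulr2n.
  rewrite {2}(reindex_inj (can_inj sgK)) -big_split /= big1 // => i _.
  by rewrite hs epN asg sgK; ring.
have swap : \sum_i h i * (a i ^+ 2 * u (sg i) ^+ 2) = \sum_i h i * (a i ^+ 2 * u i ^+ 2).
  rewrite [RHS](reindex_inj (can_inj sgK)); apply: eq_bigr => i _.
  by rewrite hs asg.
transitivity (c ^+ 2 * (\sum_i h i * u i ^+ 2) +
  r ^+ 2 * (\sum_i h i * (a i ^+ 2 * u (sg i) ^+ 2)) +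
  2 * c * r * (\sum_i h i * (ep i * a i * u (sg i) * u i))).
  rewrite !mulr_sumr -!big_split /=; apply: eq_bigr => i _; rewrite /rotate.
  have -> : (c * u i + r * (ep i * a i * u (sg i))) ^+ 2 = c ^+ 2 * u i ^+ 2 +
    r ^+ 2 * (ep i ^+ 2 * (a i ^+ 2 * u (sg i) ^+ 2)) +
    2 * c * r * (ep i * a i * u (sg i) * u i) by ring.
  rewrite ep2; ring.
rewrite cross0 swap mulr0 addr0 !mulr_sumr -big_split /=.
by apply: eq_bigr => i _; ring.
Qed.

Lemma rotateK c r u i : rotate c (- r) (rotate c r u) i =
  (c ^+ 2 + r ^+ 2 * a i ^+ 2) * u i.
Proof.
rewrite /rotate sgK epN asg; transitivity ((c ^+ 2 + ep i ^+ 2 * (r ^+ 2 * a i ^+ 2)) * u i).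
  by ring.
by rewrite ep2 mul1r.
Qed.

End Rotation.

Section QuadraticRoot.
Context {R : realType}.
Implicit Types B C w : R.

(* The positive root of [4 w^2 + B w - C] for [C >= 0]. *)
Definition pos_root B C := (Num.sqrt (B ^+ 2 + 16 * C) - B) / 8.

(** The roots have product - C / 4 <= 0, so at most one is positive. If C = 0 they are 0 and - B /
    4, hence the condition on B. *)
Lemma pos_rootP B C : 0 <= C -> (C = 0 -> B < 0) ->
  [/\ 0 < B ^+ 2 + 16 * C, 0 < pos_root B C,
      4 * pos_root B C ^+ 2 + B * pos_root B C - C = 0 &
      forall w, 0 < w -> 4 * w ^+ 2 + B * w - C = 0 -> w = pos_root B C].
Proof.
move=> C0 B0.
have D0 : 0 < B ^+ 2 + 16 * C.
  move: C0; rewrite le_eqVlt => /orP[/eqP C0|C0]; last first.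
    by have := sqr_ge0 B; lra.
  by rewrite -C0 mulr0 addr0 exprn_even_gt0 //= lt_eqF // B0.
have w0 : 0 < pos_root B C.
  rewrite divr_gt0 // subr_gt0; have [Bn|Bp] := ltP B 0.
    by apply: lt_le_trans Bn (sqrtr_ge0 _).
  have C1 : 0 < C by rewrite lt_def C0 andbT; apply/eqP => /B0; lra.
  by rewrite -{1}(ger0_norm Bp) -sqrtr_sqr ltr_sqrt //; lra.
have s2 : Num.sqrt (B ^+ 2 + 16 * C) ^+ 2 = B ^+ 2 + 16 * C by rewrite sqr_sqrtr // ltW.
have wE : 4 * pos_root B C ^+ 2 + B * pos_root B C - C = 0.
  rewrite /pos_root; move: (Num.sqrt _) s2 => s s2.
  by transitivity ((s ^+ 2 - B ^+ 2 - 16 * C) / 16); [field | rewrite s2; field].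
split => // w wp E; move: (pos_root B C) w0 wE => w' w0 wE.
apply/eqP/negPn/negP => ne; have d0 : w - w' != 0 by rewrite subr_eq0.
have : (w - w') * (4 * (w + w') + B) = 0.
  transitivity (4 * w ^+ 2 + B * w - C - (4 * w' ^+ 2 + B * w' - C)); first by ring.
  by rewrite E wE subr0.
move/eqP; rewrite mulf_eq0 (negbTE d0) /= => /eqP H.
have BE : B = - (4 * (w + w')) by lra.
have : C = - (4 * (w * w')).
  by move: E; rewrite BE => /eqP; rewrite subr_eq0 => /eqP <-; ring.
have := mulr_gt0 wp w0; lra.
Qed.

End QuadraticRoot.

Section RotationFields.
Context {R : realType} {d m : nat} {kappa : R}.
Variable Mo : light_cone_model d m kappa.
Local Notation M := (lcM Mo).
Local Notation g := (lcg Mo).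
Local Notation K := (lcK Mo).
Local Notation Phi := (lcPhi Mo).
Local Notation dPhi := (lcdPhi Mo).
Local Notation Pi := (lcPi Mo).
Local Notation b := (bf (lcJ Mo)).
Variables (A : 'rV[R]_m) (eta : R).
Hypotheses (hAA : b A A = 1) (hAK : b A K = eta) (eta0 : 0 < eta).
Local Notation N := (slice Mo A).
Local Notation k := (@slice_curv R kappa eta).
Local Notation KA := (slice_K Mo A eta).
Local Notation height := (height Mo A eta).
Local Notation zone := (zone Mo A eta).
Local Notation sc := (@slice_c R kappa eta).
Local Notation ss := (@slice_s R kappa eta).
Local Notation se := (@slice_e R kappa eta).
Local Notation projE := (projE Mo A eta).

Let hAA' : eta * b A A = eta. Proof. by rewrite hAA mulr1. Qed.

Section SphereCoordinates.
Variables (j : nat) (f : 'I_j -> 'rV[R]_m).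
Hypotheses (k0 : 0 < k) (ff : forall i i', b (f i) (f i') = (i == i')%:R).
Hypotheses (fK : forall i, b (f i) K = 0) (fA : forall i, b (f i) A = 0).
Hypothesis fspan : forall Z, b Z K = 0 -> b Z A = 0 -> Z = \sum_i b Z (f i) *: f i.

Let kn : k != 0. Proof. by rewrite gt_eqF. Qed.

(** For k > 0, [Phi] maps N onto a round sphere: the vectors of this form with z = 1 / k whose
    coordinates [u] have sum of squares 1 / k. *)
Definition sphere_vec (u : 'I_j -> R) (z : R) : 'rV[R]_m := \sum_i u i *: f i + z *: KA.

Lemma frame_KA i : b (f i) KA = 0.
Proof. by rewrite slice_KE !bfL fK fA; ring. Qed.

Lemma frame_sum (u : 'I_j -> R) i : \sum_i' u i' * b (f i') (f i) = u i.
Proof.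
rewrite (bigD1 i) //= ff eqxx mulr1 big1 ?addr0 // => i' ne.
by rewrite ff (negbTE ne) mulr0.
Qed.

Lemma sphere_vec_coord u z i : b (sphere_vec u z) (f i) = u i.
Proof.
rewrite /sphere_vec bfDl bf_suml bfZl (lc_bfC Mo KA) frame_KA mulr0 addr0.
by rewrite -[RHS]frame_sum; apply: eq_bigr => i' _; rewrite bfZl.
Qed.

Lemma sphere_vec_norm u z : b (sphere_vec u z) (sphere_vec u z) =
  \sum_i u i ^+ 2 - k * z ^+ 2.
Proof.
have E : b (sphere_vec u z) KA = - k * z.
  rewrite /sphere_vec bfDl bf_suml bfZl b_KAKA // big1 ?add0r; first by ring.
  by move=> i _; rewrite bfZl frame_KA mulr0.
rewrite {2}/sphere_vec bfDr bf_sumr bfZr E; congr (_ + _); last by ring.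
by apply: eq_bigr => i _; rewrite bfZr sphere_vec_coord expr2.
Qed.

Lemma sphere_vecK u z : b (sphere_vec u z) K = - k * z.
Proof.
rewrite /sphere_vec bfDl bf_suml bfZl (lc_bfC Mo KA) b_KKA // big1 ?add0r; first by ring.
by move=> i _; rewrite bfZl fK mulr0.
Qed.

Lemma sphere_vecA u z : b (sphere_vec u z) A = 0.
Proof.
rewrite /sphere_vec bfDl bf_suml bfZl (lc_bfC Mo KA) b_AKA // mulr0 addr0 big1 //.
by move=> i _; rewrite bfZl fA mulr0.
Qed.

Lemma sphere_coords p : N p ->
  Phi p = sphere_vec (fun i => b (Phi p) (f i)) k^-1 /\
  \sum_i b (Phi p) (f i) ^+ 2 = k^-1.
Proof.
move=> [Mp pA].
have E : Phi p = sphere_vec (fun i => b (Phi p) (f i)) k^-1.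
  have zK : b (Phi p - k^-1 *: KA) K = 0.
    by rewrite !bfL lcPhiK // (lc_bfC Mo KA) b_KKA //; field.
  have zA : b (Phi p - k^-1 *: KA) A = 0.
    by rewrite !bfL pA (lc_bfC Mo KA) b_AKA //; ring.
  have := fspan zK zA.
  have -> : \sum_i b (Phi p - k^-1 *: KA) (f i) *: f i = \sum_i b (Phi p) (f i) *: f i.
    by apply: eq_bigr => i _; rewrite !bfL (lc_bfC Mo KA) frame_KA mulr0 subr0.
  by move=> E; rewrite /sphere_vec -E subrK.
split => //; have := lcPhiPhi Mp; rewrite {1 2}E sphere_vec_norm => /eqP.
by rewrite subr_eq0 => /eqP ->; field.
Qed.

Lemma sphere_vecP p0 u : N p0 -> \sum_i u i ^+ 2 = k^-1 ->
  N (Pi (sphere_vec u k^-1)) /\ Phi (Pi (sphere_vec u k^-1)) = sphere_vec u k^-1.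
Proof.
move=> Np0 hu; have [E0 n0] := sphere_coords Np0; have [Mp0 _] := Np0.
have F1 := b_PhiKA eta Np0.
have h1 : b (sphere_vec u k^-1) (sphere_vec u k^-1) = 0.
  by rewrite sphere_vec_norm hu; field.
have h2 : b (sphere_vec u k^-1) K = -1 by rewrite sphere_vecK; field.
have h3 : b (sphere_vec u k^-1) (Phi p0) <= 0.
  rewrite /sphere_vec bfDl bf_suml bfZl (lc_bfC Mo KA) F1.
  (* The inequality 2 u y <= u^2 + y^2 bounds the product of two points of the sphere, which gives
     the sign of the pairing with [Phi p0]. *)
  have : \sum_i 2 * (u i * b (Phi p0) (f i)) <= \sum_i (u i ^+ 2 + b (Phi p0) (f i) ^+ 2).
    apply: ler_sum => i _; have := sqr_ge0 (u i - b (Phi p0) (f i)).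
    have -> : (u i - b (Phi p0) (f i)) ^+ 2 = u i ^+ 2 + b (Phi p0) (f i) ^+ 2 -
      2 * (u i * b (Phi p0) (f i)) by ring.
    by rewrite subr_ge0.
  rewrite big_split /= hu n0 -mulr_sumr.
  have -> : \sum_i b (u i *: f i) (Phi p0) = \sum_i u i * b (Phi p0) (f i).
    by apply: eq_bigr => i _; rewrite bfZl (lc_bfC Mo (f i)).
  lra.
have [MQ EQ] := lcPhi_Pi Mp0 h1 h2 h3.
by split => //; split => //; rewrite EQ sphere_vecA.
Qed.

Variables (P : pred 'I_j) (sg : 'I_j -> 'I_j) (ep : 'I_j -> R).
Hypotheses (sgK : involutive sg) (sgP : forall i, P (sg i) = P i).
Hypotheses (ep2 : forall i, ep i ^+ 2 = 1) (epN : forall i, ep (sg i) = - ep i).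

Definition speed i : R := if P i then 1 else 2.
Local Notation a := speed.
Definition rot_norm2 (X : 'rV[R]_m) := \sum_i a i ^+ 2 * b X (f i) ^+ 2.
Definition rot (X : 'rV[R]_m) : 'rV[R]_m := \sum_i (ep i * a i * b X (f (sg i))) *: f i.
Definition rot_field p : 'rV[R]_m := (Num.sqrt (rot_norm2 (Phi p)))^-1 *: rot (Phi p).

Lemma speed_sg i : a (sg i) = a i. Proof. by rewrite /speed sgP. Qed.

Lemma speed_sqr i : 1 <= a i ^+ 2 <= 4.
Proof. by rewrite /speed; case: ifP => _; apply/andP; split; lra. Qed.

Lemma rot_norm2_gt0 p : N p -> 0 < rot_norm2 (Phi p).
Proof.
move=> /sphere_coords[_ h].
apply: (@lt_le_trans _ _ (\sum_i b (Phi p) (f i) ^+ 2)); first by rewrite h invr_gt0.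
apply: ler_sum => i _; have /andP[h1 _] := speed_sqr i.
by rewrite -{1}[_ ^+ 2]mul1r; apply: ler_wpM2r => //; exact: sqr_ge0.
Qed.

Lemma rot_coord X i : b (rot X) (f i) = ep i * a i * b X (f (sg i)).
Proof.
rewrite /rot bf_suml -[RHS](frame_sum (fun i => ep i * a i * b X (f (sg i)))).
by apply: eq_bigr => i' _; rewrite bfZl.
Qed.

Lemma rot_orth Y X : (forall i, b Y (f i) = 0) -> b Y (rot X) = 0.
Proof. by move=> h; rewrite /rot bf_sumr big1 // => i _; rewrite bfZr h mulr0. Qed.

Lemma rot_rot X : b (rot X) (rot X) = rot_norm2 X.
Proof.
rewrite {2}/rot bf_sumr /rot_norm2 (reindex_inj (can_inj sgK)); apply: eq_bigr => i _.
rewrite bfZr rot_coord sgK speed_sg.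
transitivity (ep (sg i) ^+ 2 * (a i ^+ 2 * b X (f i) ^+ 2)); first by ring.
by rewrite ep2 mul1r.
Qed.

Lemma rot_skew X : b X (rot X) = 0.
Proof.
rewrite /rot bf_sumr; apply/eqP; rewrite -[_ == 0](mulrn_eq0 _ 2) /= mulr2n.
rewrite {1}(reindex_inj (can_inj sgK)) -big_split /= big1 // => i _.
by rewrite !bfZr epN speed_sg sgK; ring.
Qed.

Lemma rot_field_unit p : N p -> unit_tangent Mo A p (rot_field p).
Proof.
move=> Np; have n0 := rot_norm2_gt0 Np.
have s0 : Num.sqrt (rot_norm2 (Phi p)) != 0 by rewrite gt_eqF // sqrtr_gt0.
split; rewrite /rot_field bfZr.
- by rewrite rot_skew mulr0.
- by rewrite rot_orth ?mulr0 // => i; rewrite lc_bfC fK.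
- by rewrite rot_orth ?mulr0 // => i; rewrite lc_bfC fA.
rewrite bfZl rot_rot -{3}(sqr_sqrtr (ltW n0)); by field.
Qed.

Lemma smooth_rot_field : smooth_on N rot_field.
Proof.
have sP := @smooth_Phi_slice _ _ _ _ Mo A; have sb i := smooth_bV Mo (f i) sP.
apply: smooth_on_scale.
  apply: smooth_on_inv; last by move=> x /rot_norm2_gt0 h; rewrite gt_eqF // sqrtr_gt0.
  apply: smooth_on_sqrt; last exact: rot_norm2_gt0.
  apply: smooth_on_sum => i; apply: smooth_on_mul; first exact: smooth_on_cst.
  exact: smooth_on_exp.
apply: smooth_on_sum => i; apply: smooth_on_scale; last exact: smooth_on_cst.
by apply: smooth_on_mul => //; exact: smooth_on_cst.
Qed.

Definition rot_root (Y : 'rV[R]_m) (c : R) : R :=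
  pos_root (5 * c ^+ 2 - k * \sum_i (5 - a i ^+ 2) * b Y (f i) ^+ 2) (c ^+ 2 * (1 - c ^+ 2)).

Definition rot_inv (Y : 'rV[R]_m) (c s e : R) : 'rV[R]_m :=
  sphere_vec (fun i => rotate sg ep a c (- Num.sqrt (rot_root Y c)) (fun i => b Y (f i)) i /
    (c ^+ 2 + rot_root Y c * a i ^+ 2)) k^-1.

Lemma rot_den (c w : R) i : 0 < w -> 0 < c ^+ 2 + w * a i ^+ 2.
Proof.
move=> w0; have /andP[h1 _] := speed_sqr i.
by have := sqr_ge0 c; have : 0 < w * a i ^+ 2 by [apply: mulr_gt0; lra]; lra.
Qed.

(** The squared speeds q are roots of (q - 1)(q - 4). Hence (c^2 + w)(c^2 + 4 w) / (c^2 + w q) = c^2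
    + (5 - q) w, and clearing denominators leaves a quadratic equation in w. *)
Lemma rot_quadratic (y : 'I_j -> R) (c w : R) : \sum_i y i ^+ 2 = k^-1 -> 0 < w ->
  \sum_i y i ^+ 2 / (c ^+ 2 + w * a i ^+ 2) = k^-1 <->
  4 * w ^+ 2 + (5 * c ^+ 2 - k * \sum_i (5 - a i ^+ 2) * y i ^+ 2) * w -
    c ^+ 2 * (1 - c ^+ 2) = 0.
Proof.
move=> y1 w0; have c0 := sqr_ge0 c.
set D := (c ^+ 2 + w) * (c ^+ 2 + 4 * w).
have D0 : 0 < D by rewrite mulr_gt0; lra.
have E : D * (\sum_i y i ^+ 2 / (c ^+ 2 + w * a i ^+ 2)) =
    c ^+ 2 / k + w * \sum_i (5 - a i ^+ 2) * y i ^+ 2.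
  rewrite -y1 mulr_sumr mulr_sumr mulr_sumr -big_split /=; apply: eq_bigr => i _.
  have dn : c ^+ 2 + w * a i ^+ 2 != 0 by rewrite gt_eqF // rot_den.
  have aa : (a i ^+ 2 - 1) * (a i ^+ 2 - 4) = 0 by rewrite /speed; case: ifP => _; ring.
  move: (a i ^+ 2) dn aa => q dn aa; apply: (mulIf dn).
  rewrite mulrA mulfVK // /D.
  transitivity ((c ^+ 2 * y i ^+ 2 + w * ((5 - q) * y i ^+ 2)) * (c ^+ 2 + w * q) +
    w ^+ 2 * y i ^+ 2 * ((q - 1) * (q - 4))); first by ring.
  by rewrite aa mulr0 addr0.
move: (\sum_i (5 - a i ^+ 2) * y i ^+ 2) E => T E.
split=> [H|H].
  move: E; rewrite H => E.
  transitivity (k * (D * k^-1 - (c ^+ 2 / k + w * T))); first by rewrite /D; field.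
  by rewrite E subrr mulr0.
apply: (mulfI (lt0r_neq0 D0)); rewrite E.
apply/eqP; rewrite -subr_eq0; apply/eqP.
transitivity (- k^-1 * (4 * w ^+ 2 + (5 * c ^+ 2 - k * T) * w - c ^+ 2 * (1 - c ^+ 2))).
  by rewrite /D; field.
by rewrite H mulr0.
Qed.

(** Here C = c^2 k s^2 vanishes only if c = 0, and then B is negative because 5 - a_i^2 >= 1. *)
Lemma rot_rootP y c s e : N y -> @slice_parameters R kappa eta c s e ->
  let B := 5 * c ^+ 2 - k * \sum_i (5 - a i ^+ 2) * b (Phi y) (f i) ^+ 2 in
  let C := c ^+ 2 * (1 - c ^+ 2) in
  [/\ 0 < B ^+ 2 + 16 * C, 0 < rot_root (Phi y) c,
      4 * rot_root (Phi y) c ^+ 2 + B * rot_root (Phi y) c - C = 0 &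
      forall w, 0 < w -> 4 * w ^+ 2 + B * w - C = 0 -> w = rot_root (Phi y) c].
Proof.
move=> Ny hp B C; have [e0 s0 c1 cs ce hse _] := hp; have [_ y1] := sphere_coords Ny.
have ks : 0 < k * s ^+ 2 by rewrite mulr_gt0 // exprn_gt0.
have c2 : 1 - c ^+ 2 = k * s ^+ 2 by rewrite -cs; ring.
apply: pos_rootP; first by rewrite /C c2 mulr_ge0 ?sqr_ge0 // ltW.
move=> /eqP; rewrite /C c2 mulf_eq0 (gt_eqF ks) orbF => /eqP C0.
rewrite /B C0 mulr0 sub0r oppr_lt0 mulr_gt0 //.
apply: (@lt_le_trans _ _ (\sum_i b (Phi y) (f i) ^+ 2)); first by rewrite y1 invr_gt0.
apply: ler_sum => i _; have /andP[_ h1] := speed_sqr i.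
by rewrite -{1}[_ ^+ 2]mul1r; apply: ler_wpM2r; rewrite ?sqr_ge0 //; lra.
Qed.

(** The root [w] stands for (s / rho)^2, with rho the length of the velocity at p. Inverting
    [rotate] gives candidate coordinates [q]; the quadratic equation says that they lie on the
    sphere, and [qa] that the length there is indeed s / sqrt w. *)
Lemma rot_invP y c s e : N y -> @slice_parameters R kappa eta c s e ->
  [/\ N (Pi (rot_inv (Phi y) c s e)),
     Phi (Pi (rot_inv (Phi y) c s e)) = rot_inv (Phi y) c s e &
     forall p, N p -> c *: Phi p + s *: rot_field p + e *: KA = Phi y <->
       Phi p = rot_inv (Phi y) c s e].
Proof.
move=> Ny hp; have [e0 s0 c1 cs ce hse _] := hp; have [yE y1] := sphere_coords Ny.
have [_ w0 wE wU] := rot_rootP Ny hp; rewrite /rot_inv.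
move: (rot_root (Phi y) c) w0 wE wU => w w0 wE wU.
have r2 : Num.sqrt w ^+ 2 = w by rewrite sqr_sqrtr // ltW.
have r0 : 0 < Num.sqrt w by rewrite sqrtr_gt0.
move: (Num.sqrt w) r2 r0 => r r2 r0.
set v := fun i : 'I_j => b (Phi y) (f i) in yE y1 wE wU *.
rewrite -[\sum_i _]/(\sum_i v i ^+ 2) in y1.
pose dd i : R := c ^+ 2 + w * a i ^+ 2.
have dn i : dd i != 0 by rewrite gt_eqF // rot_den.
have dsg i : dd (sg i) = dd i by rewrite /dd speed_sg.
pose q i : R := rotate sg ep a c (- r) v i / dd i.
rewrite -[sphere_vec _ _]/(sphere_vec q k^-1).
have wQ := (rot_quadratic c y1 w0).2 wE.
have sumq (h : 'I_j -> R) : (forall i, h (sg i) = h i) ->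
    \sum_i h i * dd i * q i ^+ 2 = \sum_i h i * v i ^+ 2.
  move=> hs.
  transitivity (\sum_i (h i / dd i) * rotate sg ep a c (- r) v i ^+ 2).
    apply: eq_bigr => i _; rewrite /q; field; exact: dn.
  rewrite (rotate_sum sgK ep2 epN speed_sg); last by move=> i; rewrite hs dsg.
  by apply: eq_bigr => i _; rewrite sqrrN r2 -/(dd i) mulfVK.
have q1 : \sum_i q i ^+ 2 = k^-1.
  rewrite -wQ; have H := sumq (fun i => (dd i)^-1) (fun i => congr1 _ (dsg i)).
  transitivity (\sum_i (dd i)^-1 * dd i * q i ^+ 2).
    by apply: eq_bigr => i _; rewrite mulVf // mul1r.
  by rewrite H; apply: eq_bigr => i _; rewrite mulrC.
(* The sums of [dd i * q i ^+ 2], of [v i ^+ 2] and of [q i ^+ 2] all equal 1 / k, so the part with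
   the speeds is (1 - c^2) / k = s^2. *)
have qa : w * (\sum_i a i ^+ 2 * q i ^+ 2) = s ^+ 2.
  have H : \sum_i dd i * q i ^+ 2 = k^-1.
    have := sumq (fun=> 1) (fun=> erefl).
    under eq_bigr do rewrite mul1r.
    by move=> ->; rewrite -y1; apply: eq_bigr => i _; rewrite mul1r.
  have E : \sum_i dd i * q i ^+ 2 = c ^+ 2 / k + w * (\sum_i a i ^+ 2 * q i ^+ 2).
    by rewrite -q1 !mulr_sumr -big_split; apply: eq_bigr => i _; rewrite /dd /=; ring.
  have E2 : w * (\sum_i a i ^+ 2 * q i ^+ 2) = k^-1 - c ^+ 2 / k.
    by apply: (addrI (c ^+ 2 / k)); rewrite -E H; ring.
  by rewrite E2; apply: (mulfI kn); transitivity (1 - c ^+ 2); [field | rewrite -cs; ring].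
have [NQ EQ] := sphere_vecP Ny q1.
split => // p Np; have [pE p1] := sphere_coords Np.
have n0 := rot_norm2_gt0 Np; rewrite /rot_field.
split=> [E|E]; last first.
  have nE : Num.sqrt (rot_norm2 (Phi p)) = s / r.
    have -> : rot_norm2 (Phi p) = (s / r) ^+ 2.
      rewrite expr_div_n r2 -qa mulrC mulKf ?gt_eqF // E.
      by apply: eq_bigr => i _; rewrite sphere_vec_coord.
    by rewrite sqrtr_sqr gtr0_norm // divr_gt0.
  rewrite scalerA nE invf_div mulrC mulfVK ?gt_eqF // [RHS]yE E /sphere_vec.
  rewrite scalerDr scalerA -!addrA (addrC (c / k *: KA)) -!addrA -scalerDl !addrA.
  have -> : e + c / k = k^-1 by rewrite ce; field.
  congr (_ + _); rewrite /rot !scaler_sumr -big_split; apply: eq_bigr => i _ /=.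
  rewrite scalerA scalerA -scalerDl; congr (_ *: _).
  rewrite -/(sphere_vec q k^-1) sphere_vec_coord.
  apply: (mulfI (dn i)); transitivity (rotate sg ep a c r (rotate sg ep a c (- r) v) i).
    rewrite [RHS]/rotate -!/(dd _).
    have qE i' : rotate sg ep a c (- r) v i' = dd i' * q i' by rewrite /q mulrC mulfVK.
    by rewrite !qE dsg; ring.
  by rewrite -{1}(opprK r) (rotateK sgK ep2 epN speed_sg) sqrrN r2.
have rho2 : Num.sqrt (rot_norm2 (Phi p)) ^+ 2 = rot_norm2 (Phi p) by rewrite sqr_sqrtr // ltW.
have rho0 : 0 < Num.sqrt (rot_norm2 (Phi p)) by rewrite sqrtr_gt0.
move: (Num.sqrt _) rho2 rho0 E => rho rho2 rho0; rewrite scalerA => E.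
pose u i := b (Phi p) (f i).
have vu i : v i = rotate sg ep a c (s / rho) u i.
  rewrite /v -E bfDl bfDl !bfZl (lc_bfC Mo KA) frame_KA rot_coord mulr0 addr0.
  by [].
have w'0 : 0 < (s / rho) ^+ 2 by rewrite exprn_gt0 // divr_gt0.
have w'E : (s / rho) ^+ 2 = w.
  apply: wU => //; apply/(rot_quadratic c y1 w'0); rewrite -p1.
  transitivity (\sum_i (c ^+ 2 + (s / rho) ^+ 2 * a i ^+ 2)^-1 * rotate sg ep a c (s / rho) u i ^+ 2).
    by apply: eq_bigr => i _; rewrite vu mulrC.
  rewrite (rotate_sum sgK ep2 epN speed_sg); last by move=> i; rewrite speed_sg.
  by apply: eq_bigr => i _; rewrite mulVf ?mul1r // gt_eqF // rot_den.
have rE : s / rho = r.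
  have : (s / rho) ^+ 2 = r ^+ 2 by rewrite w'E r2.
  move/eqP; rewrite eqf_sqr => /orP[/eqP //|/eqP E'].
  by have := divr_gt0 s0 rho0; rewrite E'; lra.
rewrite pE; congr sphere_vec; apply/funext => i.
apply: (mulIf (dn i)); rewrite /q mulfVK // -/(u i).
have -> : v = rotate sg ep a c r u by apply/funext => i'; rewrite vu rE.
by rewrite (rotateK sgK ep2 epN speed_sg) r2 mulrC.
Qed.

Lemma smooth_rot_inv : smooth_on zone (fun x =>
  rot_inv (Phi (projE x)) (sc (height x)) (ss (height x)) (se (height x))).
Proof.
have [sP s_c s_s s_e] := smooth_zone_params hAA hAK eta0.
have NP x : zone x -> N (projE x) by move=> zx; have [] := slice_projP hAA hAK eta0 zx.
have H x (zx : zone x) := rot_rootP (NP x zx) (zone_parameters eta0 zx).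
have sb i := smooth_bV Mo (f i) sP.
have cst (z : R) : smooth_on zone (fun=> z) by exact: smooth_on_cst.
have cstW (z : 'rV[R]_m) : smooth_on zone (fun=> z) by exact: smooth_on_cst.
have sc2 : smooth_on zone (fun x => sc (height x) ^+ 2) by exact: smooth_on_exp.
have sB : smooth_on zone (fun x => 5 * sc (height x) ^+ 2 -
    k * \sum_i (5 - a i ^+ 2) * b (Phi (projE x)) (f i) ^+ 2).
  apply: smooth_on_add; first exact: smooth_on_mul.
  apply: smooth_on_opp; apply: smooth_on_mul => //; apply: smooth_on_sum => i.
  by apply: smooth_on_mul => //; exact: smooth_on_exp.
have sw : smooth_on zone (fun x => rot_root (Phi (projE x)) (sc (height x))).
  apply: smooth_on_mul => //; apply: smooth_on_add; last exact: smooth_on_opp.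
  apply: smooth_on_sqrt; last by move=> x /H[].
  apply: smooth_on_add; first exact: smooth_on_exp.
  apply: smooth_on_mul => //; apply: smooth_on_mul => //.
  by apply: smooth_on_add => //; exact: smooth_on_opp.
apply: smooth_on_add => //; apply: smooth_on_sum => i; apply: smooth_on_scale => //.
apply: smooth_on_div; last 1 first.
- by move=> x /H[_ h _ _]; rewrite gt_eqF // rot_den.
- apply: smooth_on_add; apply: smooth_on_mul => //; last by apply: smooth_on_mul.
  by apply: smooth_on_opp; apply: smooth_on_sqrt => // x /H[].
- by apply: smooth_on_add => //; apply: smooth_on_mul.
Qed.

Lemma rot_ray_inverse v : (forall p, N p -> dPhi p (v p) = rot_field p) ->
  ray_inverse Mo A eta v.
Proof.
move=> vE; apply: (ambient_ray_inverse hAA hAK eta0 vE smooth_rot_inv).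
  by move=> y c s e Ny hp; have [] := rot_invP Ny hp.
by move=> y p c s e Ny Np hp; have [_ _] := rot_invP Ny hp; apply.
Qed.

End SphereCoordinates.
End RotationFields.

Section SphereFields.
Context {R : realType} {d m : nat} {kappa : R}.
Variable Mo : light_cone_model d m kappa.
Local Notation M := (lcM Mo).
Local Notation g := (lcg Mo).
Local Notation K := (lcK Mo).
Local Notation Phi := (lcPhi Mo).
Local Notation dPhi := (lcdPhi Mo).
Local Notation Pi := (lcPi Mo).
Local Notation b := (bf (lcJ Mo)).
Variables (A : 'rV[R]_m) (eta : R).
Hypotheses (hAA : b A A = 1) (hAK : b A K = eta) (eta0 : 0 < eta).
Local Notation N := (slice Mo A).
Local Notation k := (@slice_curv R kappa eta).
Local Notation KA := (slice_K Mo A eta).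
Hypothesis k0 : 0 < k.

Let hAA' : eta * b A A = eta. Proof. by rewrite hAA mulr1. Qed.
Let kn : k != 0. Proof. by rewrite gt_eqF. Qed.

(** The frame at p0 is completed by the normalized k Phi p0 - KA, which points from the centre of
    the sphere to p0. *)
Lemma sphere_frame n p0 : m = (3 + n)%N -> N p0 -> exists f : 'I_n.+1 -> 'rV[R]_m,
  [/\ forall i i', b (f i) (f i') = (i == i')%:R,
      forall i, b (f i) K = 0, forall i, b (f i) A = 0 &
      forall Z, b Z K = 0 -> b Z A = 0 -> Z = \sum_i b Z (f i) *: f i].
Proof.
move=> mn Np0; have [f [[f3 ff] fspan]] := orthonormal_frame hAA hAK Np0 mn.
set s := Num.sqrt k; have s0 : 0 < s by rewrite sqrtr_gt0.
have s2 : s ^+ 2 = k by rewrite sqr_sqrtr // ltW.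
have sn : s != 0 by rewrite gt_eqF.
have [Mp0 p0A] := Np0.
have F1 := b_PhiKA eta Np0; have F2 := b_KAKA hAA' hAK.
have F3 := b_KKA hAK; have F4 := b_AKA hAA' hAK.
have PP := lcPhiPhi Mp0; have PK := lcPhiK Mp0.
have fKA i : b (f i) KA = 0.
  have [_ fK fA] := f3 i; rewrite slice_KE !bfL (lc_bfC Mo _ K) fK (lc_bfC Mo _ A) fA; ring.
have [b0 b0E] : {X | X = s^-1 *: (k *: Phi p0 - KA)} by eexists.
have h00 : b b0 b0 = 1.
  rewrite b0E !bfL PP F1 F2 (lc_bfC Mo KA (Phi p0)) F1.
  by transitivity (k / s ^+ 2); [field | rewrite s2 divff].
have h0K : b b0 K = 0 by rewrite b0E !bfL PK (lc_bfC Mo KA) F3; ring.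
have h0A : b b0 A = 0 by rewrite b0E !bfL p0A (lc_bfC Mo KA) F4; ring.
have h0f i : b b0 (f i) = 0.
  by have [fP _ _] := f3 i; rewrite b0E !bfL fP (lc_bfC Mo KA) fKA; ring.
pose f' (i : 'I_n.+1) := if unlift ord0 i is Some i' then f i' else b0.
have f'0 : f' ord0 = b0 by rewrite /f' unlift_none.
have f'S i : f' (lift ord0 i) = f i by rewrite /f' liftK.
have neqL (i : 'I_n) : (lift ord0 i == ord0) = false by rewrite eq_sym; exact/negbTE/neq_lift.
have neqR (i : 'I_n) : (ord0 == lift ord0 i) = false by exact/negbTE/neq_lift.
exists f'; split=> [i i'|i|i|Z ZK ZA].
- case: (unliftP ord0 i) => [i1 ->|->]; case: (unliftP ord0 i') => [i2 ->|->];
    rewrite ?f'0 ?f'S.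
  + by rewrite ff (inj_eq lift_inj).
  + by rewrite lc_bfC h0f neqL.
  + by rewrite h0f neqR.
  + by rewrite h00 eqxx.
- case: (unliftP ord0 i) => [i1 ->|->]; rewrite ?f'0 ?f'S // lc_bfC.
  by have [] := f3 i1.
- case: (unliftP ord0 i) => [i1 ->|->]; rewrite ?f'0 ?f'S // lc_bfC.
  by have [] := f3 i1.
have ZKA : b Z KA = 0 by rewrite slice_KE !bfL ZK ZA; ring.
have Zb : b Z b0 = s * b Z (Phi p0).
  by rewrite b0E !bfL ZKA -s2; field.
have h3 : orth3 Mo A p0 (Z - b Z b0 *: b0).
  split; rewrite !bfL !(lc_bfC Mo _ b0) ?h0K ?h0A ?(lc_bfC Mo _ Z) ?ZK ?ZA; try by ring.
  have -> : b b0 (Phi p0) = s^-1.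
    by rewrite b0E !bfL PP (lc_bfC Mo KA) F1; ring.
  by rewrite Zb; field.
have := fspan _ h3; under eq_bigr do rewrite bfDl bfNl bfZl h0f mulr0 subr0.
move=> E; rewrite big_ord_recl f'0; under eq_bigr do rewrite f'S.
by rewrite -E addrC subrK.
Qed.

(** N is the continuous image of a Euclidean sphere. This makes the parity assumption of the theorem
    applicable when k > 0. *)
Lemma compact_slice n p0 : m = (3 + n)%N -> N p0 -> compact N.
Proof.
move=> mn Np0; have [f [ff fK fA fspan]] := sphere_frame mn Np0.
pose S := [set u : 'rV[R]_n.+1 | \sum_i u ord0 i ^+ 2 = k^-1].
pose F (u : 'rV[R]_n.+1) := sphere_vec Mo A eta f (fun i => u ord0 i) k^-1.
have FP u (Su : S u) := sphere_vecP hAA hAK k0 ff fK fA fspan Np0 Su.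
have NE : N = (fun u => Pi (F u)) @` S.
  apply/seteqP; split => x.
    move=> Nx; have [E n1] := sphere_coords hAA hAK k0 ff fK fA fspan Nx.
    exists (\row_i b (Phi x) (f i)).
      by rewrite /S /= -n1; apply: eq_bigr => i _; rewrite mxE.
    have -> : F (\row_i b (Phi x) (f i)) = Phi x.
      by rewrite [RHS]E /F /sphere_vec; congr (_ + _); apply: eq_bigr => i _; rewrite mxE.
    by rewrite lcPi_Phi //; case: Nx.
  by move=> [u Su <-]; have [] := FP u Su.
have sc i (T : set 'rV[R]_n.+1) : smooth_on T (fun u : 'rV[R]_n.+1 => u ord0 i).
  by apply: (smooth_on_coord (f := id)); exact: smooth_on_id.
rewrite NE; apply: continuous_compact.
  apply: smooth_on_continuous; apply: (smooth_on_comp _ (lc_smoothPi (l := Mo))).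
    apply: smooth_on_add; last exact: smooth_on_cst.
    by apply: smooth_on_sum => i; apply: smooth_on_scale => //; exact: smooth_on_cst.
  move=> u Su; have [[Mx _] E] := FP u Su.
  by exists (Pi (F u)).
apply: bounded_closed_compact.
  exists (k^-1 + 1); split; first exact: num_real.
  move=> B hB u Su; apply: le_trans (ltW hB).
  rewrite [leLHS]/Num.norm /= mx_normrE; apply/bigmax_leP; split => [|[i1 i2] _ /=].
    by rewrite addr_ge0 // invr_ge0 ltW.
  rewrite (ord1 i1).
  have h : u ord0 i2 ^+ 2 <= k^-1.
    by rewrite -Su (bigD1 i2) //= lerDl; apply: sumr_ge0 => i _; exact: sqr_ge0.
  rewrite ler_norml; apply/andP; split.
    have := sqr_ge0 (u ord0 i2 + 1); have := sqr_ge0 (u ord0 i2); nra.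
  have := sqr_ge0 (u ord0 i2 - 1); have := sqr_ge0 (u ord0 i2); nra.
have -> : S = (fun u : 'rV[R]_n.+1 => \sum_i u ord0 i ^+ 2) @^-1` [set k^-1] by [].
apply: closed_comp; last exact: closed_eq.
move=> u _; have : smooth_on setT (fun u : 'rV[R]_n.+1 => \sum_i u ord0 i ^+ 2).
  by apply: smooth_on_sum => i; exact: smooth_on_exp.
by move=> /smooth_on_continuous_at; apply => //; exact: openT.
Qed.

Theorem rot_bifoliates n (U : set 'rV[R]_d) p0 : m = (3 + n)%N -> (1 < n)%N -> odd n ->
  N p0 -> model_exterior Mo A eta n U ->
  exists v, [/\ unit_vector_field g N v,
      smooth_line_foliation n M U (model_rays Mo A v),
      smooth_line_foliation n M U (model_rays Mo A (fun p => - v p)) &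
      ~ geodesic_vector_field g N v].
Proof.
move=> mn n1 on Np0 eU; have [f [ff fK fA fspan]] := sphere_frame mn Np0.
(* The n + 1 coordinates are paired as 2 i and 2 i + 1, which is possible as n is odd. The first
   pair turns with speed 1 and all others with speed 2; n > 1 odd guarantees a second pair. *)
pose sgn (i : nat) := if odd i then i.-1 else i.+1.
have sgnL i : (i < n.+1)%N -> (sgn i < n.+1)%N.
  rewrite /sgn => h; case: ifP => oi; first by rewrite (leq_ltn_trans (leq_pred _)).
  rewrite ltn_neqAle h andbT; apply/negP => /eqP E.
  by move: oi on; rewrite -[i]/(i.+1.-1) E /= => ->.
have sgnK i : sgn (sgn i) = i.
  rewrite /sgn; case: (boolP (odd i)) => oi /=; last by rewrite oi.
  by case: i oi => // i; rewrite /= => /negbTE ->.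
have sgnO i : odd (sgn i) = ~~ odd i.
  rewrite /sgn; case: (boolP (odd i)) => oi /=; last by rewrite oi.
  by case: i oi => // i; rewrite /= => /negbTE ->.
pose sg (i : 'I_n.+1) : 'I_n.+1 := Ordinal (sgnL i (ltn_ord i)).
pose P (i : 'I_n.+1) := (i < 2)%N.
pose ep (i : 'I_n.+1) : R := (-1) ^+ odd i.
pose ep' (i : 'I_n.+1) : R := - ep i.
have sgK : involutive sg by move=> i; apply: val_inj; exact: sgnK.
have sgP i : P (sg i) = P i.
  rewrite /P /= /sgn; case: i => [[|[|[|i]]] hi] //=; rewrite negbK.
  by case: ifP => //; case: i {hi}.
have ep2 i : ep i ^+ 2 = 1 by rewrite sqrr_sign.
have epN i : ep (sg i) = - ep i by rewrite /ep /= sgnO signrN.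
have ep'2 i : ep' i ^+ 2 = 1 by rewrite sqrrN ep2.
have ep'N i : ep' (sg i) = - ep' i by rewrite /ep' epN.
have uV p : N p -> unit_tangent Mo A p (rot_field Mo f P sg ep p).
  exact: (rot_field_unit hAA hAK k0 ff fK fA fspan sgK sgP ep2 epN).
have sV := smooth_rot_field hAA hAK k0 ff fK fA fspan P sg ep.
have [uv vE] := ambient_field hAA hAK sV uV.
set v := fun x : 'rV[R]_d => _ in uv vE.
exists v.
have r1 : ray_inverse Mo A eta v.
  exact: (rot_ray_inverse hAA hAK eta0 k0 ff fK fA fspan sgK sgP ep2 epN vE).
have r2 : ray_inverse Mo A eta (fun p => - v p).
  apply: (rot_ray_inverse hAA hAK eta0 k0 ff fK fA fspan sgK sgP ep'2 ep'N) => p Np.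
  rewrite dPhiN vE // /rot_field -scalerN; congr (_ *: _).
  by rewrite /rot -sumrN; apply: eq_bigr => i _; rewrite /ep' !mulNr scaleNr.
have [w1 w2 w3] := bifoliation hAA hAK eta0 mn uv r1 r2 Np0 eU.
split => // gv.
have n2 : (2 < n.+1)%N by [].
pose i2 : 'I_n.+1 := Ordinal n2.
(* Not geodesic: start with equal components in a slow and in a fast plane. If the field is carried
   along the great circle, [key] forces both squared speeds to equal k rx rq, so that 1 = 4. *)
pose u (i : 'I_n.+1) : R := if (i == ord0) || (i == i2) then (Num.sqrt (2 * k))^-1 else 0.
have r0 : 0 < Num.sqrt (2 * k) by rewrite sqrtr_gt0 mulr_gt0.
have u1 : \sum_i u i ^+ 2 = k^-1.
  rewrite (bigD1 ord0) //= (bigD1 i2) //= big1; last first.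
    by move=> i /andP[h1 h2]; rewrite /u (negbTE h1) (negbTE h2) expr0n.
  by rewrite /u !eqxx /= exprVn sqr_sqrtr ?mulr_ge0 ?(ltW k0) //; field.
have [Nx xE] := sphere_vecP hAA hAK k0 ff fK fA fspan Np0 u1.
set x := Pi _ in Nx xE.
have xf i : b (Phi x) (f i) = u i by rewrite xE (sphere_vec_coord eta ff fK fA).
have t0 : 0 < pi / Num.sqrt k / 2 :> R.
  by rewrite divr_gt0 // divr_gt0 ?pi_gt0 // sqrtr_gt0.
have S0 : 0 < sink k (pi / Num.sqrt k / 2).
  by apply: sink_gt0 => // _; rewrite ltr_pdivrMr //; lra.
have [q [Nq qE VqE]] := flow_pair hAA hAK (pi / Num.sqrt k / 2) mn uv vE gv Nx.
move: (cosk _ _) (sink _ _) (versk _ _) S0 qE VqE => C S E S0 qE VqE.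
have nx := rot_norm2_gt0 hAA hAK k0 ff fK fA fspan P Nx.
have nq := rot_norm2_gt0 hAA hAK k0 ff fK fA fspan P Nq.
have Vf y i : b (rot_field Mo f P sg ep y) (f i) =
    (Num.sqrt (rot_norm2 Mo f P (Phi y)))^-1 * (ep i * speed P i * b (Phi y) (f (sg i))).
  by rewrite /rot_field bfZl rot_coord.
have rx0 : 0 < Num.sqrt (rot_norm2 Mo f P (Phi x)) by rewrite sqrtr_gt0.
have rq0 : 0 < Num.sqrt (rot_norm2 Mo f P (Phi q)) by rewrite sqrtr_gt0.
have Vfx := Vf x; have Vfq := Vf q; rewrite VqE in Vfq.
move: (rot_field Mo f P sg ep x) qE Vfx Vfq => V qE Vfx Vfq.
move: (Num.sqrt (rot_norm2 _ _ _ _)) rx0 Vfx Vfq => rx rx0 Vfx Vfq.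
move: (Num.sqrt (rot_norm2 _ _ _ _)) rq0 Vfq => rq rq0 Vfq.
have key i : u (sg i) = 0 -> u i != 0 -> speed P i ^+ 2 = k * rx * rq.
  move=> ui0 uin; have := Vfq i.
  rewrite qE /slice_point !bfL !xf !Vfx sgK !xf !(lc_bfC Mo KA) !(frame_KA eta fK fA) ui0.
  rewrite epN speed_sg // => H.
  have Sn : S != 0 by rewrite gt_eqF.
  have rxn : rx != 0 by rewrite gt_eqF.
  have rqn : rq != 0 by rewrite gt_eqF.
  apply: (mulIf (mulf_neq0 Sn uin)).
  transitivity (ep i ^+ 2 * speed P i ^+ 2 * (S * u i)); first by rewrite ep2 mul1r.
  apply: (etrans _ (etrans (congr1 (fun z => - (rx * rq) * z) (esym H)) _)).
    by rewrite /=; field; rewrite ?rxn ?rqn.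
  by rewrite /=; ring.
have un : (Num.sqrt (2 * k))^-1 != 0 by rewrite invr_eq0 gt_eqF.
have h0 : speed P ord0 ^+ 2 = k * rx * rq by apply: key; rewrite /u //=.
have h2 : speed P i2 ^+ 2 = k * rx * rq by apply: key; rewrite /u //=.
by move: h2; rewrite -h0 /speed /P /=; lra.
Qed.

End SphereFields.

(** * A scalar implicit function *)

Section ImplicitFunction.
Context {R : realType}.
Variables (g g' : R -> R) (L : R).
Hypotheses (gd : forall t : R, is_derive t (1 : R) g (g' t)) (sg : smooth_open setT g).
Hypotheses (sg' : smooth_open setT g') (gL : forall t, `|g' t| <= L) (g1 : forall t, `|g t| <= 1).

Let i0 : 'I_2 := ord0.
Let i1 : 'I_2 := lift ord0 ord0.

(** On this domain the derivative in t of the left-hand side of the equation is at least 1/2, whence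
    uniqueness and the Lipschitz constant 2. *)
Definition implicit_dom : set 'rV[R]_2 := [set w | 2 * `|w ord0 i1| * L < 1].

(** A solution exists for every [w], by the intermediate value theorem and because [g] is bounded by
    1, so the default value 0 is never taken for lack of one. *)
Definition implicit (w : 'rV[R]_2) : R := xget 0 [set t | t + w ord0 i1 * g t = w ord0 i0].

Let cg t : {for t, continuous g}. Proof. by have [h _] := sg 0%N; apply: h. Qed.
Let cg' t : {for t, continuous g'}. Proof. by have [h _] := sg' 0%N; apply: h. Qed.
Let L0 : 0 <= L. Proof. exact: le_trans (normr_ge0 _) (gL 0). Qed.

Lemma implicitE w : implicit w + w ord0 i1 * g (implicit w) = w ord0 i0.
Proof.
rewrite /implicit; case: xgetP => [t _ //|H].
set s := w ord0 i1 in H *; set z := w ord0 i0 in H *.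
have B t : `|s * g t| <= `|s| by rewrite normrM ler_piMr.
have cF : {within `[z - `|s|, z + `|s|], continuous (fun t => t + s * g t)}.
  apply: continuous_subspaceT => t; apply: cvgD; first exact: cvg_id.
  by apply: cvgM; [exact: cvg_cst|exact: cg].
have le : z - `|s| <= z + `|s| by have := normr_ge0 s; lra.
have := B (z - `|s|); have := B (z + `|s|); rewrite !ler_norml => /andP[h1 h2] /andP[h3 h4].
have [|t _ tE] := IVT (v := z) le cF; last by case: (H t).
rewrite ge_min le_max; apply/andP; split; apply/orP; [left|right]; lra.
Qed.

Let mvt (x h : R) : exists2 xi, `|xi| <= `|h| & g (h + x) - g x = h * g' (xi + x).
Proof.
have [xi xih E] : exists2 xi, `|xi| <= `|h| & g (h *: (1 : R) + x) - g x = h * 'D_(1 : R) g (xi *: (1 : R) + x).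
  by apply: mvt_line => s _; have [] := gd (s *: 1 + x).
exists xi => //; have [_ H] := gd (xi *: (1 : R) + x).
by move: E; rewrite H; rewrite /GRing.scale /= !mulr1.
Qed.

Lemma implicit_lip w w' : implicit_dom w -> implicit_dom w' ->
  `|implicit w' - implicit w| <=
  2 * (`|w' ord0 i0 - w ord0 i0| + `|w' ord0 i1 - w ord0 i1|).
Proof.
move=> Ow Ow'; have E := implicitE w; have E' := implicitE w'.
have [xi _ X] := mvt (implicit w) (implicit w' - implicit w); rewrite subrK in X.
move: (implicit w) (implicit w') E E' X => t t' E E' X.
have D : (t' - t) * (1 + w' ord0 i1 * g' (xi + t)) =
    (w' ord0 i0 - w ord0 i0) - (w' ord0 i1 - w ord0 i1) * g t.
  by rewrite -E -E' mulrDr mulr1 (mulrCA (t' - t)) -X; ring.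
have h1 : `|w' ord0 i1 * g' (xi + t)| <= 2^-1.
  rewrite normrM; apply: (@le_trans _ _ (`|w' ord0 i1| * L)); first exact: ler_wpM2l.
  by move: Ow'; rewrite /implicit_dom /= -mulrA; lra.
have h2 : 2^-1 <= `|1 + w' ord0 i1 * g' (xi + t)|.
  by move: h1; rewrite ler_norml => /andP[h _]; rewrite ger0_norm; lra.
have h3 : `|t' - t| * 2^-1 <= `|t' - t| * `|1 + w' ord0 i1 * g' (xi + t)|.
  exact: ler_wpM2l.
rewrite -normrM D in h3.
have h4 : `|w' ord0 i0 - w ord0 i0 - (w' ord0 i1 - w ord0 i1) * g t| <=
    `|w' ord0 i0 - w ord0 i0| + `|w' ord0 i1 - w ord0 i1|.
  by apply: le_trans (ler_normB _ _) _; rewrite lerD2l normrM ler_piMr.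
lra.
Qed.

Lemma open_implicit_dom : open implicit_dom.
Proof.
have -> : implicit_dom = setT `&` (fun w : 'rV[R]_2 => 1 - 2 * `|w ord0 i1| * L) @^-1` [set x | 0 < x].
  by rewrite setTI; apply/seteqP; split => w; rewrite /implicit_dom /= subr_gt0.
apply: open_preimage_in; [exact: openT|exact: open_gt0|move=> w _].
have c : (fun w : 'rV[R]_2 => `|w ord0 i1|) @ w --> `|w ord0 i1|.
  exact: (cvg_norm (@coord_lin_continuous R 2 i1 w)).
exact: cvgB (cvg_cst _) (cvgM (cvgM (cvg_cst _) c) (cvg_cst _)).
Qed.

Lemma implicit_continuous w : implicit_dom w -> {for w, continuous implicit}.
Proof.
move=> Ow; apply/(@cvgrPdist_lt _ _ _ (nbhs w) (nbhs_filter w)) => e e0; near=> w'.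
have Ow' : implicit_dom w' by near: w'; exact: (open_near open_implicit_dom Ow).
rewrite distrC; apply: le_lt_trans (implicit_lip Ow Ow') _.
have h : `|w - w'| < e / 4 by near: w'; apply: cvgr_dist_lt; rewrite ?divr_gt0.
have h0 := coord_norm_le (w - w') i0; have h1 := coord_norm_le (w - w') i1.
by rewrite !mxE distrC in h0; rewrite !mxE distrC in h1; lra.
Unshelve. all: by end_near. Qed.

Lemma implicit_den w t : implicit_dom w -> 0 < 1 + w ord0 i1 * g' t.
Proof.
move=> Ow; have h1 : `|w ord0 i1 * g' t| <= 2^-1.
  rewrite normrM; apply: (@le_trans _ _ (`|w ord0 i1| * L)); first exact: ler_wpM2l.
  by move: Ow; rewrite /implicit_dom /= -mulrA; lra.
by move: h1; rewrite ler_norml => /andP[h _]; lra.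
Qed.

(** The mean value theorem gives an exact formula for the difference quotient, with [g'] at an
    intermediate point; continuity of [implicit] makes that point tend to [implicit w]. *)
Lemma is_derive_implicit w u : implicit_dom w -> is_derive w u implicit
  ((u ord0 i0 - u ord0 i1 * g (implicit w)) / (1 + w ord0 i1 * g' (implicit w))).
Proof.
move=> Ow; set t0 := implicit w.
have /choice[xi Hxi] : forall h : R, exists xi, `|xi| <= `|h| /\ g (h + t0) - g t0 = h * g' (xi + t0).
  by move=> h; have [x h1 h2] := mvt t0 h; exists x.
pose ph (t : R) := implicit (t *: u + w) - t0.
have line : (fun t : R => t *: u + w) @ (0 : R) --> w.
  rewrite -[X in _ --> X]add0r -(scale0r u).
  by apply: cvgD; [apply: cvgZl; exact: cvg_id|exact: cvg_cst].
have ph0 : ph @ (0 : R) --> (0 : R).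
  have H : (fun t : R => implicit (t *: u + w)) @ (0 : R) --> t0.
    exact: (@cvg_comp _ _ _ _ implicit _ _ _ line (implicit_continuous Ow)).
  have H' := cvgB H (cvg_cst t0); rewrite subrr in H'; exact: H'.
have xi0 : (fun t => xi (ph t)) @ (0 : R) --> (0 : R).
  apply/cvgr0Pnorm_lt => e e0; near=> t.
  apply: le_lt_trans (Hxi (ph t)).1 _.
  by near: t; exact: (@cvgr0_norm_lt _ _ _ _ _ _ ph0 e e0).
have gx : (fun t => g' (xi (ph t) + t0)) @ (0 : R) --> g' t0.
  have H : (fun t => xi (ph t) + t0) @ (0 : R) --> t0.
    by rewrite -[X in _ --> X]add0r; apply: cvgD => //; exact: cvg_cst.
  exact: (cvg_comp _ _ H (@cg' t0)).
have den : (fun t => 1 + (t *: u + w) ord0 i1 * g' (xi (ph t) + t0)) @ (0 : R) -->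
    1 + w ord0 i1 * g' t0.
  apply: cvgD; first exact: cvg_cst.
  have H : (fun t : R => (t *: u + w) ord0 i1) @ (0 : R) --> w ord0 i1.
    exact: (@cvg_comp _ _ _ _ (fun v : 'rV[R]_2 => v ord0 i1) _ _ _ line (@coord_lin_continuous _ _ i1 w)).
  exact: cvgM H gx.
have Ht : (fun t : R => t^-1 *: (implicit (t *: u + w) - t0)) @ 0^' -->
    (u ord0 i0 - u ord0 i1 * g t0) / (1 + w ord0 i1 * g' t0).
  have H : (fun t => (u ord0 i0 - u ord0 i1 * g t0) /
      (1 + (t *: u + w) ord0 i1 * g' (xi (ph t) + t0))) @ 0^' -->
    (u ord0 i0 - u ord0 i1 * g t0) / (1 + w ord0 i1 * g' t0).
    apply: cvg_trans (_ : _ @ (0 : R) --> _).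
      by apply: cvg_app; exact: cvg_within.
    apply: cvgM; first exact: cvg_cst.
    by apply: cvgV => //; rewrite gt_eqF // implicit_den.
  apply: cvg_trans H; apply: near_eq_cvg; near=> t.
  have tn : t != 0 by near: t; exact: nbhs_dnbhs_neq.
  have Owt : implicit_dom (t *: u + w).
    near: t; apply: cvg_within; apply: line; exact: (open_near open_implicit_dom Ow).
  have E := implicitE (t *: u + w); have E0 := implicitE w; rewrite -/t0 in E0.
  have dn := implicit_den (xi (ph t) + t0) Owt.
  have [_] := Hxi (ph t); rewrite {1}/ph subrK => X.
  have key : ph t * (1 + (t *: u + w) ord0 i1 * g' (xi (ph t) + t0)) =
      t * (u ord0 i0 - u ord0 i1 * g t0).
    rewrite mulrDr mulr1 mulrCA -X.
    have -> : ph t = implicit (t *: u + w) - t0 by [].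
    move: E; move: (implicit (t *: u + w)) => t1; rewrite !mxE; move: (g t1) => G E.
    have -> : t1 = t * u ord0 i0 + w ord0 i0 - (t * u ord0 i1 + w ord0 i1) * G.
      by rewrite -E; ring.
    move: E0; move: (g t0) => G0 E0.
    rewrite -E0; ring.
  move: key; move: (1 + _) dn => D dn key.
  apply: (canLR (mulfK (lt0r_neq0 dn))); rewrite -[RHS]mulrA key /GRing.scale /=.
  by rewrite mulrA mulVf // mul1r.
split; first by apply/cvg_ex; eexists; exact: Ht.
exact: (cvg_lim _ Ht).
Unshelve. all: by end_near. Qed.

(** The derivative is a smooth expression in [implicit] itself, so each order of regularity yields
    the next. *)
Lemma smooth_implicit : smooth_on implicit_dom implicit.
Proof.
apply: (smooth_open_on open_implicit_dom) => k.
have oO := open_implicit_dom.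
elim: k => [|k IH]; first by split => // w; exact: implicit_continuous.
split => [w|u]; first exact: implicit_continuous.
split => [w Ow|]; first by have [] := is_derive_implicit u Ow.
apply: (@Ck_ext _ _ _ _ _ (fun w => (u ord0 i0 - u ord0 i1 * g (implicit w)) *
  (1 + w ord0 i1 * g' (implicit w))^-1)) => // [w Ow|].
  by have [_ ->] := is_derive_implicit u Ow.
have cst (a : R) : Ck k implicit_dom (fun=> a) by exact: Ck_cst.
have cG : Ck k implicit_dom (fun w => g (implicit w)) by exact: (Ck_comp_R oO (B := setT)).
have cG' : Ck k implicit_dom (fun w => g' (implicit w)) by exact: (Ck_comp_R oO (B := setT)).
apply: Ck_mul => //.
  by apply: Ck_add => //; apply: Ck_opp => //; apply: Ck_mul.
apply: (Ck_comp_R oO (B := [set x | x != 0])); last exact: Ck_inv_R.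
  by move=> w Ow /=; rewrite gt_eqF // implicit_den.
by apply: Ck_add => //; apply: Ck_mul => //; exact: Ck_coord.
Qed.

Lemma implicit_unique w t : implicit_dom w -> t + w ord0 i1 * g t = w ord0 i0 -> implicit w = t.
Proof.
move=> Ow E; have E0 := implicitE w.
have [xi _ X] := mvt t (implicit w - t); rewrite subrK in X.
apply/eqP; rewrite -subr_eq0; apply/eqP.
apply: (mulIf (lt0r_neq0 (implicit_den (xi + t) Ow))).
by rewrite mul0r mulrDr mulr1 mulrCA -X; apply/eqP; rewrite mulrBr addrACA -opprD E E0 subrr.
Qed.

End ImplicitFunction.

(** * Curvature k = 0: twisted fields *)

Section TwistFields.
Context {R : realType} {d m : nat} {kappa : R}.
Variable Mo : light_cone_model d m kappa.
Local Notation M := (lcM Mo).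
Local Notation g := (lcg Mo).
Local Notation K := (lcK Mo).
Local Notation Phi := (lcPhi Mo).
Local Notation dPhi := (lcdPhi Mo).
Local Notation Pi := (lcPi Mo).
Local Notation b := (bf (lcJ Mo)).
Variables (A : 'rV[R]_m) (eta : R).
Hypotheses (hAA : b A A = 1) (hAK : b A K = eta) (eta0 : 0 < eta).
Local Notation N := (slice Mo A).
Local Notation k := (@slice_curv R kappa eta).
Local Notation KA := (slice_K Mo A eta).
Local Notation height := (height Mo A eta).
Local Notation zone := (zone Mo A eta).
Local Notation sc := (@slice_c R kappa eta).
Local Notation ss := (@slice_s R kappa eta).
Local Notation se := (@slice_e R kappa eta).
Local Notation projE := (projE Mo A eta).
Hypothesis k0 : k = 0.

Let hAA' : eta * b A A = eta. Proof. by rewrite hAA mulr1. Qed.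

(** The sine of the angle between the direction and [f1]. The slope is at most eta / 2, which turns
    the condition of [implicit_dom] into eta s < 1, that is [sp_eta]. *)
Definition tilt (t : R) : R := 2^-1 * sink 1 (eta * t).
Definition tilt' (t : R) : R := 2^-1 * (cosk 1 (eta * t) * eta).
Definition cotilt (t : R) : R := Num.sqrt (1 - tilt t ^+ 2).

Lemma norm_cosk_sink (t : R) : `|cosk 1 t| <= 1 /\ `|sink 1 t| <= 1.
Proof.
have := @cosk_sink R 1 t; rewrite mul1r => E.
have h (x y : R) : x ^+ 2 + y ^+ 2 = 1 -> `|x| <= 1.
  move=> H; rewrite -(expr_le1 (n := 2)) // real_normK ?num_real //.
  by have := sqr_ge0 y; lra.
by split; [exact: h E|apply: h; rewrite addrC; exact: E].
Qed.

Lemma is_derive_tilt (t : R) : is_derive t (1 : R) tilt (tilt' t).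
Proof.
have h : is_derive t (1 : R) (fun t : R => eta * t) eta.
  apply: is_derive_eq (isd_mul (isd_cst _ _ _) (is_derive_id _ _)) _; ring.
have h2 : is_derive t (1 : R) (fun t : R => sink 1 (eta * t)) (cosk 1 (eta * t) * eta).
  exact: (isd_comp (is_derive_sink 1 _) h).
apply: is_derive_eq (isd_mul (isd_cst _ _ _) h2) _.
by rewrite /tilt' /GRing.scale /=; ring.
Qed.

Lemma smooth_tilt : smooth_on setT tilt.
Proof.
apply: smooth_on_mul; first exact: smooth_on_cst.
apply: (smooth_on_comp_R (B := setT)) => //.
  by apply: smooth_on_mul; [exact: smooth_on_cst|exact: smooth_on_id].
apply: smooth_open_on; first exact: openT.
by move=> j; have [] := smooth_cosk_sink (1 : R) j.
Qed.

Lemma smooth_tilt' : smooth_on setT tilt'.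
Proof.
apply: smooth_on_mul; first exact: smooth_on_cst.
apply: smooth_on_mul; last exact: smooth_on_cst.
apply: (smooth_on_comp_R (B := setT)) => //.
  by apply: smooth_on_mul; [exact: smooth_on_cst|exact: smooth_on_id].
apply: smooth_open_on; first exact: openT.
by move=> j; have [] := smooth_cosk_sink (1 : R) j.
Qed.

Lemma tilt_bound t : `|tilt t| <= 2^-1.
Proof.
have [_ h] := norm_cosk_sink (eta * t); rewrite /tilt normrM ger0_norm //.
by rewrite -[leRHS]mulr1 ler_wpM2l.
Qed.

Lemma tilt'_bound t : `|tilt' t| <= eta / 2.
Proof.
have [h _] := norm_cosk_sink (eta * t); rewrite /tilt' !normrM ger0_norm //.
rewrite (gtr0_norm eta0) mulrC; apply: ler_wpM2r => //.
by rewrite -[leRHS]mul1r; apply: ler_wpM2r => //; exact: ltW.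
Qed.

Lemma tilt_sqr t : 0 < 1 - tilt t ^+ 2.
Proof.
have := tilt_bound t; rewrite ler_norml => /andP[h1 h2]; nra.
Qed.

Lemma cotilt_sqr t : cotilt t ^+ 2 + tilt t ^+ 2 = 1.
Proof. by rewrite /cotilt sqr_sqrtr ?ltW ?tilt_sqr // subrK. Qed.

Lemma smooth_cotilt : smooth_on setT cotilt.
Proof.
apply: smooth_on_sqrt => [|t _]; last exact: tilt_sqr.
apply: smooth_on_add; first exact: smooth_on_cst.
by apply: smooth_on_opp; apply: smooth_on_exp; exact: smooth_tilt.
Qed.

Section Twist.
Variables (f1 f2 : 'rV[R]_m) (sgn : R).
Hypotheses (h11 : b f1 f1 = 1) (h1K : b f1 K = 0) (h1A : b f1 A = 0).
Hypotheses (h22 : b f2 f2 = 1) (h2K : b f2 K = 0) (h2A : b f2 A = 0).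
Hypotheses (h12 : b f1 f2 = 0) (sgn2 : sgn ^+ 2 = 1).

(** For k = 0 the vector [KA] is null. Its coefficient makes the result tangent to N at points with
    coordinates [y1] and [t] along [f1] and [f2]; the sign covers v and - v at once. *)
Definition twist (y1 t : R) : 'rV[R]_m := sgn *:
  (cotilt t *: f1 + tilt t *: f2 + (y1 * cotilt t + t * tilt t) *: KA).
Definition twist_field p : 'rV[R]_m := twist (b (Phi p) f1) (b (Phi p) f2).

Lemma twist_pairings : [/\ b KA f1 = 0, b KA f2 = 0, b KA KA = 0, b KA K = 0 & b KA A = 0].
Proof.
have hK1 := h1K; have hA1 := h1A; have hK2 := h2K; have hA2 := h2A.
rewrite lc_bfC in hK1; rewrite lc_bfC in hA1; rewrite lc_bfC in hK2; rewrite lc_bfC in hA2.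
split; first by rewrite slice_KE !bfL hK1 hA1; ring.
- by rewrite slice_KE !bfL hK2 hA2; ring.
- by rewrite b_KAKA // k0 oppr0.
- by rewrite lc_bfC b_KKA // k0 oppr0.
by rewrite lc_bfC b_AKA.
Qed.

Lemma twist_coord y1 t :
  [/\ b (twist y1 t) f1 = sgn * cotilt t, b (twist y1 t) f2 = sgn * tilt t,
      b (twist y1 t) (twist y1 t) = 1, b (twist y1 t) K = 0 & b (twist y1 t) A = 0] /\
  (b (twist y1 t) KA = 0 /\ forall Y, b Y KA = -1 ->
     b Y (twist y1 t) = sgn * (cotilt t * (b Y f1 - y1) + tilt t * (b Y f2 - t))).
Proof.
have [e1 e2 e3 e4 e5] := twist_pairings; have h21 : b f2 f1 = 0 by rewrite lc_bfC.
have e6 : b f1 KA = 0 by rewrite lc_bfC. have e7 : b f2 KA = 0 by rewrite lc_bfC.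
rewrite /twist; split; last first.
  by split => [|Y YK]; rewrite !bfL ?e6 ?e7 ?e3 ?YK; ring.
split; rewrite !bfL ?e1 ?e2 ?e3 ?e4 ?e5 ?e6 ?e7 ?h11 ?h22 ?h12 ?h21 ?h1K ?h1A ?h2K ?h2A; try by ring.
transitivity (sgn ^+ 2 * (cotilt t ^+ 2 + tilt t ^+ 2)); first by ring.
by rewrite sgn2 cotilt_sqr mulr1.
Qed.

Lemma twist_field_unit p : N p -> unit_tangent Mo A p (twist_field p).
Proof.
move=> Np; rewrite /twist_field.
have [[c1 c2 c3 c4 c5] [c6 c7]] := twist_coord (b (Phi p) f1) (b (Phi p) f2).
split => //; [|by rewrite lc_bfC|by rewrite lc_bfC].
by rewrite c7 ?(b_PhiKA eta Np) // !subrr !mulr0 addr0 mulr0.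
Qed.

Lemma smooth_twist (V : normedModType R) (S : set V) (y t : V -> R) :
  smooth_on S y -> smooth_on S t -> smooth_on S (fun x => twist (y x) (t x)).
Proof.
move=> sy st; have cst (a : R) : smooth_on S (fun=> a) by exact: smooth_on_cst.
have cstW (a : 'rV[R]_m) : smooth_on S (fun=> a) by exact: smooth_on_cst.
have sg1 : smooth_on S (fun x => tilt (t x)) by exact: smooth_on_comp_R st smooth_tilt _.
have sg2 : smooth_on S (fun x => cotilt (t x)) by exact: smooth_on_comp_R st smooth_cotilt _.
apply: smooth_on_scale => //; apply: smooth_on_add.
  by apply: smooth_on_add; apply: smooth_on_scale.
by apply: smooth_on_scale => //; apply: smooth_on_add; apply: smooth_on_mul.
Qed.

Lemma smooth_twist_field : smooth_on N twist_field.
Proof.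
have sP := @smooth_Phi_slice _ _ _ _ Mo A.
by apply: smooth_twist; exact: smooth_bV.
Qed.

Definition twist_param (Y : 'rV[R]_m) (s : R) : 'rV[R]_2 :=
  \row_i (if i == ord0 then b Y f2 else sgn * s).
(** Paired with [f2], the equation involves only the coordinate t = <Phi p, f2>. Once t is known, so
    is the direction, and p becomes explicit. *)
Definition twist_root (Y : 'rV[R]_m) (s : R) : R := implicit tilt (twist_param Y s).
Definition twist_inv (Y : 'rV[R]_m) (c s e : R) : 'rV[R]_m :=
  let t := twist_root Y s in
  Y - s *: twist (b Y f1 - s * (sgn * cotilt t)) t - e *: KA.

Lemma twist_dom Y c s e : @slice_parameters R kappa eta c s e ->
  implicit_dom (eta / 2) (twist_param Y s).
Proof.
move=> [_ s0 _ _ _ _ h]; rewrite /implicit_dom /= mxE /=.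
have sn : `|sgn| = 1.
  apply/eqP; rewrite -(eqrXn2 (n := 2)) //; by rewrite expr1n real_normK ?num_real ?sgn2.
rewrite normrM sn mul1r (gtr0_norm s0).
have : (eta * s) ^+ 2 < 1 ^+ 2 by rewrite exprMn expr1n.
rewrite ltr_pXn2r // ?nnegrE ?mulr_ge0 ?(ltW s0) ?(ltW eta0) //; lra.
Qed.

Lemma twist_rootP Y c s e : @slice_parameters R kappa eta c s e ->
  twist_root Y s + sgn * s * tilt (twist_root Y s) = b Y f2 /\
  forall t, t + sgn * s * tilt t = b Y f2 -> twist_root Y s = t.
Proof.
move=> hp; have Od := twist_dom Y hp.
have s1 : smooth_open setT tilt by apply: smooth_on_open smooth_tilt; exact: openT.
have s2 : smooth_open setT tilt' by apply: smooth_on_open smooth_tilt'; exact: openT.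
have b1 t : `|tilt t| <= 1 by apply: le_trans (tilt_bound t) _; lra.
split; first by have := implicitE s1 b1 (twist_param Y s); rewrite !mxE /=.
move=> t E; apply: (implicit_unique is_derive_tilt s1 tilt'_bound b1 Od).
by rewrite !mxE /=.
Qed.

Lemma twist_invP y c s e : N y -> @slice_parameters R kappa eta c s e ->
  [/\ N (Pi (twist_inv (Phi y) c s e)),
     Phi (Pi (twist_inv (Phi y) c s e)) = twist_inv (Phi y) c s e &
     forall p, N p -> c *: Phi p + s *: twist_field p + e *: KA = Phi y <->
       Phi p = twist_inv (Phi y) c s e].
Proof.
move=> Ny hp; have [tE tU] := twist_rootP (Phi y) hp; have [e0 s0 c1 cs ce hse _] := hp.
rewrite k0 mul0r subr0 in ce; rewrite k0 mul0r subr0 in hse.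
have [p1 p2 p3 p4 p5] := twist_pairings.
rewrite /twist_inv ce; move: (twist_root (Phi y) s) tE tU => t tE tU.
set y1 := b (Phi y) f1 - s * (sgn * cotilt t).
have [[c2 c3 c4 c5 c6] [c7 c8]] := twist_coord y1 t.
have YKA := b_PhiKA eta Ny; have [My yA] := Ny.
have YY := lcPhiPhi My; have YK := lcPhiK My.
have Yw : b (Phi y) (twist y1 t) = s.
  rewrite c8 // /y1 -tE.
  transitivity (s * (sgn ^+ 2 * (cotilt t ^+ 2 + tilt t ^+ 2))); first by ring.
  by rewrite sgn2 cotilt_sqr !mulr1.
have wY : b (twist y1 t) (Phi y) = s by rewrite lc_bfC.
have KAY : b KA (Phi y) = -1 by rewrite lc_bfC.
have KAw : b KA (twist y1 t) = 0 by rewrite lc_bfC.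
have y1E : y1 = b (Phi y) f1 - s * (sgn * cotilt t) by [].
have [w wE] : {w | w = twist y1 t} by eexists.
rewrite -wE in c2 c3 c4 c5 c6 c7 Yw wY KAw *.
have [Q QE] : {Q | Q = Phi y - s *: w - e *: KA} by eexists.
rewrite -QE.
have QQ : b Q Q = 0.
  rewrite QE !bfL YY Yw wY c4 YKA KAY p3 c7 KAw.
  transitivity (2 * e - s ^+ 2); first by ring.
  by rewrite hse subrr.
have QK : b Q K = -1 by rewrite QE !bfL YK c5 p4; ring.
have QA : b Q A = 0 by rewrite QE !bfL yA c6 p5; ring.
have QY : b Q (Phi y) <= 0.
  rewrite QE !bfL YY wY KAY.
  have -> : 0 - s * s - e * -1 = e - s ^+ 2 by ring.
  by rewrite hse; lra.
have [MQ EQ] := lcPhi_Pi My QQ QK QY.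
have Qf1 : b Q f1 = y1 by rewrite QE !bfL c2 p1 y1E; ring.
have Qf2 : b Q f2 = t by rewrite QE !bfL c3 p2 -tE; ring.
clearbody y1.
split => //; first by split => //; rewrite EQ.
move=> p Np; rewrite /twist_field scale1r; split=> [E|->]; last first.
  by rewrite Qf1 Qf2 -wE QE; apply/rowP => i; rewrite !mxE; ring.
have PKA := b_PhiKA eta Np.
have [[d2 d3 _ _ _] _] := twist_coord (b (Phi p) f1) (b (Phi p) f2).
have e2 : b (Phi p) f2 = t.
  apply/esym/tU; rewrite -E.
  move: (twist _ _) d2 d3 => w' d2 d3; rewrite !bfL d3 p2; ring.
have e1 : b (Phi p) f1 = y1.
  rewrite y1E -E; move: d2; rewrite e2; move: (twist _ _) => w' d2.
  by rewrite !bfL d2 p1; ring.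
by rewrite QE -E e1 e2 -wE; apply/rowP => i; rewrite !mxE; ring.
Qed.

Lemma smooth_twist_inv : smooth_on zone (fun x =>
  twist_inv (Phi (projE x)) (sc (height x)) (ss (height x)) (se (height x))).
Proof.
have [sP s_c s_s s_e] := smooth_zone_params hAA hAK eta0.
have cst (a : R) : smooth_on zone (fun=> a) by exact: smooth_on_cst.
have s1 : smooth_open setT tilt by apply: smooth_on_open smooth_tilt; exact: openT.
have s2 : smooth_open setT tilt' by apply: smooth_on_open smooth_tilt'; exact: openT.
have b1 t : `|tilt t| <= 1 by apply: le_trans (tilt_bound t) _; lra.
have sw : smooth_on zone (fun x => twist_param (Phi (projE x)) (ss (height x))).
  apply: smooth_on_row => i; have [i0|i0] := eqVneq i ord0.
    apply: (@smooth_on_ext _ _ _ _ (fun x => b (Phi (projE x)) f2)); last exact: smooth_bV.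
    by move=> x _; rewrite mxE i0 eqxx.
  apply: (@smooth_on_ext _ _ _ _ (fun x => sgn * ss (height x))); last exact: smooth_on_mul.
  by move=> x _; rewrite mxE (negbTE i0).
have st : smooth_on zone (fun x => twist_root (Phi (projE x)) (ss (height x))).
  apply: (smooth_on_comp_rVR sw (smooth_implicit is_derive_tilt s1 s2 tilt'_bound b1)) => x zx.
  exact: (twist_dom _ (zone_parameters eta0 zx)).
have sg2 : smooth_on zone (fun x => cotilt (twist_root (Phi (projE x)) (ss (height x)))).
  exact: smooth_on_comp_R st smooth_cotilt _.
apply: smooth_on_add; last first.
  by apply: smooth_on_opp; apply: smooth_on_scale => //; exact: smooth_on_cst.
apply: smooth_on_add => //; apply: smooth_on_opp; apply: smooth_on_scale => //.
apply: smooth_twist => //; apply: smooth_on_add; first exact: smooth_bV.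
by apply: smooth_on_opp; apply: smooth_on_mul => //; exact: smooth_on_mul.
Qed.

Lemma twist_ray_inverse v : (forall p, N p -> dPhi p (v p) = twist_field p) ->
  ray_inverse Mo A eta v.
Proof.
move=> vE; apply: (ambient_ray_inverse hAA hAK eta0 vE smooth_twist_inv).
  by move=> y c s e Ny hp; have [] := twist_invP Ny hp.
by move=> y p c s e Ny Np hp; have [_ _] := twist_invP Ny hp; apply.
Qed.

End Twist.

Theorem twist_bifoliates n (U : set 'rV[R]_d) p0 : m = (3 + n)%N -> (1 < n)%N ->
  N p0 -> model_exterior Mo A eta n U ->
  exists v, [/\ unit_vector_field g N v,
      smooth_line_foliation n M U (model_rays Mo A v),
      smooth_line_foliation n M U (model_rays Mo A (fun p => - v p)) &
      ~ geodesic_vector_field g N v].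
Proof.
move=> mn n1 Np0 eU; have [f [[f3 ff] fspan]] := orthonormal_frame hAA hAK Np0 mn.
have n0 : (0 < n)%N by exact: ltnW.
pose i1 := Ordinal n0; pose i2 := Ordinal n1.
have h12 : b (f i1) (f i2) = 0 by rewrite ff.
have h11 : b (f i1) (f i1) = 1 by rewrite ff eqxx.
have h22 : b (f i2) (f i2) = 1 by rewrite ff eqxx.
have fK i : b (f i) K = 0 by rewrite lc_bfC; have [] := f3 i.
have fA i : b (f i) A = 0 by rewrite lc_bfC; have [] := f3 i.
have fP i : b (Phi p0) (f i) = 0 by have [] := f3 i.
have fKA i : b KA (f i) = 0.
  have [_ fK' fA'] := f3 i; rewrite slice_KE !bfL fK' fA'; ring.
have sg1 : (1 : R) ^+ 2 = 1 by rewrite expr1n.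
have sg2 : (-1 : R) ^+ 2 = 1 by rewrite sqrrN expr1n.
have uV p : N p -> unit_tangent Mo A p (twist_field (f i1) (f i2) 1 p).
  exact: (twist_field_unit h11 (fK _) (fA _) h22 (fK _) (fA _) h12 sg1).
have [uv vE] := ambient_field hAA hAK (smooth_twist_field (f i1) (f i2) 1) uV.
set v := fun x : 'rV[R]_d => _ in uv vE.
exists v.
have r1 : ray_inverse Mo A eta v.
  exact: (twist_ray_inverse h11 (fK _) (fA _) h22 (fK _) (fA _) h12 sg1 vE).
have r2 : ray_inverse Mo A eta (fun p => - v p).
  apply: (twist_ray_inverse h11 (fK _) (fA _) h22 (fK _) (fA _) h12 sg2) => p Np.
  by rewrite dPhiN vE // /twist_field /twist scale1r scaleN1r.
have [w1 w2 w3] := bifoliation hAA hAK eta0 mn uv r1 r2 Np0 eU.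
split => // gv.
have u2 : unit_tangent Mo A p0 (f i2) by split => //; rewrite lc_bfC.
have kk t : cosk k t = 1 by rewrite /cosk k0 ltxx.
have kks t : sink k t = t by rewrite /sink k0 ltxx.
(* Not geodesic: start where the tilt is 1/2 and move for the time pi / eta. A geodesic keeps its
   component along [f i2], so this coordinate goes from pi / (2 eta) to pi / eta, where the tilt is
   0. *)
have [Nx xE] := geoP hAA' hAK (pi / 2 / eta) Np0 u2.
move: (geoE _ _ _ _ _ _) Nx xE => x Nx xE.
have xf2 : b (Phi x) (f i2) = pi / 2 / eta.
  by rewrite xE /geo /slice_point !bfL fP h22 fKA kk kks; ring.
have [q [Nq qE VqE]] := flow_pair hAA hAK (pi / eta) mn uv vE gv Nx.
have V2 y : b (twist_field (f i1) (f i2) 1 y) (f i2) = tilt (b (Phi y) (f i2)).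
  have [[_ -> _ _ _] _] := twist_coord h11 (fK _) (fA _) h22 (fK _) (fA _) h12 sg1
    (b (Phi y) (f i1)) (b (Phi y) (f i2)).
  by rewrite mul1r.
have := V2 q; rewrite VqE qE.
have := V2 x; move: (twist_field _ _ _ x) => V Vx.
rewrite /slice_point !bfL Vx xf2 fKA kk kks k0.
have en : eta != 0 by rewrite gt_eqF.
have tE t : tilt (t / eta) = 2^-1 * sin t.
  by rewrite /tilt /sink ltr01 sqrtr1 mul1r divr1 (mulrC eta) mulfVK.
rewrite !mulr0 !addr0 mul1r oppr0 !mul0r add0r !tE sin_pihalf mul1r mulr1.
have -> : pi / 2 / eta + pi / eta * 2^-1 = pi / eta :> R by field.
by rewrite tE sinpi mulr0; lra.
Qed.

End TwistFields.

(** * The models of the space forms *)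

Section DotProduct.
Context {R : realType} {d : nat}.
Implicit Types (x y z u w : 'rV[R]_d) (a : R).

Lemma dotC x y : dot x y = dot y x.
Proof. by apply: eq_bigr => i _; rewrite mulrC. Qed.

Lemma dotDl x y z : dot (x + y) z = dot x z + dot y z.
Proof. by rewrite /dot -big_split; apply: eq_bigr => i _; rewrite mxE mulrDl. Qed.

Lemma dotZl a x z : dot (a *: x) z = a * dot x z.
Proof. by rewrite /dot mulr_sumr; apply: eq_bigr => i _; rewrite mxE mulrA. Qed.

Lemma dotNl x z : dot (- x) z = - dot x z.
Proof. by rewrite -scaleN1r dotZl mulN1r. Qed.

Lemma dot0l z : dot 0 z = 0.
Proof. by rewrite -(scale0r 0) dotZl mul0r. Qed.

Lemma dotDr x y z : dot z (x + y) = dot z x + dot z y.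
Proof. by rewrite dotC dotDl !(dotC z). Qed.

Lemma dotZr a x z : dot z (a *: x) = a * dot z x.
Proof. by rewrite dotC dotZl (dotC z). Qed.

Lemma dotNr x z : dot z (- x) = - dot z x.
Proof. by rewrite dotC dotNl (dotC z). Qed.

Lemma dot0r z : dot z 0 = 0. Proof. by rewrite dotC dot0l. Qed.

Lemma dot_ge0 x : 0 <= dot x x.
Proof. by apply: sumr_ge0 => i _; rewrite -expr2 sqr_ge0. Qed.

Lemma dot_eq0 x : dot x x = 0 -> x = 0.
Proof.
move=> h; apply/rowP => i; rewrite mxE; apply/eqP; rewrite -sqrf_eq0 expr2; apply/eqP.
have := h; rewrite /dot (bigD1 i) //= => E.
have h1 : 0 <= x ord0 i * x ord0 i by rewrite -expr2 sqr_ge0.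
have h2 : 0 <= \sum_(i' | i' != i) x ord0 i' * x ord0 i'.
  by apply: sumr_ge0 => i' _; rewrite -expr2 sqr_ge0.
lra.
Qed.

Lemma dot_gt0 x : x != 0 -> 0 < dot x x.
Proof. by move=> x0; rewrite lt_def dot_ge0 andbT; apply: contra x0 => /eqP/dot_eq0 ->. Qed.

Lemma dot_delta x i : dot (delta_mx ord0 i) x = x ord0 i.
Proof.
rewrite /dot (bigD1 i) //= mxE !eqxx mul1r big1 ?addr0 // => j ne.
by rewrite mxE (negbTE ne) andbF mul0r.
Qed.

Lemma dot_mx x y : (x *m y^T) ord0 ord0 = dot x y.
Proof. by rewrite mxE; apply: eq_bigr => i _; rewrite mxE. Qed.

Lemma isd_dot (f h : R -> 'rV[R]_d) (t : R) df dh : is_derive t (1 : R) f df ->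
  is_derive t (1 : R) h dh ->
  is_derive t (1 : R) (fun s => dot (f s) (h s)) (dot df (h t) + dot (f t) dh).
Proof.
move=> Df Dh; rewrite [X in is_derive _ _ _ X](_ : _ =
  \sum_i (df ord0 i * h t ord0 i + f t ord0 i * dh ord0 i)).
  by apply: isd_sum => i; apply: isd_mul; exact: isd_coord.
by rewrite /dot -big_split.
Qed.

Lemma smooth_dot (V : normedModType R) (S : set V) (f h : V -> 'rV[R]_d) :
  smooth_on S f -> smooth_on S h -> smooth_on S (fun p => dot (f p) (h p)).
Proof. by move=> sf sh; apply: smooth_on_sum => i; apply: smooth_on_mul; exact: smooth_on_coord. Qed.

End DotProduct.

Definition dotL := (@dotDl, @dotDr, @dotZl, @dotZr, @dotNl, @dotNr).

Section Conformal.
Context {R : realType} {d : nat}.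
Variable h : 'rV[R]_d -> R.
Local Notation g := (fun x => (h x)%:M : 'M[R]_d).
Implicit Types x u w : 'rV[R]_d.

Lemma inner_conformal x u w : inner g x u w = h x * dot u w.
Proof. by rewrite /inner mul_mx_scalar -scalemxAl mxE dot_mx. Qed.

Lemma partial_conformal x (i j l : 'I_d) :
  partial (fun y => (g y) j l) x i = (j == l)%:R * partial h x i.
Proof.
rewrite /partial; case: eqVneq => [->|ne].
  by rewrite mul1r; congr ('D_ _ _ _); apply/funext => y; rewrite mxE eqxx.
rewrite mul0r -[RHS](derive_cst (0 : R) x (delta_mx ord0 i)); congr ('D_ _ _ _).
by apply/funext => y; rewrite mxE (negbTE ne).
Qed.

(** The Christoffel symbols of h times the identity are three terms with a Kronecker symbol each;
    contracted with the velocity they become the dot products on the right. *)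
Lemma acceleration_conformal (c : R -> 'rV[R]_d) (t : R) (dh : 'rV[R]_d) : h (c t) != 0 ->
  (forall i, partial h (c t) i = dh ord0 i) ->
  acceleration g c t = derive1n 2 c t +
    (2 * h (c t))^-1 *: ((2 * dot dh (derive1 c t)) *: derive1 c t -
      dot (derive1 c t) (derive1 c t) *: dh).
Proof.
move=> h0 hd; apply/rowP => k; rewrite /acceleration !mxE; congr (_ + _).
set v := derive1 c t.
have chr i j : christoffel g (c t) k i j = (2 * h (c t))^-1 *
    ((j == k)%:R * dh ord0 i + (i == k)%:R * dh ord0 j - (i == j)%:R * dh ord0 k).
  rewrite /christoffel invmx_scalar invfM -mulrA; congr (_ * _).
  rewrite (bigD1 k) //= big1 ?addr0; last by move=> l ne; rewrite mxE eq_sym (negbTE ne) mul0r.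
  by rewrite mxE eqxx !partial_conformal !hd.
transitivity (\sum_i \sum_j (2 * h (c t))^-1 * (
   ((j == k)%:R * v ord0 j) * (dh ord0 i * v ord0 i) +
   ((i == k)%:R * v ord0 i) * (dh ord0 j * v ord0 j) -
   dh ord0 k * (v ord0 i * ((i == j)%:R * v ord0 j)))).
  by apply: eq_bigr => i _; apply: eq_bigr => j _; rewrite chr; ring.
have pick (a : 'I_d) : \sum_j (j == a)%:R * v ord0 j = v ord0 a.
  rewrite (bigD1 a) //= eqxx mul1r big1 ?addr0 // => j ne.
  by rewrite (negbTE ne) mul0r.
under eq_bigr do rewrite -mulr_sumr.
rewrite -mulr_sumr; congr (_ * _).
under eq_bigr do rewrite big_split /= sumrN -!mulr_sumr big_split /= -mulr_suml -mulr_sumr pick.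
rewrite big_split /= sumrN big_split /= -mulr_sumr -mulr_suml pick -mulr_sumr.
rewrite -!/(dot dh v).
have -> : \sum_i v ord0 i * \sum_j (i == j)%:R * v ord0 j = dot v v.
  apply: eq_bigr => i _; congr (_ * _).
  by rewrite -[RHS]pick; apply: eq_bigr => j _; rewrite eq_sym.
ring.
Qed.

End Conformal.

(** * The sphere in the light cone *)

Section SphereModel.
Context {R : realType} (n : nat) (kappa : R).
Hypothesis kappa0 : 0 < kappa.
Local Notation D := (amb n kappa).
Local Notation M := (@space_form R n kappa).
Local Notation g := (@space_metric R n kappa).

Definition sph_vec (v : 'rV[R]_D) (a : R) : 'rV[R]_(D + 1) := row_mx v a%:M.
(** The cone of |v|^2 - a^2 / kappa cut by a = 1 is the sphere of radius 1 / sqrt kappa, and a = 1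
    is the hyperplane of pairing -1 with (0, kappa). *)
Definition sph_J : 'M[R]_(D + 1) := block_mx 1%:M 0 0 (- kappa^-1)%:M.

Lemma sph_vecE X : X = sph_vec (lsubmx X) (rsubmx X ord0 ord0).
Proof. by rewrite /sph_vec -mx11_scalar hsubmxK. Qed.

Lemma sph_bf v a w c : bf sph_J (sph_vec v a) (sph_vec w c) = dot v w - kappa^-1 * a * c.
Proof.
rewrite /bf /sph_vec /sph_J mul_row_block tr_row_mx mul_row_col.
rewrite mulmx1 !mulmx0 addr0 add0r mxE dot_mx; congr (_ + _).
by rewrite tr_scalar_mx -!scalar_mxM mxE eqxx mulr1n; ring.
Qed.

Lemma sph_metric : g = fun=> 1%:M.
Proof. by apply/funext => x; rewrite /space_metric ltNge ltW. Qed.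

Lemma sph_M x : M x <-> dot x x = kappa^-1.
Proof.
split=> [[h _]|h]; first exact: h.
by split => [_|/lt_trans/(_ kappa0)]; rewrite ?ltxx.
Qed.

Lemma isd_sph_vec (c : R -> 'rV[R]_D) a (t : R) v : is_derive t (1 : R) c v ->
  is_derive t (1 : R) (fun s => sph_vec (c s) a) (sph_vec v 0).
Proof.
move=> dc; apply: isd_row => i; rewrite /sph_vec.
case: (split_ordP i) => i' ->; rewrite ?row_mxEl ?row_mxEr.
  apply: (@isd_near _ _ _ (fun s => c s ord0 i')); last exact: isd_coord.
  by near=> s; rewrite row_mxEl.
apply: (@isd_near _ _ _ (fun=> (a%:M : 'M[R]_1) ord0 i')).
  by near=> s; rewrite row_mxEr.
by apply: is_derive_eq (isd_cst _ _ _) _; rewrite raddf0 mxE.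
Unshelve. all: by end_near. Qed.

Lemma sph_acceleration c t : acceleration g c t = derive1n 2 c t.
Proof.
rewrite sph_metric (@acceleration_conformal _ _ (fun=> 1) c t 0) ?oner_eq0 //.
  by rewrite dot0l scaler0 mulr0 scale0r subrr scaler0 addr0.
by move=> i; rewrite mxE /partial derive_cst.
Qed.

Definition sphere_model : light_cone_model D (D + 1) kappa.
Proof.
refine (@LightConeModel R D (D + 1) kappa M g sph_J (sph_vec 0 kappa)
  (fun x => sph_vec x 1) (fun _ u => sph_vec u 0) lsubmx (fun _ Z => lsubmx Z)
  _ _ _ _ _ _ _ _ _ _ _ _ _ _ _ _ _ _ _).
- by rewrite /sph_J tr_block_mx !trmx0 trmx1 tr_scalar_mx.
- rewrite unitmxE det_ublock det1 mul1r det_scalar1.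
  by rewrite unitfE oppr_eq0 invr_eq0 gt_eqF.
- by rewrite sph_bf dot0l; field; rewrite gt_eqF.
- by move=> x /sph_M h; rewrite sph_bf h; ring.
- by move=> x _; rewrite sph_bf dot0r; field; rewrite gt_eqF.
- move=> x y /sph_M hx /sph_M hy; rewrite sph_bf.
  have := dot_ge0 (x - y); rewrite !dotL hx hy (dotC y x); lra.
- by move=> x _; rewrite row_mxKl.
- move=> x X _; rewrite (sph_vecE X) !sph_bf row_mxKl dot0r => XX XK _.
  have X1 : rsubmx X ord0 ord0 = 1.
    by move: XK; rewrite sub0r mulrAC mulVf ?gt_eqF // mul1r; lra.
  rewrite X1 in XX *; split => //.
  by apply/sph_M; move: XX; lra.
- move=> x Z _ _; rewrite (sph_vecE Z) !sph_bf dot0r => ZK Z0.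
  have Z1 : rsubmx Z ord0 ord0 = 0.
    by move: ZK; rewrite sub0r mulrAC mulVf ?gt_eqF // mul1r; lra.
  rewrite Z1 in Z0 *; rewrite mulr0 subr0; apply: dot_gt0; apply: contra Z0 => /eqP ->.
  by rewrite /sph_vec raddf0 row_mx0.
- apply: smooth_on_row_mx; [exact: smooth_on_id|exact: smooth_on_cst].
- apply: smooth_on_row => i.
  apply: (@smooth_on_ext _ _ _ _ (fun X : 'rV[R]_(D + 1) => X ord0 (lshift 1 i))).
    by move=> X _; rewrite mxE.
  by apply: (smooth_on_coord (f := id)); exact: smooth_on_id.
- by move=> x a u v; rewrite /sph_vec scale_row_mx add_row_mx raddf0 scaler0 addr0.
- by move=> c t v _; exact: isd_sph_vec.
- by move=> x u _ E; rewrite -(row_mxKl u (0%:M : 'M[R]_1)) -/(sph_vec u 0) E; apply/rowP => i; rewrite !mxE.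
- move=> x u w _; rewrite sph_bf mulr0 subr0.
  by rewrite sph_metric (inner_conformal (fun=> 1)) mul1r.
- move=> x Z _ _ ZK; have Z1 : rsubmx Z ord0 ord0 = 0.
    move: ZK; rewrite {1}(sph_vecE Z) sph_bf dot0r sub0r mulrAC mulVf ?gt_eqF // mul1r; lra.
  by rewrite [RHS]sph_vecE Z1.
- by move=> V S f v _ sv _; apply: smooth_on_row_mx => //; exact: smooth_on_cst.
- move=> V S f Z _ sZ _; apply: smooth_on_row => i.
  apply: (@smooth_on_ext _ _ _ _ (fun p => Z p ord0 (lshift 1 i))).
    by move=> X _; rewrite mxE.
  exact: smooth_on_coord.
- move=> I c t z [oI _ sc _] It; rewrite sph_acceleration sph_metric.
  rewrite (inner_conformal (fun=> 1)) mul1r.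
  have E s : I s -> derive1 (fun s => sph_vec (c s) 1) s = sph_vec (derive1 c s) 0.
    by move=> Is; apply: is_derive_derive1; exact/isd_sph_vec/(isd_smooth oI sc).
  have -> : derive1n 2 (fun s => sph_vec (c s) 1) t = sph_vec (derive1n 2 c t) 0.
    apply: is_derive_derive1; apply: (@isd_near _ _ _ (fun s => sph_vec (derive1 c s) 0)).
      by near=> s; rewrite E //; near: s; exact: (open_near oI It).
    exact/isd_sph_vec/(isd_smooth oI (smooth_derive1 oI sc)).
  by rewrite sph_bf mulr0 subr0.
Unshelve. all: by end_near.
Defined.

End SphereModel.

(** * The paraboloid lift of Euclidean space *)

Section Paraboloid.
Context {R : realType} {d : nat}.
Implicit Types (v w x : 'rV[R]_d) (a b c : R).

Definition vec3 a v b : 'rV[R]_(1 + (d + 1)) := row_mx a%:M (row_mx v b%:M).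
Definition par_mx (z : R) : 'M[R]_(1 + (d + 1)) :=
  block_mx 0 (row_mx 0 z%:M) (col_mx 0 z%:M) (block_mx 1%:M 0 0 0).
(** For this form the vectors (1, x, |x|^2) are null, and two of them pair to - |x - y|^2 / 2. The
    matrix with parameter -2 is its inverse. *)
Definition parJ := par_mx (- 2^-1).

Lemma vec3E (X : 'rV[R]_(1 + (d + 1))) :
  X = vec3 (lsubmx X ord0 ord0) (lsubmx (rsubmx X)) (rsubmx (rsubmx X) ord0 ord0).
Proof. by rewrite /vec3 -!mx11_scalar !hsubmxK. Qed.

Lemma vec3_lin a v b : vec3 a v b = a *: vec3 1 0 0 +
  v *m (row_mx 0 (row_mx 1%:M 0) : 'M[R]_(d, 1 + (d + 1))) + b *: vec3 0 0 1.
Proof.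
rewrite /vec3 !mul_mx_row !mulmx0 mulmx1 !scale_row_mx !scaler0 !add_row_mx.
by rewrite !scale_scalar_mx !mulr1 !mulr0 !raddf0 !addr0 !add0r.
Qed.

Lemma vec3D a v b a' v' b' : vec3 a v b + vec3 a' v' b' = vec3 (a + a') (v + v') (b + b').
Proof. by rewrite /vec3 !add_row_mx -!raddfD. Qed.

Lemma vec3Z z a v b : z *: vec3 a v b = vec3 (z * a) (z *: v) (z * b).
Proof. by rewrite /vec3 !scale_row_mx !scale_scalar_mx. Qed.

Lemma vec3_mx z a v b : vec3 a v b *m par_mx z = vec3 (z * b) v (z * a).
Proof.
rewrite /vec3 /par_mx !mul_row_block !mul_row_col !mul_mx_row.
rewrite !mulmx0 !mulmx1 !addr0 !add0r -!scalar_mxM add_row_mx add0r addr0.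
by rewrite !(mulrC z).
Qed.

Lemma vec3_bf a v b a' v' b' : bf parJ (vec3 a v b) (vec3 a' v' b') =
  dot v v' - 2^-1 * (a * b' + b * a').
Proof.
rewrite /bf vec3_mx /vec3 !tr_row_mx !mul_row_col !tr_scalar_mx -!scalar_mxM.
by rewrite mxE [X in _ + X]mxE dot_mx !mxE eqxx !mulr1n; ring.
Qed.

Lemma parJ_sym : parJ^T = parJ.
Proof. by rewrite /parJ /par_mx !(tr_block_mx, tr_row_mx, tr_col_mx) !trmx0 trmx1 tr_scalar_mx. Qed.

Lemma parJ_unit : parJ \in unitmx.
Proof.
have E : parJ *m par_mx (- 2) = 1%:M :> 'M[R]_(1 + (d + 1)).
  apply/row_matrixP => i.
  rewrite -[parJ *m _]mul1mx row_mul mulmxA; move: (row i 1%:M) => X.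
  by rewrite (vec3E X) !vec3_mx; congr vec3; field.
by have [] := mulmx1_unit E.
Qed.

Lemma isd_vec3 (f h : R -> R) (c : R -> 'rV[R]_d) (t f' h' : R) (c' : 'rV[R]_d) :
  is_derive t (1 : R) f f' -> is_derive t (1 : R) c c' -> is_derive t (1 : R) h h' ->
  is_derive t (1 : R) (fun s => vec3 (f s) (c s) (h s)) (vec3 f' c' h').
Proof.
move=> Df Dc Dh; rewrite vec3_lin.
rewrite (_ : (fun s => _) = fun s => f s *: vec3 1 0 0 + c s *m row_mx 0 (row_mx 1%:M 0) +
  h s *: vec3 0 0 1); last by apply/funext => s; exact: vec3_lin.
apply: is_derive_eq (isd_add (isd_add (isd_scale Df (isd_cst _ _ _)) (isd_mulmx _ Dc))
  (isd_scale Dh (isd_cst _ _ _))) _.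
by rewrite !scaler0 !addr0.
Qed.

Lemma smooth_vec3 (V : normedModType R) (S : set V) (f h : V -> R) (c : V -> 'rV[R]_d) :
  smooth_on S f -> smooth_on S c -> smooth_on S h ->
  smooth_on S (fun p => vec3 (f p) (c p) (h p)).
Proof.
move=> sf sc sh.
rewrite (_ : (fun s => _) = fun s => f s *: vec3 1 0 0 + c s *m row_mx 0 (row_mx 1%:M 0) +
  h s *: vec3 0 0 1); last by apply/funext => s; exact: vec3_lin.
apply: smooth_on_add; last by apply: smooth_on_scale => //; exact: smooth_on_cst.
apply: smooth_on_add; last exact: smooth_on_mulmx.
by apply: smooth_on_scale => //; exact: smooth_on_cst.
Qed.

End Paraboloid.

(** * Euclidean and hyperbolic space in the light cone *)

Section FlatHyperbolicModel.
Context {R : realType} (n : nat) (kappa : R).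
Hypothesis kappa0 : kappa <= 0.
Local Notation D := (amb n kappa).
Local Notation M := (@space_form R n kappa).
Local Notation g := (@space_metric R n kappa).
Local Notation "x .0" := (x ord0 (ord0 : 'I_(amb n kappa))) (at level 2, format "x .0").
Implicit Types x u v w z : 'rV[R]_D.

(* [1 / conf x] is the conformal factor: [conf = 1] if [kappa = 0] and
   [conf x = sqrt (- kappa) x_0] if [kappa < 0]. *)
Definition root_curv : R := Num.sqrt (- kappa).
Definition flat_part : R := (kappa == 0)%:R.
Definition conf x : R := flat_part + root_curv * x.0.
Local Notation q := root_curv.
Local Notation c0 := flat_part.
Local Notation l := conf.

Lemma root_curv_sqr : q ^+ 2 = - kappa.
Proof. by rewrite sqr_sqrtr // oppr_ge0. Qed.

Lemma flat_or_curved : (kappa = 0 /\ (q = 0 /\ c0 = 1)) \/ (kappa < 0 /\ (0 < q /\ c0 = 0)).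
Proof.
rewrite /root_curv /flat_part; case: (ltrgtP kappa 0) kappa0 => // [k0|->] _; [right|left].
  by rewrite sqrtr_gt0 oppr_gt0.
by rewrite oppr0 sqrtr0.
Qed.

Lemma conf_metric : g = fun x => (l x ^- 2)%:M.
Proof.
apply/funext => x; rewrite /space_metric /conf.
case: flat_or_curved => [[k0 [-> ->]]|[k0 [_ ->]]].
  have -> : (kappa < 0) = false by rewrite k0 ltxx.
  by rewrite mul0r addr0 expr1n invr1.
by rewrite k0 add0r exprMn root_curv_sqr.
Qed.

Lemma conf_M x : M x <-> 0 < l x.
Proof.
rewrite /conf; case: flat_or_curved => [[k0 [-> ->]]|[k0 [q0 ->]]].
  by rewrite mul0r addr0; split => // _; split => h; exfalso; lra.
rewrite add0r pmulr_rgt0 //; split=> [[_]|h]; first exact.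
by split => // h'; exfalso; lra.
Qed.

Definition par x := vec3 1 x (dot x x).
Definition flatPhi x := (l x)^-1 *: par x.
(** Chosen so that <par x, K> = - conf x. Dividing [par] by [conf] then normalizes the pairing to -1
    and scales the induced metric by conf^-2, as required. *)
Definition flatK : 'rV[R]_(1 + (D + 1)) := vec3 0 (- q *: delta_mx ord0 ord0) (2 * c0).
Definition flatdPhi x u :=
  (l x)^-1 *: vec3 0 u (2 * dot x u) - (q * u.0 / l x ^+ 2) *: par x.
Definition flatPi (X : 'rV[R]_(1 + (D + 1))) : 'rV[R]_D :=
  (lsubmx X ord0 ord0)^-1 *: lsubmx (rsubmx X).
Definition flatsec x (Z : 'rV[R]_(1 + (D + 1))) : 'rV[R]_D :=
  l x *: (lsubmx (rsubmx Z) - lsubmx Z ord0 ord0 *: x).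

Lemma vec3_sub (a b : R) v : (lsubmx (vec3 a v b) ord0 ord0 = a) *
  (lsubmx (rsubmx (vec3 a v b)) = v).
Proof. by rewrite /vec3 row_mxKr !row_mxKl mxE eqxx mulr1n. Qed.

Lemma dot_K v : dot v (- q *: delta_mx ord0 ord0) = - q * v.0.
Proof. by rewrite dotZr dotC dot_delta. Qed.

Lemma isd_inv (f : R -> R) (t df : R) : f t != 0 -> is_derive t (1 : R) f df ->
  is_derive t (1 : R) (fun s => (f s)^-1) (- df / f t ^+ 2).
Proof.
move=> f0 Df; apply: (@isd_near _ _ _ (fun s => 1 / f s)).
  by near=> s; rewrite div1r.
apply: is_derive_eq (isd_div f0 (isd_cst (1 : R) _ _) Df) _.
by rewrite mul0r mul1r sub0r.
Unshelve. all: by end_near. Qed.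

Lemma isd_conf (c : R -> 'rV[R]_D) (t : R) v : is_derive t (1 : R) c v ->
  is_derive t (1 : R) (fun s => l (c s)) (q * v.0).
Proof.
move=> dc; rewrite /conf.
apply: is_derive_eq (isd_add (isd_cst _ _ _) (isd_mul (isd_cst _ _ _) (isd_coord _ dc))) _.
by rewrite mul0r !add0r.
Qed.

Lemma isd_par (c : R -> 'rV[R]_D) (t : R) v : is_derive t (1 : R) c v ->
  is_derive t (1 : R) (fun s => par (c s)) (vec3 0 v (2 * dot (c t) v)).
Proof.
move=> dc; rewrite /par; apply: is_derive_eq (isd_vec3 (isd_cst _ _ _) dc (isd_dot dc dc)) _.
by congr vec3; rewrite (dotC v); ring.
Qed.

Lemma isd_flatPhi (c : R -> 'rV[R]_D) (t : R) v : l (c t) != 0 -> is_derive t (1 : R) c v ->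
  is_derive t (1 : R) (fun s => flatPhi (c s)) (flatdPhi (c t) v).
Proof.
move=> h dc; have D1 := @isd_inv (fun s => l (c s)) t _ h (isd_conf dc).
rewrite /flatPhi; apply: is_derive_eq (isd_scale D1 (isd_par dc)) _.
by rewrite /flatdPhi addrC mulNr scaleNr.
Qed.

Lemma par_bf x u w (a : R) : let E := par x in let H z := vec3 0 z (2 * dot x z) in
  [/\ bf parJ E E = 0, bf parJ E (H u) = 0, bf parJ (H u) E = 0,
      bf parJ (H u) (H w) = dot u w & bf parJ (vec3 0 u (2 * a + 2 * dot x u)) E = - a].
Proof. by move=> E H; rewrite /E /H /par; split; rewrite !vec3_bf ?(dotC u); lra. Qed.

Lemma smooth_conf (V : normedModType R) (S : set V) (c : V -> 'rV[R]_D) :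
  smooth_on S c -> smooth_on S (fun p => l (c p)).
Proof.
move=> sc; apply: smooth_on_add; first exact: smooth_on_cst.
by apply: smooth_on_mul; [exact: smooth_on_cst|exact: smooth_on_coord].
Qed.

Lemma smooth_par (V : normedModType R) (S : set V) (c : V -> 'rV[R]_D) :
  smooth_on S c -> smooth_on S (fun p => par (c p)).
Proof. by move=> sc; apply: smooth_vec3 => //; [exact: smooth_on_cst|exact: smooth_dot]. Qed.

Lemma flat_acceleration (c : R -> 'rV[R]_D) (t : R) z : l (c t) != 0 ->
  inner g (c t) (acceleration g c t) z = l (c t) ^- 2 * (dot (derive1n 2 c t) z -
    q / l (c t) * (2 * (derive1 c t).0 * dot (derive1 c t) z -
                   dot (derive1 c t) (derive1 c t) * z.0)).
Proof.
move=> ln; rewrite conf_metric inner_conformal; congr (_ * _).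
pose dh : 'rV[R]_D := (- 2 * q * l (c t) ^- 3) *: delta_mx ord0 ord0.
have hd i : partial (fun x => l x ^- 2) (c t) i = dh ord0 i.
  rewrite /partial /dh !mxE eqxx /=.
  have D1 : is_derive (c t) (delta_mx ord0 i : 'rV[R]_D) l (q * (ord0 == i)%:R).
    apply: is_derive_eq (isd_add (isd_cst _ _ _) (isd_mul (isd_cst _ _ _)
      (isd_coord ord0 (is_derive_id (c t) (delta_mx ord0 i))))) _.
    by rewrite mul0r !add0r mxE eqxx.
  have D2 := isd_mul D1 D1.
  have n2 : l (c t) * l (c t) != 0 by rewrite mulf_neq0.
  have [d2 E2] := D2.
  have E := @deriveV _ _ (fun y => l y * l y) (c t) _ n2 d2.
  rewrite (_ : (fun x => _) = (fun x => (l x * l x)^-1)); last by apply/funext => x; rewrite expr2.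
  rewrite E E2 /GRing.scale /= eq_sym; field; exact: ln.
have hn : l (c t) ^- 2 != 0 by rewrite invr_eq0 expf_neq0.
rewrite (@acceleration_conformal _ _ (fun x => l x ^- 2) c t dh hn hd).
rewrite !dotL !dot_delta.
by field.
Qed.

End FlatHyperbolicModel.

Section FlatModel.
Context {R : realType} (n : nat) (kappa : R).
Hypothesis kappa0 : kappa <= 0.
Local Notation D := (amb n kappa).
Local Notation M := (@space_form R n kappa).
Local Notation g := (@space_metric R n kappa).
Local Notation "x .0" := (x ord0 (ord0 : 'I_(amb n kappa))) (at level 2, format "x .0").
Implicit Types x u v w z : 'rV[R]_D.
Local Notation q := (@root_curv R kappa).
Local Notation c0 := (@flat_part R kappa).
Local Notation l := (@conf R n kappa).
Local Notation Phi := (@flatPhi R n kappa).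
Local Notation K := (@flatK R n kappa).
Local Notation dPhi := (@flatdPhi R n kappa).
Local Notation Pi := (@flatPi R n kappa).
Local Notation sec := (@flatsec R n kappa).
Local Notation J := (@parJ R D).

Lemma flat_l x : M x -> 0 < l x. Proof. by move=> /(conf_M kappa0). Qed.

Lemma flatPhi_bf x y : M x -> M y ->
  bf J (Phi x) (Phi y) = - (2 * (l x * l y))^-1 * dot (x - y) (x - y).
Proof.
move=> /flat_l lx /flat_l ly; rewrite /flatPhi !bfL /par vec3_bf !dotL (dotC y x).
by field; rewrite !gt_eqF.
Qed.

Lemma flatPhi_K x : M x -> bf J (Phi x) K = -1.
Proof.
move=> /flat_l lx; rewrite /flatPhi !bfL /par vec3_bf dot_K mulr0 addr0 mul1r.
have -> : - q * x.0 - 2^-1 * (2 * c0) = - l x by rewrite /conf; field.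
by rewrite mulrN mulVf // gt_eqF.
Qed.

Lemma flatPhiPi x X : M x -> bf J X X = 0 -> bf J X K = -1 -> bf J X (Phi x) <= 0 ->
  M (Pi X) /\ Phi (Pi X) = X.
Proof.
move=> /flat_l lx; rewrite (vec3E X).
move: (lsubmx X _ _) (lsubmx (rsubmx X)) (rsubmx (rsubmx X) _ _) => a v b.
rewrite /flatPhi /par /flatK !bfL !vec3_bf dot_K mulr0 addr0 mulr1 => h1 h2 h3.
have vv : dot v v = a * b by move: h1; rewrite (mulrC b); lra.
have hl : c0 * a + q * v.0 = 1 by move: h2; lra.
have an : a != 0.
  apply/eqP => a0; have v0 : v = 0 by apply: dot_eq0; rewrite vv a0 mul0r.
  by move: hl; rewrite a0 v0 mxE !mulr0 addr0 => /eqP; rewrite eq_sym oner_eq0.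
have h3' : dot v x - 2^-1 * (a * dot x x + b) <= 0.
  by move: h3; rewrite pmulr_rle0 // invr_gt0.
have sq : dot (v - a *: x) (v - a *: x) = a * (- 2 * (dot v x - 2^-1 * (a * dot x x + b))).
  by rewrite !dotL vv (dotC x v); field.
(* If a < 0, the sign condition makes |v - a x|^2 nonpositive, so v = a x; then a conf x = 1,
   against the sign of a. *)
have a0 : 0 < a.
  rewrite lt_def an leNgt; apply/negP => aneg.
  have h0 : v - a *: x = 0.
    apply: dot_eq0; apply/eqP; rewrite eq_le dot_ge0 andbT sq nmulr_rle0 //; lra.
  have vE : v = a *: x by apply/eqP; rewrite -subr_eq0 h0.
  have : a * l x = 1 by rewrite -hl /conf vE mxE; ring.
  have := nmulr_rlt0 (l x) aneg; rewrite lx => h e; move: h; rewrite e; lra.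
have lE : l (Pi (vec3 a v b)) = a^-1.
  rewrite /conf /flatPi !vec3_sub mxE; apply: (mulfI an); rewrite divff // -hl; by field.
split; first by apply/(conf_M kappa0); rewrite lE invr_gt0.
rewrite /flatPhi lE invrK /par vec3Z /flatPi !vec3_sub scalerA divff // scale1r mulr1.
congr vec3; rewrite !dotL vv; by field.
Qed.

Lemma flat_pos x Z : M x -> bf J Z (Phi x) = 0 -> bf J Z K = 0 -> Z != 0 -> 0 < bf J Z Z.
Proof.
move=> /flat_l lx; rewrite (vec3E Z).
move: (lsubmx Z _ _) (lsubmx (rsubmx Z)) (rsubmx (rsubmx Z) _ _) => a v b.
rewrite /flatPhi /par /flatK !bfL !vec3_bf dot_K mulr0 addr0 mulr1 => h1 h2 Z0.
have h3 : dot v x - 2^-1 * (a * dot x x + b) = 0.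
  by move/eqP: h1; rewrite mulf_eq0 invr_eq0 gt_eqF //= => /eqP.
have bE : b = 2 * dot v x - a * dot x x by lra.
have hl : c0 * a + q * v.0 = 0 by move: h2; lra.
have sq : dot v v - 2^-1 * (a * b + b * a) = dot (v - a *: x) (v - a *: x).
  by rewrite !dotL bE (dotC x v); field.
rewrite sq; apply: dot_gt0; apply: contra Z0; rewrite subr_eq0 => /eqP vE.
have : a * l x = 0 by rewrite -hl /conf vE mxE; ring.
move/eqP; rewrite mulf_eq0 (gt_eqF lx) orbF => /eqP a0.
by rewrite bE vE a0 scale0r dot0l mulr0 mul0r subr0 /vec3 !raddf0 !row_mx0.
Qed.

Lemma flat_inner x u w : M x -> inner g x u w = bf J (dPhi x u) (dPhi x w).
Proof.
move=> /flat_l lx; rewrite (conf_metric n kappa0) inner_conformal /flatdPhi.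
have [e1 e2 e3 e4 _] := par_bf x u w 0; have [_ e5 _ _ _] := par_bf x w u 0.
move: (par x) (vec3 0 u _) (vec3 0 w _) e1 e2 e3 e4 e5 => E U W e1 e2 e3 e4 e5.
by rewrite !bfL e1 e3 e4 e5; field; rewrite gt_eqF.
Qed.

Lemma flatdPhi_sec x Z : M x -> bf J Z (Phi x) = 0 -> bf J Z K = 0 -> dPhi x (sec x Z) = Z.
Proof.
move=> /flat_l lx; rewrite (vec3E Z).
move: (lsubmx Z _ _) (lsubmx (rsubmx Z)) (rsubmx (rsubmx Z) _ _) => a v b.
rewrite /flatPhi /par /flatK !bfL !vec3_bf dot_K mulr0 addr0 mulr1 => h1 h2.
have h3 : dot v x - 2^-1 * (a * dot x x + b) = 0.
  by move/eqP: h1; rewrite mulf_eq0 invr_eq0 gt_eqF //= => /eqP.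
have bE : b = 2 * dot v x - a * dot x x by lra.
have hl : c0 * a + q * v.0 = 0 by move: h2; lra.
have ln : l x != 0 by rewrite gt_eqF.
have aE : q * (sec x (vec3 a v b)).0 / l x ^+ 2 = - a.
  rewrite /flatsec !vec3_sub !mxE.
  have -> : q * (l x * (v.0 - a * x.0)) = - a * l x ^+ 2.
    have -> : q * (l x * (v.0 - a * x.0)) = l x * (q * v.0 - a * (q * x.0)) by ring.
    have -> : q * v.0 = - (c0 * a) by lra.
    have -> : - (c0 * a) - a * (q * x.0) = - a * l x by rewrite /conf; ring.
    by ring.
  by rewrite mulfK // expf_neq0.
rewrite /flatdPhi aE scaleNr opprK /flatsec !vec3_sub vec3Z /par vec3Z vec3D.
congr vec3; first by rewrite mulr0 add0r mulr1.
  by rewrite scalerA mulVf // scale1r subrK.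
rewrite bE !dotL (dotC x v); by field.
Qed.

Lemma flat_model_acceleration I c t z : smooth_curve M I c -> I t ->
  bf J (derive1n 2 (fun s => Phi (c s)) t) (dPhi (c t) z) =
  inner g (c t) (acceleration g c t) z.
Proof.
move=> [oI _ sc Mc] It; have lc s (Is : I s) : l (c s) != 0 by rewrite gt_eqF // flat_l //; exact: Mc.
rewrite (flat_acceleration kappa0) ?lc //.
have dc s (Is : I s) := isd_smooth oI sc Is.
have E s : I s -> derive1 (fun s => Phi (c s)) s = dPhi (c s) (derive1 c s).
  by move=> Is; apply: is_derive_derive1; exact: isd_flatPhi (lc s Is) (dc s Is).
have dc' := isd_smooth oI (smooth_derive1 oI sc) It.
set c1 := derive1 c t; set c2 := derive1n 2 c t; set y := c t.
have dl := isd_conf (dc t It).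
have ln : l y != 0 by exact: lc.
have D1 := @isd_inv _ (fun s => l (c s)) t _ ln dl.
have D2 : is_derive t (1 : R) (fun s => vec3 0 (derive1 c s) (2 * dot (c s) (derive1 c s)))
    (vec3 0 c2 (2 * dot c1 c1 + 2 * dot y c2)).
  apply: is_derive_eq (isd_vec3 (isd_cst _ _ _) dc' (isd_mul (isd_cst (2 : R) _ _) (isd_dot (dc t It) dc'))) _.
  by congr vec3; rewrite mul0r add0r mulrDr.
have D3 : is_derive t (1 : R) (fun s => q * (derive1 c s).0 / l (c s) ^+ 2)
    (q * c2.0 / l y ^+ 2 - 2 * q ^+ 2 * c1.0 ^+ 2 / l y ^+ 3).
  have := isd_mul (isd_mul (isd_mul (isd_cst q t (1 : R)) (isd_coord ord0 dc')) D1) D1.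
  move=> H; apply: (@isd_near _ _ _ (fun s => q * (derive1 c s).0 * (l (c s))^-1 * (l (c s))^-1)).
    by near=> s; rewrite expr2 invfM mulrA.
  apply: is_derive_eq H _; rewrite -/c1 -/c2 -/y; by field.
have -> : derive1n 2 (fun s => Phi (c s)) t =
    (- (q * c1.0) / l y ^+ 2 *: vec3 0 c1 (2 * dot y c1) +
     (l y)^-1 *: vec3 0 c2 (2 * dot c1 c1 + 2 * dot y c2)) -
    ((q * c2.0 / l y ^+ 2 - 2 * q ^+ 2 * c1.0 ^+ 2 / l y ^+ 3) *: par y +
     (q * c1.0 / l y ^+ 2) *: vec3 0 c1 (2 * dot y c1)).
  apply: is_derive_derive1; apply: (@isd_near _ _ _ (fun s => dPhi (c s) (derive1 c s))).
    by near=> s; rewrite E //; near: s; exact: (open_near oI It).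
  rewrite /flatdPhi.
  exact: (isd_add (isd_scale D1 D2) (isd_opp (isd_scale D3 (isd_par (dc t It))))).
rewrite /flatdPhi.
have [e1 e2 e3 e4 e5] := par_bf y c1 z (dot c1 c1); have [_ e6 _ _ _] := par_bf y z z 0.
have [_ _ _ _ e7] := par_bf y c2 z (dot c1 c1).
have e8 : bf J (vec3 0 c2 (2 * dot c1 c1 + 2 * dot y c2)) (vec3 0 z (2 * dot y z)) = dot c2 z.
  by rewrite vec3_bf; ring.
move: (par y) (vec3 0 c1 _) (vec3 0 c2 _) (vec3 0 z _) e1 e2 e3 e4 e5 e6 e7 e8.
move=> P C1 C2 Z e1 e2 e3 e4 e5 e6 e7 e8.
by rewrite !bfL e1 e3 e4 e6 e7 e8; field.
Unshelve. all: by end_near. Qed.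

Definition flat_model : light_cone_model D (1 + (D + 1)) kappa.
Proof.
refine (@LightConeModel R D (1 + (D + 1)) kappa M g J K Phi dPhi Pi sec
  (parJ_sym (d := D)) (parJ_unit (d := D)) _ _ flatPhi_K _ _ flatPhiPi flat_pos _ _ _ _ _
  flat_inner flatdPhi_sec _ _ flat_model_acceleration).
- rewrite /flatK vec3_bf dot_K !mxE eqxx mulr1.
  by transitivity (q ^+ 2); [ring|exact: root_curv_sqr].
- by move=> x Mx; rewrite flatPhi_bf // subrr dot0l mulr0.
- move=> x y Mx My; rewrite flatPhi_bf // mulNr oppr_le0 mulr_ge0 ?dot_ge0 // invr_ge0.
  by rewrite !mulr_ge0 // ltW // flat_l.
- move=> x /flat_l lx; rewrite /flatPi /flatPhi /par vec3Z !vec3_sub mulr1 invrK scalerA.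
  by rewrite divff ?gt_eqF // scale1r.
- apply: smooth_on_scale; last by apply: smooth_par; exact: smooth_on_id.
  apply: smooth_on_inv; first by apply: smooth_conf; exact: smooth_on_id.
  by move=> x /flat_l h; rewrite gt_eqF.
- have sl (m p : nat) (S : set 'rV[R]_(m + p)) : smooth_on S (fun X : 'rV[R]_(m + p) => lsubmx X).
    apply: smooth_on_row => i.
    apply: (@smooth_on_ext _ _ _ _ (fun X : 'rV[R]_(m + p) => X ord0 (lshift p i))).
      by move=> X _; rewrite mxE.
    by apply: (smooth_on_coord (f := id)); exact: smooth_on_id.
  have sr (m p : nat) (S : set 'rV[R]_(m + p)) : smooth_on S (fun X : 'rV[R]_(m + p) => rsubmx X).
    apply: smooth_on_row => i.
    apply: (@smooth_on_ext _ _ _ _ (fun X : 'rV[R]_(m + p) => X ord0 (rshift m i))).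
      by move=> X _; rewrite mxE.
    by apply: (smooth_on_coord (f := id)); exact: smooth_on_id.
  apply: smooth_on_scale.
    apply: smooth_on_inv; first by apply: smooth_on_coord; exact: sl.
    move=> X [x /flat_l lx <-]; rewrite /flatPhi /par vec3Z vec3_sub mulr1 invr_eq0.
    by rewrite gt_eqF.
  apply: (smooth_on_comp (sr _ _ _) (B := setT)) => //; exact: sl.
- move=> x a u v; rewrite /flatdPhi.
  have -> : vec3 0 (a *: u + v) (2 * dot x (a *: u + v)) =
      a *: vec3 0 u (2 * dot x u) + vec3 0 v (2 * dot x v).
    by rewrite vec3Z vec3D; congr vec3; rewrite ?dotL; ring.
  rewrite [(a *: u + v) _ _]mxE [(a *: u) _ _]mxE.
  move: (vec3 0 u _) (vec3 0 v _) (par x) => X Y P; apply/rowP => i; rewrite !mxE; ring.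
- by move=> c t v /flat_l h; apply: isd_flatPhi; rewrite gt_eqF.
- move=> x u Mx E; have := flat_inner u u Mx; rewrite E bf0l.
  rewrite (conf_metric n kappa0) inner_conformal => /eqP; rewrite mulf_eq0 invr_eq0 expf_eq0 /=.
  by rewrite (gt_eqF (flat_l Mx)) /= => /eqP/dot_eq0.
- move=> V S f v sf sv Mf; have lf p : S p -> l (f p) != 0 by move=> /Mf/flat_l h; rewrite gt_eqF.
  have slf := smooth_conf sf.
  apply: smooth_on_add.
    apply: smooth_on_scale; first exact: smooth_on_inv.
    apply: smooth_vec3 => //; first exact: smooth_on_cst.
    by apply: smooth_on_mul; [exact: smooth_on_cst|exact: smooth_dot].
  apply: smooth_on_opp; apply: smooth_on_scale; last exact: smooth_par.
  apply: smooth_on_div; last by move=> p /lf h; rewrite expf_neq0.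
    by apply: smooth_on_mul; [exact: smooth_on_cst|exact: smooth_on_coord].
  exact: smooth_on_exp.
- move=> V S f Z sf sZ Mf; apply: smooth_on_scale; first exact: smooth_conf.
  have s1 i : smooth_on S (fun p => Z p ord0 i) by exact: smooth_on_coord.
  apply: smooth_on_add.
    apply: smooth_on_row => i.
    apply: (@smooth_on_ext _ _ _ _ (fun p => Z p ord0 (rshift 1 (lshift 1 i)))) => //.
    by move=> p _; rewrite !mxE.
  apply: smooth_on_opp; apply: smooth_on_scale => //.
  apply: (@smooth_on_ext _ _ _ _ (fun p => Z p ord0 (lshift (D + 1) ord0))) => //.
  by move=> p _; rewrite mxE.
Defined.

End FlatModel.

(** * Distances, spheres and isometries *)

Section ModelDistance.
Context {R : realType} {d m : nat} {kappa : R}.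
Variable Mo : light_cone_model d m kappa.
Local Notation M := (lcM Mo).
Local Notation g := (lcg Mo).
Local Notation K := (lcK Mo).
Local Notation Phi := (lcPhi Mo).
Local Notation dPhi := (lcdPhi Mo).
Local Notation Pi := (lcPi Mo).
Local Notation b := (bf (lcJ Mo)).

Let z1 : 0 * b 0 0 = 0. Proof. by rewrite mul0r. Qed.
Let z2 : b 0 K = 0. Proof. exact: bf0l. Qed.

Lemma ambient_point p x c s e : M p -> M x -> b (Phi x) (Phi p) = - e ->
  c = 1 - kappa * e -> s ^+ 2 = 2 * e - kappa * e ^+ 2 -> s != 0 ->
  let V := s^-1 *: (Phi x - c *: Phi p - e *: K) in
  unit_tangent Mo 0 p V /\ Phi x = slice_point Mo 0 0 p V c s e.
Proof.
move=> Mp Mx xp cE s2 s0 V; have px : b (Phi p) (Phi x) = - e by rewrite lc_bfC.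
have pp := lcPhiPhi Mp; have xx := lcPhiPhi Mx; have pK := lcPhiK Mp; have xK := lcPhiK Mx.
have Kp : b K (Phi p) = -1 by rewrite lc_bfC. have Kx : b K (Phi x) = -1 by rewrite lc_bfC.
have KK := lcKK Mo.
split; last first.
  rewrite /slice_point slice_K0 /V scalerA divff // scale1r.
  by apply/rowP => i; rewrite !mxE; ring.
split; rewrite /V !bfL ?px ?pp ?pK ?xp ?xx ?xK ?Kp ?Kx ?KK ?bf0l; try by [ring|rewrite cE; ring].
transitivity (s^-1 * s^-1 * (2 * e - kappa * e ^+ 2)); first by rewrite cE; ring.
by rewrite -s2; field.
Qed.

Lemma unit_tangent_exists p : (2 < m)%N -> M p -> exists V, unit_tangent Mo 0 p V.
Proof.
move=> m2 Mp; pose B : 'M[R]_(m, 1 + 1) := row_mx (lcJ Mo *m (Phi p)^T) (lcJ Mo *m K^T).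
have : kermx B != 0.
  rewrite kermx_eq0 /row_free; apply/negP => /eqP E.
  by have := rank_leq_col B; rewrite E leqNgt m2.
move=> /rowV0Pn[Z /sub_kermxP ZB Z0].
have [h1 h2] : b Z (Phi p) = 0 /\ b Z K = 0.
  move: ZB; rewrite /B mul_mx_row !mulmxA -[RHS](row_mx0) => /eq_row_mx[e1 e2].
  by rewrite /bf e1 e2 !mxE.
have ZZ := lc_pos Mp h1 h2 Z0.
have s0 : Num.sqrt (b Z Z) != 0 by rewrite gt_eqF // sqrtr_gt0.
exists ((Num.sqrt (b Z Z))^-1 *: Z); split; rewrite ?bfL ?(lc_bfC Mo (Phi p)) ?(lc_bfC Mo K) ?h1 ?h2 ?bf0l ?mulr0 //.
by rewrite -{3}(sqr_sqrtr (ltW ZZ)); field.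
Qed.

Definition model_sphere p (r : R) : set 'rV[R]_d := [set x | exists u gamma,
  [/\ geodesic_from g M u p gamma, inner g p u u = 1 & gamma r = x]].

Lemma model_geodesic p V : M p -> unit_tangent Mo 0 p V ->
  exists u, [/\ geodesic_from g M u p (geoE Mo 0 0 p V), inner g p u u = 1 & dPhi p u = V].
Proof.
rewrite -(ambient_slice Mo) => Np uV; have [Mp _] := Np.
have E0 := geoE0 0 V Np.
have uE : dPhi p (derive1 (geoE Mo 0 0 p V) 0) = V.
  by have := dPhi_geoE z1 z2 0 Np uV; rewrite E0 dgeo0.
exists (derive1 (geoE Mo 0 0 p V) 0); split => //.
  by split => //; exact: geoE_geodesic.
by rewrite lc_inner // uE; case: uV.
Qed.

(** A unit speed geodesic from p pairs at time r with [Phi p] to - versk r. Conversely, where the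
    sine is nonzero the geodesic formula can be solved for the direction. *)
Lemma model_sphereP p r : M p -> sink kappa r != 0 ->
  model_sphere p r = [set x | M x /\ b (Phi x) (Phi p) = - versk kappa r].
Proof.
move=> Mp S0; have Np : slice Mo 0 p by rewrite ambient_slice.
have k0 : @slice_curv R kappa 0 = kappa by rewrite /slice_curv expr0n addr0.
apply/seteqP; split => x.
  move=> [u [gam [[gg g0 gu] u1 <-]]].
  have uu : b (dPhi p (derive1 gam 0)) (dPhi p (derive1 gam 0)) = 1.
    by rewrite gu -lc_inner.
  have gg' : geodesic g (slice Mo 0) setT gam by rewrite ambient_slice.
  have E := geodesic_unique z1 z2 gg' I g0 uu (I : setT r).
  have Mr : M (gam r) by have [[_ _ _ h] _] := gg; exact: h.
  have ut : unit_tangent Mo 0 p (dPhi p u).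
    have tp : tangent_space (slice Mo 0) p u.
      by exists setT, gam; split => //; have [] := gg'.
    by have [h1 h2 h3] := tangent_orth Np tp; split => //; rewrite -gu.
  split => //; rewrite E gu /geo /slice_point slice_K0 k0 !bfL lcPhiPhi // (lc_bfC Mo K) lcPhiK //.
  by have [h1 _ _ _] := ut; rewrite (lc_bfC Mo _ (Phi p)) h1; ring.
move=> [Mx xp].
have [ut xE] := ambient_point Mp Mx xp (cosk_versk _ _) (sink_versk _ _) S0.
move: (_ *: _) ut xE => V ut xE.
have [u [gf u1 _]] := model_geodesic Mp ut.
exists u, (geoE Mo 0 0 p V); split => //.
by rewrite /geoE /geo k0 -xE lcPi_Phi.
Qed.

(** As <Phi x, K> = -1, the sphere is the section orthogonal to Phi p - E K, whose square is S^2 and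
    whose pairing with K is - C. The sign of C in [A] makes eta = |C| / S positive also for radii
    beyond a great sphere. *)
Lemma model_sphere_slice p r : (2 < m)%N -> M p -> 0 < sink kappa r -> cosk kappa r != 0 ->
  exists A eta, [/\ b A A = 1, b A K = eta, 0 < eta, model_sphere p r = slice Mo A &
    exists x, slice Mo A x].
Proof.
move=> m2 Mp S0 C0; have Sn : sink kappa r != 0 by rewrite gt_eqF.
set C := cosk kappa r in C0; set S := sink kappa r in S0 Sn; set E := versk kappa r.
have CE : C = 1 - kappa * E := cosk_versk _ _.
have S2 : S ^+ 2 = 2 * E - kappa * E ^+ 2 := sink_versk _ _.
have pp := lcPhiPhi Mp; have pK := lcPhiK Mp.
have Kp : b K (Phi p) = -1 by rewrite lc_bfC.
have KK := lcKK Mo.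
pose A := (- Num.sg C / S) *: (Phi p - E *: K).
have sg2 : Num.sg C ^+ 2 = 1 by rewrite sqr_sg C0.
have AE : model_sphere p r = slice Mo A.
  rewrite model_sphereP //; apply/seteqP; split => x [Mx h]; split => //.
    by rewrite /A !bfL h lcPhiK // -/E; ring.
  move/eqP: h; rewrite /A !bfL lcPhiK // !mulf_eq0 oppr_eq0 sgr_eq0 (negbTE C0) invr_eq0 (negbTE Sn) /=.
  by move=> /eqP h; rewrite -/E; lra.
exists A, (`|C| / S); split => //.
- rewrite /A !bfL pp pK Kp KK.
  transitivity (Num.sg C ^+ 2 / S ^+ 2 * (2 * E - kappa * E ^+ 2)); first by field.
  by rewrite -S2 sg2 mulfVK ?expf_neq0.
- by rewrite /A !bfL pK KK normrEsg CE; field; exact: Sn.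
- by apply: divr_gt0 => //; rewrite normr_gt0.
rewrite -AE; have [V uV] := unit_tangent_exists m2 Mp.
have [u [gf u1 _]] := model_geodesic Mp uV.
by exists (geoE Mo 0 0 p V r), u, (geoE Mo 0 0 p V).
Qed.

Section Contraction.
Hypothesis kappa0 : kappa < 0.
Variable f : 'rV[R]_d -> 'rV[R]_d.
Hypothesis fspeed : forall c, smooth_curve M setT c -> smooth_curve M setT (fun t => f (c t)) /\
  forall t, inner g (f (c t)) (derive1 (fun t => f (c t)) t) (derive1 (fun t => f (c t)) t) =
            inner g (c t) (derive1 c t) (derive1 c t).

Let q := Num.sqrt (- kappa).
Let q0 : 0 < q. Proof. by rewrite sqrtr_gt0 oppr_gt0. Qed.
Let q2 : q ^+ 2 = - kappa. Proof. by rewrite sqr_sqrtr // oppr_ge0 ltW. Qed.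

(** Bessel's inequality in the tangent space at y: [Z] is the tangential part of [Phi p] less its
    component along [W], and its square is nonnegative. *)
Lemma unit_speed_bound p y W u : M p -> M y -> b W (Phi y) = 0 -> b W K = 0 -> b W W = 1 ->
  b (Phi p) (Phi y) = - u -> b (Phi p) W ^+ 2 <= 2 * u - kappa * u ^+ 2.
Proof.
move=> Mp My Wy WK WW py; have pp := lcPhiPhi Mp; have yy := lcPhiPhi My.
have pK := lcPhiK Mp; have yK := lcPhiK My; have KK := lcKK Mo.
have yp : b (Phi y) (Phi p) = - u by rewrite lc_bfC.
have Kp : b K (Phi p) = -1 by rewrite lc_bfC. have Ky : b K (Phi y) = -1 by rewrite lc_bfC.
have yW : b (Phi y) W = 0 by rewrite lc_bfC. have KW : b K W = 0 by rewrite lc_bfC.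
have Wp : b W (Phi p) = b (Phi p) W by rewrite lc_bfC.
have [w /esym pW] : {w | w = b (Phi p) W} by eexists.
rewrite pW in Wp *.
have [Z ZE] : {Z | Z = Phi p - (1 - kappa * u) *: Phi y - u *: K - w *: W} by eexists.
have h1 : b Z (Phi y) = 0 by rewrite ZE !bfL py yy Ky Wy; ring.
have h2 : b Z K = 0 by rewrite ZE !bfL pK yK KK WK; ring.
have h3 : b Z Z = 2 * u - kappa * u ^+ 2 - w ^+ 2.
  by rewrite ZE !bfL pp py yp yy pK yK Kp Ky KK Wp pW Wy yW WK KW WW; ring.
rewrite -subr_ge0 -h3; have [->|Z0] := eqVneq Z 0; first by rewrite bf0l.
exact/ltW/(lc_pos My).
Qed.

(** y + sqrt (y^2 - 1) is the exponential of arcosh y, and the hypothesis bounds the growth rate of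
    arcosh y by q. *)
Lemma cosh_growth (y y' : R -> R) (t : R) : 0 <= t ->
  (forall s : R, is_derive s (1 : R) y (y' s)) -> (forall s, 1 <= y s) -> y 0 = 1 ->
  (forall s, y' s ^+ 2 <= q ^+ 2 * (y s ^+ 2 - 1)) -> y t <= cosk kappa t.
Proof.
move=> t0 Dy y1 y00 hy.
have r0 := expR_gt0 (q * t).
(* [e] keeps the square root differentiable where [y = 1]. *)
have key (e : R) : 0 < e -> y t + Num.sqrt (y t ^+ 2 - 1) <= (1 + e) * expR (q * t).
  move=> e0; pose s2 s := y s ^+ 2 - 1 + e ^+ 2.
  have s20 s : 0 < s2 s.
    by rewrite /s2; have := y1 s; have : 0 < e ^+ 2 by [rewrite exprn_gt0]; nra.
  have srt0 s : 0 < Num.sqrt (s2 s) by rewrite sqrtr_gt0.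
  have Dsq (s : R) : is_derive s (1 : R) (fun s => Num.sqrt (s2 s)) (y s * y' s / Num.sqrt (s2 s)).
    have D1 : is_derive s (1 : R) s2 (2 * (y s * y' s)).
      apply: is_derive_eq (isd_add (isd_add (isd_mul (Dy s) (Dy s)) (isd_cst _ _ _)) (isd_cst _ _ _)) _.
      ring.
    apply: is_derive_eq (isd_comp (is_derive1_sqrt (s20 s)) D1) _.
    by field; rewrite gt_eqF.
  pose F s := (y s + Num.sqrt (s2 s)) * expR (- q * s).
  have DF (s : R) : is_derive s (1 : R) F
      ((y' s + y s * y' s / Num.sqrt (s2 s)) * expR (- q * s) +
       (y s + Num.sqrt (s2 s)) * (expR (- q * s) * - q)).
    have D1 : is_derive s (1 : R) (fun s => expR (- q * s)) (expR (- q * s) * - q).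
      exact: (isd_comp (is_derive_expR _) (isd_linear _ _)).
    exact: (isd_mul (isd_add (Dy s) (Dsq s)) D1).
  have dF s : derivable F s 1 by have [] := DF s.
  have : F t <= F 0.
    apply: (@ler0_derive1_nincr _ F 0 t) => // [s _|].
      rewrite derive1E; have [_ ->] := DF s; have E0 := expR_gt0 (- q * s).
      have hh : y' s <= q * Num.sqrt (s2 s).
        apply: le_trans (ler_norm _) _; rewrite -sqrtr_sqr -(gtr0_norm q0) -(sqrtr_sqr q).
        rewrite -sqrtrM ?sqr_ge0 //; apply: ler_wsqrtr; apply: le_trans (hy s) _.
        apply: ler_wpM2l; first exact: sqr_ge0.
        by rewrite /s2 lerDl sqr_ge0.
      have -> : (y' s + y s * y' s / Num.sqrt (s2 s)) * expR (- q * s) +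
         (y s + Num.sqrt (s2 s)) * (expR (- q * s) * - q) =
         - (expR (- q * s) * ((y s + Num.sqrt (s2 s)) / Num.sqrt (s2 s)) *
           (q * Num.sqrt (s2 s) - y' s)) by field; rewrite gt_eqF.
      rewrite oppr_le0 mulr_ge0 // ?subr_ge0 //; apply: mulr_ge0; first exact: ltW.
      apply: divr_ge0; last exact/ltW/srt0.
      by have := y1 s; have := srt0 s; lra.
    apply: continuous_subspaceT => s; apply: differentiable_continuous.
    by apply/derivable1_diffP; exact: dF.
  rewrite /F mulr0 expR0 mulr1 /s2 y00 expr1n subrr add0r sqrtr_sqr (gtr0_norm e0).
  rewrite mulNr expRN ler_pdivrMr // => h; apply: le_trans h; rewrite lerD2l.
  by apply: ler_wsqrtr; rewrite lerDl sqr_ge0.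
have y1t := y1 t.
have le : y t + Num.sqrt (y t ^+ 2 - 1) <= expR (q * t).
  apply/ler_addgt0Pr => e e0.
  have := key (e / expR (q * t)) (divr_gt0 e0 r0).
  by rewrite mulrDl mul1r mulfVK // gt_eqF.
have w0 := sqrtr_ge0 (y t ^+ 2 - 1).
have w2 : Num.sqrt (y t ^+ 2 - 1) ^+ 2 = y t ^+ 2 - 1 by rewrite sqr_sqrtr //; nra.
rewrite /cosk ltNge (ltW kappa0) kappa0 /= -/q expRN.
move: (expR _) r0 le => r r0 le; move: (Num.sqrt _) w0 w2 le => w w0 w2 le.
rewrite ler_pdivlMr // -(ler_pM2r r0) mulrDl mulVf ?gt_eqF //.
nra.
Qed.

(** The image of the geodesic from x to y has unit speed, so in the same time t it cannot move
    farther from f x than t, by [unit_speed_bound] and [cosh_growth]. *)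
Lemma pairing_contraction x y : M x -> M y -> - b (Phi (f x)) (Phi (f y)) <= - b (Phi x) (Phi y).
Proof.
move=> Mx My; have Nx : slice Mo 0 x by rewrite ambient_slice.
have k0 : @slice_curv R kappa 0 = kappa by rewrite /slice_curv expr0n addr0.
have e_ge0 : 0 <= - b (Phi y) (Phi x) by rewrite oppr_ge0 lcPhi_le0.
rewrite (lc_bfC Mo (Phi x)).
set e := - b (Phi y) (Phi x) in e_ge0 *.
have [e0|en] := eqVneq e 0.
  have yx : y = x; last first.
    have Mfx : M (f x).
      have sc : smooth_curve M setT (fun=> x).
        split => //; [exact: openT|].
        by move=> j; apply: Ck_cst.
      by have [[_ _ _ h] _] := fspeed sc; exact: (h 0).
    by rewrite e0 yx lcPhiPhi // oppr0.
  have xy0 : b (Phi y) (Phi x) = 0 by apply/eqP; rewrite -oppr_eq0; apply/eqP.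
  have : Phi y - Phi x = 0.
    have xy0' : b (Phi x) (Phi y) = 0 by rewrite lc_bfC.
    apply: (pos_eq0 Mx); rewrite !bfL ?xy0 ?xy0' ?lcPhiPhi // ?lcPhiK //; ring.
  by move/eqP; rewrite subr_eq0 => /eqP E; rewrite -(lcPi_Phi My) E lcPi_Phi.
have ep : 0 < e by rewrite lt_def en.
have ke : 0 < - (kappa * e) by rewrite oppr_gt0 nmulr_rlt0.
have s2 : 0 < 2 * e - kappa * e ^+ 2 by rewrite expr2 mulrA; nra.
have cs : (1 - kappa * e) ^+ 2 + kappa * Num.sqrt (2 * e - kappa * e ^+ 2) ^+ 2 = 1.
  by rewrite sqr_sqrtr ?ltW //; ring.
have [|t [tc ts tp]] := cosk_sink_surj cs; first by move=> _; lra.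
have [t0 _] : 0 < t /\ (0 < kappa -> t < pi / Num.sqrt kappa) by apply: tp; rewrite sqrtr_gt0.
have sn : sink kappa t != 0 by rewrite ts gt_eqF // sqrtr_gt0.
have sv : sink kappa t ^+ 2 = 2 * e - kappa * e ^+ 2 by rewrite ts sqr_sqrtr // ltW.
have ve : versk kappa t = e.
  have h := cosk_versk kappa t; rewrite tc in h.
  by apply: (mulfI (lt0r_neq0 (_ : 0 < - kappa))); rewrite ?oppr_gt0 //; lra.
have [uV yE] := ambient_point Mx My (esym (opprK _)) tc sv sn.
move: (_ *: _) uV yE => V uV yE.
have sc : smooth_curve M setT (geoE Mo 0 0 x V).
  by rewrite -(ambient_slice Mo); exact: geoE_curve1.
have yt : geoE Mo 0 0 x V t = y by rewrite /geoE /geo k0 ve -yE lcPi_Phi.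
have [sfc spd] := fspeed sc.
have c0 : geoE Mo 0 0 x V 0 = x by apply: geoE0.
set c := geoE Mo 0 0 x V in sc yt sfc spd c0.
pose w s := dPhi (f (c s)) (derive1 (fun s => f (c s)) s).
have Mf s : M (f (c s)) by have [_ _ _ h] := sfc; exact: (h s).
have wP s : [/\ b (w s) (Phi (f (c s))) = 0, b (w s) K = 0 & b (w s) (w s) = 1].
  have sfc' : smooth_curve (slice Mo 0) setT (fun s => f (c s)) by rewrite ambient_slice.
  have [h1 h2 _ _] := slice_curve_orth sfc' (I : setT s).
  split; rewrite ?(lc_bfC Mo (w s)) //.
  rewrite /w -lc_inner // spd lc_inner; last by have [_ _ _ h] := sc; exact: (h s).
  have Nc : slice Mo 0 x by rewrite ambient_slice.
  by rewrite dPhi_geoE //; have [] := dgeo_unit z1 z2 s Nc uV.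
pose u s := - b (Phi (f x)) (Phi (f (c s))).
have Mfx : M (f x) by rewrite -c0.
have Du (s : R) : is_derive s (1 : R) (fun s => 1 - kappa * u s) (kappa * b (Phi (f x)) (w s)).
  have D := derive_Phi_curve (@subset_refl _ M) sfc (I : setT s).
  apply: is_derive_eq (isd_add (isd_cst _ _ _) (isd_opp (isd_mul (isd_cst _ _ _)
    (isd_opp (isd_bf (lcJ Mo) (isd_cst (Phi (f x)) _ _) D))))) _.
  by rewrite bf0l /w; ring.
have : 1 - kappa * u t <= cosk kappa t.
  apply: (cosh_growth (ltW t0) Du) => [s||s].
  - have h : 0 <= u s by rewrite oppr_ge0 lcPhi_le0.
    by have := mulr_le0_ge0 (ltW kappa0) h; lra.
  - by rewrite /u c0 lcPhiPhi // oppr0 mulr0 subr0.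
  have [h1 h2 h3] := wP s; have h := unit_speed_bound Mfx (Mf s) h1 h2 h3 (esym (opprK _)).
  rewrite -/(u s) in h.
  rewrite q2 exprMn; have -> : - kappa * ((1 - kappa * u s) ^+ 2 - 1) =
    kappa ^+ 2 * (2 * u s - kappa * u s ^+ 2) by ring.
  by apply: ler_wpM2l => //; exact: sqr_ge0.
rewrite tc /u yt => h.
have : - kappa * (- b (Phi (f x)) (Phi (f y))) <= - kappa * e by lra.
by rewrite ler_pM2l // oppr_gt0.
Qed.

End Contraction.
End ModelDistance.

(** * Bifoliations of umbilic slices and their images under isometries *)

Section UmbilicSlices.
Context {R : realType} {d m : nat} {kappa : R}.
Variable Mo : light_cone_model d m kappa.
Local Notation M := (lcM Mo).
Local Notation g := (lcg Mo).
Local Notation K := (lcK Mo).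
Local Notation Phi := (lcPhi Mo).
Local Notation b := (bf (lcJ Mo)).

Definition umbilic_slice (N : set 'rV[R]_d) (A : 'rV[R]_m) (eta : R) :=
  [/\ b A A = 1, b A K = eta, 0 < eta, N = slice Mo A & exists x, N x].

Theorem umbilic_slice_bifoliation n (N U : set 'rV[R]_d) A eta : m = (3 + n)%N ->
  umbilic_slice N A eta -> model_exterior Mo A eta n U ->
  (forall v, geodesic_vector_field g N v ->
    [/\ unit_vector_field g N v, smooth_line_foliation n M U (model_rays Mo A v)
      & smooth_line_foliation n M U (model_rays Mo A (fun p => - v p))]) /\
  ((1 < n)%N -> (compact N -> odd n) -> exists v,
    [/\ unit_vector_field g N v, smooth_line_foliation n M U (model_rays Mo A v),
        smooth_line_foliation n M U (model_rays Mo A (fun p => - v p)) &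
        ~ geodesic_vector_field g N v]).
Proof.
move=> mn [AA AK eta0 -> [p Np]] eU; split=> [v gv|n1 on].
  exact: (geodesic_bifoliation AA AK eta0 mn gv Np eU).
have [k0|k0|k0] := ltrgtP (@slice_curv R kappa eta) 0.
- exact: (boost_bifoliates AA AK eta0 mn n1 k0 Np eU).
- exact: (rot_bifoliates AA AK eta0 k0 mn n1 (on (compact_slice AA AK k0 mn Np)) Np eU).
- exact: (twist_bifoliates AA AK eta0 k0 mn n1 Np eU).
Qed.

(** Only pairings between points of M are known to be preserved. For a vector in the span of two
    points and [K] this is enough, since every point pairs to -1 with [K]. *)
Lemma isometric_slice (f h : 'rV[R]_d -> 'rV[R]_d) p1 p2 (a1 a2 z : R) :
  (forall x, M x -> M (f x)) -> (forall x, M x -> M (h x)) -> (forall x, M x -> f (h x) = x) ->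
  (forall x y, M x -> M y -> b (Phi (f x)) (Phi (f y)) = b (Phi x) (Phi y)) ->
  M p1 -> M p2 ->
  let A0 := a1 *: Phi p1 + a2 *: Phi p2 + z *: K in
  exists A, [/\ b A A = b A0 A0, b A K = b A0 K & f @` slice Mo A0 = slice Mo A].
Proof.
move=> Mf Mh fh fb M1 M2 A0; exists (a1 *: Phi (f p1) + a2 *: Phi (f p2) + z *: K).
have Kf p (Mp : M p) : b K (Phi p) = -1 by rewrite lc_bfC lcPhiK.
have fK p (Mp : M p) : b (Phi p) K = -1 by exact: lcPhiK.
have A0E x : M x -> b (Phi (f x)) (a1 *: Phi (f p1) + a2 *: Phi (f p2) + z *: K) = b (Phi x) A0.
  move=> Mx; rewrite /A0 !bfDr !bfZr !fb // !fK //; exact: Mf.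
split.
- by rewrite /A0 !bfL !fb // !fK ?Kf //; exact: Mf.
- by rewrite /A0 !bfL !fK //; exact: Mf.
apply/seteqP; split => [_ [x [Mx xA] <-]|y [My yA]].
  by split; [exact: Mf|rewrite A0E].
exists (h y); last exact: fh.
by split; [exact: Mh|rewrite -A0E ?fh //; exact: Mh].
Qed.

End UmbilicSlices.

Section CurveIsometry.
Context {R : realType} {d : nat}.
Variables (g : 'rV[R]_d -> 'M[R]_d) (M : set 'rV[R]_d) (f h : 'rV[R]_d -> 'rV[R]_d).
Hypotheses (oM : open M) (sf : smooth_open M f) (sh : smooth_open M h).
Hypotheses (Mf : forall x, M x -> M (f x)) (Mh : forall x, M x -> M (h x)).
Hypothesis fh : forall x, M x -> f (h x) = x.
Hypothesis gf : forall x u w, M x -> inner g (f x) ('D_u f x) ('D_w f x) = inner g x u w.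

Lemma isd_comp_open n j (A : set 'rV[R]_n) (F : 'rV[R]_n -> 'rV[R]_j) (c : R -> 'rV[R]_n) (t : R) dc :
  open A -> smooth_open A F -> A (c t) -> is_derive t (1 : R) c dc ->
  is_derive t (1 : R) (fun s => F (c s)) ('D_dc F (c t)).
Proof.
move=> oA sF Act dcE; apply: isd_row => i.
have dF : derivable F (c t) dc by exact: Ck_derivable (sF 1%N) Act.
have [_ E] := derive_coord i dF; rewrite -E.
have [df1 <-] := dcE; apply: (is_derive_comp_dir df1).
by apply: (C1_differentiable oA _ Act); exact: (Ck_coordf i oA (sF 1%N)).
Qed.

Lemma smooth_curve_comp (F : 'rV[R]_d -> 'rV[R]_d) (c : R -> 'rV[R]_d) :
  smooth_open M F -> (forall x, M x -> M (F x)) ->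
  smooth_curve M setT c -> smooth_curve M setT (fun t => F (c t)).
Proof.
move=> sF MF [oT iT sc Mc]; split => // [k|t It]; last exact/MF/Mc.
by apply: (Ck_comp_rV oT oM) => // t It; exact: Mc.
Qed.

Lemma isometry_speed c : smooth_curve M setT c ->
  smooth_curve M setT (fun t => f (c t)) /\
  forall t, inner g (f (c t)) (derive1 (fun t => f (c t)) t) (derive1 (fun t => f (c t)) t) =
            inner g (c t) (derive1 c t) (derive1 c t).
Proof.
move=> sc; split; first exact: smooth_curve_comp.
move=> t; have [oT _ s Mc] := sc; have dc := isd_smooth oT s (I : setT t).
by rewrite (is_derive_derive1 (isd_comp_open oM sf (Mc t I) dc)) gf //; exact: Mc.
Qed.

(** The metric condition is given for [f]; it passes to [h] by applying [isometry_speed] to the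
    curve [h o c], whose image under [f] is [c]. *)
Lemma isometry_speed_inv c : smooth_curve M setT c ->
  smooth_curve M setT (fun t => h (c t)) /\
  forall t, inner g (h (c t)) (derive1 (fun t => h (c t)) t) (derive1 (fun t => h (c t)) t) =
            inner g (c t) (derive1 c t) (derive1 c t).
Proof.
move=> sc; have shc : smooth_curve M setT (fun t => h (c t)) by exact: smooth_curve_comp.
split=> [|t]; first exact: shc.
have [_ H] := isometry_speed shc; have [_ _ _ Mc] := sc; rewrite -(H t).
rewrite (_ : (fun t => f (h (c t))) = c); first by rewrite fh //; exact: Mc.
by apply/funext => s; rewrite fh //; exact: Mc.
Qed.

End CurveIsometry.

(** The map and its inverse both satisfy the contraction inequality, which gives equality. *)
Lemma isometry_pairing (R : realType) (d m : nat) (kappa : R) (Mo : light_cone_model d m kappa)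
    (f h : 'rV[R]_d -> 'rV[R]_d) :
  kappa < 0 -> open (lcM Mo) -> smooth_open (lcM Mo) f -> smooth_open (lcM Mo) h ->
  (forall x, lcM Mo x -> lcM Mo (f x)) -> (forall x, lcM Mo x -> lcM Mo (h x)) ->
  (forall x, lcM Mo x -> h (f x) = x) -> (forall x, lcM Mo x -> f (h x) = x) ->
  (forall x u w, lcM Mo x ->
     inner (lcg Mo) (f x) ('D_u f x) ('D_w f x) = inner (lcg Mo) x u w) ->
  forall x y, lcM Mo x -> lcM Mo y ->
    bf (lcJ Mo) (lcPhi Mo (f x)) (lcPhi Mo (f y)) = bf (lcJ Mo) (lcPhi Mo x) (lcPhi Mo y).
Proof.
move=> k0 oM sf sh Mf Mh hf fh gf x y Mx My.
have h1 := pairing_contraction k0 (isometry_speed oM sf Mf gf) Mx My.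
have h2 := pairing_contraction k0 (isometry_speed_inv oM sf sh Mf Mh fh gf) (Mf _ Mx) (Mf _ My).
rewrite !hf // in h2; lra.
Qed.

(** * Umbilic hypersurfaces of the sphere *)

Section PositiveCurvature.
Context {R : realType} (n : nat) (kappa : R).
Hypothesis kappa0 : 0 < kappa.
Local Notation Mo := (sphere_model n kappa0).
Local Notation E := 'rV[R]_(amb n kappa).

Lemma sphere_model_dim : (amb n kappa + 1 = 3 + n)%N.
Proof. by rewrite /amb kappa0 addn1 /= addnC. Qed.

Lemma small_sphere_slice (c : E) (r : R) : space_form c ->
  0 < r < pi / Num.sqrt kappa -> r != pi / (2 * Num.sqrt kappa) ->
  exists A eta, umbilic_slice Mo (geodesic_sphere c r) A eta.
Proof.
move=> Mc /andP[r0 rpi] rn.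
have s0 : 0 < Num.sqrt kappa by rewrite sqrtr_gt0.
have m2 : (2 < amb n kappa + 1)%N by rewrite sphere_model_dim.
have S0 : 0 < sink kappa r by apply: sink_gt0.
have C0 : cosk kappa r != 0.
  rewrite /cosk kappa0; apply: contra rn => /eqP C0; apply/eqP.
  have : Num.sqrt kappa * r = pi / 2.
    have h1 : 0 < Num.sqrt kappa * r by rewrite mulr_gt0.
    have h2 : Num.sqrt kappa * r < pi by move: rpi; rewrite ltr_pdivlMr // mulrC.
    have p0 := @pi_gt0 R.
    apply: cos_inj; rewrite ?in_itv /= ?C0 ?cos_pihalf //; apply/andP; split; lra.
  by move=> h; rewrite invfM mulrA -h; field; rewrite gt_eqF.
have [A [eta [h1 h2 h3 h4 h5]]] := model_sphere_slice (Mo := Mo) m2 Mc S0 C0.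
by exists A, eta; split => //; rewrite -[geodesic_sphere c r]/(model_sphere Mo c r) h4.
Qed.

Lemma sphere_model_exterior N U A eta : umbilic_slice Mo N A eta -> exterior N U ->
  model_exterior Mo A eta n U.
Proof.
move=> [AA AK eta0 -> _]; rewrite /exterior kappa0 => -[C [cC HC [cU NU _]]].
exists C, [set x | slice Mo A (- x)]; split => //; first by rewrite kappa0.
move=> x Mx _.
have Mnx : lcM Mo (- x).
  by apply/(sph_M kappa0); rewrite dotNl dotNr opprK; apply/(sph_M kappa0).
(* The pairings of x and - x with [A] have a constant sum, so - x lies on N exactly when x is on the
   level kappa * height = 2. *)
have E : bf (lcJ Mo) (lcPhi Mo (- x)) A + bf (lcJ Mo) (lcPhi Mo x) A = 2 * eta / kappa.
  rewrite -AK /= [in LHS](sph_vecE A) [in RHS](sph_vecE A) !sph_bf dotNl dot0r.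
  by field; rewrite gt_eqF.
rewrite /height; split => [[_ h]|h].
  rewrite h add0r in E; rewrite E; field.
  by rewrite !gt_eqF.
split => //; have en : eta != 0 by rewrite gt_eqF.
have kn : kappa != 0 by rewrite gt_eqF.
have {}h : bf (lcJ Mo) (lcPhi Mo x) A = 2 * eta / kappa.
  by apply: (mulfI kn); rewrite -[LHS](mulfVK en) -[kappa * _ / eta]mulrA h; field.
by move: E; rewrite h; lra.
Qed.

End PositiveCurvature.

(** * Umbilic hypersurfaces of Euclidean and hyperbolic space *)

Section NonpositiveCurvature.
Context {R : realType} (n : nat) (kappa : R).
Hypothesis kappa0 : kappa <= 0.
Local Notation Mo := (flat_model n kappa0).
Local Notation D := (amb n kappa).
Local Notation E := 'rV[R]_D.
Local Notation M := (@space_form R n kappa).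
Local Notation q := (@root_curv R kappa).
Local Notation e0 := (delta_mx ord0 ord0 : E).

Lemma flat_model_dim : (1 + (D + 1) = 3 + n)%N.
Proof. by rewrite /amb ltNge kappa0 /= addn0 addn1 add1n. Qed.

Lemma flat_model_exterior N U A eta : umbilic_slice Mo N A eta -> exterior N U ->
  model_exterior Mo A eta n U.
Proof.
have k0 : (0 < kappa) = false by rewrite ltNge kappa0.
move=> [AA AK eta0 -> _]; rewrite /exterior k0 => -[C [cC HC UC]].
by exists C, set0; split => //; rewrite k0.
Qed.

Lemma flatPhi_vec3 x (a z : R) (v : E) : bf (lcJ Mo) (lcPhi Mo x) (vec3 a v z) =
  (conf x)^-1 * (dot x v - 2^-1 * (z + dot x x * a)).
Proof. by rewrite /= /flatPhi bfZl /par vec3_bf mul1r. Qed.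

Lemma flatK_vec3 (a z : R) (v : E) : bf (lcJ Mo) (vec3 a v z) (lcK Mo) =
  - q * v ord0 ord0 - a * flat_part kappa.
Proof. by rewrite /= /flatK vec3_bf dot_K; field. Qed.

Lemma round_sphere_slice (c : E) (r : R) : kappa = 0 -> 0 < r ->
  exists A eta, umbilic_slice Mo [set x | dot (x - c) (x - c) = r ^+ 2] A eta.
Proof.
move=> k0 r0; have rn : r != 0 by rewrite gt_eqF.
have [[_ [q0 c1]]|[h _]] := flat_or_curved kappa0; last by exfalso; lra.
have l1 (x : E) : conf x = 1 by rewrite /conf q0 c1 mul0r addr0.
have Mx (x : E) : lcM Mo x by apply/(conf_M kappa0); rewrite l1.
(* (1, x, |x|^2) pairs with this vector to (|x - c|^2 - r^2) / (2 r); the orientation makes eta = 1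
   / r positive. *)
exists (r^-1 *: vec3 (-1) (- c) (- (dot c c - r ^+ 2))), r^-1; split.
- by rewrite !bfL vec3_bf !dotL; field.
- by rewrite bfZl flatK_vec3 q0 c1 oppr0 mul0r sub0r mulr1 opprK mulr1.
- by rewrite invr_gt0.
- apply/seteqP; split => x /=.
    move=> h; split; first exact: Mx.
    rewrite bfZr flatPhi_vec3 l1; move: h; rewrite !dotL (dotC c x) => h.
    have -> : dot c c = r ^+ 2 - dot x x + 2 * dot x c by lra.
    by field.
  move=> [_ /eqP]; rewrite bfZr flatPhi_vec3 l1 invr1 mul1r mulf_eq0 invr_eq0 (negbTE rn) /=.
  by move/eqP; rewrite !dotL (dotC c x); lra.
exists (c + r *: e0); rewrite /= addrC addKr dotZl dot_delta !mxE !eqxx /=; ring.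
Qed.

Section Hyperbolic.
Hypothesis kneg : kappa < 0.

Let q0 : 0 < q /\ flat_part kappa = 0.
Proof.
have [[h _]|[_ h]] := flat_or_curved kappa0; last exact: h.
by exfalso; move: kneg; rewrite h ltxx.
Qed.
Let qn : q != 0. Proof. by rewrite gt_eqF //; case: q0. Qed.

Lemma hyp_conf (x : E) : conf x = q * x ord0 ord0.
Proof. by rewrite /conf q0.2 add0r. Qed.

Lemma hyp_M (x : E) : lcM Mo x <-> 0 < x ord0 ord0.
Proof.
by split => [/(conf_M kappa0)|h]; [|apply/(conf_M kappa0)]; rewrite hyp_conf pmulr_rgt0 //; case: q0.
Qed.

Lemma hyp_open : open M.
Proof.
have -> : M = setT `&` (fun x : E => conf x) @^-1` [set t | 0 < t].
  by rewrite setTI; apply/seteqP; split => x /(conf_M kappa0).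
apply: open_preimage_in; [exact: openT|exact: open_gt0|move=> x _].
have s : smooth_on setT (fun x : E => conf x) by apply: smooth_conf; exact: smooth_on_id.
exact: smooth_on_continuous_at openT s I.
Qed.

Lemma hyp_sphere_slice (c : E) (r : R) : M c -> 0 < r ->
  exists A eta, umbilic_slice Mo (geodesic_sphere c r) A eta.
Proof.
move=> Mc r0; have m2 : (2 < 1 + (D + 1))%N by rewrite flat_model_dim.
have kp : 0 < kappa -> False by rewrite ltNge kappa0.
have S0 : 0 < sink kappa r by apply: sink_gt0 => // /kp.
have C0 : cosk kappa r != 0.
  have k1 : (0 < kappa) = false by rewrite ltNge kappa0.
  by rewrite gt_eqF // /cosk k1 kneg divr_gt0 // addr_gt0 // expR_gt0.
have [A [eta [h1 h2 h3 h4 h5]]] := model_sphere_slice (Mo := Mo) m2 Mc S0 C0.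
by exists A, eta; split => //; rewrite -[geodesic_sphere c r]/(model_sphere Mo c r) h4.
Qed.

Lemma isometric_umbilic (f : E -> E) (N : set E) p1 p2 (a1 a2 z : R) (A0 : 'rV[R]_(1 + (D + 1))) eta :
  Defs.isometry f -> lcM Mo p1 -> lcM Mo p2 ->
  A0 = a1 *: lcPhi Mo p1 + a2 *: lcPhi Mo p2 + z *: lcK Mo ->
  umbilic_slice Mo N A0 eta -> exists A eta, umbilic_slice Mo (f @` N) A eta.
Proof.
move=> [sf Mf [h [sh Mh hf fh]] gf] M1 M2 AE [AA AK eta0 NE [x Nx]].
have fb := isometry_pairing (Mo := Mo) kneg hyp_open sf sh Mf Mh hf fh gf.
have [A [h1 h2 h3]] := @isometric_slice _ _ _ _ Mo f h p1 p2 a1 a2 z Mf Mh fh fb M1 M2.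
exists A, eta; split => //.
- by rewrite h1 -AE.
- by rewrite h2 -AE.
- by rewrite NE AE.
by exists (f x), x.
Qed.

Lemma horosphere_slice (f : E -> E) : Defs.isometry f ->
  exists A eta, umbilic_slice Mo (f @` [set x : E | x ord0 ord0 = 1]) A eta.
Proof.
move=> isof; have [qp fl] := q0.
have M1 : lcM Mo (2 *: e0) by apply/hyp_M; rewrite !mxE !eqxx mulr1 ltr0n.
have M2 : lcM Mo e0 by apply/hyp_M; rewrite !mxE !eqxx.
(* (0, - e0, -2) pairs with [Phi x] to (1 - x_0) / conf x, so its slice is the horosphere x_0 = 1.
   The coefficients solve a linear system: [a1] and [a2] give 0 in the first entry and -2 in the
   last, and [z] corrects the multiple of e0. *)
apply: (isometric_umbilic (p1 := 2 *: e0) (p2 := e0) (a1 := - (4 * q / 3)) (a2 := 2 * q / 3)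
  (z := (3 * q)^-1) (A0 := vec3 0 (- e0) (- 2)) (eta := q) isof M1 M2).
  rewrite /= /flatPhi !hyp_conf /par /flatK fl !vec3Z !vec3D !dotL dot_delta !mxE !eqxx /=.
  congr vec3; [by field|idtac|by field].
  by rewrite !scalerA -!scalerDl -[LHS]scaleN1r; congr (_ *: _); field.
split.
- by rewrite vec3_bf !dotL dot_delta !mxE !eqxx /=; ring.
- by rewrite flatK_vec3 !mxE !eqxx fl /=; ring.
- exact: qp.
- apply/seteqP; split => x /=.
    move=> x1; have Mx : lcM Mo x by apply/hyp_M; rewrite x1.
    by split => //; rewrite flatPhi_vec3 dotNr dotC dot_delta x1; field; rewrite hyp_conf x1 mulr1.
  move=> [Mx /eqP]; have lx : 0 < conf x by apply/(conf_M kappa0).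
  rewrite flatPhi_vec3 dotNr dotC dot_delta mulf_eq0 invr_eq0 (gt_eqF lx) /= => /eqP; lra.
by exists e0; rewrite /= !mxE !eqxx.
Qed.

Lemma equidistant_slice (f : E -> E) (a : E) : Defs.isometry f -> a ord0 ord0 != 0 ->
  (exists2 i, i != ord0 & a ord0 i != 0) ->
  exists A eta, umbilic_slice Mo (f @` [set x : E | M x /\ dot a x = 0]) A eta.
Proof.
move=> isof a0n [i i0 ai]; have [qp fl] := q0.
set a0 := a ord0 ord0 in a0n.
have aa : 0 < dot a a.
  by apply: dot_gt0; apply: contra a0n => /eqP aE; rewrite /a0 aE mxE.
set na := Num.sqrt (dot a a); have na0 : 0 < na by rewrite sqrtr_gt0.
have na2 : na ^+ 2 = dot a a by rewrite sqr_sqrtr // ltW.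
have nn : na != 0 by rewrite gt_eqF.
(* Normalizes (0, a, 0) and orients it so that eta = |a_0| q / |a| is positive. *)
pose lam := - Num.sg a0 / na.
(* Phi (e0 + a') - Phi (e0 - a') is a multiple of (0, a', 0), since a' is orthogonal to e0, and K is
   one of (0, e0, 0); together they give (0, a, 0). *)
have [a' a'E] : {X | X = a - a0 *: e0} by eexists.
have a'0 : a' ord0 ord0 = 0 by rewrite a'E !mxE !eqxx mulr1 subrr.
have ea' : dot e0 a' = 0 by rewrite dot_delta.
have M1 : lcM Mo (e0 + a') by apply/hyp_M; rewrite mxE a'0 mxE !eqxx addr0.
have M2 : lcM Mo (e0 - a') by apply/hyp_M; rewrite mxE [(- a') _ _]mxE a'0 mxE !eqxx subr0.
have lamn : lam != 0 by rewrite mulf_neq0 ?oppr_eq0 ?sgr_eq0 // invr_eq0.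
apply: (isometric_umbilic (p1 := e0 + a') (p2 := e0 - a') (a1 := lam * q / 2)
  (a2 := - (lam * q / 2)) (z := - (lam * a0 / q)) (A0 := lam *: vec3 0 a 0)
  (eta := `|a0| * q / na) isof M1 M2).
  have l1 : conf (e0 + a') = q by rewrite hyp_conf mxE a'0 mxE !eqxx addr0 mulr1.
  have l2 : conf (e0 - a') = q.
    by rewrite hyp_conf mxE [(- a') _ _]mxE a'0 mxE !eqxx subr0 mulr1.
  rewrite /= /flatPhi l1 l2 /par /flatK fl !vec3Z !vec3D.
  congr vec3; [by field| |by rewrite !dotL (dotC a') ea'; field].
  by rewrite a'E; apply/rowP => j; rewrite !mxE; field.
split.
- have E0 : bf (lcJ Mo) (vec3 0 a 0) (vec3 0 a 0) = na ^+ 2 by rewrite vec3_bf na2; ring.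
  rewrite bfZl bfZr E0; transitivity (Num.sg a0 ^+ 2); first by rewrite /lam; field.
  by rewrite sqr_sg a0n.
- by rewrite bfZl flatK_vec3 mul0r subr0 -/a0 normrEsg /lam; field.
- by rewrite divr_gt0 // mulr_gt0 // normr_gt0.
- apply/seteqP; split => x /= [Mx h]; split => //.
    by rewrite bfZr flatPhi_vec3 dotC h; ring.
  have lx : 0 < conf x by apply/(conf_M kappa0).
  move/eqP: h; rewrite bfZr flatPhi_vec3 mulf_eq0 (negbTE lamn) mulf_eq0 invr_eq0 (gt_eqF lx) /=.
  by move=> /eqP; rewrite mulr0 addr0 mulr0 subr0 dotC.
exists (e0 - (a0 / a ord0 i) *: delta_mx ord0 i); split.
  by apply/hyp_M; rewrite !mxE !eqxx eq_sym (negbTE i0) mulr0 subr0.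
by rewrite dotDr dotNr dotZr !(dotC a) !dot_delta mulfVK // subrr.
Qed.

End Hyperbolic.

End NonpositiveCurvature.

(* Hypothesis [compact N -> odd n]: spheres of even dimension carry no unit
   tangent vector field, bifoliating or not (hairy ball theorem). *)
Theorem theorem4 (R : realType) (n : nat) (kappa : R)
    (N U : set 'rV[R]_(amb n kappa))
    (umbilicN : complete_umbilic N) (extU : exterior N U) :
  (forall v : 'rV[R]_(amb n kappa) -> 'rV[R]_(amb n kappa),
     geodesic_vector_field (@space_metric R n kappa) N v -> bifoliates N U v)
  /\
  ((1 < n)%N -> (compact N -> odd n) ->
   exists v : 'rV[R]_(amb n kappa) -> 'rV[R]_(amb n kappa),
     bifoliates N U v /\
     ~ geodesic_vector_field (@space_metric R n kappa) N v).
Proof.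
have [k0|k0] := ltP 0 kappa.
  have [A [eta us]] : exists A eta, umbilic_slice (sphere_model n k0) N A eta.
    case: umbilicN => [c r h|c r _ Mc rb rn|c r h|f h|f a h]; try by exfalso; lra.
    exact: small_sphere_slice.
  have eU := sphere_model_exterior us extU.
  have [h1 h2] := umbilic_slice_bifoliation (sphere_model_dim n k0) us eU.
  have [_ _ _ NE _] := us.
  have raysE v : rays N v = model_rays (sphere_model n k0) A v by rewrite NE.
  split=> [v gv|n1 on]; first by rewrite /bifoliates !raysE; exact: h1.
  have [v [w1 w2 w3 w4]] := h2 n1 on; exists v; split => //.
  by rewrite /bifoliates !raysE.
have [A [eta us]] : exists A eta, umbilic_slice (flat_model n k0) N A eta.
  case: umbilicN => [c r h r0|c r h|c r h Mc r0|f h fi|f a h fi a0 ai].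
  - exact: round_sphere_slice.
  - by exfalso; lra.
  - exact: hyp_sphere_slice.
  - exact: horosphere_slice.
  - exact: equidistant_slice.
have eU := flat_model_exterior us extU.
have [h1 h2] := umbilic_slice_bifoliation (flat_model_dim n k0) us eU.
have [_ _ _ NE _] := us.
have raysE v : rays N v = model_rays (flat_model n k0) A v by rewrite NE.
split=> [v gv|n1 on]; first by rewrite /bifoliates !raysE; exact: h1.
have [v [w1 w2 w3 w4]] := h2 n1 on; exists v; split => //.
by rewrite /bifoliates !raysE.
Qed.
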